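(* Let $b>0$ and $2<p<4$, and assume $V$ satisfies $(V_0)$ and $(V_1)$. Then equation (1.5) has a ground state solution in $E$.
   Context: Let $V:\mathbb R^2\to\mathbb R$. Condition $(V_0)$: $V\in L^1_{loc}(\mathbb R^2)$, $V_0:=\inf_{\mathbb R^2}V>0$, and the Lebesgue measure of $\{x\in\mathbb R^2: V(x)\le M\}$ is finite for every $M>0$. Condition $(V_1)$: $V\in C(\mathbb R^2,\mathbb R)$ is weakly differentiable and there exist $\alpha,\beta>0$ such that for a.e. $x\in\mathbb R^2$: $|(\nabla V(x),x)|\le \alpha V(x)$ and $2V(x)+(\nabla V(x),x)\ge-\beta$. $|\cdot|_s$ denotes the $L^s(\mathbb R^2)$-norm. $H_V=\{u\in H^1(\mathbb R^2):\int_{\mathbb R^2}Vu^2\,dx<\infty\}$ with norm $\|u\|_V=(\int_{\mathbb R^2}(|\nabla u|^2+V(x)u^2)\,dx)^{1/2}$. For measurable $u$, $|u|_*=(\int_{\mathbb R^2}\log(1+|x|)u^2\,dx)^{1/2}$. $E=\{u\in H_V:|u|_*<\infty\}$ is the Hilbert space with norm $\|u\|_E=(\|u\|_V^2+|u|_*^2)^{1/2}$. $N_0(u)=\frac1{2\pi}\int_{\mathbb R^2}\int_{\mathbb R^2}\log(|x-y|)u^2(x)u^2(y)\,dx\,dy$. For $b\ge0$, $p>2$, $I:E\to\mathbb R$ is $I(u)=\frac12\|u\|_V^2+\frac14N_0(u)-\frac bp|u|_p^p$, a $C^1$ functional. Equation (1.5) is $-\Delta u+V(x)u+\frac1{2\pi}(\log(|\cdot|)*|u|^2)u=b|u|^{p-2}u$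 in $\mathbb R^2$; its (weak) solutions are the critical points of $I$ in $E$. A ground state solution is a critical point $u\ne0$ of $I$ with $I(u)\le I(w)$ for every critical point $w\ne0$ of $I$. *)

(* Defs.v *)
From HB Require Import structures.
From mathcomp Require Import all_boot all_order all_algebra.
From mathcomp Require Import all_classical all_reals all_analysis.
Set Implicit Arguments. Unset Strict Implicit. Unset Printing Implicit Defensive.
Import Order.TTheory GRing.Theory Num.Theory.
Import numFieldNormedType.Exports.
Local Open Scope classical_set_scope.
Local Open Scope ring_scope.

Section Defs.
Variable R : realType.

Definition pt := (R * R)%type.

Definition leb2 := (@lebesgue_measure R \x @lebesgue_measure R)%E.

Definition enorm (x : pt) : R := Num.sqrt (x.1 ^+ 2 + x.2 ^+ 2).
Definition dot (x y : pt) : R := x.1 * y.1 + x.2 * y.2.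
Definition psub (x y : pt) : pt := (x.1 - y.1, x.2 - y.2).

Definition integ (f : pt -> R) : \bar R := (\int[leb2]_x (f x)%:E)%E.
Definition intR (f : pt -> R) : R := fine (integ f).

Definition inLp (s : R) (f : pt -> R) :=
  measurable_fun setT f /\ (integ (fun x => powR `|f x| s) < +oo)%E.

Definition loc_int (f : pt -> R) :=
  measurable_fun setT f /\
  forall K : set pt, compact K -> (\int[leb2]_(x in K) `|f x|%:E < +oo)%E.

Definition shift (b : bool) (x : pt) (t : R) : pt :=
  if b then (x.1 + t, x.2) else (x.1, x.2 + t).
Definition pd (b : bool) (f : pt -> R) : pt -> R :=
  fun x => derive1 (fun t : R => f (shift b x t)) 0.
Definition iter_pd (l : seq bool) (f : pt -> R) : pt -> R := foldr pd f l.

Definition smooth (f : pt -> R) :=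
  forall l : seq bool, continuous (iter_pd l f) /\
    forall (b : bool) (x : pt), derivable (fun t : R => iter_pd l f (shift b x t)) 0 1.

Definition test_fun (phi : pt -> R) :=
  smooth phi /\ exists r : R, forall x, r < enorm x -> phi x = 0.

Definition weak_grad (u g1 g2 : pt -> R) :=
  [/\ loc_int u, loc_int g1, loc_int g2 &
   forall phi, test_fun phi ->
     integ (fun x => u x * pd true phi x) = (- integ (fun x => (g1 x * phi x)%R))%E /\
     integ (fun x => u x * pd false phi x) = (- integ (fun x => (g2 x * phi x)%R))%E].

Definition inH1 (u g1 g2 : pt -> R) :=
  [/\ inLp 2 u, inLp 2 g1, inLp 2 g2 & weak_grad u g1 g2].

Definition inE (V : pt -> R) (u g1 g2 : pt -> R) :=
  [/\ inH1 u g1 g2,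
      (integ (fun x => (V x * u x ^+ 2)%R) < +oo)%E &
      (integ (fun x => (ln (1 + enorm x) * u x ^+ 2)%R) < +oo)%E].

Definition normV2 (V : pt -> R) (u g1 g2 : pt -> R) : R :=
  intR (fun x => g1 x ^+ 2 + g2 x ^+ 2 + V x * u x ^+ 2).

Definition N0 (u : pt -> R) : R :=
  (2 * pi)^-1 * fine (\int[leb2]_x \int[leb2]_y
     (ln (enorm (psub x y)) * u x ^+ 2 * u y ^+ 2)%:E)%E.

(* the energy functional I, evaluated at u whose weak gradient is (g1, g2) *)
Definition Ifun (V : pt -> R) (b p : R) (u g1 g2 : pt -> R) : R :=
  2^-1 * normV2 V u g1 g2 + 4^-1 * N0 u - b / p * intR (fun x => powR `|u x| p).

Definition comb (u v : pt -> R) (t : R) : pt -> R := fun x => u x + t * v x.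

Definition critical (V : pt -> R) (b p : R) (u g1 g2 : pt -> R) :=
  inE V u g1 g2 /\
  forall v h1 h2, inE V v h1 h2 ->
    is_derive (0 : R) (1 : R)
      (fun t : R => Ifun V b p (comb u v t) (comb g1 h1 t) (comb g2 h2 t)) 0.

(* u <> 0 as an element of E, i.e. u is not a.e. zero *)
Definition nontrivial (u : pt -> R) := (0 < integ (fun x => (u x ^+ 2)%R))%E.

Definition ground_state (V : pt -> R) (b p : R) (u : pt -> R) :=
  exists g1 g2, [/\ nontrivial u, critical V b p u g1 g2 &
    forall w k1 k2, nontrivial w -> critical V b p w k1 k2 ->
      Ifun V b p u g1 g2 <= Ifun V b p w k1 k2].

Definition condV0 (V : pt -> R) :=
  [/\ loc_int V, 0 < inf (range V) &
      forall M : R, 0 < M -> (leb2 [set x | (V x <= M)%R] < +oo)%E].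

Definition condV1 (V : pt -> R) :=
  continuous V /\
  exists g1 g2, weak_grad V g1 g2 /\
    exists alpha beta : R, [/\ 0 < alpha, 0 < beta &
      {ae leb2, forall x, `|dot (g1 x, g2 x) x| <= alpha * V x /\
                          - beta <= 2 * V x + dot (g1 x, g2 x) x}].

End Defs.

(* Main.v *)
Require Import Defs.
From HB Require Import structures.
From mathcomp Require Import all_boot all_order all_algebra.
From mathcomp Require Import all_classical all_reals all_analysis.
From mathcomp Require Import measurable_realfun.
From mathcomp Require Import ring lra.
Set Implicit Arguments. Unset Strict Implicit. Unset Printing Implicit Defensive.
Import Order.TTheory GRing.Theory Num.Theory.
Import numFieldNormedType.Exports.
Local Open Scope classical_set_scope.
Local Open Scope ring_scope.

(** Adding [mu / 2 * |u|_*^2] makes bounded Palais-Smale sequences converge, and the monotonicity trick yields such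
  sequences at the mountain pass level for some [mu -> 0]. A Pohozaev inequality, tested with [u (l x) - u x] as [l -> 1],
  bounds the resulting critical points; their masses do not vanish, so they converge in [E] to a nontrivial critical
  point. By the same compactness a minimizing sequence of nontrivial critical points converges. *)

(* [lra] translates the whole context and compares atoms up to conversion, which is slow on the functionals
  below: these are abstracted first, and only arithmetic hypotheses are kept. *)
Ltac abstract_atoms :=
 repeat match goal with H : is_true _ |- _ => revert H | H : @eq (Real.sort _) _ _ |- _ => revert H end;
 repeat match goal with R : realType |- context [?f ?u] =>
  let t := constr:(f u) in let T := type of t in unify T (Real.sort R);
  let X := type of u in let X := eval hnf in X in
  lazymatch X with (_ * _)%type => idtac | _ -> _ => idtac end;
  generalize t; intro
 end;
 repeat match goal with H : ?T |- _ => lazymatch type of T with Prop => clear H end end.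
Ltac alra := first [abstract_atoms; lra | lra].
Ltac mproj := repeat first [exact: measurable_fst | exact: measurable_snd | apply: measurableT_comp].

(** For [p < 4] the equation tested with [u] bounds [|u|_V^2] by four times the energy plus a
    positive multiple of [|u|_p^p], so almost critical sequences have no evident bound. Bounds are
    therefore sought for exact critical points, where the Pohozaev relation is available. Only one
    side of it enters, so dilations [l >= 1] are used, and [(V_1)] is read as a bound on differences
    of [V] along rays. The difference [u (l x) - u x] is [O(l - 1)] in [L^2] once [|x| grad u] is in
    [L^2], which is why critical points are first shown to decay.

    The estimates on weakly differentiable functions rest on one transport formula along the motions
    [x -> (1 + k s) x + s c]: translations give compactness in [L^2] and
    [|u|_4^4 <= 16 |u|_2^2 |grad u|_2^2], dilations give the bounds on [V] and on [u (l x) - u x].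

    The logarithm is split into its positive part, which is dominated by the weight of [E] and
    controls it near a nonzero element, and its negative part, whose form is bounded by [L^4] norms.
    An element of [E] is a triple: a function and its two weak derivatives. *)

Section planar.
Context (R : realType).
Local Notation id1 x f a := (is_derive (x : R) (1 : R) (f : R -> R) (a : R)).
Local Notation pt := (Defs.pt R).
Local Notation mfun := (measurable_fun setT).

Lemma le_eq d (T : porderType d) (x y : T) : x = y -> (x <= y)%O.
Proof. by move->. Qed.

Lemma norm_sq (x : R) : `|x| ^+ 2 = x ^+ 2.
Proof. exact: real_normK (num_real x). Qed.

(** * Lebesgue measure on the line and in the plane *)

Section leb1.
(** Lebesgue measure comes on the alias [measurableTypeR R]; its copy on [R] itself makes [pt] the
    product space on which [mu2] lives. Integrals are transferred by pushing forward along the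
    identity. *)
Definition leb1 : set R -> \bar R := @lebesgue_measure R.
Lemma leb1_0 : leb1 set0 = 0%E. Proof. exact: measure0. Qed.
Lemma leb1_ge0 A : (0 <= leb1 A)%E. Proof. exact: measure_ge0. Qed.
Lemma leb1_sa : semi_sigma_additive leb1.
Proof. exact: (@measure_semi_sigma_additive _ _ _ (@lebesgue_measure R)). Qed.
HB.instance Definition _ := isMeasure.Build _ _ _ leb1 leb1_0 leb1_ge0 leb1_sa.
Lemma leb1_sf : sigma_finite setT leb1.
Proof. exact: (@sigma_finiteT _ _ _ (@lebesgue_measure R)). Qed.
HB.instance Definition _ := @Measure_isSigmaFinite.Build _ _ _ leb1 leb1_sf.
Definition mu2 : set pt -> \bar R := (leb1 \x leb1)%E.
HB.instance Definition _ := Measure.copy mu2 (leb1 \x leb1)%E.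
Lemma mu2_sf : sigma_finite setT mu2.
Proof.
have /sigma_finiteP[F [TF ndF Foo]] := leb1_sf.
exists (fun n => F n `*` F n).
 rewrite -setXTT TF predeqE => -[x y]; split.
  move=> [/= [n _ Fnx] [k _ Gky]]; exists (maxn n k) => //; split.
  - by move: x Fnx; exact/subsetPset/ndF/leq_maxl.
  - by move: y Gky; exact/subsetPset/ndF/leq_maxr.
 by move=> [n _ []/= ? ?]; split; exists n.
move=> k; have [? ?] := Foo k; split; first exact: measurableX.
by rewrite /mu2 product_measure1E// lte_mul_pinfty// ge0_fin_numE.
Qed.
HB.instance Definition _ := @Measure_isSigmaFinite.Build _ _ _ mu2 mu2_sf.

Let idR' : measurableTypeR R -> R := id.
Let midR' : mfun idR'.
Proof. by move=> _ Y mY; rewrite setTI. Qed.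

Lemma ge0_integral_leb1 (D : set R) (f : R -> \bar R) : measurable D ->
  measurable_fun D f -> {in D, forall y, (0 <= f y)%E} ->
 (\int[@lebesgue_measure R]_(x in D) f x = \int[leb1]_(x in D) f x)%E.
Proof.
move=> mD mf f0.
have := ge0_integral_pushforward midR' (@lebesgue_measure R) mD mf f0.
by move=> /esym; rewrite (_ : _ \o _ = f).
Qed.

Let midR2' : mfun (idfun : measurableTypeR R * measurableTypeR R -> pt).
Proof.
apply/measurable_fun_pairP; split.
exact: (measurableT_comp midR' measurable_fst).
exact: (measurableT_comp midR' measurable_snd).
Qed.
Let lm2 : {measure set (measurableTypeR R * measurableTypeR R) -> \bar R} :=
 (@lebesgue_measure R \x @lebesgue_measure R)%E.
Lemma leb2E (A : set pt) : measurable A -> leb2 A = mu2 A.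
Proof.
move=> mA; apply/esym.
apply: (@product_measure_unique _ _ _ _ _ leb1 leb1 (pushforward lm2 (idfun : measurableTypeR R * measurableTypeR R -> pt)) _ A mA).
move=> B C mB mC. rewrite /pushforward/=.
exact: product_measure1E.
Qed.
Lemma ge0_integral_leb2 (D : set pt) (f : pt -> \bar R) : measurable D ->
  measurable_fun D f -> {in D, forall y, (0 <= f y)%E} ->
 (\int[@leb2 R]_(x in D) f x = \int[mu2]_(x in D) f x)%E.
Proof.
move=> mD mf f0.
have := ge0_integral_pushforward midR2' lm2 mD mf f0.
rewrite (_ : _ \o _ = f)//= => /esym e.
rewrite [LHS]e.
apply: eq_measure_integral => //= A mA _. exact: leb2E.
Qed.
End leb1.

(** * Real-valued integration: Cauchy-Schwarz, convergence theorems, Riesz-Fischer *)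

Section integral_toolbox.
Context d (T : measurableType d) (m : {measure set T -> \bar R}).
Implicit Types f g h w : T -> R.

Definition Int f := m.-integrable setT (EFin \o f).
(** [fine] sends an infinite integral to [0], so identities between values of [rint] come with
    integrability hypotheses [Int]. *)
Definition rint f : R := fine (\int[m]_x (f x)%:E).

Lemma eq_rint f g : (forall x, f x = g x) -> rint f = rint g.
Proof. by move=> /funext->. Qed.

Lemma eq_Int f g : (forall x, f x = g x) -> Int f -> Int g.
Proof. by move=> /funext->. Qed.

Lemma Int_mf f : Int f -> mfun f.
Proof. by move=> /measurable_int/measurable_EFinP. Qed.

Lemma Int_fin f : Int f -> (\int[m]_x (f x)%:E)%E = (rint f)%:E.
Proof. by move=> If; rewrite /rint fineK//; exact: integrable_fin_num If. Qed.

Lemma Int_le g f : Int g -> mfun f ->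
 (forall x, `|f x| <= g x) -> Int f.
Proof.
move=> Ig mf fg; apply: (le_integrable measurableT _ _ Ig).
 exact/measurable_EFinP.
by move=> x _ /=; rewrite lee_fin (le_trans (fg x))// ler_norm.
Qed.

Lemma Int_ge0 f : mfun f -> (forall x, 0 <= f x) ->
 (\int[m]_x (f x)%:E < +oo)%E -> Int f.
Proof.
move=> mf f0 foo; apply/integrableP; split; first exact/measurable_EFinP.
by under eq_integral => x _ do rewrite /= ger0_norm//.
Qed.

Lemma Int_abs f : Int f -> Int (fun x => `|f x|).
Proof. by move=> If; have := integrable_norm If. Qed.

Lemma Int_D f g : Int f -> Int g -> Int (fun x => f x + g x).
Proof. by move=> If Ig; have := integrableD measurableT If Ig. Qed.

Lemma Int_Z c f : Int f -> Int (fun x => c * f x).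
Proof. by move=> If; have := integrableZl measurableT c If. Qed.

Lemma Int_N f : Int f -> Int (fun x => - f x).
Proof. by move=> /(Int_Z (-1)); under eq_fun do rewrite mulN1r. Qed.

Lemma Int_B f g : Int f -> Int g -> Int (fun x => f x - g x).
Proof. by move=> If /Int_N; exact: Int_D. Qed.

Lemma Int_0 : Int (fun=> 0).
Proof. exact: integrable0. Qed.

Lemma rintD f g : Int f -> Int g -> rint (fun x => f x + g x) = rint f + rint g.
Proof. by move=> If Ig; have := RintegralD measurableT If Ig. Qed.

Lemma rintZ c f : Int f -> rint (fun x => c * f x) = c * rint f.
Proof. by move=> If; have := @RintegralZl _ _ _ m setT f c measurableT If. Qed.

Lemma rintN f : Int f -> rint (fun x => - f x) = - rint f.
Proof.
by move=> If; rewrite -[RHS]mulN1r -rintZ//; congr rint; apply/funext=> x; rewrite mulN1r.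
Qed.

Lemma rintB f g : Int f -> Int g -> rint (fun x => f x - g x) = rint f - rint g.
Proof. by move=> If Ig; rewrite rintD ?rintN//; exact: Int_N. Qed.

Lemma rint_le f g : Int f -> Int g -> (forall x, f x <= g x) -> rint f <= rint g.
Proof. by move=> If Ig fg; apply: (le_Rintegral measurableT If Ig) => x _. Qed.

Lemma rint_ge0 f : (forall x, 0 <= f x) -> 0 <= rint f.
Proof. by move=> f0; apply: Rintegral_ge0. Qed.

Lemma rint_norm f : Int f -> `|rint f| <= rint (fun x => `|f x|).
Proof. by move=> If; exact: (le_normr_Rintegral measurableT If). Qed.

Lemma rint_bound f g : Int g -> mfun f ->
 (forall x, `|f x| <= g x) -> `|rint f| <= rint g.
Proof.
move=> Ig mf fg; have If := Int_le Ig mf fg.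
by rewrite (le_trans (rint_norm If))// rint_le//; exact: Int_abs.
Qed.

Lemma rint0 : rint (fun=> 0) = 0.
Proof. by rewrite /rint integral0. Qed.

Lemma rint_ae f g : mfun f -> mfun g ->
 {ae m, forall x, f x = g x} -> rint f = rint g.
Proof.
move=> mf mg fg; rewrite /rint; congr fine; apply: ae_eq_integral => //.
- exact/measurable_EFinP.
- exact/measurable_EFinP.
- by apply: filterS fg => x /= -> _.
Qed.

Lemma Int_ae f g : mfun g -> {ae m, forall x, f x = g x} ->
 Int f -> Int g.
Proof.
move=> mg fg If; have mf := Int_mf If.
apply/integrableP; split; first exact/measurable_EFinP.
have /integrableP[_] := If; congr (_ < _)%E.
apply: ae_eq_integral => //.
- by apply/measurable_EFinP; apply: measurableT_comp.
- by apply/measurable_EFinP; apply: measurableT_comp.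
- by apply: filterS fg => x /= -> _.
Qed.

(** The maximum of [f] and [g] dominates [f] everywhere and equals [g] almost everywhere. *)
Lemma rint_le_ae f g : Int f -> Int g -> {ae m, forall x, f x <= g x} ->
 rint f <= rint g.
Proof.
move=> If Ig fg; have mf := Int_mf If; have mg := Int_mf Ig.
rewrite (@rint_ae g (fun x => Num.max (f x) (g x)))//.
- apply: rint_le => //; last by move=> x; rewrite le_max lexx.
 apply: Int_ae Ig; first exact: measurable_maxr.
 by apply: filterS fg => x /= /max_idPr.
- exact: measurable_maxr.
- by apply: filterS fg => x /= /max_idPr.
Qed.

Lemma rint_eq0 f : Int f -> (forall x, 0 <= f x) -> rint f = 0 ->
 {ae m, forall x, f x = 0}.
Proof.
move=> If f0 i0; have : ae_eq m setT (EFin \o f) (cst 0%E).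
 apply/ae_eq_integral_abs => //.
  by apply/measurable_EFinP; exact: Int_mf.
 under eq_integral => x _ do rewrite /= ger0_norm//.
 by rewrite Int_fin// i0.
by apply: filterS => x /= /(_ I) [].
Qed.

Lemma Int_prod2 w f g : mfun w -> (forall x, 0 <= w x) ->
 mfun f -> mfun g ->
 Int (fun x => w x * f x ^+ 2) -> Int (fun x => w x * g x ^+ 2) ->
 Int (fun x => w x * (f x * g x)).
Proof.
move=> mw w0 mf mg If Ig; apply: (Int_le (Int_D If Ig)).
 by apply: measurable_funM => //; exact: measurable_funM.
move=> x; rewrite normrM (ger0_norm (w0 x)) -mulrDr ler_wpM2l//.
rewrite ler_norml; apply/andP; split; nra.
Qed.

Lemma Int_sum2 w f g : mfun w -> (forall x, 0 <= w x) ->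
 mfun f -> mfun g ->
 Int (fun x => w x * f x ^+ 2) -> Int (fun x => w x * g x ^+ 2) ->
 Int (fun x => w x * (f x + g x) ^+ 2).
Proof.
move=> mw w0 mf mg If Ig.
rewrite (_ : (fun x => _) = (fun x => (w x * f x ^+ 2 + w x * g x ^+ 2) + 2 * (w x * (f x * g x)))).
 apply: Int_D; first exact: Int_D.
 by apply: Int_Z; exact: Int_prod2.
by apply/funext => x; ring.
Qed.

(** The integral of [w (s f + t g)^2] is a nonnegative quadratic form in [(s, t)]. *)
Lemma cauchy_schwarz w f g : mfun w -> (forall x, 0 <= w x) ->
 mfun f -> mfun g ->
 Int (fun x => w x * f x ^+ 2) -> Int (fun x => w x * g x ^+ 2) ->
 (rint (fun x => w x * (f x * g x))) ^+ 2 <=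
 rint (fun x => w x * f x ^+ 2) * rint (fun x => w x * g x ^+ 2).
Proof.
move=> mw w0 mf mg If Ig; have Ifg := Int_prod2 mw w0 mf mg If Ig.
set a := rint (fun x => w x * f x ^+ 2); set c := rint (fun x => w x * g x ^+ 2).
set b := rint _.
have a0 : 0 <= a by apply: rint_ge0 => x; rewrite mulr_ge0// sqr_ge0.
have c0 : 0 <= c by apply: rint_ge0 => x; rewrite mulr_ge0// sqr_ge0.
have P (s t : R) : 0 <= s ^+ 2 * a + 2 * s * t * b + t ^+ 2 * c.
 have -> : s ^+ 2 * a + 2 * s * t * b + t ^+ 2 * c =
   rint (fun x => (s ^+ 2 * (w x * f x ^+ 2) + (2 * s * t) * (w x * (f x * g x))) +
     t ^+ 2 * (w x * g x ^+ 2)).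
  by rewrite !rintD ?rintZ//; do ?apply: Int_D; exact: Int_Z.
 apply: rint_ge0 => x.
 rewrite (_ : _ + _ = w x * (s * f x + t * g x) ^+ 2); last by ring.
 by rewrite mulr_ge0// sqr_ge0.
have [c1|] := ltP 0 c.
 have := P c (- b); rewrite (_ : _ + _ = c * (a * c - b ^+ 2)); last by ring.
 by rewrite pmulr_rge0// subr_ge0.
move=> c1; have cE : c = 0 by lra.
have [->|b0] := eqVneq b 0; first by rewrite expr0n/= mulr_ge0.
(* For [c = 0] and [b <> 0] this point makes the form equal to [- 1]. *)
have := P 1 (- (a + 1) / (2 * b)); rewrite cE.
rewrite (_ : _ + _ = - 1); first by rewrite lerNr oppr0 ler10.
by field.
Qed.

Lemma limn_einf_le (u : (\bar R)^nat) (C : \bar R) :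
 (forall n, u n <= C)%E -> (limn_einf u <= C)%E.
Proof.
move=> uC; rewrite limn_einf_lim; apply: lime_le; first exact: is_cvg_einfs.
by apply: nearW => n; apply: le_trans (uC n); apply: ereal_inf_lbound; exists n => /=.
Qed.

Lemma measurable_fun_limn_einf (h : nat -> T -> \bar R) :
 (forall n, mfun (h n)) ->
 mfun (fun x => limn_einf (h ^~ x)).
Proof.
move=> mh; apply: (emeasurable_fun_cvg (fun n x => einfs (h ^~ x) n)).
 by move=> n; exact: measurable_fun_einfs.
by move=> x _; rewrite limn_einf_lim; exact: is_cvg_einfs.
Qed.

Lemma fatou_rint (f_ : nat -> T -> R) f (C : R) :
 (forall n, Int (f_ n)) -> mfun f ->
 (forall n x, 0 <= f_ n x) -> (forall x, 0 <= f x) ->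
 (forall n, rint (f_ n) <= C) ->
 {ae m, forall x, f_ n x @[n --> \oo] --> f x} ->
 Int f /\ rint f <= C.
Proof.
move=> If_ mf f_0 f0 le_C cvf.
have mf_ n : mfun (f_ n) by exact: Int_mf.
have mf_' n : mfun (fun x => (f_ n x)%:E) by exact/measurable_EFinP.
have f_0' n x : setT x -> (0 <= (f_ n x)%:E)%E by rewrite lee_fin.
have fat := fatou m measurableT mf_' f_0'.
have leC : (\int[m]_x (f x)%:E <= C%:E)%E.
 apply: (@le_trans _ _ (limn_einf (fun n => \int[m]_x (f_ n x)%:E)%E)).
  apply: le_trans fat; apply: le_eq.
  apply: ae_eq_integral => //.
  - exact/measurable_EFinP.
  - by apply: measurable_fun_limn_einf.
  - apply: filterS cvf => x /= cx _; apply/esym.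
   have /cvg_limn_einf_sup[] // : (f_ n x)%:E @[n --> \oo] --> (f x)%:E.
   by apply/cvg_EFin => //; near=> n.
 by apply: limn_einf_le => n; rewrite Int_fin// lee_fin.
have If : Int f by apply: Int_ge0 => //; rewrite (le_lt_trans leC)// ltry.
by split => //; rewrite -lee_fin -Int_fin.
Unshelve. all: by end_near. Qed.

Lemma fatou_rint_near (f_ : nat -> T -> R) f (C : R) :
 (forall n, Int (f_ n)) -> mfun f ->
 (forall n x, 0 <= f_ n x) -> (forall x, 0 <= f x) ->
 (\forall n \near \oo, rint (f_ n) <= C) ->
 {ae m, forall x, f_ n x @[n --> \oo] --> f x} ->
 Int f /\ rint f <= C.
Proof.
move=> If_ mf f_0 f0 [N _ le_C] cvf.
apply: (@fatou_rint (fun n => f_ (n + N)%N)) => //.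
 by move=> n; apply: le_C; rewrite /= leq_addl.
by apply: filterS cvf => x /= cx; rewrite (cvg_shiftn N (fun n => f_ n x)).
Qed.

Lemma dominated_rint (f_ : nat -> T -> R) f g :
 (forall n, mfun (f_ n)) -> mfun f -> Int g ->
 (forall n x, `|f_ n x| <= g x) ->
 {ae m, forall x, f_ n x @[n --> \oo] --> f x} ->
 Int f /\ rint (f_ n) @[n --> \oo] --> rint f.
Proof.
move=> mf_ mf Ig fg cvf.
have mf_' n : mfun (fun x => (f_ n x)%:E) by exact/measurable_EFinP.
have mf' : mfun (fun x => (f x)%:E) by exact/measurable_EFinP.
have c1 : {ae m, forall x, setT x -> (f_ n x)%:E @[n --> \oo] --> (f x)%:E}.
 apply: filterS cvf => x /= cx _; apply/cvg_EFin => //; by near=> n.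
have c2 : {ae m, forall x (n : nat), setT x -> (`|(f_ n x)%:E| <= (EFin \o g) x)%E}.
 by apply: aeW => x n _; rewrite /= lee_fin.
have [If _ cv] := dominated_convergence measurableT mf_' mf' c1 Ig c2.
split => //; apply/fine_cvg.
by rewrite fineK ?(integrable_fin_num _ If).
Unshelve. all: by end_near. Qed.

Lemma cauchy_summable (u : nat -> R) (C : R) :
 (forall n, \sum_(k < n) `|u k.+1 - u k| <= C) -> cvgn u.
Proof.
move=> uC.
have -> : u = (fun n => u 0%N + series (fun k => u k.+1 - u k) n).
 apply/funext => n; rewrite /series/= telescope_sumr//; ring.
apply: is_cvgD; first exact: is_cvg_cst.
apply: normed_cvg; apply: nondecreasing_is_cvgn.
 by apply: nondecreasing_series => k _ _ /=.
exists C => _ [n _ <-].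
by have := uC n; rewrite -(big_mkord xpredT (fun k => `|u k.+1 - u k|)).
Qed.

Lemma increasing_choice (P : nat -> nat -> Prop) :
 (forall k, exists N, forall n, (N <= n)%N -> P k n) ->
 exists s : nat -> nat, (forall k, (s k < s k.+1)%N) /\ forall k, P k (s k).
Proof.
move=> H; have [N HN] := choice H.
pose s := fix s k := if k is k'.+1 then maxn (s k').+1 (N k) else N 0%N.
exists s; split => [k|[|k]] /=; first exact: leq_maxl.
 exact: HN.
by apply: HN; exact: leq_maxr.
Qed.

Lemma increasing_subseq_ge (s : nat -> nat) : (forall k, (s k < s k.+1)%N) ->
 forall k, (k <= s k)%N.
Proof. by move=> sS; elim=> // k IH; exact: leq_ltn_trans IH (sS k). Qed.

(* Along a fast subsequence [\int \sum_k 4^k |f_(k+1) - f_k|^2] is finite, so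
  [\sum_k |f_(k+1) - f_k|] converges almost everywhere. *)
Lemma riesz_fischer (f_ : nat -> T -> R) :
 (forall n, mfun (f_ n)) ->
 (forall n k, Int (fun x => (f_ n x - f_ k x) ^+ 2)) ->
 (forall e, 0 < e -> exists N, forall n k, (N <= n)%N -> (N <= k)%N ->
   rint (fun x => (f_ n x - f_ k x) ^+ 2) <= e) ->
 exists f, exists s : nat -> nat, [/\ mfun f,
  (forall k, (s k < s k.+1)%N) &
  {ae m, forall x, f_ (s k) x @[k --> \oo] --> f x}].
Proof.
move=> mf_ If_ cau.
have [s [sS sP]] : exists s : nat -> nat, (forall k, (s k < s k.+1)%N) /\
  forall k, forall n l, (s k <= n)%N -> (s k <= l)%N ->
   rint (fun x => (f_ n x - f_ l x) ^+ 2) <= 8%:R^-1 ^+ k.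
 apply: (@increasing_choice (fun k N => forall n l, (N <= n)%N -> (N <= l)%N ->
   rint (fun x => (f_ n x - f_ l x) ^+ 2) <= 8%:R^-1 ^+ k)) => k.
 have [|N NP] := cau (8%:R^-1 ^+ k); first by rewrite exprn_gt0// invr_gt0.
 by exists N => n Nn i l ni nl; apply: NP; exact: leq_trans Nn _.
(* Increments of squared norm at most [8^-k], weighted by [2^k], have summable integrals; then
   [|a| <= 2^k a^2 + 2^-k] recovers the absolute values from the weighted squares. *)
pose dd k x := 2 ^+ k * (f_ (s k.+1) x - f_ (s k) x) ^+ 2.
have md k : mfun (dd k).
 by apply: measurable_funM => //; apply: measurable_funX; exact: measurable_funB.
have d0 k x : 0 <= dd k x by apply: mulr_ge0; [exact: exprn_ge0|exact: sqr_ge0].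
have Idk k : (\int[m]_x (dd k x)%:E <= (4%:R^-1 ^+ k)%:E)%E.
 rewrite Int_fin; last exact: Int_Z.
 rewrite lee_fin rintZ//.
 have -> : 4%:R^-1 ^+ k = 2 ^+ k * 8%:R^-1 ^+ k :> R.
  by rewrite -exprMn; congr (_ ^+ _); field.
 rewrite ler_wpM2l ?exprn_ge0//; apply: sP => //; exact: ltnW.
have Sfin : (\int[m]_x (\sum_(0 <= k <oo) (dd k x)%:E) < +oo)%E.
 rewrite integral_nneseries//; last first.
 - by move=> n x _; rewrite lee_fin.
 - by move=> n; exact/measurable_EFinP.
 apply: (@le_lt_trans _ _ (2%:E)); last by rewrite ltry.
 apply: lime_le; first by apply: is_cvg_nneseries => n _ _; apply: integral_ge0 => x _; rewrite lee_fin.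
 apply: nearW => n; apply: (@le_trans _ _ (\sum_(0 <= k < n) (4%:R^-1 ^+ k)%:E)%E).
  by apply: lee_sum => k _; exact: Idk.
 rewrite sumEFin lee_fin.
 have -> : \sum_(0 <= i < n) 4%:R^-1 ^+ i = (4/3) * (1 - 4%:R^-1 ^+ n) :> R.
  elim: n => [|n IH]; first by rewrite big_nil expr0 subrr mulr0.
  by rewrite big_nat_recr//= IH exprS; field.
 have : 0 <= 4%:R^-1 ^+ n :> R by rewrite exprn_ge0 ?invr_ge0.
 lra.
have mS : mfun (fun x => \sum_(0 <= k <oo) (dd k x)%:E)%E.
 apply: ge0_emeasurable_sum => [k x _ _|k _]; first by rewrite lee_fin.
 exact/measurable_EFinP.
have S0 x : (0 <= \sum_(0 <= k <oo) (dd k x)%:E)%E.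
 by apply: nneseries_ge0 => k _ _; rewrite lee_fin.
have aeS : {ae m, forall x, (\sum_(0 <= k <oo) (dd k x)%:E)%E \is a fin_num}.
 have : m.-integrable setT (fun x => \sum_(0 <= k <oo) (dd k x)%:E)%E.
  apply/integrableP; split => //.
  by under eq_integral => x _ do rewrite gee0_abs//.
 by move/(integrable_ae measurableT); apply: filterS => x /= /(_ I).
have aecv : {ae m, forall x, cvgn (fun k => f_ (s k) x)}.
 apply: filterS aeS => x /= xfin.
 apply: (@cauchy_summable _ (fine (\sum_(0 <= k <oo) (dd k x)%:E)%E + 2)) => n.
 apply: (@le_trans _ _ (\sum_(k < n) (dd k x + 2^-1 ^+ k))).
  apply: ler_sum => k _; rewrite /dd.
  set a := _ - _; rewrite exprVn.
  have p2 : 0 < 2 ^+ k :> R by rewrite exprn_gt0.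
  have : 0 <= 2 ^+ k * (`|a| - (2 ^+ k)^-1) ^+ 2 by rewrite mulr_ge0 ?sqr_ge0// ltW.
  rewrite (_ : _ * _ = 2 ^+ k * a ^+ 2 + (2 ^+ k)^-1 - 2 * `|a|); last first.
   by rewrite -[a ^+ 2]norm_sq; field; exact: lt0r_neq0.
  by have := normr_ge0 a; lra.
 rewrite big_split/= lerD//.
  rewrite -lee_fin fineK// -sumEFin.
  rewrite -(big_mkord xpredT (fun k => (dd k x)%:E)).
  by apply: nneseries_lim_ge => k _; rewrite lee_fin.
 have -> : \sum_(i < n) 2^-1 ^+ i = 2 * (1 - 2^-1 ^+ n) :> R.
  elim: n => [|n IH]; first by rewrite big_ord0 expr0 subrr mulr0.
  by rewrite big_ord_recr/= IH exprS; field.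
 have : 0 <= 2^-1 ^+ n :> R by rewrite exprn_ge0 ?invr_ge0.
 lra.
have [N [mN N0 NP]] := aecv.
(* Cutting off on the exceptional null set makes the sequence converge everywhere, so that its
   pointwise limit is measurable. *)
pose g_ k x := f_ (s k) x * \1_(~` N) x.
have gE x : ~ N x -> (fun k => g_ k x) = (fun k => f_ (s k) x).
 move=> xN; apply/funext => k; rewrite /g_.
 have -> : \1_(~` N) x = 1 :> R by rewrite indicE mem_set.
 by rewrite mulr1.
have cvg_ x : cvgn (fun k => g_ k x).
 have [xN|xN] := pselect (N x).
  have -> : (fun k => g_ k x) = (fun=> 0).
   apply/funext => k; rewrite /g_.
   have -> : \1_(~` N) x = 0 :> R by rewrite indicE memNset// => h; exact: (h xN).
   by rewrite mulr0.
  exact: is_cvg_cst.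
 rewrite gE//; apply: contrapT => h; apply: xN; exact: NP.
exists (fun x => limn (fun k => g_ k x)), s; split => //.
 apply: (measurable_fun_cvg (h := g_)) => [k|x _]; last exact: cvg_.
 apply: measurable_funM => //; apply: measurable_indic; exact: measurableC.
exists N; split => // x /= h; apply: contrapT => xN; apply: h.
by have := cvg_ x; rewrite gE.
Qed.

End integral_toolbox.

Definition pushm d d' (T1 : measurableType d) (T2 : measurableType d') (R : realType)
 (m : {measure set T1 -> \bar R}) (f : T1 -> T2) (mf : mfun f)
 : {measure set T2 -> \bar R} :=
 measure_function_pushforward__canonical__measure_function_Measure m mf.

Local Notation "[ 'int' x , E ]" := (rint mu2 (fun x => E)) (x name).
Local Notation "[ 'L1' x , E ]" := (Int mu2 (fun x => E)) (x name).
Local Notation "[ 'ae' x , P ]" := {ae mu2, forall x, P} (x name).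

(** * Affine changes of variables *)

Section planar_measure.

Definition affm (a : R) (c : pt) (x : pt) : pt := (a * x.1 + c.1, a * x.2 + c.2).

Lemma measurable_affm a c : mfun (affm a c).
Proof.
by apply/measurable_fun_pairP; split; apply: measurable_funD => //; exact: measurable_funM.
Qed.

Let aff1 (a c t : R) : R := a * t + c.
Let maff1 a c : mfun (aff1 a c : R -> measurableTypeR R).
Proof. by apply: (@measurable_funD _ _ R) => //; exact: measurable_funM. Qed.

(** By uniqueness of Lebesgue measure: [a] times the image measure has the right value on half-open
    intervals. The plane follows in the same way from rectangles. *)
Lemma leb1_aff (a c : R) (A : set R) : 0 < a -> measurable A ->
 leb1 (aff1 a c @^-1` A) = (a^-1%:E * leb1 A)%E.
Proof.
move=> a0 mA.
have H : @lebesgue_measure R A = (a%:E * leb1 (aff1 a c @^-1` A))%E.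
 apply: (@lebesgue_measure_unique _ (mscale (NngNum (ltW a0)) (pushm leb1 (maff1 a c))) _ A mA).
 move=> _ [[x y] _ <-].
 rewrite -[RHS]/(a%:E * @lebesgue_measure R (aff1 a c @^-1` `]x, y]%classic))%E.
 rewrite lebesgue_measure_itv/=.
 have -> : aff1 a c @^-1` `]x, y]%classic = `](x - c) / a, (y - c) / a]%classic.
  apply/seteqP; split => t /=; rewrite !in_itv/= /aff1 => /andP[h1 h2]; apply/andP; split.
  - by rewrite ltr_pdivrMr//; lra.
  - by rewrite ler_pdivlMr//; lra.
  - by move: h1; rewrite ltr_pdivrMr//; lra.
  - by move: h2; rewrite ler_pdivlMr//; lra.
 rewrite lebesgue_measure_itv/= !lte_fin ltr_pM2r ?invr_gt0// ltrD2r.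
 case: ifPn => _; last by rewrite mule0.
 by rewrite -!EFinB -EFinM; congr _%:E; field; exact: lt0r_neq0.
by rewrite [leb1 A]H muleA -EFinM mulVf ?gt_eqF// mul1e.
Qed.

Lemma mu2_prod (A B : set R) : measurable A -> measurable B ->
 mu2 (A `*` B) = (leb1 A * leb1 B)%E.
Proof. by move=> mA mB; rewrite /mu2 product_measure1E. Qed.

Lemma mu2_affm (a : R) c (A : set pt) : 0 < a -> measurable A ->
 mu2 (affm a c @^-1` A) = ((a ^- 2)%:E * mu2 A)%E.
Proof.
move=> a0 mA.
have a20 : 0 <= a ^+ 2 by rewrite sqr_ge0.
have H : mu2 A = ((a ^+ 2)%:E * mu2 (affm a c @^-1` A))%E.
 apply: (@product_measure_unique _ _ _ _ _ leb1 leb1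
  (mscale (NngNum a20) (pushm mu2 (measurable_affm a c))) _ A mA).
 move=> B C mB mC.
 rewrite -[LHS]/((a ^+ 2)%:E * mu2 (affm a c @^-1` (B `*` C)))%E.
 have -> : affm a c @^-1` (B `*` C) = (aff1 a c.1 @^-1` B) `*` (aff1 a c.2 @^-1` C) by [].
 have mp D d : measurable D -> measurable (aff1 a d @^-1` D).
  by move=> mD; have := maff1 a d measurableT mD; rewrite setTI.
 rewrite mu2_prod; do ?exact: mp.
 rewrite !leb1_aff// muleACA muleA -!EFinM.
 rewrite !muleA -EFinM (_ : a ^+ 2 * (a^-1 / a) = 1) ?mul1e//.
 by field; exact: lt0r_neq0.
by rewrite H muleA -EFinM mulVf ?mul1e// sqrf_eq0 gt_eqF.
Qed.

Lemma ge0_integral_affm (a : R) c (f : pt -> \bar R) : 0 < a ->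
 mfun f -> (forall x, 0 <= f x)%E ->
 (\int[mu2]_x f (affm a c x) = (a ^- 2)%:E * \int[mu2]_x f x)%E.
Proof.
move=> a0 mf f0.
have a20 : 0 <= a ^- 2 by rewrite invr_ge0 sqr_ge0.
transitivity (\int[mscale (NngNum a20) mu2]_x f x)%E; last by rewrite ge0_integral_mscale.
have f0' : {in setT, forall y, (0 <= f y)%E} by move=> y _; exact: f0.
have := ge0_integral_pushforward (measurable_affm a c) mu2 measurableT mf f0'.
rewrite preimage_setT => <-.
apply: (@eq_measure_integral _ _ _ _ (mscale (NngNum a20) mu2) (pushm mu2 (measurable_affm a c))).
by move=> A mA _; rewrite [LHS]mu2_affm.
Qed.

Lemma Int_affm (a : R) c f : 0 < a -> Int mu2 f -> [L1 x, f (affm a c x)].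
Proof.
move=> a0 If; have mf := Int_mf If.
apply/integrableP; split.
 by apply/measurable_EFinP; apply: measurableT_comp => //; exact: measurable_affm.
rewrite (ge0_integral_affm c a0 (f := fun x => `|(f x)%:E|%E))//.
 have /integrableP[_] := If => h.
 by rewrite lte_mul_pinfty// ?lee_fin ?invr_ge0 ?sqr_ge0.
by apply: measurableT_comp => //; exact/measurable_EFinP.
Qed.

Lemma rint_affm (a : R) c f : 0 < a -> Int mu2 f ->
 [int x, f (affm a c x)] = a ^- 2 * rint mu2 f.
Proof.
move=> a0 If.
have pos g : Int mu2 g -> (forall x, 0 <= g x) ->
  [int x, g (affm a c x)] = a ^- 2 * rint mu2 g.
 move=> Ig g0; rewrite /rint (ge0_integral_affm c a0 (f := fun x => (g x)%:E))//.
  by rewrite Int_fin.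
 by apply/measurable_EFinP; have := Int_mf Ig.
have In : [L1 x, `|f x| - f x] by apply: Int_B => //; exact: Int_abs.
have E : f = (fun x => `|f x| - (`|f x| - f x)) by apply/funext => x; rewrite opprB addrC subrK.
rewrite [in LHS]E.
rewrite (@rintB _ _ mu2 (fun x => `|f (affm a c x)|) (fun x => `|f (affm a c x)| - f (affm a c x))).
- rewrite (pos (fun x => `|f x|))//; last exact: Int_abs.
 rewrite (pos (fun x => `|f x| - f x))//; last by move=> x; rewrite subr_ge0 ler_norm.
 by rewrite -mulrBr -rintB//; [congr (_ * rint _ _); exact: esym|exact: Int_abs].
- by apply: (Int_affm c a0 (f := fun x => `|f x|)); exact: Int_abs.
- exact: (Int_affm c a0 In).
Qed.

Lemma ae_affm (a : R) c (P : pt -> Prop) : 0 < a ->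
 [ae x, P x] -> [ae x, P (affm a c x)].
Proof.
move=> a0 [N [mN N0 NP]]; exists (affm a c @^-1` N); split.
- by have := measurable_affm a c measurableT mN; rewrite setTI.
- by rewrite mu2_affm// N0 mule0.
- by move=> x h; apply: NP.
Qed.

Lemma leb1_itv (a b : R) (s t : bool) : a <= b ->
 leb1 [set` Interval (BSide s a) (BSide t b)] = (b - a)%:E.
Proof.
move=> ab; rewrite /leb1 lebesgue_measure_itv/= lte_fin.
case: ifPn => //; rewrite -leNgt => ba; congr _%:E.
by apply/eqP; rewrite eq_sym subr_eq0 eq_le ab ba.
Qed.

End planar_measure.

(** * Null sets in product spaces *)

Section almost_everywhere.
Context d1 d2 (T1 : measurableType d1) (T2 : measurableType d2)
 (m1 : {sigma_finite_measure set T1 -> \bar R})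
 (m2 : {sigma_finite_measure set T2 -> \bar R}).

(** Tonelli for the indicator of the complement of [A]: one iterated integral vanishes, hence so
    does the other, and a nonnegative function of zero integral vanishes almost everywhere. *)
Lemma ae_prod (A : set (T1 * T2)) : measurable A ->
 {ae m1, forall x, {ae m2, forall y, A (x, y)}} ->
 {ae m2, forall y, {ae m1, forall x, A (x, y)}}.
Proof.
move=> mA H.
have mC : measurable (~` A) by exact: measurableC.
pose f := (fun z => (\1_(~` A) z : R)%:E).
have mf : mfun f by apply/measurable_EFinP; exact: measurable_indic.
have f0 z : (0 <= f z)%E by rewrite lee_fin.
have h0 : (\int[m1]_x \int[m2]_y f (x, y) = 0)%E.
 rewrite (@ae_eq_integral _ _ _ m1 setT (cst 0%E))//; first by rewrite integral0.
  by have := measurable_fun_fubini_tonelli_F (m2 := m2) f mf f0.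
 apply: filterS H => x /= Hx _.
 rewrite (@ae_eq_integral _ _ _ m2 setT (cst 0%E))//; first by rewrite integral0.
  exact: measurableT_comp.
 apply: filterS Hx => y /= Ay _; rewrite /f.
 by have -> : \1_(~` A) (x, y) = 0 :> R by rewrite indicE memNset// => h; exact: h.
rewrite (fubini_tonelli f mf f0) in h0.
have : ae_eq m2 setT (fun y => \int[m1]_x f (x, y))%E (cst 0%E).
 apply/ae_eq_integral_abs => //.
  by have := measurable_fun_fubini_tonelli_G (m1 := m1) f mf f0.
 under eq_integral => y _ do rewrite gee0_abs ?integral_ge0//.
 exact: h0.
apply: filterS => y /= /(_ I) hy.
have : ae_eq m1 setT (fun x => f (x, y)) (cst 0%E).
 apply/ae_eq_integral_abs => //; first exact: measurableT_comp.
 by under eq_integral => x _ do rewrite gee0_abs//.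
apply: filterS => x /= /(_ I); rewrite /f indicE => -[] h.
apply: contrapT => nA; move: h; rewrite mem_set//= => /eqP; by rewrite oner_eq0.
Qed.

End almost_everywhere.

(** * Smooth functions, test functions and bumps *)

Section smooth_functions.
Implicit Types (f g : R -> R) (u v : pt -> R).

(** The powers of [t^-1] make the family closed under differentiation up to linear combinations, see
    [flat_derive]. *)
Definition flat (n : nat) (t : R) : R := if 0 < t then t^-1 ^+ n * expR (- t^-1) else 0.

(** A syntactic class closed under differentiation: smoothness is obtained by induction on the
    construction, with no iterated derivative to compute. [flat] and [expR] serve the bumps, [sin]
    and [cos] the cut-offs in the decay estimate. *)
Inductive sm : (R -> R) -> Prop :=
| sm_cst c : sm (fun=> c)
| sm_id : sm (fun t => t)
| sm_add f g : sm f -> sm g -> sm (fun t => f t + g t)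
| sm_mul f g : sm f -> sm g -> sm (fun t => f t * g t)
| sm_aff f a c : sm f -> sm (fun t => f (a * t + c))
| sm_flat n : sm (flat n)
| sm_exp f : sm f -> sm (fun t => expR (f t))
| sm_sin : sm sin
| sm_cos : sm cos.

(** The exponential beats the power of degree [n + 2]. Quadratic vanishing at [0] gives the
    derivative there. *)
Lemma flat_le n t : `|flat n t| <= (n.+2)`!%:R * t ^+ 2.
Proof.
rewrite /flat; case: ifPn => t0; last by rewrite normr0 mulr_ge0 ?sqr_ge0.
rewrite ger0_norm ?mulr_ge0 ?exprn_ge0 ?expR_ge0 ?invr_ge0 ?(ltW t0)//.
have it0 : 0 <= t^-1 by rewrite invr_ge0 ltW.
have h := @expR_ge1Dxn R t^-1 n.+1 it0.
have h2 : t^-1 ^+ n.+2 <= (n.+2)`!%:R * expR t^-1.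
 rewrite -ler_pdivrMl ?ltr0n ?fact_gt0// mulrC; apply: le_trans h; lra.
rewrite expRN ler_pdivrMr ?expR_gt0//.
have -> : t^-1 ^+ n = t ^+ 2 * t^-1 ^+ n.+2.
 have -> : t^-1 ^+ n.+2 = t^-1 ^+ n * t^-1 ^+ 2 by rewrite -exprD addn2.
 by rewrite mulrCA -exprMn divff ?gt_eqF// expr1n mulr1.
have -> : (n.+2)`!%:R * t ^+ 2 * expR t^-1 = t ^+ 2 * ((n.+2)`!%:R * expR t^-1) by ring.
by apply: ler_wpM2l h2; exact: sqr_ge0.
Qed.

Lemma flat_derive n x : is_derive x (1 : R) (flat n) (- n%:R * flat n.+1 x + flat n.+2 x).
Proof.
have [x0|x0|->] := ltgtP x 0.
- rewrite /flat !ltNge (ltW x0)/= mulr0 addr0.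
 have : \forall y \near x, cst 0 y = flat n y.
  near=> y; rewrite /flat ifF//; apply/negbTE; rewrite -leNgt ltW//; near: y.
  exact: lt_nbhsl.
 by move=> h; apply: near_eq_is_derive h _; exact: is_derive_cst.
- rewrite /flat x0.
 have : \forall y \near x, y^-1 ^+ n * expR (- y^-1) = flat n y.
  by near=> y; rewrite /flat ifT//; near: y; exact: lt_nbhsr.
 move=> h; apply: near_eq_is_derive h _.
 have dV : is_derive x (1 : R) (fun y : R => y^-1) (- x ^- 2).
  have := @is_deriveV R id x (1 : R) (1 : R) (lt0r_neq0 x0) (is_derive_id x (1 : R)).
  by rewrite [_ *: _]mulr1.
 have dX : is_derive x (1 : R) (fun y : R => y^-1 ^+ n) (n%:R * x^-1 ^+ n.-1 * (- x ^- 2)).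
  have := @is_deriveX _ _ (fun y : R => y^-1) n x 1 _ dV.
  rewrite (_ : _ ^+ n = (fun y : R => y^-1 ^+ n)); last first.
   by apply/funext => y; elim: n => // n IH; rewrite !exprS -IH.
  by move=> h2; exact: h2.
 have dN : is_derive x (1 : R) (fun y : R => - y^-1) (x ^- 2).
  by have := is_deriveN dV; rewrite opprK.
 have dE : is_derive x (1 : R) (fun y : R => expR (- y^-1)) (expR (- x^-1) * x ^- 2).
  exact: (@is_derive1_comp _ expR (fun y : R => - y^-1)).
 have := is_deriveM dX dE => h2; apply: is_derive_eq h2 _.
 have -> : (x ^- 2 : R) = x^-1 ^+ 2 by rewrite exprVn.
 rewrite -[X in X + _ = _]/(x^-1 ^+ n * (expR (- x^-1) * x^-1 ^+ 2)).
 rewrite -[X in _ + X = _]/(expR (- x^-1) * (n%:R * x^-1 ^+ n.-1 * - x^-1 ^+ 2)).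
 clear dX; case: n => [|n]; rewrite /= ?(exprS _ n.+2) ?(exprS _ n.+1) ?(exprS _ n) ?expr0 ?expr1; ring.
(* At [0], Caratheodory's criterion with slope [flat n z / z]: it is [0] at [z = 0] by the
   convention on division, and [flat_le] makes it continuous there. *)
- apply/is_derive1_caratheodory; exists (fun z => flat n z / z); split.
 + move=> z; rewrite /flat ltxx subr0 subr0; have [->|z0] := eqVneq z 0.
   by rewrite ltxx mulr0.
  by rewrite divfK.
 + apply/cvgrPdist_le => /= e e0; near=> z.
  have -> : flat n 0 / 0 = 0 by rewrite /flat ltxx mul0r.
  rewrite sub0r normrN normrM normfV.
  have [->|z0] := eqVneq z 0; first by rewrite normr0 invr0 mulr0 ltW.
  rewrite ler_pdivrMr ?normr_gt0//; apply: le_trans (flat_le n z) _.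
  rewrite -[z ^+ 2]norm_sq expr2 mulrA ler_wpM2r//.
  rewrite -ler_pdivlMl ?ltr0n ?fact_gt0//.
  near: z; apply: (@nbhs0_le R R); by rewrite mulr_gt0// invr_gt0 ltr0n fact_gt0.
 + by rewrite invr0 !mulr0 /flat ltxx mulr0 addr0.
Unshelve. all: by end_near. Qed.

Lemma sm_derive f : sm f -> exists f', sm f' /\ forall x, is_derive x (1 : R) f (f' x).
Proof.
elim => [c||{}f g _ [f' [sf' df]] _ [g' [sg' dg]]|{}f g sf [f' [sf' df]] sg [g' [sg' dg]]|{}f a c _ [f' [sf' df]]|n|{}f sf [f' [sf' df]]||].
- by exists (fun=> 0); split; [exact: sm_cst|move=> x; exact: is_derive_cst].
- by exists (fun=> 1); split; [exact: sm_cst|move=> x; exact: is_derive_id].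
- by exists (fun t => f' t + g' t); split; [exact: sm_add|move=> x; exact: is_deriveD].
- exists (fun t => f t * g' t + g t * f' t); split; last by move=> x; exact: is_deriveM.
 by apply: sm_add; exact: sm_mul.
- exists (fun t => f' (a * t + c) * a); split.
  by apply: (@sm_mul (fun t => f' (a * t + c)) (fun=> a)); [exact: sm_aff|exact: sm_cst].
 move=> x; apply: (@is_derive1_comp _ f (fun t => a * t + c)).
 have h : is_derive x 1 (a \*: (id : R -> R) + cst c) (a *: 1 + 0).
  by apply: is_deriveD.
 by rewrite addr0 scaler1 in h.
- exists (fun t => - n%:R * flat n.+1 t + flat n.+2 t); split; last exact: flat_derive.
 apply: (@sm_add (fun t => - n%:R * flat n.+1 t)); last exact: sm_flat.
 by apply: (@sm_mul (fun=> - n%:R)); [exact: sm_cst|exact: sm_flat].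
- exists (fun t => expR (f t) * f' t); split; first by apply: sm_mul => //; exact: sm_exp.
 by move=> x; apply: (@is_derive1_comp _ expR f).
- by exists cos; split; [exact: sm_cos|move=> x; exact: is_derive_sin].
- exists (fun t => - 1 * sin t); split.
  by apply: (@sm_mul (fun=> - 1)); [exact: sm_cst|exact: sm_sin].
 by move=> x; rewrite mulN1r; exact: is_derive_cos.
Qed.

Lemma is_derive_continuous f x d : is_derive x (1 : R) f d -> {for x, continuous f}.
Proof. by move=> [h _]; apply: differentiable_continuous; exact/derivable1_diffP. Qed.

Lemma sm_continuous f : sm f -> continuous f.
Proof. by move=> /sm_derive[f' [_ df]] x; exact: is_derive_continuous (df x). Qed.

Definition is_pd (b : bool) u v := forall x, is_derive (0 : R) (1 : R) (fun t => u (Defs.shift b x t)) (v x).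

Lemma is_pdE b u v : is_pd b u v -> pd b u = v.
Proof.
move=> h; apply/funext => x; rewrite /pd derive1E.
by have := h x => hx; rewrite derive_val.
Qed.

Inductive sm2 : (pt -> R) -> Prop :=
| sm2_smooth u : smooth u -> sm2 u
| sm2_fst f : sm f -> sm2 (fun x => f x.1)
| sm2_snd f : sm f -> sm2 (fun x => f x.2)
| sm2_add u v : sm2 u -> sm2 v -> sm2 (fun x => u x + v x)
| sm2_mul u v : sm2 u -> sm2 v -> sm2 (fun x => u x * v x)
| sm2_aff u a c : sm2 u -> sm2 (fun x => u (affm a c x)).

Lemma is_derive_addl f x d : is_derive x (1 : R) f d -> is_derive (0 : R) (1 : R) (fun t => f (x + t)) d.
Proof.
move=> df; rewrite -[d]mulr1; apply: (@is_derive1_comp _ f (fun t => x + t)).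
 by rewrite addr0.
have h : is_derive (0 : R) (1 : R) (cst x + (id : R -> R)) (0 + 1).
 by apply: is_deriveD.
by rewrite add0r in h.
Qed.

Lemma sm2_pd u : sm2 u -> continuous u /\ forall b, exists v, sm2 v /\ is_pd b u v.
Proof.
elim => [{}u su|f sf|f sf|{}u v _ [cu du] _ [cv dv]|{}u v su [cu du] sv [cv dv]|{}u a c _ [cu du]].
- split; first by have [] := su [::].
 move=> b; exists (pd b u); split.
  by apply: sm2_smooth => l; have := su (rcons l b); rewrite /iter_pd foldr_rcons.
 move=> x; have [_ h] := su [::]; have := h b x; rewrite /iter_pd/= => dx.
 by rewrite /pd derive1E; exact: DeriveDef.
- split.
  move=> x; apply: (@continuous_comp _ _ _ fst f); first exact: cvg_fst.
  exact: sm_continuous.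
 have [f' [sf' df]] := sm_derive sf.
 case; [exists (fun x => f' x.1)|exists (fun=> 0)]; split.
 + exact: sm2_fst.
 + by move=> x; exact: is_derive_addl.
 + by apply: (@sm2_fst (fun=> 0)); exact: sm_cst.
 + by move=> x; exact: (is_derive_cst (f x.1) (0 : R) (1 : R)).
- split.
  move=> x; apply: (@continuous_comp _ _ _ snd f); first exact: cvg_snd.
  exact: sm_continuous.
 have [f' [sf' df]] := sm_derive sf.
 case; [exists (fun=> 0)|exists (fun x => f' x.2)]; split.
 + by apply: (@sm2_fst (fun=> 0)); exact: sm_cst.
 + by move=> x; exact: (is_derive_cst (f x.2) (0 : R) (1 : R)).
 + exact: sm2_snd.
 + by move=> x; exact: is_derive_addl.
- split; first by move=> x; apply: continuousD; [exact: cu|exact: cv].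
 move=> b; have [u' [su' du']] := du b; have [v' [sv' dv']] := dv b.
 by exists (fun x => u' x + v' x); split; [exact: sm2_add|move=> x; exact: is_deriveD].
- split; first by move=> x; apply: continuousM; [exact: cu|exact: cv].
 move=> b; have [u' [su' du']] := du b; have [v' [sv' dv']] := dv b.
 exists (fun x => u x * v' x + v x * u' x); split; first by apply: sm2_add; exact: sm2_mul.
 move=> x; have := is_deriveM (du' x) (dv' x).
 by have -> : Defs.shift b x 0 = x by case: x => x1 x2; rewrite /Defs.shift/= !addr0; case: b {du dv du' dv'}.
- split.
  move=> x; apply: (@continuous_comp _ _ _ (affm a c) u); last exact: cu.
  apply: (@cvg_pair _ _ _ (nbhs x) (nbhs (a * x.1 + c.1)) (nbhs (a * x.2 + c.2))
    _ _ _ (fun x => a * x.1 + c.1) (fun x => a * x.2 + c.2)).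
   apply: (@cvgD _ _ _ _ _ (fun x : pt => a * x.1) (fun=> c.1)); last exact: cvg_cst.
   by apply: cvgM; [exact: cvg_cst|exact: cvg_fst].
  apply: (@cvgD _ _ _ _ _ (fun x : pt => a * x.2) (fun=> c.2)); last exact: cvg_cst.
  by apply: cvgM; [exact: cvg_cst|exact: cvg_snd].
 move=> b; have [u' [su' du']] := du b.
 exists (fun x => u' (affm a c x) * a); split.
  apply: (@sm2_mul (fun x => u' (affm a c x)) (fun=> a)); first exact: sm2_aff.
  by apply: (@sm2_fst (fun=> a)); exact: sm_cst.
 move=> x; have -> : (fun t => u (affm a c (Defs.shift b x t))) =
   (fun t => u (Defs.shift b (affm a c x) t)) \o (fun t => a * t).
  apply/funext => t; rewrite /= /affm /Defs.shift; case: b {du du'} => /=; congr (u (_, _)); ring.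
 apply: is_derive1_comp; first by rewrite mulr0.
 have h : is_derive (0 : R) (1 : R) (a \*: (id : R -> R)) (a *: 1).
  by apply: is_deriveZ.
 by rewrite scaler1 in h.
Qed.

Lemma sm2_is_smooth u : sm2 u -> smooth u.
Proof.
move=> su l.
have : sm2 (iter_pd l u).
 elim: l => //= b l IH; have [_ /(_ b)[v [sv dv]]] := sm2_pd IH.
 by rewrite /iter_pd/= -/(iter_pd l u) (is_pdE dv).
move=> sl; have [cl dl] := sm2_pd sl; split => // b x.
by have [v [_ dv]] := dl b; have [] := dv x.
Qed.

Definition csupp f := exists r, forall t, r < `|t| -> f t = 0.
Definition tprod f g : pt -> R := fun x => f x.1 * g x.2.

Lemma tprod_test f g : sm f -> csupp f -> sm g -> csupp g -> test_fun (tprod f g).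
Proof.
move=> sf [r hr] sg [s hs]; split.
 by apply: sm2_is_smooth; apply: sm2_mul; [exact: sm2_fst|exact: sm2_snd].
pose M := Num.max 0 (Num.max r s).
exists (M + M) => x xM; rewrite /tprod.
have M0 : 0 <= M by rewrite le_max lexx.
have [h1|h1] := ltP r `|x.1|; first by rewrite hr ?mul0r.
have [h2|h2] := ltP s `|x.2|; first by rewrite hs ?mulr0.
have e1 : `|x.1| <= M by rewrite !le_max h1 orbT.
have e2 : `|x.2| <= M by rewrite !le_max h2 !orbT.
suff : enorm x <= M + M by move: xM; rewrite ltNge => /negP.
rewrite /enorm -(@ler_sqr _ _ (M + M)) ?nnegrE ?sqrtr_ge0 ?addr_ge0//.
rewrite sqr_sqrtr ?addr_ge0 ?sqr_ge0//.
have := normr_ge0 x.1; have := normr_ge0 x.2.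
rewrite -[x.1 ^+ 2]norm_sq -[x.2 ^+ 2]norm_sq; nra.
Qed.

Lemma tprod_pd f f' g g' : (forall x, is_derive x (1 : R) f (f' x)) -> (forall x, is_derive x (1 : R) g (g' x)) ->
 pd true (tprod f g) = tprod f' g /\ pd false (tprod f g) = tprod f g'.
Proof.
move=> df dg; split; apply: is_pdE => x.
 have h := @is_deriveM _ _ _ _ _ _ _ _ (is_derive_addl (df x.1)) (is_derive_cst (g x.2) (0 : R) (1 : R)).
 apply: is_derive_eq h _; by rewrite scaler0 add0r /tprod mulrC.
have h := @is_deriveM _ _ _ _ _ _ _ _ (is_derive_cst (f x.1) (0 : R) (1 : R)) (is_derive_addl (dg x.2)).
apply: is_derive_eq h _; by rewrite scaler0 addr0.
Qed.

Lemma sm_X f n : sm f -> sm (fun t => f t ^+ n).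
Proof.
move=> sf; elim: n => [|n IH]; first by under eq_fun do rewrite expr0; exact: sm_cst.
by under eq_fun do rewrite exprS; exact: sm_mul.
Qed.

(** [ramp n] is [0] for [t <= 0] and tends to [1] for [t > 0]; hence [bump c d n] tends to the
    indicator of the open interval from [c] to [d], staying between [0] and [1]. *)
Definition ramp (n : nat) (t : R) : R := 1 - expR (- flat 0 t) ^+ n.
Definition bump (c d : R) (n : nat) (t : R) : R := ramp n (t - c) * ramp n (d - t).

Lemma ramp_sm n a c : sm (fun t => ramp n (a * t + c)).
Proof.
apply: (@sm_aff (ramp n)); rewrite /ramp; apply: (@sm_add (fun=> 1)); first exact: sm_cst.
rewrite (_ : (fun t => - _) = (fun t => (fun=> - 1) t * expR (- flat 0 t) ^+ n)); last first.
 by apply/funext => t; rewrite mulN1r.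
apply: sm_mul; first exact: sm_cst.
apply: sm_X; apply: sm_exp.
rewrite (_ : (fun t => - _) = (fun t => (fun=> - 1) t * flat 0 t)); last first.
 by apply/funext => t; rewrite mulN1r.
by apply: sm_mul; [exact: sm_cst|exact: sm_flat].
Qed.

Lemma bump_sm c d n : sm (bump c d n).
Proof.
rewrite (_ : bump c d n = (fun t => ramp n (1 * t + (- c)) * ramp n (- 1 * t + d))).
 by apply: sm_mul; exact: ramp_sm.
by apply/funext => t; rewrite /bump mul1r mulN1r [- t + d]addrC.
Qed.

Lemma flat_ge0 n t : 0 <= flat n t.
Proof. by rewrite /flat; case: ifPn => // t0; rewrite mulr_ge0 ?expR_ge0 ?exprn_ge0 ?invr_ge0 ?ltW. Qed.

Lemma ramp_itv n t : 0 <= ramp n t <= 1.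
Proof.
have e0 := expR_ge0 (- flat 0 t).
have e1 : expR (- flat 0 t) <= 1 by rewrite -[leRHS]expR0 ler_expR oppr_le0 flat_ge0.
by rewrite /ramp subr_ge0 exprn_ile1//= lerBlDr lerDl exprn_ge0.
Qed.

Lemma ramp_le0 n t : t <= 0 -> ramp n t = 0.
Proof. by move=> t0; rewrite /ramp /flat ltNge t0/= oppr0 expR0 expr1n subrr. Qed.

Lemma ramp_cvg t : 0 < t -> ramp n t @[n --> \oo] --> (1 : R).
Proof.
move=> t0; rewrite -[X in _ --> X]subr0; apply: cvgB; first exact: cvg_cst.
apply: cvg_expr; rewrite ger0_norm ?expR_ge0// -[ltRHS]expR0 ltr_expR oppr_lt0.
by rewrite /flat t0 expr0 mul1r expR_gt0.
Qed.

Lemma bump_itv c d n t : 0 <= bump c d n t <= 1.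
Proof.
have /andP[a0 a1] := ramp_itv n (t - c); have /andP[b0 b1] := ramp_itv n (d - t).
apply/andP; split; first exact: (mulr_ge0 a0 b0).
exact: (mulr_ile1 a0 b0 a1 b1).
Qed.

Lemma bump_out c d n t : ~~ (c < t < d) -> bump c d n t = 0.
Proof.
rewrite negb_and -!leNgt => /orP[h|h]; rewrite /bump.
 by rewrite (@ramp_le0 n (t - c)) ?mul0r// subr_le0.
by rewrite (@ramp_le0 n (d - t)) ?mulr0// subr_le0.
Qed.

Lemma bump_csupp c d n : csupp (bump c d n).
Proof.
exists (Num.max `|c| `|d|) => t; rewrite gt_max => /andP[h1 h2]; apply: bump_out.
apply/negP => /andP[ct td]; have [t0|t0] := leP 0 t.
 rewrite (ger0_norm t0) in h2; have := ler_norm d; lra.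
rewrite (ltr0_norm t0) in h1; have := ler_norm (- c); rewrite normrN; lra.
Qed.

Lemma bump_cvg c d t : c < t < d -> bump c d n t @[n --> \oo] --> (1 : R).
Proof.
move=> /andP[ct td]; rewrite -[X in _ --> X]mulr1.
by apply: cvgM; apply: ramp_cvg; rewrite subr_gt0.
Qed.

End smooth_functions.

(** * Measurability, local integrability and weak gradients in the plane *)

Section planar_topology.
Implicit Types (w u f g phi : pt -> R).

(** An open set is the countable union of the open squares with rational centre and half-side that
    it contains. *)
Lemma open_measurable2 (A : set pt) : open A -> measurable A.
Proof.
move=> oA.
pose bx (q1 q2 s : rat) : set pt :=
 `](ratr q1 - ratr s), (ratr q1 + ratr s)[%classic `*` `](ratr q2 - ratr s), (ratr q2 + ratr s)[%classic.
have mbx q1 q2 s : measurable (bx q1 q2 s) by exact: measurableX.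
have -> : A = \bigcup_q1 \bigcup_q2 \bigcup_s (if `[< bx q1 q2 s `<=` A >] then bx q1 q2 s else set0).
 apply/seteqP; split => [x Ax|x [q1 _ [q2 _ [s _]]]]; last by case: asboolP => // h; exact: h.
 have /nbhs_ballP[e /= e0 be] : nbhs x A by exact: open_nbhs_nbhs.
 have [s] : exists s : rat, ratr s \in `]0, e / 2[%R by apply: rat_in_itvoo; rewrite divr_gt0.
 rewrite in_itv/= => /andP[s0 se].
 have [q1] : exists q : rat, ratr q \in `](x.1 - ratr s), (x.1 + ratr s)[%R.
  by apply: rat_in_itvoo; lra.
 have [q2] : exists q : rat, ratr q \in `](x.2 - ratr s), (x.2 + ratr s)[%R.
  by apply: rat_in_itvoo; lra.
 rewrite !in_itv/= => /andP[h1 h2] /andP[h3 h4].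
 exists q1 => //; exists q2 => //; exists s => //.
 case: asboolP => [_|[]]; first by split; rewrite /= in_itv/=; apply/andP; split; lra.
 move=> y [/=]; rewrite !in_itv/= => /andP[i1 i2] /andP[i3 i4]; apply: be.
 by split; rewrite /ball/= ltr_norml; apply/andP; split; lra.
apply: bigcupT_measurable_rat => q1; apply: bigcupT_measurable_rat => q2.
by apply: bigcupT_measurable_rat => s; case: asboolP.
Qed.

Lemma continuous_measurable2 f : continuous f -> mfun f.
Proof.
move=> cf; apply: (measurability _ (RGenOInfty.measurableE R)).
move=> _ [_ [x ->] <-]; rewrite setTI; apply: open_measurable2.
by apply: open_comp => //; exact: interval_open.
Qed.

Lemma closed_measurable2 (A : set pt) : closed A -> measurable A.
Proof. by move=> cA; rewrite -[A]setCK; apply: measurableC; apply: open_measurable2; exact: closed_openC. Qed.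

Definition cube (r : R) : set pt := `[- r, r]%classic `*` `[- r, r]%classic.

Lemma cubeP r x : cube r x <-> `|x.1| <= r /\ `|x.2| <= r.
Proof.
by rewrite /cube /setX/= !in_itv/= !ler_norml.
Qed.

Lemma measurable_cube r : measurable (cube r).
Proof. exact: measurableX. Qed.

Lemma compact_cube r : compact (cube r).
Proof. by apply: compact_setX; exact: segment_compact. Qed.

Lemma cubeS r s : r <= s -> cube r `<=` cube s.
Proof. by move=> rs x /cubeP[h1 h2]; apply/cubeP; split; exact: le_trans rs. Qed.

Lemma mu2_cube r : (mu2 (cube r) < +oo)%E.
Proof.
rewrite mu2_prod//; have [r0|r0] := leP 0 r.
 by rewrite !leb1_itv ?ge0_cp// -?EFinM ?ltry// lerNl opprK.
rewrite set_itv_ge ?measure0 ?mule0 ?mul0e// bnd_simp -ltNge.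
lra.
Qed.

Lemma compact_sub_cube (K : set pt) : compact K -> exists r, K `<=` cube r.
Proof.
move=> cK.
have [M1 [_ h1]] : bounded_set [set x.1 | x in K].
 apply: compact_bounded; apply: continuous_compact => //.
 by apply: continuous_subspaceT => x; exact: cvg_fst.
have [M2 [_ h2]] : bounded_set [set x.2 | x in K].
 apply: compact_bounded; apply: continuous_compact => //.
 by apply: continuous_subspaceT => x; exact: cvg_snd.
exists (Num.max (M1 + 1) (M2 + 1)) => x Kx; apply/cubeP; split.
 by rewrite le_max (h1 (M1 + 1))// ?ltrDl//; exists x.
by rewrite le_max (h2 (M2 + 1)) ?orbT// ?ltrDl//; exists x.
Qed.

Lemma enorm_ge0 x : 0 <= @enorm R x.
Proof. exact: sqrtr_ge0. Qed.

Lemma enorm_sq x : @enorm R x ^+ 2 = x.1 ^+ 2 + x.2 ^+ 2.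
Proof. by rewrite sqr_sqrtr// addr_ge0 ?sqr_ge0. Qed.

Lemma enorm_ge1 x : `|x.1| <= @enorm R x.
Proof. by rewrite -ler_sqr ?nnegrE ?enorm_ge0// enorm_sq norm_sq lerDl sqr_ge0. Qed.

Lemma enorm_ge2 x : `|x.2| <= @enorm R x.
Proof. by rewrite -ler_sqr ?nnegrE ?enorm_ge0// enorm_sq norm_sq lerDr sqr_ge0. Qed.

Lemma measurable_enorm : mfun (@enorm R).
Proof.
apply: continuous_measurable2 => x.
apply: (@continuous_comp _ _ _ (fun x : pt => x.1 ^+ 2 + x.2 ^+ 2) (@Num.sqrt R)); last exact: sqrt_continuous.
apply: cvgD; apply: (@continuous_comp _ _ _ _ (fun t : R => t ^+ 2)); do ?exact: exprn_continuous.
 exact: cvg_fst.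
exact: cvg_snd.
Qed.

(* Locally integrable functions, with cubes in place of compact sets. *)
Definition LI w := mfun w /\ forall r, [L1 x, w x * \1_(cube r) x].

Lemma LI_mf w : LI w -> mfun w. Proof. by case. Qed.

Lemma loc_intP w : loc_int w <-> LI w.
Proof.
split=> -[mw h]; split => //.
 move=> r; have := h _ (@compact_cube r).
 rewrite ge0_integral_leb2//; last 2 first.
 - exact: measurable_cube.
 - by apply/measurable_EFinP; apply: measurable_funTS; exact: measurableT_comp.
 move=> hr; apply/integrableP; split.
  apply/measurable_EFinP; apply: measurable_funM => //.
  by apply: measurable_indic; exact: measurable_cube.
 apply: le_lt_trans hr; rewrite [leRHS]integral_mkcond/=.
 apply: le_eq; apply: eq_integral => x _.
 rewrite patchE normrM indicE; case: ifPn => _; first by rewrite normr1 mulr1.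
 by rewrite normr0 mulr0.
move=> K cK; have [r Kr] := compact_sub_cube cK.
have mK : measurable K by apply: closed_measurable2; exact: compact_closed.
rewrite ge0_integral_leb2//; last first.
 by apply/measurable_EFinP; apply: measurable_funTS; exact: measurableT_comp.
have /integrableP[_] := h r; apply: le_lt_trans.
rewrite [leLHS]integral_mkcond/=.
have E x : ((fun x => `|w x|%:E) \_ K) x = (`|w x| * \1_K x)%:E.
 rewrite patchE indicE; case: ifPn => _; first by rewrite mulr1.
 by rewrite mulr0.
under eq_integral => x _ do rewrite E.
apply: ge0_le_integral => //.
- apply/measurable_EFinP; apply: measurable_funM; first exact: measurableT_comp.
 exact: measurable_indic.
- apply/measurable_EFinP; apply: measurableT_comp => //; apply: measurable_funM => //.
 by apply: measurable_indic; exact: measurable_cube.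
- move=> x _; rewrite lee_fin normrM ler_wpM2l// indicE; case: (boolP (x \in K)) => [xK|_]; last exact: normr_ge0.
 by rewrite indicE mem_set ?normr1//; apply: Kr; rewrite inE in xK.
Qed.

(** Bounded functions of bounded support: they can be integrated against every element of [LI], and
    contain the test functions and their derivatives. *)
Definition bs phi := mfun phi /\
 exists r C, forall x, `|phi x| <= C * \1_(cube r) x.

Lemma Int_LI_bs w phi : LI w -> bs phi -> [L1 x, w x * phi x].
Proof.
move=> [mw Iw] [mphi [r [C hC]]].
have Ig := Int_Z `|C| (Int_abs (Iw r)); apply: Int_le Ig _ _.
 exact: measurable_funM.
move=> x; rewrite !normrM [`|\1__ x|]ger0_norm// mulrCA ler_wpM2l//.
by rewrite (le_trans (hC x))// ler_wpM2r// ler_norm.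
Qed.

Lemma bs_LI phi : bs phi -> LI phi.
Proof.
move=> [mphi [r [C hC]]]; split => // s.
have I1 : [L1 x, C * \1_(cube r) x].
 apply: Int_Z; apply: Int_ge0 => //; first by apply: measurable_indic; exact: measurable_cube.
 by rewrite integral_indic ?setIT ?mu2_cube//; exact: measurable_cube.
apply: Int_le I1 _ _.
 by apply: measurable_funM => //; apply: measurable_indic; exact: measurable_cube.
move=> x; rewrite normrM (le_trans _ (hC x))// ler_piMr// indicE.
by case: (_ \in _); rewrite ?normr1 ?normr0.
Qed.

Lemma continuous_bs phi r : continuous phi -> (forall x, ~ cube r x -> phi x = 0) -> bs phi.
Proof.
move=> cphi h0; split; first exact: continuous_measurable2.
have [M [_ hM]] : bounded_set [set phi x | x in cube r].
 apply: compact_bounded; apply: continuous_compact; last exact: compact_cube.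
 exact: continuous_subspaceT.
exists r, (M + 1) => x; rewrite indicE; have [xr|xr] := pselect (cube r x).
 by rewrite mem_set// mulr1 (hM (M + 1)) ?ltrDl//; exists x.
by rewrite memNset// mulr0 h0// normr0.
Qed.

Lemma test_fun_bs phi : test_fun phi -> bs phi /\ forall b, bs (pd b phi).
Proof.
move=> [sphi [r hr]]; have [c0 _] := sphi [::].
have out x : ~ cube (Num.max 0 r + 1) x -> r < enorm x.
 move=> nc; rewrite ltNge; apply/negP => er; apply: nc; apply/cubeP.
 have r0 : r <= Num.max 0 r by rewrite le_max lexx orbT.
 by split; [apply: le_trans (enorm_ge1 x) _|apply: le_trans (enorm_ge2 x) _]; lra.
split; first by apply: (continuous_bs c0) => x /out; exact: hr.
move=> b; have [c1 _] := sphi [:: b].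
apply: (@continuous_bs _ (Num.max 0 r + 1)) => // x /out rx.
rewrite /pd derive1E.
have : \forall t \near (0 : R), cst 0 t = phi (Defs.shift b x t).
 have : \forall t \near (0 : R), r < enorm (Defs.shift b x t).
  have cs : {for (0 : R), continuous (fun t => enorm (Defs.shift b x t))}.
   apply: (@continuous_comp _ _ _ (fun t => (Defs.shift b x t).1 ^+ 2 + (Defs.shift b x t).2 ^+ 2) (@Num.sqrt R)); last exact: sqrt_continuous.
   rewrite /Defs.shift; case: b c1 => _ /=.
    apply: cvgD; last exact: cvg_cst.
    apply: (@continuous_comp _ _ _ (fun t => x.1 + t) (fun t : R => t ^+ 2)); last exact: exprn_continuous.
    by apply: cvgD; [exact: cvg_cst|exact: cvg_id].
   apply: cvgD; first exact: cvg_cst.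
   apply: (@continuous_comp _ _ _ (fun t => x.2 + t) (fun t : R => t ^+ 2)); last exact: exprn_continuous.
   by apply: cvgD; [exact: cvg_cst|exact: cvg_id].
  apply: (cvgr_gt _ cs).
  by have -> : Defs.shift b x 0 = x by case: x rx {cs} => x1 x2 _; rewrite /Defs.shift/= !addr0; case: b c1.
 by apply: filterS => t /hr ->.
move=> /near_eq_is_derive/(_ (is_derive_cst (0 : R) (0 : R) (1 : R))) h.
by rewrite derive_val.
Qed.

Lemma sm_tprod_bs (f g : R -> R) : sm f -> csupp f -> sm g -> csupp g -> bs (tprod f g).
Proof. by move=> sf cf sg cg; have [] := test_fun_bs (tprod_test sf cf sg cg). Qed.

(** [weak_grad] with real integrals over [mu2]. All the integrands are integrable by [Int_LI_bs], so
    the two notions agree. *)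
Definition WG u g1 g2 := [/\ LI u, LI g1, LI g2 & forall phi, test_fun phi ->
 [int x, u x * pd true phi x] = - [int x, g1 x * phi x] /\
 [int x, u x * pd false phi x] = - [int x, g2 x * phi x]].

Lemma integ_mu2 f : mfun f -> integ f = (\int[mu2]_x (f x)%:E)%E.
Proof.
move=> mf; rewrite /integ integralE [RHS]integralE.
have mf' : mfun (fun x => (f x)%:E) by exact/measurable_EFinP.
rewrite !ge0_integral_leb2//.
- by apply: measurable_funeneg.
- by apply: measurable_funepos.
Qed.

Lemma integ_Int f : Int mu2 f -> integ f = (rint mu2 f)%:E.
Proof. by move=> If; rewrite integ_mu2 ?Int_fin//; exact: Int_mf If. Qed.

Lemma intR_rint f : mfun f -> intR f = rint mu2 f.
Proof. by move=> mf; rewrite /intR integ_mu2. Qed.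

Lemma weak_gradP u g1 g2 : weak_grad u g1 g2 <-> WG u g1 g2.
Proof.
split=> -[/loc_intP Lu /loc_intP L1 /loc_intP L2 H]; split => //; do ?exact/loc_intP; move=> phi tphi.
 have [b0 b1] := test_fun_bs tphi; have [h1 h2] := H _ tphi; move: h1 h2.
 rewrite !integ_Int; do ?exact: Int_LI_bs.
 by rewrite -!EFinN => -[->] [->].
have [b0 b1] := test_fun_bs tphi; have [h1 h2] := H _ tphi.
move: Lu L1 L2 => /loc_intP Lu /loc_intP L1 /loc_intP L2.
rewrite !integ_Int; do ?exact: Int_LI_bs.
by rewrite h1 h2 !EFinN.
Qed.

End planar_topology.

(** * The fundamental lemma of the calculus of variations *)

Section uniqueness.
Implicit Types (w : pt -> R).

Lemma Int_indic d (T : measurableType d) (m : {measure set T -> \bar R}) (f : T -> R) (A : set T) :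
 measurable A -> Int m f -> Int m (fun x => f x * \1_A x).
Proof.
move=> mA If; apply: Int_le (Int_abs If) _ _.
 by apply: measurable_funM; [exact: Int_mf If|exact: measurable_indic].
by move=> x; rewrite normrM ler_piMr// indicE; case: (_ \in _); rewrite ?normr1 ?normr0.
Qed.

(** The sets over whose preimage [w] integrates to zero form a Dynkin system: complements because
    the total integral vanishes, disjoint unions by dominated convergence. *)
Lemma pi_lambda_zero d d' (T : measurableType d) (S : measurableType d')
 (m : {measure set T -> \bar R}) (p : T -> S) (G : set (set S)) (w : T -> R) :
 mfun p -> d'.-measurable = <<s G >> -> setI_closed G ->
 Int m w -> rint m w = 0 ->
 (forall A, G A -> rint m (fun x => w x * \1_(p @^-1` A) x) = 0) ->
 forall A, measurable A -> rint m (fun x => w x * \1_(p @^-1` A) x) = 0.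
Proof.
move=> mp mG GI Iw w0 HG.
have mpre A : measurable A -> measurable (p @^-1` A).
 by move=> mA; have := mp measurableT A mA; rewrite setTI.
move=> A mA.
apply: (@dynkin_induction _ S G (fun A => rint m (fun x => w x * \1_(p @^-1` A) x) = 0)) => //.
- rewrite preimage_setT -[RHS]w0; apply: eq_rint => x.
 by rewrite indicT mulr1.
- move=> B mB B0; rewrite preimage_setC.
 have -> : (fun x => w x * \1_(~` (p @^-1` B)) x) = (fun x => w x - w x * \1_(p @^-1` B) x).
  apply/funext => x; rewrite !indicE in_setC; by case: (_ \in _); rewrite /= ?mulr1 ?mulr0 ?subrr ?subr0.
 by rewrite rintB ?w0 ?B0 ?subr0//; apply: Int_indic => //; exact: mpre.
- move=> F mF tF F0.
 have mU n : measurable (\bigcup_(k in `I_n) (p @^-1` F k)).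
  by apply: bigcup_measurable => k _; exact: mpre.
 have cv x : w x * \1_(\bigcup_(k in `I_n) (p @^-1` F k)) x @[n --> \oo] -->
   w x * \1_(p @^-1` (\bigcup_k F k)) x.
  apply: cvgM; first exact: cvg_cst.
  have [[k _ Fk]|nF] := pselect ((p @^-1` (\bigcup_k F k)) x).
   rewrite indicE mem_set; last by exists k.
   apply: cvg_near_cst; exists k.+1 => // n /= kn.
   by rewrite indicE mem_set//; exists k.
  rewrite indicE memNset//; apply: cvg_near_cst; apply: nearW => n.
  by rewrite indicE memNset// => -[k _ Fk]; apply: nF; exists k.
 have [_] : Int m (fun x => w x * \1_(p @^-1` (\bigcup_k F k)) x) /\
   rint m (fun x => w x * \1_(\bigcup_(k in `I_n) (p @^-1` F k)) x) @[n --> \oo] -->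
   rint m (fun x => w x * \1_(p @^-1` (\bigcup_k F k)) x).
 apply: (@dominated_rint _ _ m _ _ (fun x => `|w x|)).
 - by move=> n; apply: measurable_funM; [exact: Int_mf Iw|exact: measurable_indic].
 - apply: measurable_funM; [exact: Int_mf Iw|apply: measurable_indic; apply: mpre].
  exact: bigcup_measurable.
 - exact: Int_abs.
 - by move=> n x; rewrite normrM ler_piMr// indicE; case: (_ \in _); rewrite ?normr1 ?normr0.
 - by apply: aeW => x; exact: cv.
 have -> : (fun n => rint m (fun x => w x * \1_(\bigcup_(k in `I_n) (p @^-1` F k)) x)) = (fun=> 0).
  apply/funext; elim => [|n IH].
   by rewrite II0 bigcup_set0 -[RHS](@rint0 _ _ m); apply: eq_rint => x; rewrite indic0 mulr0.
  have -> : (fun x => w x * \1_(\bigcup_(k in `I_n.+1) (p @^-1` F k)) x) =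
    (fun x => w x * \1_(\bigcup_(k in `I_n) (p @^-1` F k)) x + w x * \1_(p @^-1` F n) x).
   apply/funext => x; rewrite -mulrDr; congr (_ * _); rewrite !indicE.
   rewrite IIS bigcup_setU bigcup_set1 in_setU.
   case: (boolP (x \in p @^-1` F n)) => xn; last by rewrite orbF addr0.
   rewrite orbT (_ : (x \in _) = false) ?add0r//; apply/negbTE/negP; rewrite inE.
   move=> [k /= kn Fk]; rewrite inE in xn.
   have e : k = n by apply: (tF k n I I); exists (p x); split.
   by rewrite e ltnn in kn.
  rewrite rintD ?IH ?F0 ?addr0//; first exact: Int_indic.
  by apply: Int_indic => //; exact: mpre.
 by move=> h; apply/esym; apply: cvg_unique (cvg_cst _) h => //; exact: norm_hausdorff.
- by rewrite -mG.
Qed.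

Lemma itv_bound (a b t : R) : a < t < b -> `|t| <= `|a| + `|b|.
Proof.
move=> /andP[h1 h2]; have := ler_norm (- a); have := ler_norm b; rewrite normrN => *.
have := normr_ge0 a; have := normr_ge0 b.
by rewrite ler_norml => *; apply/andP; split; lra.
Qed.

(** Tensor products of bumps tend to indicators of open boxes, so [w] integrates to zero over boxes.
    The Dynkin argument extends this to measurable sets, one coordinate after the other and then in
    the product. *)
Lemma LI_uniq w : LI w ->
 (forall f g, sm f -> csupp f -> sm g -> csupp g -> [int x, w x * tprod f g x] = 0) ->
 [ae x, w x = 0].
Proof.
move=> [mw Iw] H.
pose box a b c d : set pt := `]a, b[%classic `*` `]c, d[%classic.
have Hbox a b c d : [int x, w x * \1_(box a b c d) x] = 0.
 pose r := `|a| + `|b| + `|c| + `|d|.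
 have cv x : w x * tprod (bump a b n) (bump c d n) x @[n --> \oo] --> w x * \1_(box a b c d) x.
  apply: cvgM; first exact: cvg_cst.
  rewrite /tprod indicE.
  have [h1|h1] := boolP (a < x.1 < b); last first.
   rewrite memNset; last by move=> [/=]; rewrite in_itv/= (negbTE h1).
   by apply: cvg_near_cst; apply: nearW => n; rewrite bump_out// mul0r.
  have [h2|h2] := boolP (c < x.2 < d); last first.
   rewrite memNset; last by move=> [_ /=]; rewrite in_itv/= (negbTE h2).
   by apply: cvg_near_cst; apply: nearW => n; rewrite [X in _ * X]bump_out// mulr0.
  rewrite mem_set; last by split; rewrite /= in_itv.
  by rewrite -[X in _ --> X]mulr1; apply: cvgM; exact: bump_cvg.
 have [_] : [L1 x, w x * \1_(box a b c d) x] /\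
   [int x, w x * tprod (bump a b n) (bump c d n) x] @[n --> \oo] -->
   [int x, w x * \1_(box a b c d) x].
 apply: (@dominated_rint _ _ mu2 _ _ (fun x => `|w x * \1_(cube r) x|)).
 - move=> n; apply: measurable_funM => //; apply: continuous_measurable2.
  have [sp _] := tprod_test (bump_sm a b n) (bump_csupp a b n) (bump_sm c d n) (bump_csupp c d n).
  by have [] := sp [::].
 - by apply: measurable_funM => //; apply: measurable_indic; exact: measurableX.
 - exact: (Int_abs (Iw r)).
 - move=> n x; rewrite normrM [leRHS]normrM; apply: ler_wpM2l => //; rewrite /tprod indicE.
  have /andP[a0 a1] := bump_itv a b n x.1; have /andP[b0 b1] := bump_itv c d n x.2.
  have [h1|h1] := boolP (a < x.1 < b); last by rewrite bump_out// mul0r normr0.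
  have [h2|h2] := boolP (c < x.2 < d); last by rewrite [X in _ * X]bump_out// mulr0 normr0.
  rewrite mem_set; last first.
   apply/cubeP; split; rewrite /r -addrA.
    by rewrite (le_trans (itv_bound h1))// lerDl addr_ge0.
   by rewrite addrA (le_trans (itv_bound h2))// -addrA lerDr addr_ge0.
  by rewrite normr1 (ger0_norm (mulr_ge0 a0 b0)) (mulr_ile1 a0 b0 a1 b1).
 - exact: aeW.
 have -> : (fun n => [int x, w x * tprod (bump a b n) (bump c d n) x]) = (fun=> 0).
  by apply/funext => n; apply: H; [exact: bump_sm|exact: bump_csupp|exact: bump_sm|exact: bump_csupp].
 by move=> h; apply/esym; apply: cvg_unique (cvg_cst _) h => //; exact: norm_hausdorff.
have mbox a b c d : measurable (box a b c d) by exact: measurableX.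
(* Restricted to the box [Q n], [w] is integrable with zero total integral, as [pi_lambda_zero]
   requires. *)
pose Q n := box (- n%:R) n%:R (- n%:R) n%:R.
pose v n x := w x * \1_(Q n) x.
have QE n x : (\1_(Q n) x : R) = \1_(cube n%:R) x * \1_(Q n) x.
 rewrite !indicE; case: (boolP (x \in Q n)) => [|_]; last by rewrite mulr0.
 rewrite inE => -[/=]; rewrite !in_itv/= => /andP[? ?] /andP[? ?].
 by rewrite mem_set ?mulr1//; apply/cubeP; rewrite !ler_norml; split; apply/andP; split; lra.
have Iv n : Int mu2 (v n).
 rewrite /v; under eq_fun do rewrite QE mulrA.
 by apply: Int_indic => //; exact: mbox.
have boxI a b c d a' b' c' d' : box a b c d `&` box a' b' c' d' =
  box (Num.max a a') (Num.min b b') (Num.max c c') (Num.min d d').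
 apply/seteqP; split => x.
  move=> [[/= + +] [/=]]; rewrite !in_itv/= => /andP[? ?] /andP[? ?] /andP[? ?] /andP[? ?].
  by split; rewrite /= in_itv/= gt_max lt_min; apply/andP; split; apply/andP; split.
 move=> [/=]; rewrite !in_itv/= !gt_max !lt_min => /andP[/andP[? ?] /andP[? ?]] /andP[/andP[? ?] /andP[? ?]].
 by split; split; rewrite /= in_itv/=; apply/andP; split.
have indI (A B : set pt) x : (\1_A x * \1_B x : R) = \1_(A `&` B) x.
 by rewrite indicI.
have vbox n a b c d : [int x, v n x * \1_(box a b c d) x] = 0.
 rewrite /v; under eq_fun do rewrite -mulrA indI boxI.
 exact: Hbox.
pose G : set (set R) := [set A | exists a b, A = `]a, b[%classic].
have GE : @measurable _ R = <<s G >>.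
 exact: RGenOpens.measurableE.
have GI : setI_closed G.
 move=> _ _ [a [b ->]] [c [d ->]]; exists (Num.max a c), (Num.min b d).
 apply/seteqP; split => x /=; rewrite !in_itv/= gt_max lt_min.
  by move=> [/andP[-> ->] /andP[-> ->]].
 by move=> /andP[/andP[-> ->] /andP[-> ->]].
have prodE (A B : set R) x : (\1_(A `*` B) x : R) = \1_(snd @^-1` B) x * \1_(fst @^-1` A) x.
 by rewrite indI; congr (\1_ _ x); apply/seteqP; split => y [].
have vfull n : v n = (fun x => v n x * \1_(Q n) x).
 by apply/funext => x; rewrite /v -mulrA indI setIid.
have v0 n : rint mu2 (v n) = 0 by rewrite vfull; exact: vbox.
have H1 n c d A : measurable A -> [int x, v n x * \1_(A `*` `]c, d[%classic) x] = 0.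
 move=> mA; under eq_fun do rewrite prodE mulrA.
 apply: (@pi_lambda_zero _ _ _ _ mu2 fst G) => //.
 - apply: Int_indic => //; have := @measurable_snd _ _ R R measurableT `]c, d[%classic.
  by rewrite setTI; apply; exact: measurable_itv.
 - rewrite (vfull n); under eq_fun do rewrite -mulrA indI.
  have -> : Q n `&` snd @^-1` `]c, d[%classic = box (- n%:R) n%:R (Num.max (- n%:R) c) (Num.min n%:R d).
   apply/seteqP; split => x /=.
    move=> [[/= + +]]; rewrite !in_itv/= => ? /andP[? ?] /andP[? ?].
    by split; rewrite /= in_itv/= ?gt_max ?lt_min; [|apply/andP; split; apply/andP; split].
   move=> [/=]; rewrite !in_itv/= gt_max lt_min => ? /andP[/andP[? ?] /andP[? ?]].
   by split; [split; rewrite /= in_itv/=; [|apply/andP; split]|apply/andP; split].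
  exact: vbox.
 - move=> _ [a [b ->]]; under eq_fun do rewrite -mulrA -prodE; exact: vbox.
have H2 n A B : measurable A -> measurable B -> [int x, v n x * \1_(A `*` B) x] = 0.
 move=> mA mB; under eq_fun do rewrite prodE [X in _ * X]mulrC mulrA.
 have mA' : measurable ((fst : pt -> R) @^-1` A).
  by have := @measurable_fst _ _ R R measurableT A mA; rewrite setTI.
 apply: (@pi_lambda_zero _ _ _ _ mu2 snd G) => //.
 - exact: Int_indic.
 - rewrite (vfull n); under eq_fun do rewrite -mulrA indI.
  have -> : Q n `&` fst @^-1` A = (A `&` `]- n%:R, n%:R[%classic) `*` `]- n%:R, n%:R[%classic.
   by apply/seteqP; split => x /=; [move=> [[? ?] ?]|move=> [[? ?] ?]].
  by apply: H1; exact: measurableI.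
 - move=> _ [a [b ->]]; under eq_fun do rewrite -mulrA [X in _ * X]mulrC -prodE; exact: H1.
have H3 n A : measurable A -> [int x, v n x * \1_A x] = 0.
 move=> mA; apply: (@pi_lambda_zero _ _ _ _ mu2 idfun [set A `*` B | A in measurable & B in measurable]) => //.
 - exact: measurable_id.
 - exact: measurable_prod_measurableType.
 - move=> _ _ [A1 mA1 [B1 mB1 <-]] [A2 mA2 [B2 mB2 <-]]; rewrite -setXI.
  by exists (A1 `&` A2); [exact: measurableI|exists (B1 `&` B2) => //; exact: measurableI].
 - by move=> _ [A1 mA1 [B1 mB1 <-]]; exact: H2.
have aev n : [ae x, v n x = 0].
 have mv := Int_mf (Iv n).
 pose A := [set x | 0 <= v n x].
 have mA : measurable A.
  by have := mv measurableT `[0, +oo[%classic (measurable_itv _); rewrite setTI; congr measurable; apply/seteqP; split => x /=; rewrite in_itv/= andbT.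
 have E x : `|v n x| = v n x * \1_A x - v n x * \1_(~` A) x.
  rewrite !indicE in_setC; have [h|h] := pselect (A x).
   by rewrite mem_set//= ger0_norm// mulr1 mulr0 subr0.
  rewrite memNset//= mulr1 mulr0 sub0r ler0_norm// leNgt.
  by apply/negP => /ltW.
 have : [int x, `|v n x|] = 0.
  under eq_fun do rewrite E; rewrite rintB ?H3 ?subr0//; do ?exact: measurableC.
   exact: Int_indic.
  by apply: Int_indic => //; exact: measurableC.
 move/rint_eq0 => /(_ (Int_abs (Iv n)) (fun x => normr_ge0 _)).
 by apply: filterS => x /normr0_eq0.
have : [ae x, forall n, v n x = 0] by exact/ae_foralln.
apply: filterS => x h.
pose n := (Num.bound (`|x.1| + `|x.2|)).
have nb : `|x.1| + `|x.2| < n%:R by apply: archi_boundP; rewrite addr_ge0.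
have := h n; rewrite /v indicE mem_set ?mulr1//.
have := normr_ge0 x.1; have := normr_ge0 x.2 => h1 h2.
by split; rewrite /= in_itv/= -ltr_norml; lra.
Qed.

End uniqueness.

(** * Fubini's theorem for real-valued integrals *)

Section fubini_real.
Context d1 d2 (T1 : measurableType d1) (T2 : measurableType d2)
 (m1 : {sigma_finite_measure set T1 -> \bar R})
 (m2 : {sigma_finite_measure set T2 -> \bar R}).
Implicit Types F : T1 * T2 -> R.
Local Notation m12 := (m1 \x m2)%E.

Lemma measurable_rint1 F : mfun F ->
 mfun (fun x => rint m2 (fun y => F (x, y))).
Proof.
move=> mF; have mF' : mfun (EFin \o F) by exact/measurable_EFinP.
rewrite /rint; apply: measurableT_comp => //.
under eq_fun => x do rewrite integralE.
apply: emeasurable_funB.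
 have h : mfun ((EFin \o F)^\+)%E by exact: measurable_funepos.
 rewrite [X in measurable_fun _ X](_ : _ = fubini_F m2 ((EFin \o F)^\+)%E).
  by apply: (measurable_fun_fubini_tonelli_F _ h) => z; exact: funepos_ge0.
 by apply/funext => x; apply: eq_integral => y _; rewrite !funeposE.
have h : mfun ((EFin \o F)^\-)%E by exact: measurable_funeneg.
rewrite [X in measurable_fun _ X](_ : _ = fubini_F m2 ((EFin \o F)^\-)%E).
  by apply: (measurable_fun_fubini_tonelli_F _ h) => z; exact: funeneg_ge0.
 by apply/funext => x; apply: eq_integral => y _; rewrite !funenegE.
Qed.

Lemma measurable_rint2 F : mfun F ->
 mfun (fun y => rint m1 (fun x => F (x, y))).
Proof.
move=> mF; have mF' : mfun (EFin \o F) by exact/measurable_EFinP.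
rewrite /rint; apply: measurableT_comp => //.
under eq_fun => x do rewrite integralE.
apply: emeasurable_funB.
 have h : mfun ((EFin \o F)^\+)%E by exact: measurable_funepos.
 rewrite [X in measurable_fun _ X](_ : _ = fubini_G m1 ((EFin \o F)^\+)%E).
  by apply: (measurable_fun_fubini_tonelli_G _ h) => z; exact: funepos_ge0.
 by apply/funext => x; apply: eq_integral => y _; rewrite !funeposE.
have h : mfun ((EFin \o F)^\-)%E by exact: measurable_funeneg.
rewrite [X in measurable_fun _ X](_ : _ = fubini_G m1 ((EFin \o F)^\-)%E).
  by apply: (measurable_fun_fubini_tonelli_G _ h) => z; exact: funeneg_ge0.
 by apply/funext => x; apply: eq_integral => y _; rewrite !funenegE.
Qed.

Lemma Int_prodP F (h : T1 -> R) : mfun F -> Int m1 h ->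
 (forall x, (\int[m2]_y `|F (x, y)|%:E <= (h x)%:E)%E) -> Int m12 F.
Proof.
move=> mF Ih Fh; apply/integrable12ltyP; first exact/measurable_EFinP.
have := integrableP _ _ _ Ih => -[mh]; apply: le_lt_trans.
apply: ge0_le_integral => //.
- by move=> x _; exact: integral_ge0.
- apply: (measurable_fun_fubini_tonelli_F (m2 := m2) (fun z => `|F z|%:E)%E) => //.
 by apply/measurable_EFinP; exact: measurableT_comp.
- by apply: measurableT_comp.
- by move=> x _; apply: le_trans (Fh x) _; rewrite lee_fin ler_norm.
Qed.

Lemma Int_prod_le F (a : T1 -> R) (b : T2 -> R) : mfun F ->
 Int m1 a -> Int m2 b -> (forall x y, `|F (x, y)| <= a x * b y) -> Int m12 F.
Proof.
move=> mF Ia Ib Fab.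
apply: (@Int_prodP F (fun x => a x * rint m2 b)) => //.
 by under eq_fun do rewrite mulrC; exact: Int_Z.
move=> x; rewrite EFinM -(Int_fin Ib) -integralZl//.
apply: ge0_le_integral => //.
- by apply/measurable_EFinP; apply: measurableT_comp => //; exact: measurableT_comp.
- by apply/measurable_EFinP; apply: measurable_funM => //; exact: Int_mf Ib.
- by move=> y _; rewrite -EFinM lee_fin.
Qed.

Lemma rint_fubini1 F : Int m12 F ->
 [/\ Int m1 (fun x => rint m2 (fun y => F (x, y))),
  rint m1 (fun x => rint m2 (fun y => F (x, y))) = rint m12 F &
  {ae m1, forall x, Int m2 (fun y => F (x, y))}].
Proof.
move=> IF; have mF := Int_mf IF.
have mF' : mfun (EFin \o F) by exact/measurable_EFinP.
have aeI : {ae m1, forall x, Int m2 (fun y => F (x, y))}.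
 by have := ae_integrable1 IF.
have mr := measurable_rint1 mF.
have E : {ae m1, forall x, setT x -> fubini_F m2 (EFin \o F) x = (EFin \o (fun x => rint m2 (fun y => F (x, y)))) x}.
 by apply: filterS aeI => x /= Ix _; rewrite /fubini_F/= Int_fin.
have mFF : mfun (fubini_F m2 (EFin \o F)) by exact: (@measurable_fubini_F _ _ _ _ _ m1 m2 _ IF).
split => //.
 have /integrableP[_] := @integrable_fubini_F _ _ _ _ _ m1 m2 _ IF => h.
 apply/integrableP; split; first exact/measurable_EFinP.
 rewrite (@ae_eq_integral _ _ _ m1 setT (abse \o fubini_F m2 (EFin \o F)))//.
 - by apply: measurableT_comp => //; exact/measurable_EFinP.
 - exact: measurableT_comp.
 - by apply: filterS E => x /= + _ => ->.
have e2 := @integral12_prod_meas1 _ _ _ _ _ m1 m2 _ IF.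
rewrite [in RHS]/rint; rewrite -[X in fine X]e2 [in LHS]/rint; congr fine.
apply/esym/ae_eq_integral => //; exact/measurable_EFinP.
Qed.

End fubini_real.

Section fubini_real2.
Context d1 d2 (T1 : measurableType d1) (T2 : measurableType d2)
 (m1 : {sigma_finite_measure set T1 -> \bar R})
 (m2 : {sigma_finite_measure set T2 -> \bar R}).
Implicit Types F : T1 * T2 -> R.
Local Notation m12 := (m1 \x m2)%E.

Lemma rint_fubini2 F : Int m12 F ->
 [/\ Int m2 (fun y => rint m1 (fun x => F (x, y))),
  rint m2 (fun y => rint m1 (fun x => F (x, y))) = rint m12 F &
  {ae m2, forall y, Int m1 (fun x => F (x, y))}].
Proof.
move=> IF; have mF := Int_mf IF.
have mF' : mfun (EFin \o F) by exact/measurable_EFinP.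
have aeI : {ae m2, forall y, Int m1 (fun x => F (x, y))}.
 by have := ae_integrable2 IF.
have mr : mfun (fun y => rint m1 (fun x => F (x, y))) by apply: measurable_rint2.
have E : {ae m2, forall x, setT x -> fubini_G m1 (EFin \o F) x = (EFin \o (fun y => rint m1 (fun x => F (x, y)))) x}.
 by apply: filterS aeI => x /= Ix _; rewrite /fubini_G/= Int_fin.
have mFF : mfun (fubini_G m1 (EFin \o F)) by exact: (@measurable_fubini_G _ _ _ _ _ m1 m2 _ IF).
split => //.
 have [] := @rint_fubini1 _ _ _ _ m2 m1 (fun z => F (z.2, z.1)) => //.
 apply/integrable12ltyP; last by have /integrable21ltyP := IF; apply.
 by apply/measurable_EFinP; apply: measurableT_comp => //; exact: measurable_swap.
have e2 := @integral21_prod_meas1 _ _ _ _ _ m1 m2 _ IF.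
rewrite [in RHS]/rint; rewrite -[X in fine X]e2 [in LHS]/rint; congr fine.
apply/esym/ae_eq_integral => //; exact/measurable_EFinP.
Qed.

Lemma rint_swap F : Int m12 F ->
 rint m1 (fun x => rint m2 (fun y => F (x, y))) =
 rint m2 (fun y => rint m1 (fun x => F (x, y))).
Proof.
by move=> IF; have [_ -> _] := rint_fubini1 IF; have [_ -> _] := rint_fubini2 IF.
Qed.

End fubini_real2.

(** * Averages over the unit interval *)

Section one_dimension.
Implicit Types f : R -> R.

Lemma integral_leb1 (D : set R) f : measurable D -> measurable_fun D f ->
 (\int[@lebesgue_measure R]_(x in D) (f x)%:E = \int[leb1]_(x in D) (f x)%:E)%E.
Proof.
move=> mD mf; rewrite integralE [RHS]integralE.
have mf' : measurable_fun D (fun x => (f x)%:E) by exact/measurable_EFinP.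
by rewrite !ge0_integral_leb1//; [exact: measurable_funeneg|exact: measurable_funepos].
Qed.

(** Averages over [[0, 1]] are integrals over the whole line with this weight, so that they combine
    with [mu2] in product measures. *)
Definition I01 (s : R) : R := \1_(`[0, 1]%classic : set R) s.

Lemma measurable_I01 : mfun I01.
Proof. exact: measurable_indic. Qed.

Lemma I01E s : I01 s = (0 <= s <= 1)%R%:R.
Proof.
rewrite /I01 indicE; congr (_%:R); congr nat_of_bool.
by apply/idP/idP; rewrite inE /= in_itv.
Qed.

Lemma int_I01 : (\int[leb1]_x (I01 x)%:E = 1%:E)%E.
Proof.
rewrite /I01 integral_indic// setIT.
by have := @leb1_itv 0 1 true false ler01; rewrite subr0.
Qed.

Lemma Int_I01 : Int leb1 I01.
Proof.
apply: Int_ge0 => //; first exact: measurable_I01.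
by rewrite int_I01 ltry.
Qed.

Lemma rint_I01 : rint leb1 I01 = 1.
Proof. by rewrite /rint int_I01. Qed.

Lemma Int_I01_le f C : mfun f -> (forall s, 0 <= s <= 1 -> `|f s| <= C) ->
 Int leb1 (fun s => I01 s * f s).
Proof.
move=> mf fC; have I := Int_Z C Int_I01; apply: Int_le I _ _.
 by apply: measurable_funM => //; exact: measurable_I01.
move=> s; rewrite I01E; case: (boolP (0 <= s <= 1)) => [/fC|_].
 by rewrite mul1r mulr1.
by rewrite mul0r mulr0 normr0.
Qed.

Lemma ftc01 (F f : R -> R) : (forall s : R, 0 <= s <= 1 -> is_derive s (1 : R) F (f s)) ->
 {within `[0, 1]%classic, continuous f} -> mfun (fun s => I01 s * f s) ->
 rint leb1 (fun s => I01 s * f s) = F 1 - F 0.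
Proof.
move=> dF cf mf.
have E : (\int[@lebesgue_measure R]_(x in `[0%R, 1%R]) (f x)%:E = (F 1)%:E - (F 0)%:E)%E.
 apply: continuous_FTC2 => //.
  have dr s : 0 <= s <= 1 -> {for s, continuous F}.
   by move=> /dF; exact: is_derive_continuous.
  split.
  + by move=> s; rewrite in_itv/= => /andP[s0 s1]; have [] := dF s; rewrite ?ltW.
  + by apply: cvg_at_right_filter; apply: dr; rewrite lexx ler01.
  + by apply: cvg_at_left_filter; apply: dr; rewrite lexx ler01.
 move=> s; rewrite in_itv/= => /andP[s0 s1]; rewrite derive1E.
 by have := dF s ltac:(by rewrite !ltW) => ?; rewrite derive_val.
have mf' : measurable_fun (`[0, 1]%classic : set R) f.
 by apply: subspace_continuous_measurable_fun.
rewrite integral_leb1// integral_mkcond in E.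
rewrite /rint (_ : (\int[leb1]_x (I01 x * f x)%:E)%E = ((F 1)%:E - (F 0)%:E)%E)//.
rewrite -E; apply: eq_integral => s _; rewrite patchE /I01 indicE.
by case: (_ \in _); rewrite ?mul1r ?mul0r.
Qed.

(* Jensen's inequality on the unit interval. *)
Lemma sqr_rint01 f : mfun f -> Int leb1 (fun s => I01 s * f s ^+ 2) ->
 rint leb1 (fun s => I01 s * f s) ^+ 2 <= rint leb1 (fun s => I01 s * f s ^+ 2).
Proof.
move=> mf If; have := @cauchy_schwarz _ _ leb1 I01 f (fun=> 1) measurable_I01 _ mf _ If _.
rewrite (_ : (fun x => I01 x * 1 ^+ 2) = I01); last by apply/funext => s; rewrite expr1n mulr1.
rewrite rint_I01 mulr1 (_ : (fun x => I01 x * (f x * 1)) = (fun s => I01 s * f s)); last first.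
 by apply/funext => s; rewrite mulr1.
by move=> H; apply: H => //; exact: Int_I01.
Qed.

End one_dimension.

(** * Derivatives in one variable *)

Section derivative_rules.
Implicit Types (f g : R -> R) (x a b c : R).

Lemma idM f g x a b : id1 x f a -> id1 x g b -> id1 x (fun t => f t * g t) (a * g x + f x * b).
Proof.
move=> h1 h2; have h := @is_deriveM _ _ _ _ _ _ _ _ h1 h2.
by apply: is_derive_eq h _; rewrite addrC ![_ *: _]mulrC; congr (_ + _); rewrite mulrC.
Qed.

Lemma idD f g x a b : id1 x f a -> id1 x g b -> id1 x (fun t => f t + g t) (a + b).
Proof. by move=> h1 h2; exact: is_deriveD. Qed.

Lemma idC c x : id1 x (fun=> c) 0.
Proof. exact: is_derive_cst. Qed.

Lemma idid x : id1 x (fun t => t) 1.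
Proof. exact: is_derive_id. Qed.

Lemma idcomp f g x a b : id1 (g x) f a -> id1 x g b -> id1 x (fun t => f (g t)) (a * b).
Proof. by move=> h1 h2; exact: (@is_derive1_comp _ f g). Qed.

Lemma idV f x a : f x != 0 -> id1 x f a -> id1 x (fun t => (f t)^-1) (- a * (f x)^-1 ^+ 2).
Proof.
move=> h0 h1; have h := @is_deriveV _ f x a 1 h0 h1.
apply: is_derive_eq h _.
by rewrite [_ *: _]mulrC mulrN mulNr exprVn.
Qed.

(** The formula [x * expR (- ln (x ^+ 2))] writes inversion as a combination of measurable
    functions; at [0] both sides vanish by convention. *)
Lemma measurable_inv : mfun (fun x : R => x^-1).
Proof.
have -> : (fun x : R => x^-1) = (fun x => x * expR (- ln (x ^+ 2))).
 apply/funext => x; have [->|x0] := eqVneq x 0; first by rewrite invr0 mul0r.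
 have x2 : 0 < x ^+ 2 by rewrite exprn_even_gt0.
 by rewrite expRN lnK// expr2 invfM mulrA divff// mul1r.
apply: measurable_funM => //; apply: measurableT_comp; first exact: measurable_expR.
apply: measurableT_comp => //; apply: measurableT_comp; first exact: measurable_ln.
exact: measurable_funX.
Qed.

End derivative_rules.

(** * Transported densities in one variable *)

Section transport.
Context (k c : R).
Hypothesis k0 : 0 <= k.
Implicit Types (A : R -> R) (s t : R).

Let sg s := 1 + k * s.
(* [t |-> kern A s t] is the density transported by [t |-> sg s * t + s * c]; it
  solves the continuity equation for the velocity [wk]. *)
Definition kern A s t : R := (1 + k * s)^-1 * A ((t - s * c) * (1 + k * s)^-1).
Definition wk s t : R := (k * t + c) * (1 + k * s)^-1.
Definition dkern A (A' : R -> R) s t : R :=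
 - ((1 + k * s)^-1 ^+ 2 * (k * A ((t - s * c) * (1 + k * s)^-1) +
   (k * ((t - s * c) * (1 + k * s)^-1) + c) * A' ((t - s * c) * (1 + k * s)^-1))).

Lemma sg_ge1 s : 0 <= s -> 1 <= 1 + k * s.
Proof. by move=> s0; rewrite lerDl mulr_ge0. Qed.

Lemma sg_gt0 s : 0 <= s -> 0 < 1 + k * s.
Proof. by move=> /sg_ge1; apply: lt_le_trans. Qed.

Lemma kern0 A t : kern A 0 t = A t.
Proof. by rewrite /kern mulr0 addr0 invr1 mul1r mul0r subr0 mulr1. Qed.

Lemma kern_sm A s : sm A -> sm (kern A s).
Proof.
move=> sA; rewrite /kern.
apply: (@sm_mul (fun=> (1 + k * s)^-1) (fun t => A ((t - s * c) * (1 + k * s)^-1))).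
 exact: sm_cst.
rewrite (_ : (fun t => _) = (fun t => A ((1 + k * s)^-1 * t + (- (s * c) * (1 + k * s)^-1)))).
 exact: sm_aff.
by apply/funext => t; congr A; ring.
Qed.

Lemma wk_kern_sm A s : sm A -> sm (fun t => wk s t * kern A s t).
Proof.
move=> sA; apply: sm_mul; last exact: kern_sm.
rewrite /wk; apply: (@sm_mul (fun t => k * t + c) (fun=> (1 + k * s)^-1)); last exact: sm_cst.
apply: (@sm_add (fun t => k * t)); last exact: sm_cst.
by apply: (@sm_mul (fun=> k)); [exact: sm_cst|exact: sm_id].
Qed.

Lemma kern_supp A r : 0 <= r -> (forall t, r < `|t| -> A t = 0) -> forall s t, 0 <= s <= 1 ->
 (1 + k) * r + `|c| < `|t| -> r < `|(t - s * c) * (1 + k * s)^-1|.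
Proof.
move=> r0 Ar s t /andP[s0 s1] rt; have sg0 := sg_gt0 s0.
rewrite normrM normfV (ger0_norm (ltW sg0)) ltr_pdivlMr//.
have h1 : `|s * c| <= `|c| by rewrite normrM ger0_norm// ler_piMl.
have h2 : r * (1 + k * s) <= (1 + k) * r.
 by rewrite mulrC ler_wpM2r// lerD2l ler_piMr.
have h3 : `|t| <= `|t - s * c| + `|s * c| by rewrite -{1}(subrK (s * c) t) ler_normD.
lra.
Qed.

Lemma kern_derive_s A (A' : R -> R) t : (forall x, id1 x A (A' x)) -> forall s, 0 <= s ->
 id1 s (fun s => kern A s t) (dkern A A' s t).
Proof.
move=> dA s s0; have sg0 := sg_gt0 s0.
have d1 : id1 s (fun s => 1 + k * s) k.
 have := idD (idC 1 s) (idM (idC k s) (idid s)).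
 by move/is_derive_eq; apply; ring.
have d2 : id1 s (fun s => (1 + k * s)^-1) (- k * (1 + k * s)^-1 ^+ 2).
 exact: (@idV (fun s => 1 + k * s) s k (lt0r_neq0 sg0) d1).
have d3 : id1 s (fun s => t - s * c) (- c).
 have := idD (idC t s) (idM (idid s) (idC (- c) s)).
 rewrite (_ : (fun s0 => _) = (fun s => t - s * c)); last by apply/funext => z; ring.
 by move/is_derive_eq; apply; ring.
have d4 := idM d3 d2.
have d5 := @idcomp A (fun s => (t - s * c) * (1 + k * s)^-1) _ _ _ (dA _) d4.
have d6 := idM d2 d5.
by apply: is_derive_eq d6 _; rewrite /dkern; field; exact: lt0r_neq0.
Qed.

Lemma kern_derive_t A (A' : R -> R) s : (forall x, id1 x A (A' x)) -> 0 <= s -> forall t,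
 id1 t (fun t => wk s t * kern A s t) (- dkern A A' s t).
Proof.
move=> dA s0 t; have sg0 := sg_gt0 s0.
set iv := (1 + k * s)^-1.
have d1 : id1 t (fun t => (k * t + c) * iv) (k * iv).
 have := idM (idD (idM (idC k t) (idid t)) (idC c t)) (idC iv t).
 by move/is_derive_eq; apply; ring.
have d2 : id1 t (fun t => (t - s * c) * iv) iv.
 have := idM (idD (idid t) (idC (- (s * c)) t)) (idC iv t).
 by move/is_derive_eq; apply; ring.
have d3 := idM (idC iv t) (@idcomp A (fun t => (t - s * c) * iv) _ _ _ (dA _) d2).
have d4 := idM d1 d3.
apply: is_derive_eq d4 _; rewrite /dkern /wk /kern -/iv.
have e : iv * (1 + k * s) = 1 by rewrite /iv mulVf// lt0r_neq0.
have -> : (k * t + c) * iv = k * ((t - s * c) * iv) + c.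
 rewrite mulrDl -[X in _ = _ + X]mulr1 -e; ring.
ring.
Qed.

Lemma measurable_kern d (T : measurableType d) A (f g : T -> R) : mfun A ->
 mfun f -> mfun g ->
 mfun (fun z => kern A (f z) (g z)).
Proof.
move=> mA mf mg.
have mi : mfun (fun z => (1 + k * f z)^-1).
 apply: measurableT_comp; first exact: measurable_inv.
 by apply: measurable_funD => //; exact: measurable_funM.
apply: measurable_funM => //; apply: measurableT_comp => //.
apply: measurable_funM => //; apply: measurable_funB => //; exact: measurable_funM.
Qed.

Lemma measurable_dkern d (T : measurableType d) A (A' : R -> R) (f g : T -> R) : mfun A ->
 mfun A' -> mfun f -> mfun g ->
 mfun (fun z => dkern A A' (f z) (g z)).
Proof.
move=> mA mA' mf mg.
have mi : mfun (fun z => (1 + k * f z)^-1).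
 apply: measurableT_comp; first exact: measurable_inv.
 by apply: measurable_funD => //; exact: measurable_funM.
have mx : mfun (fun z => (g z - f z * c) * (1 + k * f z)^-1).
 by apply: measurable_funM => //; apply: measurable_funB => //; exact: measurable_funM.
apply: measurableT_comp => //; apply: measurable_funM; first exact: measurable_funX.
apply: measurable_funD; first by apply: measurable_funM => //; exact: measurableT_comp.
apply: measurable_funM; last exact: measurableT_comp.
by apply: measurable_funD => //; exact: measurable_funM.
Qed.

End transport.

Section bounded.

Lemma sm_bounded (A : R -> R) : sm A -> csupp A -> exists M r, [/\ 0 <= M, 0 <= r,
 (forall t, `|A t| <= M) & forall t, r < `|t| -> A t = 0].
Proof.
move=> sA [r hr]; pose r' := Num.max 0 r.
have [M0 [_ hM]] : bounded_set [set A t | t in `[- r', r']%classic].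
 apply: compact_bounded; apply: continuous_compact; last exact: segment_compact.
 by apply: continuous_subspaceT; exact: sm_continuous.
have hr' t : r' < `|t| -> A t = 0 by rewrite gt_max => /andP[_ /hr].
exists (Num.max 0 (M0 + 1)), r'; split => //; rewrite ?le_max ?lexx// => t.
have [h|/hr' ->] := leP `|t| r'; last by rewrite normr0 le_max lexx.
rewrite le_max (hM (M0 + 1)) ?ltrDl ?orbT//; exists t => //=.
by rewrite in_itv/= -ler_norml.
Qed.

Lemma sm_derive_csupp (A A' : R -> R) : (forall x, is_derive x (1 : R) A (A' x)) -> csupp A -> csupp A'.
Proof.
move=> dA [r hr]; exists r => t rt.
have h : \forall y \near t, A y = cst 0 y.
 have : \forall y \near t, r < `|y|.
  have cn : {for t, continuous (fun y : R => `|y|)} by exact: norm_continuous.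
  exact: (cvgr_gt _ cn _ rt).
 by apply: filterS => y /hr ->.
have d1 := near_eq_is_derive h (dA t).
have := @derive_val _ _ _ _ _ _ _ d1.
by rewrite derive_cst.
Qed.

End bounded.

(** * The transport formula for weakly differentiable functions *)

Section flow.
Context (k : R) (c : pt).
Hypothesis k0 : 0 <= k.
Implicit Types (h u g w : pt -> R) (s t : R).

(** The uniform motion from [x] at time [0] to [(1 + k) x + c] at time [1]. Dilations have [c = 0],
    translations [k = 0]. *)
Definition flw s (x : pt) : pt := affm (1 + k * s) (s * c.1, s * c.2) x.
Definition flavg h (x : pt) : R := rint leb1 (fun s => I01 s * h (flw s x)).

Lemma flw_cube r s x : 0 <= s <= 1 -> cube r x ->
 cube ((1 + k) * r + `|c.1| + `|c.2|) (flw s x).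
Proof.
move=> /andP[s0 s1] /cubeP[h1 h2].
have H (y d : R) : `|y| <= r -> `|(1 + k * s) * y + s * d| <= (1 + k) * r + `|d|.
 move=> yr; apply: le_trans (ler_normD _ _) _; apply: lerD; last first.
  by rewrite normrM ger0_norm// ler_piMl.
 rewrite normrM ger0_norm ?ler_pM ?addr_ge0 ?mulr_ge0//.
 by rewrite lerD2l ler_piMr.
apply/cubeP; split; rewrite /flw /affm/=.
 by apply: le_trans (H _ _ h1) _; rewrite lerDl.
by apply: le_trans (H _ _ h2) _; rewrite -addrA lerD2l lerDr.
Qed.

Lemma measurable_flw h : mfun h ->
 mfun (fun z : R * pt => h (flw z.1 z.2)).
Proof.
move=> mh; apply: measurableT_comp => //.
have m1 : mfun (fun z : R * pt => z.1) by mproj.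
have m2 : mfun (fun z : R * pt => z.2.1) by mproj.
have m3 : mfun (fun z : R * pt => z.2.2) by mproj.
by apply/measurable_fun_pairP; split; apply: measurable_funD; apply: measurable_funM => //; apply: measurable_funD => //;
 exact: measurable_funM.
Qed.

(** For [k >= 0] composition with [flw] multiplies integrals by [(1 + k s) ^- 2 <= 1], and the
    support of [xi] is moved inside one larger cube for all times; so the time slices are bounded
    uniformly. *)
Lemma Int_flow h xi : LI h -> bs xi ->
 Int (leb1 \x mu2)%E (fun z => I01 z.1 * (h (flw z.1 z.2) * xi z.2)).
Proof.
move=> [mh Ih] [mxi [r [C xiC]]].
set r' := (1 + k) * r + `|c.1| + `|c.2|.
pose f y := `|C| * `|h y * \1_(cube r') y|.
have If : Int mu2 f by apply: Int_Z; exact: Int_abs.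
apply: (@Int_prodP _ _ _ _ leb1 mu2 _ (fun s => rint mu2 f * I01 s)).
- apply: measurable_funM; first by apply: measurableT_comp => //; exact: measurable_I01.
 by apply: measurable_funM; [exact: measurable_flw|exact: measurableT_comp].
- by apply: Int_Z; exact: Int_I01.
move=> s; rewrite I01E; case: (boolP (0 <= s <= 1)) => [s01|_]; last first.
 by under eq_integral do rewrite mul0r normr0; rewrite integral0 mulr0.
have a1 : 1 <= 1 + k * s by apply: sg_ge1 => //; case/andP: s01.
have a0 : 0 < 1 + k * s by apply: lt_le_trans a1.
have Ifa := Int_affm (s * c.1, s * c.2) a0 If.
have mhs : mfun (fun x => h (flw s x)).
 by apply: measurableT_comp => //; exact: measurable_affm.
rewrite mulr1; apply: (@le_trans _ _ ([int x, f (flw s x)])%:E).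
 rewrite -(Int_fin Ifa); apply: ge0_le_integral => //.
 - apply/measurable_EFinP; apply: measurableT_comp => //; apply: measurable_funM => //.
  exact: (measurable_funM mhs mxi).
 - by apply/measurable_EFinP; exact: Int_mf Ifa.
 move=> x _; rewrite lee_fin mul1r normrM /f mulrC.
 have := xiC x; rewrite indicE; have [xr|xr] := pselect (cube r x).
  rewrite mem_set// mulr1 => hx; rewrite normrM indicE mem_set ?normr1 ?mulr1.
   by rewrite ler_wpM2r// (le_trans hx)// ler_norm.
  exact: flw_cube.
 rewrite memNset// mulr0 => hx; have /eqP -> : `|xi x| == 0 by rewrite eq_le hx/=.
 by rewrite mul0r mulr_ge0.
rewrite lee_fin (@rint_affm _ (s * c.1, s * c.2) f a0 If) ler_piMl ?rint_ge0//.
 by move=> x; rewrite mulr_ge0.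
by rewrite invf_le1 ?exprn_gt0// exprn_ege1.
Qed.

Lemma bs_cube r : bs (\1_(cube r) : pt -> R).
Proof.
split; first by apply: measurable_indic; exact: measurable_cube.
by exists r, 1 => x; rewrite mul1r ger0_norm.
Qed.

Lemma cube_cover (x : pt) : exists n : nat, cube n%:R x.
Proof.
exists (Num.truncn (`|x.1| + `|x.2|)).+1; apply/cubeP.
have := truncnS_gt (`|x.1| + `|x.2|); have := normr_ge0 x.1; have := normr_ge0 x.2.
by move=> *; split; lra.
Qed.

Lemma flow_ae h : LI h -> [ae x, Int leb1 (fun s => I01 s * h (flw s x))].
Proof.
move=> Lh.
have H (n : nat) : [ae x, cube n%:R x -> Int leb1 (fun s => I01 s * h (flw s x))].
 have [_ _] := rint_fubini2 (Int_flow Lh (bs_cube n%:R)).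
 apply: filterS => x /= Ix xn; move: Ix; rewrite indicE mem_set//.
 by under eq_fun do rewrite mulr1.
have := ae_foralln H; apply: filterS => x /= Hx.
by have [n /Hx] := cube_cover x.
Qed.

Lemma measurable_flavg h : mfun h -> mfun (flavg h).
Proof.
move=> mh; apply: (@measurable_rint2 _ _ _ _ leb1 (fun z : R * pt => I01 z.1 * h (flw z.1 z.2))).
by apply: measurable_funM; [apply: measurableT_comp measurable_I01 _; mproj|exact: measurable_flw].
Qed.

Lemma flow_test h xi : LI h -> bs xi ->
 [/\ [L1 x, flavg h x * xi x],
  Int leb1 (fun s => I01 s * [int x, h (flw s x) * xi x]) &
  [int x, flavg h x * xi x] =
  rint leb1 (fun s => I01 s * [int x, h (flw s x) * xi x])].
Proof.
move=> Lh bxi; have IF := Int_flow Lh bxi.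
have [I2 E2 _] := rint_fubini2 IF; have [I1 E1 ae1] := rint_fubini1 IF.
have aeE : [ae x, rint leb1 (fun s => I01 s * (h (flw s x) * xi x)) = flavg h x * xi x].
 apply: filterS (flow_ae Lh) => x Ix; rewrite mulrC /flavg -rintZ//.
 by apply: eq_rint => s; rewrite mulrA mulrC.
have mp : mfun (fun x => flavg h x * xi x).
 by apply: measurable_funM; [exact: measurable_flavg (LI_mf Lh)|case: bxi].
have aeE1 : {ae leb1, forall s, [int x, I01 s * (h (flw s x) * xi x)] =
  I01 s * [int x, h (flw s x) * xi x]}.
 apply: filterS ae1 => s /=; rewrite I01E; case: (0 <= s <= 1) => Is.
  by rewrite mul1r; apply: eq_rint => x; rewrite mul1r.
 by rewrite mul0r -[RHS](@rint0 _ _ mu2); apply: eq_rint => x; rewrite mul0r.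
have mq : mfun (fun s => I01 s * [int x, h (flw s x) * xi x]).
 apply: measurable_funM; first exact: measurable_I01.
 apply: (@measurable_rint1 _ _ _ _ mu2 (fun z : R * pt => h (flw z.1 z.2) * xi z.2)).
 apply: measurable_funM; first exact: measurable_flw (LI_mf Lh).
 by apply: measurableT_comp => //; case: bxi.
split.
- exact: Int_ae aeE I2.
- exact: Int_ae aeE1 I1.
rewrite -(rint_ae (Int_mf I2) mp aeE) -(rint_ae (Int_mf I1) mq aeE1).
by rewrite E1 -E2.
Qed.

Lemma flow_LI h : LI h -> LI (flavg h).
Proof.
by move=> Lh; split=> [|r]; [exact: measurable_flavg (LI_mf Lh)|have [] := flow_test Lh (bs_cube r)].
Qed.

Lemma flow_change h xi eta s : 0 <= s -> [L1 y, h y * eta y] ->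
 (forall x, xi x = (1 + k * s) ^+ 2 * eta (flw s x)) ->
 [int x, h (flw s x) * xi x] = [int y, h y * eta y].
Proof.
move=> s0 I E; have a0 := sg_gt0 k0 s0.
have I2 := Int_Z ((1 + k * s) ^+ 2) I.
have a2 : (1 + k * s) ^+ 2 != 0 by rewrite expf_neq0// lt0r_neq0.
rewrite -[RHS]mul1r -(mulVf a2) -mulrA -(rintZ _ I) -(rint_affm (s * c.1, s * c.2) a0 I2).
by apply: eq_rint => x; rewrite E mulrCA.
Qed.

Lemma bs_affmul (xi : pt -> R) (a b d : R) : bs xi -> bs (fun x => (a * x.1 + b * x.2 + d) * xi x).
Proof.
move=> [mxi [r [C xiC]]]; split.
 apply: measurable_funM => //; apply: measurable_funD => //.
 by apply: measurable_funD => //; exact: measurable_funM.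
exists r, ((`|a| * `|r| + `|b| * `|r| + `|d|) * `|C|) => x; rewrite normrM.
have := xiC x; rewrite indicE; have [xr|xr] := pselect (cube r x).
 rewrite mem_set// !mulr1 => hx; apply: ler_pM => //; last exact: le_trans hx (ler_norm _).
 case/cubeP: xr => h1 h2; apply: le_trans (ler_normD _ _) _; rewrite lerD2r.
 apply: le_trans (ler_normD _ _) _; rewrite !normrM.
 by apply: lerD; rewrite ler_wpM2l// (le_trans _ (ler_norm r)).
rewrite memNset// !mulr0 => hx; have /eqP -> : `|xi x| == 0 by rewrite eq_le hx/=.
by rewrite mulr0.
Qed.

Lemma LI_flw1 h : LI h -> LI (fun x => h (flw 1 x)).
Proof.
move=> [mh Ih]; split; first by apply: measurableT_comp => //; exact: measurable_affm.
move=> r; have a0 : 0 < 1 + k * 1 by apply: sg_gt0.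
apply: Int_le (Int_abs (Int_affm (1 * c.1, 1 * c.2) a0 (Ih ((1 + k) * r + `|c.1| + `|c.2|)))) _ _.
 apply: measurable_funM; last by apply: measurable_indic; exact: measurable_cube.
 by apply: measurableT_comp => //; exact: measurable_affm.
move=> x; rewrite !normrM ler_wpM2l// !indicE.
have [xr|xr] := pselect (cube r x); last by rewrite (memNset xr) normr0.
rewrite mem_set// (@mem_set _ _ (affm _ _ x))//.
by apply: (@flw_cube r 1) => //; rewrite ler01 lexx.
Qed.

Lemma dkern_bound (A A' : R -> R) (d : R) : sm A -> csupp A -> sm A' -> csupp A' ->
 exists C r, 0 <= C /\ forall s t, 0 <= s <= 1 ->
  `|kern k d A s t| <= C * (`|t| <= r)%R%:R /\ `|dkern k d A A' s t| <= C * (`|t| <= r)%R%:R.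
Proof.
move=> sA cA sA' cA'.
have [M [r [M0 r0 AM Ar]]] := sm_bounded sA cA.
have [M' [r' [M'0 r'0 AM' Ar']]] := sm_bounded sA' cA'.
set q := Num.max r r'; have q0 : 0 <= q by rewrite le_max r0.
have p0 : 0 <= k * M by rewrite mulr_ge0.
have p1 : 0 <= (k * q + `|d|) * M' by rewrite mulr_ge0 ?addr_ge0 ?mulr_ge0.
exists (M + (k * M + (k * q + `|d|) * M')), ((1 + k) * q + `|d|); split => [|s t s01].
 by rewrite !addr_ge0.
have s0 : 0 <= s by case/andP: s01.
have a1 := sg_ge1 k0 s0; have a0 := sg_gt0 k0 s0.
have i1 : (1 + k * s)^-1 <= 1 by rewrite invf_le1.
have i0 : 0 <= (1 + k * s)^-1 by rewrite invr_ge0 ltW.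
have [tq|tq] := leP `|t| ((1 + k) * q + `|d|); last first.
 have h1 : r < `|(t - s * d) * (1 + k * s)^-1|.
  by apply: (kern_supp k0 r0 Ar s01); apply: le_lt_trans tq; rewrite lerD2r ler_wpM2l ?addr_ge0// le_max lexx.
 have h2 : r' < `|(t - s * d) * (1 + k * s)^-1|.
  by apply: (kern_supp k0 r'0 Ar' s01); apply: le_lt_trans tq; rewrite lerD2r ler_wpM2l ?addr_ge0// le_max lexx orbT.
 by rewrite /kern /dkern Ar// Ar'// !mulr0 addr0 mulr0 oppr0 normr0.
rewrite mulr1; split.
 rewrite /kern normrM (ger0_norm i0); apply: le_trans (_ : M <= _); last by lra.
 by rewrite -[leRHS]mul1r ler_pM.
rewrite /dkern normrN normrM ger0_norm ?exprn_ge0//.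
apply: le_trans (_ : k * M + (k * q + `|d|) * M' <= _); last by lra.
set a := (t - s * d) * _.
rewrite -[leRHS]mul1r; apply: ler_pM => //; rewrite ?exprn_ge0 ?exprn_ile1//.
apply: le_trans (ler_normD _ _) _; apply: lerD.
 by rewrite normrM ger0_norm// ler_wpM2l.
have [aq|aq] := leP `|a| q.
 rewrite normrM; apply: ler_pM => //; apply: le_trans (ler_normD _ _) _.
 by rewrite lerD2r normrM ger0_norm// ler_wpM2l.
by rewrite (Ar' a) ?mulr0 ?normr0//; apply: le_lt_trans aq; rewrite le_max lexx orbT.
Qed.

Lemma sg_continuous s : {for s, continuous (fun s : R => 1 + k * s)}.
Proof.
apply: continuousD; first exact: cst_continuous.
by apply: continuousM; [exact: cst_continuous|exact: cvg_id].
Qed.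

Lemma inner_continuous (d t s : R) : 0 <= s ->
 {for s, continuous (fun s => (1 + k * s)^-1)} /\
 {for s, continuous (fun s => (t - s * d) * (1 + k * s)^-1)}.
Proof.
move=> s0; have a0 := sg_gt0 k0 s0.
have c1 : {for s, continuous (fun s => (1 + k * s)^-1)}.
 by apply: continuousV; [exact: lt0r_neq0|exact: sg_continuous].
split => //; apply: continuousM => //; apply: continuousB; first exact: cst_continuous.
by apply: continuousM; [exact: cvg_id|exact: cst_continuous].
Qed.

Lemma kern_continuous (A A' : R -> R) (d t s : R) : continuous A -> continuous A' -> 0 <= s ->
 {for s, continuous (fun s => kern k d A s t)} /\ {for s, continuous (fun s => dkern k d A A' s t)}.
Proof.
move=> cA cA' s0; have [c1 c2] := inner_continuous d t s0.
have c3 : {for s, continuous (fun s => A ((t - s * d) * (1 + k * s)^-1))}.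
 by apply: continuous_comp => //; exact: cA.
have c4 : {for s, continuous (fun s => A' ((t - s * d) * (1 + k * s)^-1))}.
 by apply: continuous_comp => //; exact: cA'.
split; first exact: continuousM.
apply: continuousN; apply: continuousM.
 by apply: (@continuous_comp _ _ _ (fun s => (1 + k * s)^-1) (fun t => t ^+ 2)); [exact: c1|exact: exprn_continuous].
apply: continuousD; first by apply: continuousM => //; exact: cst_continuous.
apply: continuousM => //; apply: continuousD; last exact: cst_continuous.
by apply: continuousM => //; exact: cst_continuous.
Qed.

(* A test function transported along the flow satisfies the continuity equation
  [d/ds psi = - div (wk psi)], so testing the weak gradient with [wk psi] gives
  [d/ds \int u psi = \int (wk . g) psi]. *)
Lemma flow u g1 g2 : WG u g1 g2 ->
 [ae x, u (flw 1 x) - u x =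
  (k * x.1 + c.1) * flavg g1 x + (k * x.2 + c.2) * flavg g2 x].
Proof.
move=> [Lu L1 L2 W].
have L1x : LI (fun x => (k * x.1 + c.1) * flavg g1 x + (k * x.2 + c.2) * flavg g2 x).
 have Lg1 := flow_LI L1; have Lg2 := flow_LI L2.
 have H (a b d : R) w : LI w -> LI (fun x => (a * x.1 + b * x.2 + d) * w x).
  move=> Lw; split.
   apply: measurable_funM; last by case: Lw.
   apply: measurable_funD => //; apply: measurable_funD; exact: measurable_funM.
  move=> r; have := Int_LI_bs Lw (bs_affmul a b d (bs_cube r)).
  by congr Int; apply/funext => x; rewrite mulrCA mulrA.
 have [m1 I1] := H k 0 c.1 _ Lg1; have [m2 I2] := H 0 k c.2 _ Lg2.
 move: m1 I1 m2 I2; under eq_fun do rewrite mul0r addr0.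
 move=> m1 I1; under eq_fun do rewrite mul0r add0r.
 move=> m2 I2; split; first exact: measurable_funD.
 move=> r; under eq_fun do rewrite mulrDl; apply: Int_D.
  by have := I1 r; under eq_fun do rewrite mul0r addr0.
 by have := I2 r; under eq_fun do rewrite mul0r add0r.
have Lu1 := LI_flw1 Lu.
have Ldiff : LI (fun x => u (flw 1 x) - u x -
  ((k * x.1 + c.1) * flavg g1 x + (k * x.2 + c.2) * flavg g2 x)).
 case: L1x Lu1 Lu => m1 I1 [m2 I2] [m3 I3]; split.
  by apply: measurable_funB => //; exact: measurable_funB.
 by move=> r; under eq_fun do rewrite mulrBl mulrBl; apply: Int_B => //; exact: Int_B.
suff : [ae x, u (flw 1 x) - u x -
  ((k * x.1 + c.1) * flavg g1 x + (k * x.2 + c.2) * flavg g2 x) = 0].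
 by apply: filterS => x /eqP; rewrite subr_eq0 => /eqP.
(* Tensor products suffice as test functions, and the flow, acting on each coordinate separately,
   transports them into tensor products. *)
apply: (LI_uniq Ldiff) => A B sA cA sB cB.
have [A' [sA' dA]] := sm_derive sA; have [B' [sB' dB]] := sm_derive sB.
have cA' := sm_derive_csupp dA cA; have cB' := sm_derive_csupp dB cB.
have bAB := sm_tprod_bs sA cA sB cB.
have [CA [rA [CA0 hA]]] := dkern_bound c.1 sA cA sA' cA'.
have [CB [rB [CB0 hB]]] := dkern_bound c.2 sB cB sB' cB'.
pose psi s := tprod (kern k c.1 A s) (kern k c.2 B s).
pose D s (y : pt) := dkern k c.1 A A' s y.1 * kern k c.2 B s y.2 +
 kern k c.1 A s y.1 * dkern k c.2 B B' s y.2.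
have ck (d : R) A0 s : sm A0 -> csupp A0 -> 0 <= s -> csupp (kern k d A0 s) /\ csupp (fun t => wk k d s t * kern k d A0 s t).
 move=> sA0 [r hr] s0; have a0 := sg_gt0 k0 s0.
 suff cs : csupp (kern k d A0 s).
  by split => //; have [q hq] := cs; exists q => t /hq ->; rewrite mulr0.
 exists ((1 + k * s) * Num.max 0 r + `|s * d|) => t ht; rewrite /kern hr ?mulr0//.
 apply: (@le_lt_trans _ _ (Num.max 0 r)); first by rewrite le_max lexx orbT.
 rewrite normrM normfV (gtr0_norm a0) ltr_pdivlMr// mulrC.
 have h3 : `|t| <= `|t - s * d| + `|s * d| by rewrite -{1}(subrK (s * d) t) ler_normD.
 lra.
have bpsi s : 0 <= s -> bs (psi s).
 by move=> s0; apply: sm_tprod_bs; [exact: kern_sm|exact: (ck _ _ _ sA cA s0).1|exact: kern_sm|exact: (ck _ _ _ sB cB s0).1].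
have psiE s x : 0 <= s -> tprod A B x = (1 + k * s) ^+ 2 * psi s (flw s x).
 move=> s0; have a0 := lt0r_neq0 (sg_gt0 k0 s0).
 rewrite /psi /tprod /kern /flw /affm /= !addrK !(mulrC (1 + k * s)) !mulfK//.
 by field.
have b1 : bs (fun x => (k * x.1 + c.1) * tprod A B x).
 by have := bs_affmul k 0 c.1 bAB; under eq_fun do rewrite mul0r addr0.
have b2 : bs (fun x => (k * x.2 + c.2) * tprod A B x).
 by have := bs_affmul 0 k c.2 bAB; under eq_fun do rewrite mul0r add0r.
have [I1 J1 E1] := flow_test L1 b1; have [I2 J2 E2] := flow_test L2 b2.
have Iu1 := Int_LI_bs Lu1 bAB; have Iu := Int_LI_bs Lu bAB.
rewrite (_ : (fun x => _) = (fun x => (u (flw 1 x) * tprod A B x - u x * tprod A B x) -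
 (flavg g1 x * ((k * x.1 + c.1) * tprod A B x) + flavg g2 x * ((k * x.2 + c.2) * tprod A B x)))); last first.
 by apply/funext => x; ring.
rewrite rintB; [|exact: Int_B|exact: Int_D].
rewrite rintB// rintD// E1 E2 -rintD//.
have Ipsi s : 0 <= s -> [L1 y, u y * psi s y] by move=> s0; exact: Int_LI_bs (bpsi _ s0).
rewrite (flow_change ler01 (Ipsi _ ler01)); last by move=> x; exact: psiE.
have P (x y r r' : R) : `|x| <= CA * (`|r| <= rA)%R%:R -> `|y| <= CB * (`|r'| <= rB)%R%:R ->
  `|x * y| <= CA * CB * \1_(cube (Num.max rA rB)) (r, r').
 move=> hx hy; rewrite normrM; apply: le_trans (ler_pM _ _ hx hy) _ => //.
 rewrite mulrACA; apply: ler_wpM2l; first exact: mulr_ge0.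
 rewrite indicE; case: (leP `|r| rA) => r1; case: (leP `|r'| rB) => r2; rewrite ?mulr0 ?mul0r//.
 by rewrite mem_set ?mulr1//; apply/cubeP; rewrite !le_max r1 r2 orbT.
have mA := continuous_measurable_fun (sm_continuous sA).
have mB := continuous_measurable_fun (sm_continuous sB).
have mA' := continuous_measurable_fun (sm_continuous sA').
have mB' := continuous_measurable_fun (sm_continuous sB').
have IDs s : 0 <= s <= 1 -> [L1 y, u y * (dkern k c.1 A A' s y.1 * kern k c.2 B s y.2)] /\
  [L1 y, u y * (kern k c.1 A s y.1 * dkern k c.2 B B' s y.2)].
 move=> s01; split; apply: Int_LI_bs => //; split.
 - by apply: measurable_funM; [apply: measurable_dkern|apply: measurable_kern].
 - exists (Num.max rA rB), (CA * CB) => y.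
  by have := P _ _ y.1 y.2 (hA s y.1 s01).2 (hB s y.2 s01).1; case: y.
 - by apply: measurable_funM; [apply: measurable_kern|apply: measurable_dkern].
 - exists (Num.max rA rB), (CA * CB) => y.
  by have := P _ _ y.1 y.2 (hA s y.1 s01).1 (hB s y.2 s01).2; case: y.
have Es s : 0 <= s <= 1 ->
 [int x, g1 (flw s x) * ((k * x.1 + c.1) * tprod A B x)] +
 [int x, g2 (flw s x) * ((k * x.2 + c.2) * tprod A B x)] =
 [int y, u y * D s y].
 move=> s01; have s0 : 0 <= s by case/andP: s01.
 have a0 := lt0r_neq0 (sg_gt0 k0 s0).
 have [KA [_ hKA]] := sm_derive (kern_sm k c.1 s sA).
 have [KB [_ hKB]] := sm_derive (kern_sm k c.2 s sB).
 have [e1 _] := tprod_pd (kern_derive_t c.1 k0 dA s0) hKB.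
 have [_ e2] := tprod_pd hKA (kern_derive_t c.2 k0 dB s0).
 have t1 : test_fun (tprod (fun t => wk k c.1 s t * kern k c.1 A s t) (kern k c.2 B s)).
  apply: tprod_test; [exact: wk_kern_sm|exact: (ck _ _ _ sA cA s0).2|exact: kern_sm|exact: (ck _ _ _ sB cB s0).1].
 have t2 : test_fun (tprod (kern k c.1 A s) (fun t => wk k c.2 s t * kern k c.2 B s t)).
  apply: tprod_test; [exact: kern_sm|exact: (ck _ _ _ sA cA s0).1|exact: wk_kern_sm|exact: (ck _ _ _ sB cB s0).2].
 have [bt1 _] := test_fun_bs t1; have [bt2 _] := test_fun_bs t2.
 rewrite (flow_change s0 (Int_LI_bs L1 bt1)); last first.
  move=> x; rewrite (psiE s)//.
  rewrite /psi /tprod /kern /wk /flw /affm /= !addrK !(mulrC (1 + k * s)) !mulfK//.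
  by field.
 rewrite (flow_change s0 (Int_LI_bs L2 bt2)); last first.
  move=> x; rewrite (psiE s)//.
  rewrite /psi /tprod /kern /wk /flw /affm /= !addrK !(mulrC (1 + k * s)) !mulfK//.
  by field.
 have [w1 _] := W _ t1; have [_ w2] := W _ t2.
 rewrite -[LHS]opprK opprD -w1 -w2 e1 e2.
 have [ID1 ID2] := IDs s s01.
 rewrite /D; under [in RHS]eq_fun do rewrite mulrDr.
 rewrite rintD// opprD -!rintN//; last 2 first.
 - by under eq_fun do rewrite /tprod mulrN; have := Int_N ID2; under eq_fun do rewrite -mulrN.
 - by apply: (eq_Int _ (Int_N ID1)) => x; rewrite /tprod; ring.
 by congr (_ + _); apply: eq_rint => x; rewrite /tprod; ring.
have -> : rint leb1 (fun s => I01 s * [int x, g1 (flw s x) * ((k * x.1 + c.1) * tprod A B x)] +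
  I01 s * [int x, g2 (flw s x) * ((k * x.2 + c.2) * tprod A B x)]) =
 rint leb1 (fun s => [int y, I01 s * (u y * D s y)]).
 apply: eq_rint => s; rewrite I01E; case: (boolP (0 <= s <= 1)) => s01.
  by rewrite !mul1r Es//; apply: eq_rint => y; rewrite mul1r.
 rewrite !mul0r addr0 -[LHS](@rint0 _ _ mu2); apply: eq_rint => y.
 by rewrite mul0r.
have -> : tprod A B = psi 0.
 by apply/funext => x; rewrite /psi /tprod !kern0.
have mD : mfun (fun z : R * pt => D z.1 z.2).
 by apply: measurable_funD; apply: measurable_funM; (apply: measurable_dkern || apply: measurable_kern) => //; mproj.
have mDy y : mfun (fun s => D s y) by exact: measurableT_comp mD (measurable_pair2 y).
have Db s y : 0 <= s <= 1 -> `|D s y| <= 2 * (CA * CB) * \1_(cube (Num.max rA rB)) y.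
 move=> s01; have [p1 q1] := hA s y.1 s01; have [p2 q2] := hB s y.2 s01.
 have := P _ _ _ _ q1 p2; have := P _ _ _ _ p1 q2; case: y {p1 q1 p2 q2} => y1 y2 /= H1 H2.
 by apply: le_trans (ler_normD _ _) _; rewrite -mulrA mulr_natl mulr2n lerD.
have ICu : [L1 y, 2 * (CA * CB) * `|u y * \1_(cube (Num.max rA rB)) y|].
 by apply: Int_Z; apply: Int_abs; case: Lu.
have swap : Int (leb1 \x mu2)%E (fun z => I01 z.1 * (u z.2 * D z.1 z.2)).
 apply: (Int_prod_le _ Int_I01 ICu).
  apply: measurable_funM; first by apply: measurableT_comp; [exact: measurable_I01|exact: measurable_fst].
  by apply: measurable_funM => //; apply: measurableT_comp; [exact: LI_mf Lu|exact: measurable_snd].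
 move=> s y; rewrite I01E; case: (boolP (0 <= s <= 1)) => s01; last by rewrite !mul0r normr0.
 rewrite !mul1r !normrM [X in _ <= _ * (_ * X)]ger0_norm// mulrCA ler_wpM2l//.
 exact: Db.
(* After exchanging the integrals, the time integral of [D s y] at fixed [y] is
   [psi 1 y - psi 0 y]. *)
rewrite (rint_swap swap) /=.
rewrite -rintB ?Ipsi// -rintB//.
- rewrite -[RHS](@rint0 _ _ mu2); apply: eq_rint => y.
 have -> : rint leb1 (fun s => I01 s * (u y * D s y)) = u y * rint leb1 (fun s => I01 s * D s y).
  rewrite -rintZ; first by apply: eq_rint => s; rewrite mulrCA.
  apply: (@Int_I01_le _ (2 * (CA * CB) * \1_(cube (Num.max rA rB)) y)).
   exact: mDy.
  by move=> s s01; exact: Db.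
 have -> : rint leb1 (fun s => I01 s * D s y) = psi 1 y - psi 0 y; last by ring.
 apply: (@ftc01 (fun s => psi s y) (fun s => D s y)).
 + move=> s /andP[s0 s1].
  have d1 : is_derive s (1 : R) (fun s => kern k c.1 A s y.1) (dkern k c.1 A A' s y.1) by exact: kern_derive_s.
  have d2 : is_derive s (1 : R) (fun s => kern k c.2 B s y.2) (dkern k c.2 B B' s y.2) by exact: kern_derive_s.
  exact: (idM d1 d2).
 + apply: continuous_in_subspaceT => s; rewrite inE/= in_itv/= => /andP[s0 _].
  have [c1 c2] := kern_continuous c.1 y.1 (sm_continuous sA) (sm_continuous sA') s0.
  have [c3 c4] := kern_continuous c.2 y.2 (sm_continuous sB) (sm_continuous sB') s0.
  exact: (continuousD (continuousM c2 c3) (continuousM c1 c4)).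
 + apply: measurable_funM; first exact: measurable_I01.
  exact: mDy.
- by apply: Int_B; exact: Ipsi.
- by have [] := rint_fubini2 swap.
Qed.

End flow.

(** * Inequalities for powers *)

Section power_inequalities.
Implicit Types (a b t s p q : R).

Definition spow q t : R := `|t| `^ (q - 2) * t.

Lemma young_powR q a b : 1 < q -> 0 <= a -> 0 <= b ->
 q * a `^ (q - 1) * b <= (q - 1) * a `^ q + b `^ q.
Proof.
move=> q1 a0 b0; have q0 : 0 < q by lra.
have q10 : 0 < q - 1 by lra.
have := @conjugate_powR R b (a `^ (q - 1)) q (q / (q - 1)) b0 (powR_ge0 _ _) q0.
rewrite -powRrM (_ : (q - 1) * (q / (q - 1)) = q); last by field; lra.
move=> /(_ (divr_gt0 q0 q10)) H.
have : b * a `^ (q - 1) <= b `^ q / q + a `^ q / (q / (q - 1)).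
 by apply: H; field; lra.
rewrite -(ler_pM2l q0) (_ : q * (_ / _ + _) = b `^ q + (q - 1) * a `^ q); last by field; lra.
by rewrite mulrA (mulrAC q) [X in _ <= X -> _]addrC.
Qed.

Lemma powR_sub1 q t : 1 < q -> 0 <= t -> t `^ (q - 1) * t = t `^ q.
Proof.
move=> q1; rewrite le_eqVlt => /orP[/eqP <-|t0].
 by rewrite mulr0 powR0//; lra.
by rewrite -{2}(powRr1 (ltW t0)) -powRD ?subrK//; apply/implyP => _; rewrite gt_eqF.
Qed.

Lemma powR_sub2 q t : 2 < q -> 0 <= t -> t `^ (q - 2) * t = t `^ (q - 1).
Proof.
move=> q2 t0; have := @powR_sub1 (q - 1) t; rewrite -addrA -opprD => -> //; lra.
Qed.

Lemma powR_sub22 q t : 2 < q -> 0 <= t -> t `^ (q - 2) * t ^+ 2 = t `^ q.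
Proof. by move=> q2 t0; rewrite expr2 mulrA powR_sub2// powR_sub1//; lra. Qed.

(** The first term suffices for [t <= s], the second for [t >= s] because [p < 4]. A small [s] makes
    the coefficient of the lower power small, a large [s] that of the higher one; all absorptions of
    the power term rest on this choice. *)
Lemma powR_interp p s t : 2 < p < 4 -> 0 < s -> 0 <= t ->
 t `^ (p - 2) <= s `^ (p - 2) + s `^ (p - 4) * t ^+ 2.
Proof.
move=> /andP[p2 p4] s0 t0; have [ts|st] := leP t s.
 apply: (@le_trans _ _ (s `^ (p - 2))).
  by apply: ge0_ler_powR; rewrite ?nnegrE//; lra.
 by rewrite lerDl mulr_ge0 ?powR_ge0 ?sqr_ge0.
have t1 : 0 < t by exact: lt_trans st.
have -> : t `^ (p - 2) = t `^ (p - 4) * t ^+ 2.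
 rewrite -powR_mulrn ?ltW// -powRD; last by apply/implyP => _; rewrite gt_eqF.
 by congr (_ `^ _); lra.
apply: ler_wpDl; first exact: powR_ge0.
rewrite ler_wpM2r ?sqr_ge0//.
have -> : p - 4 = - (4 - p) by lra.
rewrite !powRN lef_pV2 ?posrE ?powR_gt0//.
by apply: ge0_ler_powR; rewrite ?nnegrE; lra.
Qed.

Lemma spow_norm p t : 2 < p -> `|spow p t| = `|t| `^ (p - 1).
Proof. by move=> p2; rewrite /spow normrM ger0_norm ?powR_ge0// powR_sub2. Qed.

Lemma spow_mul p t : 2 < p -> spow p t * t = `|t| `^ p.
Proof.
by move=> p2; rewrite /spow -mulrA -expr2 -[t ^+ 2]norm_sq powR_sub22.
Qed.

Lemma spowN p t : spow p (- t) = - spow p t.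
Proof. by rewrite /spow normrN mulrN. Qed.

Lemma powR_convex p a b : 2 < p ->
 p * spow p a * (b - a) <= `|b| `^ p - `|a| `^ p.
Proof.
move=> p2; rewrite mulrBr -[_ * a]mulrA spow_mul//.
have := @young_powR p `|a| `|b| _ (normr_ge0 _) (normr_ge0 _).
have : p * spow p a * b <= p * `|a| `^ (p - 1) * `|b|.
 rewrite -[p * _ * b]mulrA -[p * _ * `|b|]mulrA; apply: ler_wpM2l; first lra.
 by rewrite -(spow_norm a p2) -normrM; exact: ler_norm.
move=> h /(_ _)-/(_ ltac:(lra)); lra.
Qed.

Lemma spow_lip0 p a b : 2 < p -> 0 <= b -> b <= a ->
 spow p a - spow p b <= (p - 1) * a `^ (p - 2) * (a - b).
Proof.
move=> p2 b0 ba; have a0 : 0 <= a by exact: le_trans ba.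
rewrite /spow !ger0_norm// !powR_sub2//.
have := @young_powR (p - 1) a b _ a0 b0.
rewrite -[p - 1 - 1]addrA -opprD => /(_ ltac:(lra)).
have := powR_sub2 p2 a0; nra.
Qed.

Lemma spow_mono0 p a b : 2 < p -> 0 <= b -> b <= a -> spow p b <= spow p a.
Proof.
move=> p2 b0 ba; have a0 : 0 <= a by exact: le_trans ba.
rewrite /spow !ger0_norm// !powR_sub2//.
by apply: ge0_ler_powR; rewrite ?nnegrE//; lra.
Qed.

(** By symmetry [|b| <= |a|] and [0 <= a]. For [b] of the same sign this is Young's inequality; for
    opposite signs the two values add up, as do the sizes in [|a - b|]. *)
Lemma spow_lip p a b : 2 < p ->
 `|spow p a - spow p b| <= (p - 1) * (`|a| + `|b|) `^ (p - 2) * `|a - b|.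
Proof.
move=> p2.
wlog ab : a b / `|b| <= `|a|.
 move=> H; have [/H//|/ltW/H] := leP `|b| `|a|.
 by rewrite distrC [`|b| + _]addrC [`|b - a|]distrC.
wlog a0 : a b ab / 0 <= a.
 move=> H; have [/H|a0] := leP 0 a; first exact.
 have := H (- a) (- b); rewrite !normrN !spowN => /(_ ab).
 by rewrite -opprD normrN -opprD normrN; apply; lra.
rewrite (ger0_norm a0) in ab *.
have M : a `^ (p - 2) <= (a + `|b|) `^ (p - 2).
 by apply: ge0_ler_powR; [lra|rewrite nnegrE|rewrite nnegrE addr_ge0|rewrite lerDl].
have P0 := powR_ge0 a (p - 2).
have [b0|b0] := leP 0 b.
 rewrite (ger0_norm b0) in ab M *.
 rewrite ger0_norm ?subr_ge0 ?spow_mono0// ger0_norm ?subr_ge0//.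
 apply: le_trans (spow_lip0 p2 b0 ab) _.
 by rewrite ler_wpM2r ?subr_ge0// ler_wpM2l//; lra.
rewrite (ltr0_norm b0) in ab M *.
have -> : spow p b = - spow p (- b) by rewrite spowN opprK.
have sa : 0 <= spow p a by rewrite mulr_ge0 ?powR_ge0.
have nb0 : 0 <= - b by lra.
have sb : spow p (- b) <= a `^ (p - 2) * (- b).
 rewrite /spow ler_wpM2r// ger0_norm//.
 by apply: ge0_ler_powR; rewrite ?nnegrE//; lra.
have sb0 : 0 <= spow p (- b) by rewrite mulr_ge0 ?powR_ge0.
rewrite opprK ger0_norm ?addr_ge0// ger0_norm; last by lra.
have saE : spow p a = a `^ (p - 2) * a by rewrite /spow ger0_norm.
have : (a `^ (p - 2)) * (a - b) <= (p - 1) * (a - b) `^ (p - 2) * (a - b).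
 rewrite ler_wpM2r; [by []|lra|].
 by rewrite (le_trans M)// ler_peMl ?powR_ge0//; lra.
by rewrite saE; nra.
Qed.

(** Convexity at [a] makes the remainder nonnegative; convexity at [b] bounds it by
    [p (spow p b - spow p a) (b - a)], to which [spow_lip] applies. *)
Lemma powR_taylor p a b : 2 < p ->
 `| `|b| `^ p - `|a| `^ p - p * spow p a * (b - a)| <=
 p * (p - 1) * (`|a| + `|b|) `^ (p - 2) * (b - a) ^+ 2.
Proof.
move=> p2; have h1 := powR_convex a b p2; have h2 := powR_convex b a p2.
rewrite ger0_norm ?subr_ge0//.
have h3 := spow_lip b a p2.
have : (spow p b - spow p a) * (b - a) <= (p - 1) * (`|a| + `|b|) `^ (p - 2) * (b - a) ^+ 2.
 apply: le_trans (ler_norm _) _; rewrite normrM -[(b - a) ^+ 2]norm_sq.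
 by rewrite expr2 mulrA ler_wpM2r// [`|a| + _]addrC.
rewrite -(@ler_pM2l _ p); last by lra.
move: (spow p a) (spow p b) h2 => sa sb; lra.
Qed.

(* Both error terms of [powR_taylor], at [a] and at [b], enter; the linear terms
  cancel. *)
End power_inequalities.

Section domination.
Context d (T : measurableType d) (m : {measure set T -> \bar R}).

Lemma Int_le_ae (f h : T -> R) : Int m h -> mfun f ->
 (forall x, 0 <= f x) -> (forall x, 0 <= h x) -> {ae m, forall x, f x <= h x} -> Int m f.
Proof.
move=> Ih mf f0 h0 fh; have I' : Int m (fun x => Num.min (f x) (h x)).
 apply: (Int_le Ih); first by apply: measurable_minr => //; exact: Int_mf Ih.
 by move=> x; rewrite ger0_norm ?le_min ?f0 ?h0// ge_min lexx orbT.
by apply: (Int_ae mf _ I'); apply: filterS fh => x h'; rewrite min_l.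
Qed.

Lemma measurable_le_set (f g : T -> R) :
 mfun f -> mfun g -> measurable [set x | f x <= g x].
Proof.
move=> mf mg; rewrite (_ : [set x | _] = setT `&` [set x | f x <= g x]); last by rewrite setTI.
exact: measurable_fun_le.
Qed.

End domination.

(** * Translation estimates and Ladyzhenskaya's inequality *)

Section flow_estimates.
Implicit Types (u g D : pt -> R) (c : pt).

Lemma Int_LI D : Int mu2 D -> LI D.
Proof.
by move=> ID; split; [exact: Int_mf ID|move=> r; apply: Int_indic => //; exact: measurable_cube].
Qed.

(** At every time the flow expands areas, so composing with it can only decrease the integral of a
    nonnegative function. *)
Lemma flavg_Int k c D : 0 <= k -> Int mu2 D -> (forall x, 0 <= D x) ->
 Int mu2 (flavg k c D) /\ rint mu2 (flavg k c D) <= rint mu2 D.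
Proof.
move=> k0 ID D0.
have IDs s : 0 <= s -> [L1 x, D (flw k c s x)] /\
  [int x, D (flw k c s x)] <= rint mu2 D.
 move=> s0; have a0 := sg_gt0 k0 s0; have a1 := sg_ge1 k0 s0; split.
  exact: (Int_affm (s * c.1, s * c.2) a0 ID).
 rewrite (@rint_affm _ (s * c.1, s * c.2) D a0 ID) ler_piMl ?rint_ge0//.
 by rewrite invf_le1 ?exprn_gt0// exprn_ege1.
have mF : mfun (fun z : R * pt => I01 z.1 * D (flw k c z.1 z.2)).
 apply: measurable_funM; first by apply: measurableT_comp; [exact: measurable_I01|exact: measurable_fst].
 exact: measurable_flw (Int_mf ID).
have bd s : (\int[mu2]_x `|I01 s * D (flw k c s x)|%:E <= (rint mu2 D * I01 s)%:E)%E.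
 rewrite I01E; case: (boolP (0 <= s <= 1)) => [/andP[s0 _]|_]; last first.
  by under eq_integral do rewrite mul0r normr0; rewrite integral0 mulr0.
 have [I1 I2] := IDs s s0.
 under eq_integral do rewrite mul1r ger0_norm//.
 by rewrite Int_fin// mulr1 lee_fin.
have IF := Int_prodP mF (Int_Z (rint mu2 D) Int_I01) bd.
have [I1 e1 _] := rint_fubini1 IF; have [I2 e2 _] := rint_fubini2 IF.
split => //; rewrite [leLHS]e2 -e1.
rewrite -[leRHS]mulr1 -rint_I01 -rintZ; last exact: Int_I01.
apply: rint_le => //; first by apply: Int_Z; exact: Int_I01.
move=> s /=; rewrite I01E; case: (boolP (0 <= s <= 1)) => [/andP[s0 _]|_]; last first.
 by under [X in rint _ X]eq_fun do rewrite mul0r; rewrite rint0 mulr0.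
by under [X in rint _ X]eq_fun do rewrite mul1r; rewrite mulr1; case: (IDs s s0).
Qed.

(** Jensen's inequality in time applied to [flow], then [flavg_Int]. The dominating function [D] is
    left free so that translations and dilations are both covered. *)
Lemma flow_L2 k c u g1 g2 D : 0 <= k -> WG u g1 g2 -> Int mu2 D -> (forall x, 0 <= D x) ->
 (forall s x, 0 <= s <= 1 ->
  ((k * x.1 + c.1) * g1 (flw k c s x) + (k * x.2 + c.2) * g2 (flw k c s x)) ^+ 2 <= D (flw k c s x)) ->
 [/\ [ae x, (u (flw k c 1 x) - u x) ^+ 2 <= flavg k c D x],
  [L1 x, (u (flw k c 1 x) - u x) ^+ 2] &
  [int x, (u (flw k c 1 x) - u x) ^+ 2] <= rint mu2 D].
Proof.
move=> k0 W ID D0 HD; have [Lu L1 L2 _] := W.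
have [IfD rfD] := flavg_Int c k0 ID D0.
have f0 x : 0 <= flavg k c D x.
 by apply: rint_ge0 => s; rewrite mulr_ge0// I01E.
have ae1 : [ae x, (u (flw k c 1 x) - u x) ^+ 2 <= flavg k c D x].
 have aeg : [ae x, Int leb1 (fun s => I01 s * g1 (flw k c s x)) /\
   Int leb1 (fun s => I01 s * g2 (flw k c s x))].
  by apply: filterS2 (flow_ae c k0 L1) (flow_ae c k0 L2).
 have aeD : [ae x, Int leb1 (fun s => I01 s * D (flw k c s x)) /\
   u (flw k c 1 x) - u x = (k * x.1 + c.1) * flavg k c g1 x + (k * x.2 + c.2) * flavg k c g2 x].
  by apply: filterS2 (flow_ae c k0 (Int_LI ID)) (flow c k0 W).
 apply: filterS2 aeg aeD => x [I1 I2] [ID' ->].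
 rewrite /flavg -!rintZ// -rintD; do ?exact: Int_Z.
 set f := fun s => (k * x.1 + c.1) * g1 (flw k c s x) + (k * x.2 + c.2) * g2 (flw k c s x).
 have -> : (fun s => (k * x.1 + c.1) * (I01 s * g1 (flw k c s x)) +
   (k * x.2 + c.2) * (I01 s * g2 (flw k c s x))) = (fun s => I01 s * f s).
  by apply/funext => s; rewrite /f; ring.
 have mf : mfun f.
  have H g : LI g -> mfun (fun s => g (flw k c s x)).
   move=> [mg _]; have := measurable_flw k c mg => /measurableT_comp H.
   exact: (H _ _ _ _ (measurable_pair2 x)).
  by apply: measurable_funD; apply: measurable_funM => //; exact: H.
 have If : Int leb1 (fun s => I01 s * f s ^+ 2).
  apply: Int_le ID' _ _.
   by apply: measurable_funM; [exact: measurable_I01|exact: measurable_funX].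
  move=> s; rewrite I01E; case: (boolP (0 <= s <= 1)) => [s01|_]; last by rewrite !mul0r normr0.
  by rewrite !mul1r ger0_norm ?sqr_ge0//; exact: HD.
 apply: le_trans (sqr_rint01 mf If) _; apply: rint_le => // s.
 rewrite I01E; case: (boolP (0 <= s <= 1)) => [s01|_]; last by rewrite !mul0r.
 by rewrite !mul1r; exact: HD.
have mw : mfun (fun x => (u (flw k c 1 x) - u x) ^+ 2).
 apply: measurable_funX; apply: measurable_funB; last exact: LI_mf Lu.
 by apply: (measurableT_comp (LI_mf Lu)); exact: measurable_affm.
have Iw : [L1 x, (u (flw k c 1 x) - u x) ^+ 2].
 by apply: (Int_le_ae IfD) => // x; exact: sqr_ge0.
split => //; apply: le_trans rfD; exact: rint_le_ae.
Qed.

Definition trans c (x : pt) : pt := (x.1 + c.1, x.2 + c.2).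

Lemma flw0 c s x : flw 0 c s x = trans (s * c.1, s * c.2) x.
Proof. by rewrite /flw /affm /trans mul0r addr0 !mul1r. Qed.

Definition H1 u g1 g2 := [/\ WG u g1 g2, [L1 x, u x ^+ 2],
 [L1 x, g1 x ^+ 2] & [L1 x, g2 x ^+ 2]].

Definition grad2 g1 g2 : R := [int x, g1 x ^+ 2 + g2 x ^+ 2].

Lemma translation_estimate c u g1 g2 : H1 u g1 g2 ->
 [L1 x, (u (trans c x) - u x) ^+ 2] /\
 [int x, (u (trans c x) - u x) ^+ 2] <= (c.1 ^+ 2 + c.2 ^+ 2) * grad2 g1 g2.
Proof.
move=> [W _ I1 I2]; have Is := Int_D I1 I2.
have [] := @flow_L2 0 c u g1 g2 (fun x => (c.1 ^+ 2 + c.2 ^+ 2) * (g1 x ^+ 2 + g2 x ^+ 2)) (lexx 0) W.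
- exact: Int_Z.
- by move=> x; rewrite mulr_ge0// addr_ge0// sqr_ge0.
- move=> s x _; rewrite !mul0r !add0r; set a := g1 _; set b := g2 _.
 have := sqr_ge0 (c.1 * b - c.2 * a); nra.
move=> _; rewrite rintZ//.
have -> : (fun x => (u (flw 0 c 1 x) - u x) ^+ 2) = (fun x => (u (trans c x) - u x) ^+ 2) => //.
by apply/funext => x; rewrite flw0 /trans !mul1r.
Qed.

Lemma leb1_affine (a d : R) (f : R -> R) : 0 < a -> Int leb1 f -> (forall x, 0 <= f x) ->
 Int leb1 (fun t => f (a * t + d)) /\ rint leb1 (fun t => f (a * t + d)) = a^-1 * rint leb1 f.
Proof.
move=> a0 If f0; have mf := Int_mf If.
have ma : mfun (fun t : R => a * t + d) by apply: measurable_funD => //; exact: measurable_funM.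
have i0 : 0 <= a^-1 by rewrite invr_ge0 ltW.
have E : (\int[leb1]_t (f (a * t + d))%:E = a^-1%:E * \int[leb1]_t (f t)%:E)%E.
 transitivity (\int[mscale (NngNum i0) leb1]_t (f t)%:E)%E; last first.
  rewrite ge0_integral_mscale//; first exact/measurable_EFinP.
  by move=> x _; rewrite lee_fin.
 have f0' : {in setT, forall y, (0 <= (f y)%:E)%E} by move=> y _; rewrite lee_fin.
 have mf' : mfun (EFin \o f) by exact/measurable_EFinP.
 have := ge0_integral_pushforward ma leb1 measurableT mf' f0'.
 rewrite preimage_setT /= => <-.
 apply: (@eq_measure_integral _ _ _ _ (mscale (NngNum i0) leb1) (pushm leb1 ma)).
 by move=> A mA _; have := @leb1_aff a d A a0 mA.
split; last by rewrite /rint E Int_fin.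
apply: Int_ge0 => //; first exact: measurableT_comp.
by rewrite E Int_fin// -EFinM ltry.
Qed.

Lemma ae_mu2_fst (P : R -> Prop) : {ae leb1, forall t, P t} -> [ae x, P x.1].
Proof.
move=> [N [mN N0 NP]]; exists (N `*` setT); split; first exact: measurableX.
 by rewrite mu2_prod// N0 mul0e.
by move=> x /= h; split => //; exact: NP.
Qed.

Lemma ae_mu2_snd (P : R -> Prop) : {ae leb1, forall t, P t} -> [ae x, P x.2].
Proof.
move=> [N [mN N0 NP]]; exists (setT `*` N); split; first exact: measurableX.
 by rewrite mu2_prod// N0 mule0.
by move=> x /= h; split => //; exact: NP.
Qed.

Definition other (b : bool) (x : pt) : R := if b then x.2 else x.1.

Lemma slice b (f : pt -> R) : Int mu2 f -> (forall x, 0 <= f x) ->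
 exists a : R -> R, [/\ Int leb1 a, (forall t, 0 <= a t), rint leb1 a = rint mu2 f &
  [ae x, Int leb1 (fun t => f (Defs.shift b x t)) /\
    rint leb1 (fun t => f (Defs.shift b x t)) = a (other b x)]].
Proof.
move=> If f0; case: b.
 have [I1 e1 ae1] := rint_fubini2 (m1 := leb1) (m2 := leb1) If.
 exists (fun y => rint leb1 (fun x => f (x, y))); split => //.
  by move=> t; exact: rint_ge0.
 have := ae_mu2_snd ae1; apply: filterS => x /= Ix.
 have [] := leb1_affine x.1 ltr01 Ix (fun t => f0 (t, x.2)).
 rewrite invr1 mul1r => h1 h2; rewrite /other -h2; split; last first.
  by apply: eq_rint => t; rewrite mul1r addrC.
 by apply: (eq_Int _ h1) => t; rewrite mul1r addrC.
have [I1 e1 ae1] := rint_fubini1 (m1 := leb1) (m2 := leb1) If.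
exists (fun x => rint leb1 (fun y => f (x, y))); split => //.
 by move=> t; exact: rint_ge0.
have := ae_mu2_fst ae1; apply: filterS => x /= Ix.
have [] := leb1_affine x.2 ltr01 Ix (fun t => f0 (x.1, t)).
rewrite invr1 mul1r => h1 h2; rewrite /other -h2; split; last first.
 by apply: eq_rint => t; rewrite mul1r addrC.
by apply: (eq_Int _ h1) => t; rewrite mul1r addrC.
Qed.

Lemma measurable_other b : mfun (other b).
Proof. by case: b; [exact: measurable_snd|exact: measurable_fst]. Qed.

Lemma measurable_shift b : mfun (fun z : R * pt => Defs.shift b z.2 z.1).
Proof.
by case: b; apply/measurable_fun_pairP; split; rewrite /comp /=; try apply: measurable_funD; mproj.
Qed.

(* Averaging [u x ^ 2 <= 2 u (x + h e) ^ 2 + 2 h \int g ^ 2] over [0 < h <= l]. *)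
Lemma slice_bound b u g1 g2 l (U G : R -> R) : H1 u g1 g2 -> 0 < l ->
 Int leb1 U -> Int leb1 G -> (forall t, 0 <= U t) -> (forall t, 0 <= G t) ->
 [ae x, Int leb1 (fun t => u (Defs.shift b x t) ^+ 2) /\
    rint leb1 (fun t => u (Defs.shift b x t) ^+ 2) = U (other b x)] ->
 [ae x, Int leb1 (fun t => (if b then g1 else g2) (Defs.shift b x t) ^+ 2) /\
    rint leb1 (fun t => (if b then g1 else g2) (Defs.shift b x t) ^+ 2) = G (other b x)] ->
 [ae x, u x ^+ 2 <= 2 / l * U (other b x) + 2 * l * G (other b x)].
Proof.
move=> HH l0 IU IG U0 G0 aeU aeG; have [W I0 I1 I2] := HH; have [Lu L1 L2 _] := W.
set g := if b then g1 else g2.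
have Ig : [L1 x, g x ^+ 2] by rewrite /g; case: (b).
(* Including [z.1 <= 0] makes [A (h, x)] hold for every [h] and almost every [x]. *)
pose A : set (R * pt) := [set z | z.1 <= 0] `|`
 [set z | u z.2 ^+ 2 <= 2 * u (Defs.shift b z.2 z.1) ^+ 2 + 2 * z.1 * G (other b z.2)].
have mu2' : mfun (fun z : R * pt => u z.2).
 by apply: (measurableT_comp (LI_mf Lu)); exact: measurable_snd.
have mA : measurable A.
 apply: measurableU; first by apply: measurable_le_set => //; exact: measurable_fst.
 apply: measurable_le_set; first exact: measurable_funX.
 apply: measurable_funD.
  apply: measurable_funM => //; apply: measurable_funX.
  by apply: (measurableT_comp (LI_mf Lu)); exact: measurable_shift.
 apply: measurable_funM; first by apply: measurable_funM => //; exact: measurable_fst.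
 apply: (measurableT_comp (Int_mf IG)); apply: measurableT_comp; first exact: measurable_other.
 exact: measurable_snd.
have aeA : {ae leb1, forall h, [ae x, A (h, x)]}.
 apply: nearW => h; have [h0|h0] := leP h 0.
  by apply: nearW => x; left.
 pose c : pt := if b then (h, 0) else (0, h).
 have cE s x : flw 0 c s x = Defs.shift b x (s * h).
  by rewrite flw0 /trans /c /Defs.shift; case: (b); rewrite /= mulr0 addr0.
 have [ae1 _ _] := @flow_L2 0 c u g1 g2 (fun x => h ^+ 2 * g x ^+ 2) (lexx 0) W
  (Int_Z _ Ig) (fun x => mulr_ge0 (sqr_ge0 h) (sqr_ge0 _)) ltac:(
   by move=> s x _; rewrite /c /g; case: (b); rewrite /= !mul0r !add0r ?mul0r ?addr0 ?add0r exprMn).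
 move: ae1; apply: filterS2 aeG => x [Ix Ex] h1; right => /=.
 have [h2 h3] := leb1_affine 0 h0 Ix (fun t => sqr_ge0 _).
 have h4 : flavg 0 c (fun x => h ^+ 2 * g x ^+ 2) x <= h * G (other b x).
  rewrite /flavg -Ex; have -> : h * rint leb1 (fun t => g (Defs.shift b x t) ^+ 2) =
   rint leb1 (fun t => h ^+ 2 * g (Defs.shift b x (h * t + 0)) ^+ 2).
   by rewrite rintZ// h3 mulrA expr2 mulfK ?gt_eqF.
  apply: rint_le.
  - have I3 := Int_Z (h ^+ 2) h2; apply: (Int_le I3).
    apply: measurable_funM; first exact: measurable_I01.
    have -> : (fun s => h ^+ 2 * g (flw 0 c s x) ^+ 2) = (fun s => h ^+ 2 * g (Defs.shift b x (h * s + 0)) ^+ 2).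
     by apply/funext => s; rewrite cE addr0 [s * h]mulrC.
    exact: Int_mf I3.
   move=> s; rewrite I01E cE addr0 [h * s]mulrC; case: (0 <= s <= 1).
    by rewrite mul1r ger0_norm// mulr_ge0// sqr_ge0.
   by rewrite mul0r normr0 mulr_ge0// sqr_ge0.
  - exact: Int_Z.
  move=> s; rewrite I01E cE addr0 [h * s]mulrC; case: (0 <= s <= 1); first by rewrite mul1r.
  by rewrite mul0r mulr_ge0// sqr_ge0.
 have := le_trans h1 h4; rewrite cE mul1r.
 have := sqr_ge0 (2 * u (Defs.shift b x h) - u x).
 nra.
(* The order of the quantifiers is exchanged: for almost every [x] the inequality now holds for
   almost every [h], and can be integrated in [h]. *)
have := ae_prod mA aeA; apply: filterS2 (filterI aeU aeG) => x [[Iu Eu] [Ig' Eg]] aeh.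
pose J (h : R) : R := \1_(`]0, l]%classic : set R) h.
have iJ : (\int[leb1]_h (J h)%:E = l%:E)%E.
 rewrite /J integral_indic// setIT.
 by have := @leb1_itv 0 l false false (ltW l0); rewrite subr0.
have IJ : Int leb1 J.
 apply: Int_ge0 => //; first exact: measurable_indic.
 by rewrite iJ ltry.
have rJ : rint leb1 J = l.
 by rewrite /rint iJ.
have : rint leb1 (fun h => u x ^+ 2 * J h) <=
  rint leb1 (fun h => 2 * u (Defs.shift b x h) ^+ 2 + 2 * l * G (other b x) * J h).
 apply: rint_le_ae; first exact: Int_Z.
  by apply: Int_D; exact: Int_Z.
 apply: filterS aeh => h [h0|h0] /=.
  rewrite /J indicE memNset /=; last by rewrite in_itv/= ltNge h0.
  by rewrite !mulr0 addr0 mulr_ge0// sqr_ge0.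
 rewrite /J indicE; have [hl|hl] := pselect (`]0, l]%classic h); last first.
  by rewrite memNset// !mulr0 addr0 mulr_ge0// sqr_ge0.
 rewrite mem_set// !mulr1; apply: le_trans h0 _; rewrite lerD2l ler_wpM2r//.
 by move: hl; rewrite /= in_itv/= ler_pM2l// => /andP[].
rewrite rintD; do ?exact: Int_Z.
rewrite !rintZ// rJ Eu => h.
have li : l * l^-1 = 1 by rewrite mulfV// gt_eqF.
rewrite -(ler_pM2r l0) mulrDl (_ : 2 / l * _ * l = (l * l^-1) * (2 * U (other b x))); last by ring.
by rewrite li mul1r.
Qed.

Lemma prod_int (a b : R -> R) : Int leb1 a -> Int leb1 b ->
 (forall t, 0 <= a t) -> (forall t, 0 <= b t) ->
 [L1 x, a x.1 * b x.2] /\ [int x, a x.1 * b x.2] = rint leb1 a * rint leb1 b.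
Proof.
move=> Ia Ib a0 b0.
have I : [L1 x, a x.1 * b x.2].
 apply: (Int_prod_le (m1 := leb1) (m2 := leb1) _ Ia Ib).
  by apply: measurable_funM; apply: measurableT_comp; do ?[exact: Int_mf Ia|exact: Int_mf Ib]; [exact: measurable_fst|exact: measurable_snd].
 by move=> x y; rewrite /= ger0_norm// mulr_ge0.
split => //; have [_ <- _] := rint_fubini1 (m1 := leb1) (m2 := leb1) I.
rewrite mulrC -rintZ//; apply: eq_rint => x /=.
by rewrite rintZ// mulrC.
Qed.

(** By [slice_bound] in the two directions, [u^2] is at most a function of [x.2] alone and at most a
    function of [x.1] alone. Hence [u^4] is at most their product, whose integral factorizes; the
    length [l] is then optimized. *)
Lemma ladyzhenskaya u g1 g2 : H1 u g1 g2 -> [L1 x, u x ^+ 4] /\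
 [int x, u x ^+ 4] <= 16 * [int x, u x ^+ 2] * grad2 g1 g2.
Proof.
move=> HH; have [W I0 I1 I2] := HH; have [Lu _ _ _] := W.
set m := [int x, u x ^+ 2].
have m0 : 0 <= m by apply: rint_ge0 => x; exact: sqr_ge0.
have A0 : 0 <= grad2 g1 g2 by apply: rint_ge0 => x; rewrite addr_ge0// sqr_ge0.
have [U1 [IU1 U10 rU1 aU1]] := slice true I0 (fun x => sqr_ge0 _).
have [U2 [IU2 U20 rU2 aU2]] := slice false I0 (fun x => sqr_ge0 _).
have [G1 [IG1 G10 rG1 aG1]] := slice true I1 (fun x => sqr_ge0 _).
have [G2 [IG2 G20 rG2 aG2]] := slice false I2 (fun x => sqr_ge0 _).
have m4 : mfun (fun x => u x ^+ 4) by apply: measurable_funX; exact: LI_mf Lu.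
have u4 x : 0 <= u x ^+ 4 by rewrite exprn_even_ge0.
have key l : 0 < l -> [L1 x, u x ^+ 4] /\
  [int x, u x ^+ 4] <= (2 / l * m + 2 * l * grad2 g1 g2) ^+ 2.
 move=> l0; have il : 0 <= 2 / l by rewrite divr_ge0// ltW.
 have b1 := slice_bound HH l0 IU1 IG1 U10 G10 aU1 aG1.
 have b2 := slice_bound HH l0 IU2 IG2 U20 G20 aU2 aG2.
 pose a y := 2 / l * U1 y + 2 * l * G1 y; pose b x := 2 / l * U2 x + 2 * l * G2 x.
 have l2 : 0 <= 2 * l by rewrite mulr_ge0// ltW.
 have a0 y : 0 <= a y by rewrite addr_ge0// mulr_ge0.
 have b0 y : 0 <= b y by rewrite addr_ge0// mulr_ge0.
 have Ia : Int leb1 a by apply: Int_D; exact: Int_Z.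
 have Ib : Int leb1 b by apply: Int_D; exact: Int_Z.
 have [Ip rp] := prod_int Ib Ia b0 a0.
 have ae4 : [ae x, u x ^+ 4 <= b x.1 * a x.2].
  move: b1 b2; apply: filterS2 => x h1 h2.
  by rewrite -[4%N]/(2 * 2)%N exprM expr2 ler_pM ?sqr_ge0.
 have I4 : [L1 x, u x ^+ 4].
  by apply: (Int_le_ae Ip) => // x; rewrite mulr_ge0.
 split => //; apply: le_trans (rint_le_ae I4 Ip ae4) _; rewrite rp expr2.
 have rG x : 0 <= [int y, x y ^+ 2] by apply: rint_ge0 => y; exact: sqr_ge0.
 apply: ler_pM; do ?exact: rint_ge0.
  rewrite /b rintD ?rintZ//; do ?exact: Int_Z.
  rewrite rU2 rG2 /grad2 rintD// lerD2l ler_wpM2l// lerDr; exact: rG.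
 rewrite /a rintD ?rintZ//; do ?exact: Int_Z.
 rewrite rU1 rG1 /grad2 rintD// lerD2l ler_wpM2l// lerDl; exact: rG.
have [I4 _] := key 1 ltr01; split => //.
move: (grad2 g1 g2) A0 key => A A0 key.
(* If the gradient or the mass vanishes there is no optimal [l]: the bound is driven to zero by a
   large [l] in the first case and by a small [l] in the second. *)
have [A1|A1] := ltP 0 A; last first.
 have -> : A = 0 by lra.
 rewrite mulr0; apply/ler_addgt0Pr => e e0; rewrite add0r.
 have l0 : 0 < 2 * (m + 1) / Num.sqrt e by rewrite divr_gt0 ?sqrtr_gt0//; lra.
 have [_ h] := key _ l0; apply: le_trans h _.
 have -> : A = 0 by lra.
 have s0 : 0 < Num.sqrt e by rewrite sqrtr_gt0.
 rewrite mulr0 addr0 (_ : _ * m = Num.sqrt e * (m / (m + 1))); last first.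
  by field; rewrite (gt_eqF s0) andbT gt_eqF//; lra.
 rewrite exprMn sqr_sqrtr; last exact: ltW.
 rewrite ler_piMr//; first exact: ltW.
 rewrite exprn_ile1 ?divr_ge0//; try lra.
 by rewrite ler_pdivrMr; lra.
have [m1|m1] := ltP 0 m; last first.
 have mE : m = 0 by lra.
 rewrite mE mulr0 mul0r; apply/ler_addgt0Pr => e e0; rewrite add0r.
 have s0 : 0 < Num.sqrt e by rewrite sqrtr_gt0.
 have l0 : 0 < Num.sqrt e / (2 * A) by rewrite divr_gt0//; lra.
 have [_ h] := key _ l0; apply: le_trans h _; rewrite mE mulr0 add0r.
 rewrite (_ : 2 * _ * A = Num.sqrt e); first by rewrite sqr_sqrtr// ltW.
 by field; rewrite gt_eqF//; lra.
pose a := Num.sqrt A; pose q := Num.sqrt m.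
have a0 : 0 < a by rewrite sqrtr_gt0.
have q0 : 0 < q by rewrite sqrtr_gt0.
have aE : a ^+ 2 = A by rewrite sqr_sqrtr.
have qE : q ^+ 2 = m by rewrite sqr_sqrtr.
(* The length [q / a] balances the two terms, each being [2 q a]; this is the origin of
   [16 = 4^2]. *)
have [_ h] := key (q / a) (divr_gt0 q0 a0); apply: le_trans h _.
rewrite -aE -qE (_ : _ + _ = 4 * (q * a)); last by field; rewrite !gt_eqF.
by rewrite !exprMn; lra.
Qed.

End flow_estimates.

(** * An abstract mountain pass theorem with a parameter *)

Section mountain_pass.
Context (X : lmodType R) (E : X -> Prop) (N J B : X -> R)
 (DJ DB : X -> X -> R) (e : X) (r0 : R).
Let Jm (mu : R) u := J u + mu * B u.
Let dJm (mu : R) u v := DJ u v + mu * DB u v.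
Hypothesis E0 : E 0.
Hypothesis ED : forall u v, E u -> E v -> E (u + v).
Hypothesis EZ : forall (c : R) u, E u -> E (c *: u).
Hypothesis N_ge0 : forall u, 0 <= N u.
Hypothesis ND : forall u v, E u -> E v -> N (u + v) <= N u + N v.
Hypothesis NZ : forall (c : R) u, E u -> N (c *: u) = `|c| * N u.
Hypothesis B_ge0 : forall u, 0 <= B u.
Hypothesis dlin : forall mu u w w' (s t : R), E u -> E w -> E w' ->
 dJm mu u (s *: w + t *: w') = s * dJm mu u w + t * dJm mu u w'.
Hypothesis smooth : forall r, exists2 C, 0 < C & forall mu u v w,
 0 <= mu <= 1 -> E u -> E v -> E w -> N u <= r -> N v <= r ->
 [/\ `|Jm mu (u + v) - Jm mu u - dJm mu u v| <= C * N v ^+ 2,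
   `|dJm mu (u + v) w - dJm mu u w| <= C * N v * N w &
   `|dJm mu u w| <= C * N w].
Hypothesis control : forall K, exists r, forall u mu, E u -> 0 <= mu <= 1 ->
 B u <= K -> Jm mu u <= K -> N u <= r.
Hypothesis J0 : J 0 = 0.
Hypothesis B0 : B 0 = 0.
Hypothesis Ee : E e.
Hypothesis Je : Jm 1 e < 0.
Hypothesis r0_gt0 : 0 < r0.

(** Paths are polygonal and given by their vertices, so that continuity in [X] never has to be
    expressed and a deformation only moves vertices. *)
Definition segm (g : nat -> X) i (t : R) : X := (1 - t) *: g i + t *: g i.+1.
Let ppath n g := [/\ g 0%N = 0, g n = e & forall i, E (g i)].
Hypothesis barrier : forall n g, ppath n g ->
 exists i (t : R), [/\ (i < n)%N, 0 <= t <= 1 & r0 <= J (segm g i t)].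

(** Upper bounds along paths are collected instead of maxima; their infimum is the minimax level. *)
Let S mu := [set M | exists n g, ppath n g /\
 forall i t, (i < n)%N -> 0 <= t <= 1 -> Jm mu (segm g i t) <= M].
Definition mp_level mu := inf (S mu).
Let c := mp_level.

Lemma EB u v : E u -> E v -> E (u - v).
Proof. by move=> Eu Ev; rewrite -scaleN1r; apply: ED => //; exact: EZ. Qed.

Lemma E_segm g i t : (forall i, E (g i)) -> E (segm g i t).
Proof. by move=> Eg; apply: ED; apply: EZ. Qed.

Lemma N_N u : E u -> N (- u) = N u.
Proof. by move=> Eu; rewrite -scaleN1r NZ// normrN normr1 mul1r. Qed.

Lemma Je_ mu : mu <= 1 -> Jm mu e < 0.
Proof. by move=> m1; apply: le_lt_trans Je; rewrite lerD2l ler_wpM2r. Qed.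

Lemma J_le_Jm mu u : 0 <= mu -> J u <= Jm mu u.
Proof. by move=> m0; rewrite lerDl mulr_ge0. Qed.

Lemma S_lb mu : 0 <= mu -> lbound (S mu) r0.
Proof.
move=> m0 M [n [g [pg gM]]]; have [i [t [i_n t01 r0J]]] := barrier pg.
by rewrite (le_trans r0J)// (le_trans (J_le_Jm _ m0))// gM.
Qed.

Lemma Jm_bound r : exists K, forall mu u, 0 <= mu <= 1 -> E u -> N u <= r -> Jm mu u <= K.
Proof.
have [C C0 HC] := smooth (Num.max 0 r).
exists (C * Num.max 0 r + C * Num.max 0 r ^+ 2) => mu u m01 Eu Nu.
have Nu' : N u <= Num.max 0 r by rewrite le_max Nu orbT.
have N0' : N 0 <= Num.max 0 r.
 by rewrite -(scale0r u) NZ// normr0 mul0r le_max lexx.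
have [+ _ +] := HC mu 0 u u m01 E0 Eu Eu N0' Nu'.
rewrite add0r {2}/Jm J0 B0 mulr0 addr0 subr0 !ler_norml => /andP[_ h1] /andP[_ h2].
have : C * N u ^+ 2 <= C * Num.max 0 r ^+ 2.
 by rewrite ler_pM2l// ler_sqr// ?nnegrE// le_max lexx.
have : C * N u <= C * Num.max 0 r by rewrite ler_pM2l.
lra.
Qed.

Lemma S_ne mu : 0 <= mu <= 1 -> S mu !=set0.
Proof.
move=> m01; have [K HK] := Jm_bound (N e).
exists K; exists 1%N, (fun i => if i is 0%N then 0 else e); split.
 by split => // -[|i].
move=> [|//] t _ /andP[t0 t1]; rewrite /segm scaler0 add0r HK//; first exact: EZ.
by rewrite NZ// ger0_norm// ler_piMl.
Qed.

Lemma S_hasinf mu : 0 <= mu <= 1 -> has_inf (S mu).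
Proof. by move=> /[dup] /S_ne ? /andP[m0 _]; split => //; exists r0; exact: S_lb. Qed.

Lemma mp_level_ge mu : 0 <= mu <= 1 -> r0 <= mp_level mu.
Proof. by move=> /[dup] /S_ne ? /andP[m0 _]; apply: lb_le_inf => //; exact: S_lb. Qed.

Lemma mp_level_mono mu mu' : 0 <= mu -> mu <= mu' -> mu' <= 1 ->
 mp_level mu <= mp_level mu'.
Proof.
move=> m0 mm m1.
have m01 : 0 <= mu' <= 1 by rewrite m1 andbT (le_trans m0).
have m01' : 0 <= mu <= 1 by rewrite m0 (le_trans mm).
apply: lb_le_inf; first exact: S_ne.
move=> M [n [g [pg gM]]]; apply: inf_lbound; first by have [] := S_hasinf m01'.
exists n, g; split => // i t i_n t01; apply: le_trans (gM i t i_n t01).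
by rewrite lerD2l ler_wpM2r.
Qed.

(** Each edge is cut into [m] equal pieces: vertex [j] of the new path lies on edge [j %/ m] at
    parameter [(j %% m) / m]. *)
Lemma refine n g h : ppath n g -> 0 < h -> exists n' g', [/\ ppath n' g',
 forall i t, (i < n')%N -> 0 <= t <= 1 -> exists i' t', [/\ (i' < n)%N,
   0 <= t' <= 1 & segm g' i t = segm g i' t'] &
 forall i, (i < n')%N -> N (g' i.+1 - g' i) <= h].
Proof.
move=> [g0 gn Eg] h0.
have [m m0 mP] : exists2 m, (0 < m)%N & forall i, (i < n)%N -> N (g i.+1 - g i) <= m%:R * h.
 have sum_ge i : (i < n)%N -> N (g i.+1 - g i) <= \sum_(j < n) N (g j.+1 - g j).
  by move=> i_n; rewrite (bigD1 (Ordinal i_n))//= lerDl sumr_ge0.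
 have s0 : 0 <= (\sum_(j < n) N (g j.+1 - g j)) / h.
  by rewrite divr_ge0 ?(ltW h0)// sumr_ge0.
 exists (Num.bound ((\sum_(j < n) N (g j.+1 - g j)) / h)).+1 => // i i_n.
 rewrite (le_trans (sum_ge _ i_n))// -ler_pdivrMr//.
 by rewrite (le_trans (ltW (archi_boundP s0)))// ler_nat.
have m0' : 0 < m%:R :> R by rewrite ltr0n.
pose g' j := segm g (j %/ m) ((j %% m)%:R / m%:R).
have g'S j : g' j.+1 = segm g (j %/ m) ((j %% m).+1%:R / m%:R).
 rewrite /g'; have := ltn_pmod j m0; rewrite leq_eqVlt => /orP[/eqP jm|jm].
  rewrite jm divff ?gt_eqF//.
  have -> : j.+1 = (((j %/ m).+1 * m) + 0)%N by rewrite addn0 mulSn {1}(divn_eq j m) addnC -addSn jm.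
  rewrite divnMDl// modnMDl mod0n div0n addn0 mul0r /segm.
  by rewrite subr0 subrr !scale1r !scale0r addr0 add0r.
 have -> : j.+1 = ((j %/ m) * m + (j %% m).+1)%N by rewrite addnS -divn_eq.
 by rewrite divnMDl// modnMDl (modn_small jm) (divn_small jm) addn0.
have seg' j t : segm g' j t = segm g (j %/ m) (((j %% m)%:R + t) / m%:R).
 rewrite {1}/segm g'S /g' /segm !scalerDr !scalerA addrACA -!scalerDl.
 by congr (_ *: _ + _ *: _); rewrite -?natr1; field; exact: lt0r_neq0.
exists (n * m)%N, g'; split.
- split.
 + by rewrite /g' div0n mod0n /segm mul0r subr0 scale1r scale0r addr0.
 + by rewrite /g' mulnK// modnMl /segm mul0r subr0 scale1r scale0r addr0.
 + by move=> i; exact: E_segm.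
- move=> i t i_n /andP[t0 t1]; exists (i %/ m)%N, (((i %% m)%:R + t) / m%:R); split.
 + by rewrite ltn_divLR.
 + rewrite divr_ge0 ?addr_ge0 ?ler0n//= ler_pdivrMr// mul1r.
  by rewrite (@le_trans _ _ ((i %% m)%:R + 1))// ?lerD2l// natr1 ler_nat ltn_pmod.
 + exact: seg'.
- move=> i i_n; rewrite g'S /g' /segm.
 have dif (t t' : R) x y : (1 - t') *: x + t' *: y - ((1 - t) *: x + t *: y) =
   (t' - t) *: (y - x) :> X.
  rewrite opprD addrACA -!scalerBl (_ : 1 - t' - (1 - t) = - (t' - t)); last by ring.
  by rewrite scaleNr addrC -scalerBr.
 rewrite dif (_ : _ - _ = m%:R^-1); last by rewrite -natr1; field; exact: lt0r_neq0.
 rewrite NZ; last exact: EB.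
 rewrite ger0_norm ?invr_ge0 ?ler0n// ler_pdivrMl//; apply: mP.
 by rewrite ltn_divLR.
Qed.

Ltac mlra := first
 [repeat match goal with H : is_true _ |- _ => lazymatch H with r0_gt0 => fail | Je => fail | _ => revert H end end;
  clear - E0 ED EZ N_ge0 ND NZ B_ge0 dlin smooth control J0 B0 Ee Je r0_gt0 barrier c; intros; lra | lra].

Lemma mp_deform (K delta : R) : 0 <= K -> 0 < delta -> exists2 eta0, 0 < eta0 &
 forall a b, 0 <= a -> a < b -> b <= 1 -> b - a < eta0 ->
 c b - c a <= K * (b - a) ->
 exists u, [/\ E u, c a - 2 * (b - a) <= Jm a u, Jm b u <= c b + (b - a) &
  forall v, E v -> `|dJm a u v| <= delta * N v].
Proof.
move=> K0 d0.
have c1_ge mu : 0 <= mu <= 1 -> c mu <= c 1.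
 by move=> /andP[? ?]; apply: mp_level_mono.
have [r0' Hr'] := control (Num.max (K + 3) (c 1 + 1)).
pose r := Num.max 0 r0'.
have Hr u mu : E u -> 0 <= mu <= 1 -> B u <= K + 3 -> Jm mu u <= c 1 + 1 -> N u <= r.
 move=> Eu m01 h1 h2; rewrite /r le_max (Hr' u mu) ?orbT//.
  by rewrite le_max h1.
 by rewrite le_max h2 orbT.
have r_ge0 : 0 <= r by rewrite le_max lexx.
have [C C0 HC] := smooth (r + 1).
(* A step of length [k * eta] along a slope at least [delta / 2] gains [2 * (K + 3) * eta], more
   than the excess [(K + 1) * eta] of the path over [c a]. *)
pose k := 4 * (K + 3) / delta.
have k0 : 0 < k by rewrite divr_gt0// mulr_gt0//; mlra.
pose eta0 := Num.min (r0 / 2) (Num.min k^-1 (Num.min (2 * C * k ^+ 2)^-1 1)).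
exists eta0.
 rewrite !lt_min ltr01 invr_gt0 k0 divr_gt0//= andbT invr_gt0.
 by apply: mulr_gt0; [exact: mulr_gt0|exact: exprn_gt0].
move=> a b a0 ab b1; rewrite !lt_min => /and4P[h1 h2 h3 h4] cK.
set eta := b - a in h1 h2 h3 h4 cK *.
have eta_gt0 : 0 < eta by rewrite subr_gt0.
have a01 : 0 <= a <= 1 by rewrite a0 (le_trans (ltW ab)).
have b01 : 0 <= b <= 1 by rewrite b1 (le_trans a0 (ltW ab)).
apply: contrapT => /forallNP noPS.
pose hot u := [/\ E u, c a - 2 * eta <= Jm a u & Jm b u <= c b + eta].
(* Subtracting the two bounds on a hot point gives [(b - a) * B u <= (K + 3) * (b - a)], and
   [control] bounds its norm. *)
have hotN u : hot u -> N u <= r.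
 move=> [Eu l1 l2]; apply: (Hr u b) => //.
  have : eta * B u <= (K + 3) * eta by rewrite /Jm /eta in l1 l2 cK *; nra.
  by rewrite mulrC ler_pM2r.
 by rewrite (le_trans l2)// lerD// ?c1_ge// ltW.
have r1 : r <= r + 1 by rewrite lerDl.
have hotV u : hot u -> exists v, [/\ E v, N v <= 1 & delta <= dJm a u v].
 move=> hu; have Nu := hotN _ hu; have [Eu l1 l2] := hu.
 have /existsNP[v /not_implyP[Ev /negP]] : ~ forall v, E v -> `|dJm a u v| <= delta * N v.
  by move=> h; apply: (noPS u).
 rewrite -ltNge => dv.
 have N0r : N 0 <= r + 1 by rewrite -(scale0r u) NZ// normr0 mul0r addr_ge0.
 have [_ _ h5] := HC a u 0 v a01 Eu E0 Ev (le_trans Nu r1) N0r.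
 have Nv : 0 < N v.
  rewrite lt_neqAle N_ge0 andbT; apply/eqP => Nv0.
  by move: h5 dv; rewrite -Nv0 !mulr0 => h5; rewrite ltNge h5.
 pose sg : R := if 0 <= dJm a u v then 1 else -1.
 have sgE : sg * dJm a u v = `|dJm a u v|.
  by rewrite /sg; case: ifPn => h; [rewrite mul1r ger0_norm|rewrite mulN1r ler0_norm// ltW// ltNge].
 have sg1 : `|sg| = 1 by rewrite /sg; case: ifP; rewrite ?normrN normr1.
 exists ((sg / N v) *: v); split; first exact: EZ.
  by rewrite NZ// normrM sg1 mul1r normfV ger0_norm// mulVf// gt_eqF.
 have := dlin a (sg / N v) 0 Eu Ev E0; rewrite scaler0 addr0 mul0r addr0 => ->.
 by rewrite mulrAC sgE ler_pdivlMr// ltW.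
have [V HV] : exists V, forall u, hot u -> [/\ E (V u), N (V u) <= 1 & delta <= dJm a u (V u)].
 have H u : exists v, hot u -> [/\ E v, N v <= 1 & delta <= dJm a u v].
  by have [/hotV[v vP]|nh] := pselect (hot u); [exists v|exists 0 => /nh].
 by have [V HV] := choice H; exists V.
have inter : exists M, S b M /\ M <= c b + eta.
 have [M SM Mc] := inf_adherent eta_gt0 (S_hasinf b01).
 by exists M; split => //; exact: ltW.
have {inter} [n0 [g_ [pg_ gb_]]] : exists n g, ppath n g /\
  forall i t, (i < n)%N -> 0 <= t <= 1 -> Jm b (segm g i t) <= c b + eta.
 have [M [[n [g [pg gM]]] Mc]] := inter; exists n, g; split => // i t i_n t01.
 by apply: le_trans Mc; exact: gM.
(* With this mesh, nearby points have values differing by at most [2 * C * h <= eta / 2] and slopes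
   differing by at most [C * h <= delta / 2]. *)
pose h := Num.min 1 (Num.min (delta / (2 * C)) (eta / (4 * C))).
have h0 : 0 < h by rewrite !lt_min ltr01 !divr_gt0// mulr_gt0.
have [n [g [pg sub gh]]] := refine pg_ h0.
have [g0 gn Eg] := pg.
have gb i t : (i < n)%N -> 0 <= t <= 1 -> Jm b (segm g i t) <= c b + eta.
 by move=> i_n t01; have [i' [t' [? ? ->]]] := sub i t i_n t01; exact: gb_.
have h_1 : h <= 1 by rewrite ge_min lexx.
have h_d : C * h <= delta / 2.
 rewrite -ler_pdivlMl//; apply: (@le_trans _ _ (delta / (2 * C))).
  by rewrite !ge_min lexx orbT.
 by apply: le_eq; field; exact: lt0r_neq0.
have h_e : 2 * C * h <= eta / 2.
 rewrite -ler_pdivlMl ?mulr_gt0//; apply: (@le_trans _ _ (eta / (4 * C))).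
  by rewrite !ge_min lexx !orbT.
 by apply: le_eq; field; exact: lt0r_neq0.
(* Nearby points have nearby values and slopes. *)
have near_ u u' w : E u -> E u' -> E w -> N u <= r + 1 -> N (u' - u) <= h -> N w <= 1 ->
  Jm a u - eta / 2 <= Jm a u' /\ dJm a u w - delta / 2 <= dJm a u' w.
 move=> Eu Eu' Ew Nu Nd Nw; have Ed := EB Eu' Eu.
 have Nd' : N (u' - u) <= r + 1 by rewrite (le_trans Nd)// (le_trans h_1)// lerDr.
 have [e1 _ e2] := HC a u (u' - u) (u' - u) a01 Eu Ed Ed Nu Nd'.
 have [_ e3 _] := HC a u (u' - u) w a01 Eu Ed Ew Nu Nd'.
 have uu : u + (u' - u) = u' by rewrite addrC subrK.
 rewrite uu in e1 e3.
 have d_0 := N_ge0 (u' - u).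
 move: e1 e2 e3; rewrite !ler_norml => /andP[e1 _] /andP[e2 _] /andP[e3 _]; split.
  have : C * N (u' - u) ^+ 2 <= C * h.
   by rewrite ler_pM2l// expr2 -[h]mulr1; apply: ler_pM => //; exact: le_trans h_1.
  have : C * N (u' - u) <= C * h by rewrite ler_pM2l.
  mlra.
 have : C * N (u' - u) * N w <= C * h.
  by rewrite -[C * h]mulr1; apply: ler_pM => //; rewrite ?mulr_ge0 ?(ltW C0)// ler_pM2l.
 mlra.
have segL i : segm g i 0 = g i by rewrite /segm subr0 scale1r scale0r addr0.
have segR i : segm g i 1 = g i.+1 by rewrite /segm subrr scale1r scale0r add0r.
have dL i t : (i < n)%N -> 0 <= t <= 1 -> N (segm g i t - g i) <= h.
 move=> i_n /andP[t0 t1]; rewrite /segm scalerBl scale1r addrAC [g i - _]addrC addrK addrC.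
 rewrite -scalerBr NZ; last exact: EB.
 by rewrite ger0_norm// (le_trans _ (gh _ i_n))// ler_piMl.
have dR i t : (i < n)%N -> 0 <= t <= 1 -> N (segm g i t - g i.+1) <= h.
 move=> i_n /andP[t0 t1].
 have -> : segm g i t - g i.+1 = - ((1 - t) *: (g i.+1 - g i)).
  rewrite /segm scalerBr opprB -addrA; congr (_ + _).
  by rewrite scalerBl scale1r opprB.
 rewrite N_N; last by apply: EZ; exact: EB.
 rewrite NZ; last exact: EB.
 by rewrite ger0_norm ?subr_ge0// (le_trans _ (gh _ i_n))// ler_piMl// gerBl.
(* Only hot vertices move; along an edge the displacement is interpolated linearly. *)
pose v_ i : X := if pselect (hot (g i)) then V (g i) else 0.
have v_hot i : hot (g i) -> v_ i = V (g i) by rewrite /v_; case: pselect.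
have v_nhot i : ~ hot (g i) -> v_ i = 0 by rewrite /v_; case: pselect.
have Ev i : E (v_ i).
 have [hi|hi] := pselect (hot (g i)); last by rewrite v_nhot.
 by rewrite v_hot//; have [] := HV _ hi.
have Nv i : N (v_ i) <= 1.
 have [hi|hi] := pselect (hot (g i)); first by rewrite v_hot//; have [] := HV _ hi.
 by rewrite v_nhot// -(scale0r e) NZ// normr0 mul0r.
pose s := k * eta.
have s0 : 0 < s by rewrite mulr_gt0.
have s1 : s <= 1 by rewrite /s mulrC -ler_pdivlMr// mul1r ltW.
have sC : C * s ^+ 2 <= eta / 2.
 have Ck : 0 < 2 * C * k ^+ 2 by apply: mulr_gt0; [exact: mulr_gt0|exact: exprn_gt0].
 move: h3; rewrite -[X in _ < X]div1r ltr_pdivlMr// => h3.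
 rewrite /s; have := ltW h3; rewrite -(ler_pM2l eta_gt0) => h5; nra.
have sd : s * (delta / 2) = 2 * (K + 3) * eta.
 by rewrite /s /k; field; exact: lt0r_neq0.
pose g2 i := g i - s *: v_ i.
(* The end points are not hot, since [eta < r0 / 2] and [c a >= r0] put [c a - 2 * eta] above their
   values; so they stay fixed. *)
have pg2 : ppath n g2.
 split.
 - rewrite /g2 g0 v_nhot ?scaler0 ?subr0// g0 => -[_ + _].
  rewrite /Jm J0 B0 mulr0 addr0; have := mp_level_ge a01; rewrite -/c.
  by move: h1; rewrite ltr_pdivlMr//; mlra.
 - rewrite /g2 gn v_nhot ?scaler0 ?subr0// gn => -[_ + _].
  have := Je_ (le_trans (ltW ab) b1); have := mp_level_ge a01; rewrite -/c.
  by move: h1; rewrite ltr_pdivlMr//; mlra.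
 - by move=> i; apply: EB => //; exact: EZ.
suff : S a (c a - eta / 2).
 move=> SA; have := inf_lbound (proj2 (S_hasinf a01)) SA.
 by rewrite -/(mp_level a) -/(c a); mlra.
clear h1 h2 h3 h4 h_d h_e k0 h0.
exists n, g2; split => // i t i_n t01; have /andP[t0 t1] := t01.
set u := segm g i t; pose w := (1 - t) *: v_ i + t *: v_ i.+1.
have Eu : E u by exact: E_segm.
have Ew : E w by apply: ED; exact: EZ.
have Nw : N w <= 1.
 rewrite (le_trans (ND _ _))//; do ?exact: EZ.
 rewrite !NZ// !ger0_norm ?subr_ge0//.
 by have := Nv i; have := Nv i.+1; nra.
have -> : segm g2 i t = u - s *: w.
 by rewrite /segm /g2 /u /w /segm !scalerBr scalerDr opprD addrACA !scalerA ![s * _]mulrC.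
have ub : Jm b u <= c b + eta by exact: gb.
have glb : Jm b (g i) <= c b + eta by rewrite -segL; apply: gb => //; rewrite lexx ler01.
have grb : Jm b (g i.+1) <= c b + eta by rewrite -segR; apply: gb => //; rewrite lexx ler01.
have N' x y : E x -> E y -> N (x - y) = N (y - x).
 by move=> Ex Ey; rewrite -opprB N_N//; exact: EB.
have hotLR : c a - eta <= Jm a u -> hot (g i) /\ hot (g i.+1).
 move=> ua; have hu : hot u by split => //; mlra.
 have Nu := le_trans (hotN _ hu) r1.
 have N00 : N 0 <= 1 by rewrite -(scale0r e) NZ// normr0 mul0r.
 have [e1 _] := near_ u (g i) 0 Eu (Eg i) E0 Nu ltac:(by rewrite N' ?dL) N00.
 have [e2 _] := near_ u (g i.+1) 0 Eu (Eg i.+1) E0 Nu ltac:(by rewrite N' ?dR) N00.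
 by split; split => //; mlra.
have slopeL : hot (g i) -> delta / 2 <= dJm a u (v_ i).
 move=> hi; rewrite v_hot//; have [EV NV dV] := HV _ hi.
 have [_] := near_ (g i) u (V (g i)) (Eg i) Eu EV (le_trans (hotN _ hi) r1) (dL _ _ i_n t01) NV.
 by apply: le_trans; rewrite lerBrDr -splitr.
have slopeR : hot (g i.+1) -> delta / 2 <= dJm a u (v_ i.+1).
 move=> hi; rewrite v_hot//; have [EV NV dV] := HV _ hi.
 have [_] := near_ (g i.+1) u (V (g i.+1)) (Eg i.+1) Eu EV (le_trans (hotN _ hi) r1) (dR _ _ i_n t01) NV.
 by apply: le_trans; rewrite lerBrDr -splitr.
have dJ0 : dJm a u 0 = 0.
 by have := dlin a 0 0 Eu E0 E0; rewrite !scale0r addr0 !mul0r addr0.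
have [hLR|/not_orP[nL nR]] := pselect (hot (g i) \/ hot (g i.+1)); last first.
 have -> : w = 0 by rewrite /w !v_nhot// !scaler0 addr0.
 rewrite scaler0 subr0 leNgt; apply/negP => ua.
 by apply: nL; have [] := hotLR _; first mlra.
have Nu : N u <= r + 1.
 have tri x : E x -> N u <= N x + N (u - x).
  by move=> Ex; rewrite -{1}(subrK x u) addrC ND//; exact: EB.
 case: hLR => hh; have := hotN _ hh.
  by have := tri _ (Eg i); have := dL _ _ i_n t01; mlra.
 by have := tri _ (Eg i.+1); have := dR _ _ i_n t01; mlra.
have step : Jm a (u - s *: w) <= Jm a u - s * dJm a u w + eta / 2.
 have Esw : E (- (s *: w)) by rewrite -scaleNr; exact: EZ.
 have Nsw : N (- (s *: w)) <= s by rewrite -scaleNr NZ// normrN (ger0_norm (ltW s0)) ler_piMr// ltW.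
 have Nsw' : N (- (s *: w)) <= r + 1 by rewrite (le_trans Nsw)// (le_trans s1)// lerDr.
 have [+ _ _] := HC a u _ _ a01 Eu Esw Esw Nu Nsw'.
 have -> : dJm a u (- (s *: w)) = - (s * dJm a u w).
  have := dlin a (- s) 0 Eu Ew E0; rewrite scaler0 addr0 mul0r addr0 scaleNr => ->.
  by rewrite mulNr.
 rewrite ler_norml => /andP[_ e1].
 have : C * N (- (s *: w)) ^+ 2 <= C * s ^+ 2.
  by rewrite ler_pM2l// ler_sqr// nnegrE// ltW.
 mlra.
have dw : dJm a u w = (1 - t) * dJm a u (v_ i) + t * dJm a u (v_ i.+1) by exact: dlin.
(* Above [c a - eta] both end points of the edge are hot and the full gain is available. Below, it
   is enough that the step does not raise the value by more than [eta / 2]. *)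
have [ua|ua] := leP (c a - eta) (Jm a u).
 have [/slopeL sL /slopeR sR] := hotLR ua.
 have dwd : delta / 2 <= dJm a u w by rewrite dw; nra.
 have : s * (delta / 2) <= s * dJm a u w by rewrite ler_pM2l.
 have : Jm a u <= Jm b u by rewrite lerD2l ler_wpM2r// ltW.
 have : 0 <= K * eta by rewrite mulr_ge0// ltW.
 mlra.
have dw0 : 0 <= dJm a u w.
 have pos j : (hot (g j) -> delta / 2 <= dJm a u (v_ j)) -> 0 <= dJm a u (v_ j).
  have [hj /(_ hj)|/v_nhot -> _] := pselect (hot (g j)); last by rewrite dJ0.
  by apply: le_trans; rewrite divr_ge0// ltW.
 by rewrite dw addr_ge0// mulr_ge0 ?subr_ge0//; exact: pos.
have : 0 <= s * dJm a u w by rewrite mulr_ge0// ltW.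
mlra.
Qed.

(** One half of an interval always keeps a difference quotient at most [K]. This plays the part of a
    point where the monotone function [c] is differentiable. *)
Lemma bisect a0 b0 K : 0 <= a0 -> a0 < b0 -> b0 <= 1 -> c b0 - c a0 <= K * (b0 - a0) ->
 exists ab : nat -> R * R, forall n,
  [/\ [/\ a0 <= (ab n).1, (ab n).2 <= b0 & (ab n).2 - (ab n).1 = (b0 - a0) / 2 ^+ n],
    c (ab n).2 - c (ab n).1 <= K * ((ab n).2 - (ab n).1),
    (ab n).1 <= (ab n.+1).1 & (ab n.+1).2 <= (ab n).2].
Proof.
move=> a00 ab0 b01 cK.
pose nxt (x : R * R) := let mid := (x.1 + x.2) / 2 in
 if c mid - c x.1 <= K * (mid - x.1) then (x.1, mid) else (mid, x.2).
pose ab n := iter n nxt (a0, b0).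
have nxtP x : x.1 < x.2 -> c x.2 - c x.1 <= K * (x.2 - x.1) ->
  [/\ x.1 <= (nxt x).1, (nxt x).2 <= x.2, (nxt x).2 - (nxt x).1 = (x.2 - x.1) / 2 &
   c (nxt x).2 - c (nxt x).1 <= K * ((nxt x).2 - (nxt x).1)].
 move=> x12 cx; rewrite /nxt; case: ifPn => /= h; [|rewrite -ltNge in h]; split; mlra.
have abP n : [/\ [/\ a0 <= (ab n).1, (ab n).2 <= b0 & (ab n).2 - (ab n).1 = (b0 - a0) / 2 ^+ n],
    (ab n).1 < (ab n).2 & c (ab n).2 - c (ab n).1 <= K * ((ab n).2 - (ab n).1)].
 elim: n => [|n [[h1 h2 h3] h4 h5]]; first by split => //; split => //; rewrite expr0 divr1.
 have [i1 i2 i3 i4] := nxtP _ h4 h5.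
 have i3' : (ab n.+1).2 - (ab n.+1).1 = (b0 - a0) / 2 ^+ n.+1.
  rewrite [LHS]i3 h3 exprS invfM; ring.
 split => //; first by split => //; [exact: le_trans i1|exact: le_trans h2].
 by rewrite -subr_gt0 i3' divr_gt0 ?exprn_gt0// subr_gt0.
exists ab => n; have [h1 h2 h3] := abP n; have [i1 i2 _ _] := nxtP _ h2 h3.
by split.
Qed.

(* Bounded Palais-Smale sequences exist where the difference quotients of the
  minimax level are bounded, which bisection arranges inside any interval. *)
Lemma monotonicity_trick a0 b0 : 0 <= a0 -> a0 < b0 -> b0 <= 1 ->
 exists mu r l, [/\ a0 <= mu <= b0, r0 <= l, l <= mp_level 1 &
  forall delta, 0 < delta -> exists u, [/\ E u, N u <= r, `|Jm mu u - l| <= delta &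
   forall v, E v -> `|dJm mu u v| <= delta * N v]].
Proof.
move=> a00 ab0 b01.
pose K := (c b0 - c a0) / (b0 - a0).
have K0 : 0 <= K.
 by rewrite divr_ge0 ?subr_ge0 ?(ltW ab0)//; apply: mp_level_mono => //; exact: ltW.
have cK : c b0 - c a0 <= K * (b0 - a0) by rewrite /K divfK// subr_eq0 gt_eqF.
have [ab abP] := bisect a00 ab0 b01 cK.
pose a n := (ab n).1; pose b n := (ab n).2.
have a_le n : a0 <= a n by have [[]] := abP n.
have b_le n : b n <= b0 by have [[]] := abP n.
have ba n : b n - a n = (b0 - a0) / 2 ^+ n by have [[]] := abP n.
have a_lt_b n : a n < b n by rewrite -subr_gt0 ba divr_gt0 ?subr_gt0// exprn_gt0.
have a_mono n k : (n <= k)%N -> a n <= a k.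
 elim: k => [|k IH]; first by rewrite leqn0 => /eqP ->.
 rewrite leq_eqVlt => /orP[/eqP ->//|/IH h].
 by apply: le_trans h _; have [] := abP k.
have b_mono n k : (n <= k)%N -> b k <= b n.
 elim: k => [|k IH]; first by rewrite leqn0 => /eqP ->.
 rewrite leq_eqVlt => /orP[/eqP ->//|/IH h].
 by apply: le_trans h; have [] := abP k.
have ab_lt n k : a n <= b k.
 apply: (@le_trans _ _ (a (maxn n k))); first by apply: a_mono; exact: leq_maxl.
 apply: (@le_trans _ _ (b (maxn n k))); first exact: ltW.
 by apply: b_mono; exact: leq_maxr.
pose mu := sup (range a).
have hs : has_sup (range a).
 by split; [exists (a 0%N), 0%N|exists (b 0%N) => _ [n _ <-]].
have a_mu n : a n <= mu by apply: ub_le_sup; [have [] := hs|exists n].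
have mu_b n : mu <= b n by apply: ge_sup; [have [] := hs|move=> _ [k _ <-]].
have mu01 : 0 <= mu <= 1.
 by rewrite (le_trans a00 (le_trans (a_le 0%N) (a_mu _)))/= (le_trans (mu_b 0%N))// (le_trans (b_le _)).
have a01 n : 0 <= a n <= 1.
 by rewrite (le_trans a00)//= (le_trans (ltW (a_lt_b n)))// (le_trans (b_le _)).
have b01' n : b n <= 1 by rewrite (le_trans (b_le _)).
have [r0' Hr'] := control (Num.max (K + 3) (c 1 + 1)).
have [C C0 HC] := smooth r0'.
exists mu, r0', (c mu); split.
- by rewrite (le_trans (a_le 0%N) (a_mu _))/= (le_trans (mu_b 0%N)).
- exact: mp_level_ge.
- by have /andP[? ?] := mu01; apply: mp_level_mono.
move=> delta d0; have d20 : 0 < delta / 2 by rewrite divr_gt0.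
have [eta0 eta00 HD] := mp_deform K0 d20.
pose d1 := Num.min (Num.min eta0 1) (Num.min (delta / (2 * K + 6)) (delta / (4 * C))).
have d10 : 0 < d1.
 rewrite !lt_min eta00 ltr01 divr_gt0 ?divr_gt0 ?mulr_gt0//=; mlra.
have [n nP] : exists n, b n - a n < d1.
 pose n := Num.bound ((b0 - a0) / d1); exists n.
 rewrite ba ltr_pdivrMr ?exprn_gt0// mulrC -ltr_pdivrMr//.
 apply: lt_trans (archi_boundP _) _; first by rewrite divr_ge0 ?subr_ge0 ?ltW.
 by rewrite -natrX ltr_nat ltn_expl.
set eta := b n - a n in nP.
have eta_gt0 : 0 < eta by rewrite subr_gt0.
move: nP; rewrite !lt_min => /andP[/andP[e1 e2] /andP[e3 e4]].
have [_ cKn _ _] := abP n; rewrite -/(a n) -/(b n) -/eta in cKn.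
have /andP[an0 an1] := a01 n.
have [u [Eu l1 l2 dJu]] := HD _ _ an0 (a_lt_b n) (b01' n) e1 cKn.
rewrite -/eta in l1 l2.
have bn01 : 0 <= b n <= 1 by rewrite b01' andbT (le_trans an0)// ltW.
have cb1 : c (b n) <= c 1 by have /andP[? ?] := bn01; apply: mp_level_mono.
have Bu : B u <= K + 3.
 have : eta * B u <= (K + 3) * eta by rewrite /Jm in l1 l2; rewrite /eta in l1 l2 cKn *; nra.
 by rewrite mulrC ler_pM2r.
have Nu : N u <= r0'.
 apply: (Hr' u (b n)) => //; rewrite le_max ?Bu//; apply/orP; right; mlra.
have can : c (a n) <= c mu by apply: mp_level_mono => //; have /andP[] := mu01.
have cbn : c mu <= c (b n) by apply: mp_level_mono => //; have /andP[] := mu01.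
have e3' : (2 * K + 6) * eta <= delta by rewrite mulrC -ler_pdivlMr ?ltW//; mlra.
have Ja : Jm (a n) u <= Jm mu u by rewrite lerD2l ler_wpM2r.
have Jb : Jm mu u <= Jm (b n) u by rewrite lerD2l ler_wpM2r.
exists u; split => //.
 have : 0 <= K * eta by rewrite mulr_ge0// ltW.
 rewrite ler_norml => ?; apply/andP; split; mlra.
move=> v Ev.
have N0r : N 0 <= r0' by rewrite -(scale0r u) NZ// normr0 mul0r (le_trans (N_ge0 u)).
have [_ _ h0] := HC 0 u 0 v ltac:(by rewrite lexx ler01) Eu E0 Ev Nu N0r.
have [_ _ h1] := HC 1 u 0 v ltac:(by rewrite lexx ler01) Eu E0 Ev Nu N0r.
(* [DB] is the difference of the derivatives at parameters [1] and [0], both bounded on bounded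
   sets; so passing from [a n] to [mu] costs at most a multiple of [eta]. *)
have hD : `|DB u v| <= 2 * C * N v.
 have -> : DB u v = dJm 1 u v - dJm 0 u v by rewrite /dJm; ring.
 by rewrite (le_trans (ler_normB _ _))//; mlra.
have -> : dJm mu u v = dJm (a n) u v + (mu - a n) * DB u v by rewrite /dJm; ring.
rewrite (le_trans (ler_normD _ _))//.
have h2 := dJu v Ev.
have h3 : `|(mu - a n) * DB u v| <= eta * (2 * C * N v).
 rewrite normrM ger0_norm ?subr_ge0//; apply: ler_pM; rewrite ?subr_ge0//.
 by rewrite lerD2r.
have h4 : eta * (2 * C * N v) <= delta / 2 * N v.
 rewrite !mulrA ler_wpM2r//.
 have := ltW e4; rewrite ler_pdivlMr ?mulr_gt0//; mlra.
mlra.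
Qed.

End mountain_pass.

(** * The potential along dilations *)

Section potential.

Definition dil (a : R) (x : pt) : pt := (a * x.1, a * x.2).

Lemma flw_dil k s x : flw k (0, 0) s x = dil (1 + k * s) x.
Proof. by rewrite /flw /affm /dil /= !mulr0 !addr0. Qed.

Lemma ae_continuous_le (f : pt -> R) : continuous f -> [ae x, f x <= 0] ->
 forall x, f x <= 0.
Proof.
move=> cf [N [mN N0 NP]] x; rewrite leNgt; apply/negP => fx.
have : \forall y \near x, 0 < f y by apply: (cvgr_gt _ (cf x) _ fx).
move=> /nbhs_ballP[e /= e0 he].
pose B : set pt := `]x.1 - e, x.1 + e[%classic `*` `]x.2 - e, x.2 + e[%classic.
have BN : B `<=` N.
 move=> y [/= y1 y2]; apply: NP => /=; apply/negP; rewrite -ltNge; apply: he.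
 split; rewrite /ball/= /ball_/=.
  by move: y1; rewrite in_itv/= ltr_distlC.
 by move: y2; rewrite in_itv/= ltr_distlC.
have : (mu2 B <= mu2 N)%E.
 by apply: le_measure => //; rewrite inE//; exact: measurableX.
rewrite N0 mu2_prod// leb1_itv; last lra.
rewrite leb1_itv; last lra.
by rewrite -EFinM lee_fin leNgt => /negP; apply; apply: mulr_gt0; lra.
Qed.

(** An almost everywhere statement can be used at countably many parameters at once; continuity in
    the parameter does the rest. *)
Lemma rational_le (f : R -> R) (k : R) : 0 <= k -> {for k, continuous f} ->
 (forall n j : nat, j%:R / n.+1%:R <= k -> f (j%:R / n.+1%:R) <= 0) -> f k <= 0.
Proof.
move=> k0 cf H; rewrite leNgt; apply/negP => fk.
have : \forall y \near k, 0 < f y by apply: (cvgr_gt _ cf _ fk).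
move=> /nbhs_ballP[e /= e0 he].
pose n := Num.truncn e^-1; pose j := Num.truncn (k * n.+1%:R).
have n0 : 0 < n.+1%:R :> R by [].
have ne : e^-1 < n.+1%:R by exact: truncnS_gt.
have /truncn_itv/andP[j1 j2] : 0 <= k * n.+1%:R by rewrite mulr_ge0.
have h1 : j%:R / n.+1%:R <= k by rewrite ler_pdivrMr.
have : 0 < f (j%:R / n.+1%:R).
 apply: he; rewrite /ball/= /ball_/= ger0_norm ?subr_ge0//.
 rewrite ltrBlDr -ltrBlDl ltr_pdivlMr// mulrBl.
 have : 1 < e * n.+1%:R by rewrite mulrC -ltr_pdivrMr// div1r.
 move: j2; rewrite -[j.+1%:R]natr1 => j2 h2; lra.
by rewrite ltNge H.
Qed.

(** At each time the flow pulls null sets back to null sets; [ae_prod] exchanges time and space. *)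
Lemma flow_null k c (P : pt -> Prop) : 0 <= k -> [ae x, P x] ->
 [ae x, {ae leb1, forall s, 0 <= s -> P (flw k c s x)}].
Proof.
move=> k0 [N [mN N0 NP]].
pose A : set (R * pt) := [set z | z.1 < 0] `|` (fun z => flw k c z.1 z.2) @^-1` (~` N).
have mA : measurable A.
 apply: measurableU.
  have -> : [set z : R * pt | z.1 < 0] = setT `&` fst @^-1` `]-oo, 0[%classic.
   by rewrite setTI; apply/seteqP; split => z /=; rewrite in_itv.
  by apply: measurable_fst.
 have mf : mfun (fun z : R * pt => flw k c z.1 z.2).
  have h1 := measurable_flw k c (@measurable_fst _ _ R R).
  have h2 := measurable_flw k c (@measurable_snd _ _ R R).
  by apply/measurable_fun_pairP; split; [exact: h1|exact: h2].
 by rewrite -[X in measurable X]setTI; apply: mf => //; exact: measurableC.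
have aeA : {ae leb1, forall s, [ae x, A (s, x)]}.
 apply: nearW => s; have [s0|s0] := ltP s 0; first by apply: nearW => x; left.
 have aeN : [ae x, (~` N) x] by exists N; split => // x /= /contrapT.
 by have := ae_affm (s * c.1, s * c.2) (sg_gt0 k0 s0) aeN; apply: filterS => x; right.
have := ae_prod mA aeA; apply: filterS => x; apply: filterS => s [/= s0|/= h] s1.
 by move: s0; rewrite ltNge s1.
by apply: contrapT => h'; apply: h; exact: NP.
Qed.

Variables (V g1 g2 : pt -> R) (alpha beta : R).
Hypotheses (cV : continuous V) (V_ge0 : forall x, 0 <= V x) (W : WG V g1 g2).
Hypotheses (alpha0 : 0 < alpha) (beta0 : 0 < beta).
Hypothesis HV : [ae x, `|dot (g1 x, g2 x) x| <= alpha * V x /\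
             - beta <= 2 * V x + dot (g1 x, g2 x) x].

Let lower_arith (b M v t d : R) : 0 < b -> 0 <= M -> v <= M -> 1 <= t ->
 - b <= 2 * v + t * d -> - (b + 2 * M) <= d.
Proof.
move=> b0 M0 vM t1 h; have [d0|d0] := leP 0 d; first lra.
have : 0 <= (t - 1) * (- d) by rewrite mulr_ge0 ?subr_ge0// oppr_ge0 ltW.
lra.
Qed.

(** [flow] with [c = 0] writes the increment of [V] as [k] times a time average of [(x, grad V)] at
    [(1 + k s) x]. There the hypotheses control [(1 + k s)] times this quantity; as the factor is at
    least [1], the bounds survive the division. *)
Let ray (k : R) : 0 <= k -> [ae x, forall M : R, 0 <= M ->
 (forall s : R, 0 <= s <= 1 -> V (dil (1 + k * s) x) <= M) ->
 `|V (dil (1 + k) x) - V x| <= k * (alpha * M) /\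
 - (k * (beta + 2 * M)) <= V (dil (1 + k) x) - V x].
Proof.
move=> k0; have [_ L1 L2 _] := W.
have aeg : [ae x, Int leb1 (fun s => I01 s * g1 (flw k (0, 0) s x)) /\
  Int leb1 (fun s => I01 s * g2 (flw k (0, 0) s x))].
 by apply: filterS2 (flow_ae (0, 0) k0 L1) (flow_ae (0, 0) k0 L2).
have aeE : [ae x, V (flw k (0, 0) 1 x) - V x =
   (k * x.1 + 0) * flavg k (0, 0) g1 x + (k * x.2 + 0) * flavg k (0, 0) g2 x /\
   {ae leb1, forall s, 0 <= s -> `|dot (g1 (flw k (0, 0) s x), g2 (flw k (0, 0) s x)) (flw k (0, 0) s x)|
    <= alpha * V (flw k (0, 0) s x) /\
    - beta <= 2 * V (flw k (0, 0) s x) + dot (g1 (flw k (0, 0) s x), g2 (flw k (0, 0) s x)) (flw k (0, 0) s x)}].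
 by apply: filterS2 (flow (0, 0) k0 W) (flow_null (0, 0) k0 HV).
apply: filterS2 aeg aeE => x [I1 I2] [E aes] M M0 HM.
rewrite flw_dil mulr1 in E.
pose f s := x.1 * (I01 s * g1 (flw k (0, 0) s x)) + x.2 * (I01 s * g2 (flw k (0, 0) s x)).
have If : Int leb1 f by apply: Int_D; exact: Int_Z.
have Ef : V (dil (1 + k) x) - V x = k * rint leb1 f.
 rewrite E /f rintD ?rintZ//; do ?exact: Int_Z.
 by rewrite /flavg; ring.
have bf : {ae leb1, forall s, `|f s| <= alpha * M * I01 s /\ - (beta + 2 * M) * I01 s <= f s}.
 apply: filterS aes => s hs; rewrite /f I01E.
 case: (boolP (0 <= s <= 1)) => [s01|_]; last by rewrite !mul0r !mulr0 addr0 normr0.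
 have s0 : 0 <= s by case/andP: s01.
 have a1 := sg_ge1 k0 s0; have a0 := sg_gt0 k0 s0.
 have [h1 h2] := hs s0; have := HM s s01; rewrite -(flw_dil k s x) => hM.
 move: h1 h2; rewrite {3 8}flw_dil /dot /dil /= !mul1r !mulr1.
 set a := g1 _; set b := g2 _; set v := V _ in hM *; set t := 1 + k * s in a0 a1 *.
 have -> : a * (t * x.1) + b * (t * x.2) = t * (x.1 * a + x.2 * b) by ring.
 set d := x.1 * a + x.2 * b; rewrite normrM (gtr0_norm a0) => h1 h2.
 have v0 : 0 <= v by exact: V_ge0.
 have nd : `|d| <= t * `|d| by rewrite ler_peMl.
 split; first by apply: le_trans nd (le_trans h1 _); rewrite ler_pM2l.
 exact: (lower_arith beta0 M0 hM a1 h2).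
rewrite Ef; have IaM := Int_Z (alpha * M) Int_I01.
have IbM := Int_Z (- (beta + 2 * M)) Int_I01.
split.
 rewrite normrM ger0_norm// ler_wpM2l// (le_trans (rint_norm If))//.
 rewrite -[leRHS]mulr1 -rint_I01 -rintZ; last exact: Int_I01.
 by apply: rint_le_ae => //; [exact: Int_abs|apply: filterS bf => s []].
rewrite -mulrN ler_wpM2l//.
rewrite (_ : - _ = rint leb1 (fun s => - (beta + 2 * M) * I01 s)); last first.
 by rewrite rintZ ?rint_I01 ?mulr1//; exact: Int_I01.
by apply: rint_le_ae => //; apply: filterS bf => s [].
Qed.

Let dil_continuous_t (x : pt) : continuous (fun t : R => V (dil (1 + t) x)).
Proof.
move=> t; apply: (@continuous_comp _ _ _ (fun t : R => dil (1 + t) x) V); last exact: cV.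
have h (y : R) : {for t, continuous (fun t : R => (1 + t) * y)}.
 apply: continuousM; last exact: cst_continuous.
 by apply: continuousD; [exact: cst_continuous|exact: cvg_id].
by apply: (@cvg_pair _ _ _ (nbhs t) (nbhs ((1 + t) * x.1)) (nbhs ((1 + t) * x.2)) _ _ _ _ _ (h x.1) (h x.2)).
Qed.

Lemma dil_continuous (a : R) : continuous (fun x => V (dil a x)).
Proof.
move=> x; apply: (@continuous_comp _ _ _ (dil a) V); last exact: cV.
have h1 : {for x, continuous (fun x : pt => a * x.1)}.
 by apply: continuousM; [exact: cst_continuous|exact: cvg_fst].
have h2 : {for x, continuous (fun x : pt => a * x.2)}.
 by apply: continuousM; [exact: cst_continuous|exact: cvg_snd].
by apply: (@cvg_pair _ _ _ (nbhs x) (nbhs (a * x.1)) (nbhs (a * x.2)) _ _ _ _ _ h1 h2).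
Qed.

(** For almost every [x], [ray] holds at all rational parameters simultaneously. Continuity of [V]
    along the ray gives the parameter [k], and continuity in [x] removes the null set. *)
Lemma potential_dilation (k : R) (x : pt) : 0 <= k -> alpha * k <= 4^-1 ->
 `|V (dil (1 + k) x) - V x| <= 2 * alpha * k * V x /\
 - (k * (beta + 2 * (1 + 2 * alpha * k) * V x)) <= V (dil (1 + k) x) - V x.
Proof.
move=> k0 ak.
have aer : [ae x, forall n j : nat, forall M : R, 0 <= M ->
 (forall s : R, 0 <= s <= 1 -> V (dil (1 + j%:R / n.+1%:R * s) x) <= M) ->
 `|V (dil (1 + j%:R / n.+1%:R) x) - V x| <= j%:R / n.+1%:R * (alpha * M) /\
 - (j%:R / n.+1%:R * (beta + 2 * M)) <= V (dil (1 + j%:R / n.+1%:R) x) - V x].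
 apply: ae_foralln => n; apply: ae_foralln => j; apply: ray.
 by rewrite divr_ge0.
have aek : [ae x, `|V (dil (1 + k) x) - V x| - 2 * alpha * k * V x <= 0 /\
 - (k * (beta + 2 * (1 + 2 * alpha * k) * V x)) - (V (dil (1 + k) x) - V x) <= 0].
 apply: filterS aer => y Hy.
 pose v t := V (dil (1 + t) y).
 have cv : continuous v by exact: dil_continuous_t.
 have v0 : v 0 = V y by rewrite /v /dil addr0 !mul1r; case: (y).
 (* The maximum [M] along the ray is itself bounded by [V y + alpha * k * M]; with
    [alpha * k <= 4^-1] this gives [M <= (1 + 2 * alpha * k) * V y]. *)
 have [t0 t0k vmax] := @EVT_max R v 0 k k0 (continuous_subspaceT cv).
 set M := v t0 in vmax; have M0 : 0 <= M by exact: V_ge0.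
 have Hr (n j : nat) : j%:R / n.+1%:R <= k -> `|v (j%:R / n.+1%:R) - v 0| <= j%:R / n.+1%:R * (alpha * M) /\
   - (j%:R / n.+1%:R * (beta + 2 * M)) <= v (j%:R / n.+1%:R) - v 0.
  move=> jk; rewrite v0; apply: Hy => // s /andP[s0 s1]; apply: vmax.
  by rewrite in_itv/= mulr_ge0 ?divr_ge0//= (le_trans _ jk)// ler_piMr// divr_ge0.
 have cab : forall t, {for t, continuous (fun t : R => `|v t - v 0| - t * (alpha * M))}.
  move=> t; apply: continuousB; last by apply: continuousM; [exact: cvg_id|exact: cst_continuous].
  apply: (@continuous_comp _ _ _ (fun t => v t - v 0) (fun z : R => `|z|)); last exact: norm_continuous.
  by apply: continuousB; [exact: cv|exact: cst_continuous].
 have clo : {for k, continuous (fun t : R => - (t * (beta + 2 * M)) - (v t - v 0))}.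
  apply: continuousB; last by apply: continuousB; [exact: cv|exact: cst_continuous].
  by apply: continuousN; apply: continuousM; [exact: cvg_id|exact: cst_continuous].
 have a1 t : 0 <= t <= k -> `|v t - v 0| <= t * (alpha * M).
  move=> /andP[t1 t2]; rewrite -subr_le0.
  apply: (rational_le t1 (cab t)) => n j jt; rewrite subr_le0.
  by have [] := Hr n j (le_trans jt t2).
 have a2 : - (k * (beta + 2 * M)) <= v k - v 0.
  rewrite -subr_le0; apply: (rational_le k0 clo) => n j jt; rewrite subr_le0.
  by have [] := Hr n j jt.
 have MV : M <= (1 + 2 * (alpha * k)) * V y.
  move: t0k; rewrite in_itv/= => /andP[t01 t02].
  have := a1 t0 ltac:(by rewrite t01 t02); rewrite ler_norml => /andP[_]; rewrite -/M v0 => h.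
  have h2 : t0 * (alpha * M) <= (alpha * k) * M by rewrite [alpha * k]mulrC -mulrA ler_wpM2r// mulr_ge0// ltW.
  have Vy := V_ge0 y; have ak0 : 0 <= alpha * k by rewrite mulr_ge0// ltW.
  move: (alpha * k) ak ak0 h2 => a a4 a0' h2.
  have : (1 - a) * M <= V y by lra.
  move=> h3; have h4 : 0 < 1 - a by lra.
  rewrite -(ler_pM2l h4) (le_trans h3)// mulrA ler_peMl//.
  nra.
 rewrite -/(v k) -v0; split.
  rewrite subr_le0; apply: le_trans (a1 k _) _; first by rewrite k0 lexx.
  rewrite v0 (_ : 2 * alpha * k * V y = k * (alpha * (2 * V y))); last by ring.
  rewrite ler_wpM2l// ler_pM2l// (le_trans MV)// ler_wpM2r//; lra.
 rewrite subr_le0; apply: le_trans a2; rewrite lerN2 ler_wpM2l// lerD2l v0 -mulrA ler_pM2l//.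
 by rewrite -[2 * alpha * k]mulrA.
have cVk : continuous (fun x => V (dil (1 + k) x)) by exact: dil_continuous.
split.
 rewrite -subr_le0; apply: (ae_continuous_le (f := fun x => `|V (dil (1 + k) x) - V x| - 2 * alpha * k * V x)).
  move=> y; apply: cvgB; last by apply: cvgM; [exact: cvg_cst|exact: cV].
  by apply: cvg_norm; apply: cvgB; [exact: cVk|exact: cV].
 by apply: filterS aek => y [].
rewrite -subr_le0; apply: (ae_continuous_le (f := fun x => - (k * (beta + 2 * (1 + 2 * alpha * k) * V x)) - (V (dil (1 + k) x) - V x))).
 move=> y; apply: cvgB; last by apply: cvgB; [exact: cVk|exact: cV].
 apply: cvgN; apply: cvgM; first exact: cvg_cst.
 apply: cvgD; first exact: cvg_cst.
 by apply: cvgM; [exact: cvg_cst|exact: cV].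
by apply: filterS aek => y [].
Qed.

End potential.

(** * The logarithmic kernel *)

Local Notation m4 := (mu2 \x mu2)%E.
Section log_kernel.
Implicit Types (f h u v : pt -> R) (x y z : pt).

Let triangle_arith (a b x1 x2 y1 y2 : R) : b ^+ 2 = y1 ^+ 2 + y2 ^+ 2 ->
 a ^+ 2 = x1 ^+ 2 + x2 ^+ 2 -> - (x1 * y1 + x2 * y2) <= a * b ->
 (x1 - y1) ^+ 2 + (x2 - y2) ^+ 2 <= (a + b) ^+ 2.
Proof. by nra. Qed.

Lemma enorm_psub x y : enorm (psub x y) <= enorm x + enorm y.
Proof.
have h : - (x.1 * y.1 + x.2 * y.2) <= enorm x * enorm y.
 apply: le_trans (ler_norm _) _; rewrite normrN.
 rewrite -ler_sqr ?nnegrE ?mulr_ge0 ?enorm_ge0// exprMn !enorm_sq norm_sq.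
 have := sqr_ge0 (x.1 * y.2 - x.2 * y.1); nra.
have s0 : 0 <= enorm x + enorm y by rewrite addr_ge0 ?enorm_ge0.
rewrite -ler_sqr ?nnegrE ?enorm_ge0//.
have := enorm_sq (psub x y); have := enorm_sq x; have := enorm_sq y; rewrite /psub /=.
set a := enorm x in h *; set b := enorm y in h *; set c := enorm _ => h1 h2 ->.
exact: triangle_arith.
Qed.

Lemma enorm_psubC x y : enorm (psub x y) = enorm (psub y x).
Proof.
by rewrite /enorm /psub /= -[x.1 - y.1]opprB -[x.2 - y.2]opprB !sqrrN.
Qed.

Lemma enorm_dil (a : R) x : 0 <= a -> enorm (dil a x) = a * enorm x.
Proof.
move=> a0; rewrite /enorm /dil /= !exprMn -mulrDr sqrtrM ?sqr_ge0//.
by rewrite sqrtr_sqr ger0_norm.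
Qed.

Definition lnorm x : R := ln (1 + enorm x).
(** Adding [1] to [lnorm] merges the [L^2] norm and [|.|_*] into one weighted norm with weight at
    least [1]. *)
Definition LL x : R := 1 + lnorm x.

Lemma lnorm_ge0 x : 0 <= lnorm x.
Proof. by rewrite ln_ge0// lerDl enorm_ge0. Qed.

Lemma LL_ge1 x : 1 <= LL x.
Proof. by rewrite lerDl lnorm_ge0. Qed.

Lemma LL_gt0 x : 0 < LL x.
Proof. exact: lt_le_trans (LL_ge1 x). Qed.

Lemma LL_ge0 x : 0 <= LL x.
Proof. exact: ltW (LL_gt0 x). Qed.

Lemma measurable_lnorm : mfun lnorm.
Proof.
apply: measurableT_comp; first exact: measurable_ln.
by apply: measurable_funD => //; exact: measurable_enorm.
Qed.

Lemma measurable_LL : mfun LL.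
Proof. by apply: measurable_funD => //; exact: measurable_lnorm. Qed.

Lemma LL_le x : LL x <= 1 + enorm x.
Proof.
rewrite lerD2l; apply: le_trans (_ : ln (expR (enorm x)) <= _); last by rewrite expRK.
by rewrite ler_ln ?posrE ?expR_gt0 ?expR_ge1Dx// ltr_pwDl// enorm_ge0.
Qed.

Lemma LL_dil (a : R) x : 1 <= a -> LL x <= LL (dil a x) /\ LL (dil a x) <= a * LL x.
Proof.
move=> a1; have a0 : 0 < a by lra.
have e0 := enorm_ge0 x; have p1 : 0 < 1 + enorm x by lra.
have ae0 : enorm x <= a * enorm x by rewrite ler_peMl.
have ae : 0 < 1 + a * enorm x by lra.
rewrite /LL /lnorm enorm_dil; last exact: ltW.
split; first by rewrite lerD2l ler_ln ?posrE// lerD2l.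
apply: (@le_trans _ _ (1 + (ln a + ln (1 + enorm x)))).
 by rewrite lerD2l -lnM ?posrE// ler_ln ?posrE ?mulr_gt0// mulrDr mulr1 lerD2r.
have l1 := lnorm_ge0 x; rewrite /lnorm in l1.
have la : ln a <= a - 1.
 apply: le_trans (_ : ln (expR (a - 1)) <= _); last by rewrite expRK.
 by rewrite ler_ln ?posrE ?expR_gt0// -{1}(subrK 1 a) addrC expR_ge1Dx.
have : 0 <= (a - 1) * ln (1 + enorm x) by rewrite mulr_ge0// subr_ge0.
lra.
Qed.

Definition K0 x y : R := ln (enorm (psub x y)).
(** Positive and negative parts of the logarithm: [K1] is dominated by the weights, while [K2] is
    supported at distance less than [1] and has slices of constant finite mass. *)
Definition K1 x y : R := Num.max (K0 x y) 0.
Definition K2 x y : R := Num.max (- K0 x y) 0.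

Lemma K_split x y : K0 x y = K1 x y - K2 x y.
Proof.
rewrite /K1 /K2; set t := K0 x y; have [h|h] := leP 0 t.
 by rewrite (max_idPr _) ?subr0// oppr_le0.
by rewrite (max_idPl _) ?oppr_ge0 ?(ltW h)// sub0r opprK.
Qed.

Lemma K1_ge0 x y : 0 <= K1 x y. Proof. by rewrite le_max lexx orbT. Qed.
Lemma K2_ge0 x y : 0 <= K2 x y. Proof. by rewrite le_max lexx orbT. Qed.

Lemma K0C x y : K0 x y = K0 y x. Proof. by rewrite /K0 enorm_psubC. Qed.
Lemma K2C x y : K2 x y = K2 y x. Proof. by rewrite /K2 K0C. Qed.

Lemma measurable_K0 : mfun (fun z : pt * pt => K0 z.1 z.2).
Proof.
apply: measurableT_comp; first exact: measurable_ln.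
apply: (measurableT_comp measurable_enorm (g := fun z : pt * pt => psub z.1 z.2)).
by apply/measurable_fun_pairP; split; apply: measurable_funB; mproj.
Qed.

Lemma measurable_K1 : mfun (fun z : pt * pt => K1 z.1 z.2).
Proof. by apply: measurable_maxr => //; exact: measurable_K0. Qed.

Lemma measurable_K2 : mfun (fun z : pt * pt => K2 z.1 z.2).
Proof.
apply: measurable_maxr => //; apply: measurableT_comp => //; exact: measurable_K0.
Qed.

Lemma K1_le x y : K1 x y <= lnorm x + lnorm y.
Proof.
have x0 := enorm_ge0 x; have y0 := enorm_ge0 y.
rewrite ge_max addr_ge0 ?lnorm_ge0// andbT.
have [h|h] := leP (enorm (psub x y)) 0.
 by rewrite /K0 ln0// addr_ge0 ?lnorm_ge0.
have p : 0 < (1 + enorm x) * (1 + enorm y) by rewrite mulr_gt0//; lra.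
rewrite /lnorm -lnM ?posrE; try lra.
rewrite ler_ln ?posrE//; have := enorm_psub x y; nra.
Qed.

Lemma K1_LL x y : K1 x y <= LL x * LL y.
Proof.
apply: le_trans (K1_le x y) _; rewrite /LL.
have := lnorm_ge0 x; have := lnorm_ge0 y; nra.
Qed.

Lemma min_count (t : R) (n : nat) : 0 <= t ->
 Num.min t n%:R <= \sum_(j < n) (j%:R < t)%R%:R.
Proof.
move=> t0; elim: n => [|n IH]; first by rewrite big_ord0 ge_min lexx orbT.
rewrite big_ord_recr /=; apply: le_trans (_ : Num.min t n%:R + (n%:R < t)%R%:R <= _).
 have [h|h] := ltP n%:R t.
  by rewrite natr1 ge_min lexx orbT.
 by rewrite addr0 ge_min lexx.
by rewrite lerD2r.
Qed.

Definition k2 z : R := K2 z (0, 0).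

Lemma K2E x y : K2 x y = k2 (affm 1 (- x.1, - x.2) y).
Proof.
rewrite K2C /K2 /k2 /K2 /K0; congr (Num.max (- ln (enorm _)) 0).
by rewrite /psub /affm /= !subr0 !mul1r.
Qed.

Lemma measurable_k2 : mfun k2.
Proof.
apply: measurable_maxr => //; apply: measurableT_comp => //; apply: measurableT_comp; first exact: measurable_ln.
apply: (measurableT_comp measurable_enorm (g := fun z : pt => psub z (0, 0))).
by apply/measurable_fun_pairP; split; exact: measurable_funB.
Qed.

(** Layer by layer: [min (k2, n)] is at most the number of [j < n] with [k2 > j], and [k2 z > j]
    forces [|z| <= expR (- j) <= 2^-j]. The squares have areas [4 * 4^-j], of sum [16 / 3]; Fatou
    removes the truncation. *)
Lemma Int_k2 : Int mu2 k2.
Proof.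
have mk2 := measurable_k2; have k20 z : 0 <= k2 z by exact: K2_ge0.
pose c (j : nat) : R := 2^-1 ^+ j.
have Ic r : Int mu2 (\1_(cube r)).
 apply: Int_ge0 => //; first by apply: measurable_indic; exact: measurable_cube.
 by have mc := @measurable_cube r; rewrite integral_indic// setIT; exact: mu2_cube.
have rc r : 0 <= r -> rint mu2 (\1_(cube r)) = 4 * r ^+ 2.
 move=> r0; have mc := @measurable_cube r; rewrite /rint integral_indic// setIT.
 have E : mu2 (cube r) = (4 * r ^+ 2)%:E.
  rewrite mu2_prod// leb1_itv; last lra.
  by rewrite -EFinM; congr _%:E; ring.
 by transitivity (fine ((4 * r ^+ 2)%:E)) => //; congr fine; exact: E.
have Is n : [L1 z, \sum_(j < n) \1_(cube (c j)) z] /\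
  [int z, \sum_(j < n) \1_(cube (c j)) z] <= 16 / 3 * (1 - 4^-1 ^+ n).
 elim: n => [|n [I1 r1]].
  under eq_fun do rewrite big_ord0; split; first exact: Int_0.
  by rewrite rint0 expr0 subrr mulr0.
 under eq_fun do rewrite big_ord_recr /=; split; first exact: Int_D.
 have cq : c n ^+ 2 = 4^-1 ^+ n.
  by rewrite /c -exprM mulnC exprM; congr (_ ^+ n); field.
 rewrite rintD// rc ?exprn_ge0// cq exprS.
 move: r1; set q := 4^-1 ^+ n; lra.
pose F (n : nat) z := Num.min (k2 z) n%:R.
have Fle n z : F n z <= \sum_(j < n) \1_(cube (c j)) z.
 apply: le_trans (min_count n (k20 z)) _; apply: ler_sum => j _.
 case: (ltP j%:R (k2 z)) => // jk; rewrite indicE mem_set//.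
 have zc : enorm z <= c j.
  move: jk; rewrite /k2 /K2 lt_max /K0 (_ : psub z (0, 0) = z); last first.
   by rewrite /psub /= !subr0; case: z.
  case/orP; last by rewrite ltNge ler0n.
  have [e0|e0] := leP (enorm z) 0; first by move=> _; apply: le_trans e0 _; rewrite exprn_ge0.
  rewrite ltrNr => h; have : enorm z <= expR (- j%:R).
   by rewrite -[leLHS](@lnK R) ?posrE// ler_expR ltW.
  move=> /le_trans; apply; rewrite expRN -[j%:R]mulr1 expRM_natl /c exprVn.
  rewrite lef_pV2 ?posrE ?exprn_gt0 ?expR_gt0//.
  by apply: lerXn2r; rewrite ?nnegrE ?expR_ge0//; have := expR_ge1Dx (1 : R).
 by apply/cubeP; split; apply: le_trans zc; [exact: enorm_ge1|exact: enorm_ge2].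
have F0 n z : 0 <= F n z by rewrite le_min k20 ler0n.
have mF n : mfun (F n) by exact: measurable_minr.
have IF n : Int mu2 (F n).
 by apply: (Int_le (Is n).1) => // z; rewrite ger0_norm.
have [] // := @fatou_rint _ _ mu2 F k2 (16 / 3) IF mk2 F0 k20.
 move=> n; apply: le_trans (rint_le (IF n) (Is n).1 (Fle n)) _; apply: le_trans (Is n).2 _.
 by rewrite ler_piMr// gerBl exprn_ge0.
apply: nearW => z; apply: cvg_near_cst; near=> n; rewrite /F min_l//.
near: n; exact: nbhs_infty_ger.
Unshelve. all: by end_near. Qed.

Definition kap : R := rint mu2 k2.

Lemma kap_ge0 : 0 <= kap. Proof. by apply: rint_ge0 => z; exact: K2_ge0. Qed.

Lemma K2_slice x : [L1 y, K2 x y] /\ [int y, K2 x y] = kap.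
Proof.
under eq_fun do rewrite K2E; split; first exact: Int_affm Int_k2.
by rewrite (rint_affm _ ltr01 Int_k2) expr1n invr1 mul1r.
Qed.

Lemma K2_mass f : Int mu2 f -> (forall x, 0 <= f x) ->
 [/\ Int m4 (fun z : pt * pt => K2 z.1 z.2 * f z.1), rint m4 (fun z : pt * pt => K2 z.1 z.2 * f z.1) = kap * rint mu2 f,
   Int m4 (fun z : pt * pt => K2 z.1 z.2 * f z.2) & rint m4 (fun z : pt * pt => K2 z.1 z.2 * f z.2) = kap * rint mu2 f].
Proof.
move=> If f0.
have mF : mfun (fun z : pt * pt => K2 z.1 z.2 * f z.1).
 apply: measurable_funM; first exact: measurable_K2.
 by apply: (measurableT_comp (Int_mf If)); exact: measurable_fst.
have s x : [L1 y, K2 x y * f x] /\ [int y, K2 x y * f x] = kap * f x.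
 have [I r] := K2_slice x; under eq_fun do rewrite mulrC; split; first exact: Int_Z.
 by rewrite rintZ// r mulrC.
have I1 : Int m4 (fun z : pt * pt => K2 z.1 z.2 * f z.1).
 apply: (Int_prodP mF (Int_Z kap If)) => x /=.
 under eq_integral do rewrite ger0_norm ?mulr_ge0 ?K2_ge0//.
 by have [I r] := s x; rewrite Int_fin// r.
have r1 : rint m4 (fun z : pt * pt => K2 z.1 z.2 * f z.1) = kap * rint mu2 f.
 have [_ <- _] := rint_fubini1 I1; rewrite -rintZ//; apply: eq_rint => x /=.
 by have [] := s x.
have mF2 : mfun (fun z : pt * pt => K2 z.1 z.2 * f z.2).
 apply: measurable_funM; first exact: measurable_K2.
 by apply: (measurableT_comp (Int_mf If)); exact: measurable_snd.
have I2 : Int m4 (fun z : pt * pt => K2 z.1 z.2 * f z.2).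
 apply/integrable21ltyP; first exact/measurable_EFinP.
 have : (\int[mu2]_x \int[mu2]_y `|(K2 x y * f x)%:E| < +oo)%E.
  by move: I1 => /integrable12ltyP; apply; exact/measurable_EFinP.
 have <- : (\int[mu2]_y \int[mu2]_x `|(K2 x y * f y)%:E| = \int[mu2]_x \int[mu2]_y `|(K2 x y * f x)%:E|)%E.
  by apply: eq_integral => x _; apply: eq_integral => y _; rewrite K2C.
 by move=> H; exact: H.
split => //; have [_ <- _] := rint_fubini2 I2; rewrite -rintZ//; apply: eq_rint => y /=.
by under eq_fun do rewrite K2C; have [] := s y.
Qed.

(** Products of two elements of [E] are of this kind. The weighted [L^1] norm serves [K1] and the
    [L^2] norm serves [K2]. *)
Definition dens f := [/\ mfun f, [L1 x, LL x * `|f x|] &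
 [L1 x, f x ^+ 2]].
Definition nL f : R := [int x, LL x * `|f x|].
Definition n2 f : R := [int x, f x ^+ 2].

Lemma nL_ge0 f : 0 <= nL f.
Proof. by apply: rint_ge0 => x; rewrite mulr_ge0 ?LL_ge0. Qed.

Lemma n2_ge0 f : 0 <= n2 f. Proof. by apply: rint_ge0 => x; exact: sqr_ge0. Qed.

Lemma dens_Int1 f : dens f -> Int mu2 f.
Proof.
move=> [mf I _]; apply: (Int_le I) => // x.
by rewrite ler_peMl// LL_ge1.
Qed.

Lemma measurable_tensor f h : mfun f -> mfun h ->
 mfun (fun z : pt * pt => f z.1 * h z.2).
Proof.
move=> mf mh; apply: measurable_funM.
 by apply: (measurableT_comp mf); exact: measurable_fst.
by apply: (measurableT_comp mh); exact: measurable_snd.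
Qed.

Lemma tensor_int f h : Int mu2 f -> Int mu2 h ->
 Int m4 (fun z : pt * pt => f z.1 * h z.2) /\ rint m4 (fun z : pt * pt => f z.1 * h z.2) = rint mu2 f * rint mu2 h.
Proof.
move=> If Ih.
have I : Int m4 (fun z : pt * pt => f z.1 * h z.2).
 apply: (Int_prod_le (m1 := mu2) (m2 := mu2) _ (Int_abs If) (Int_abs Ih)).
  exact: measurable_tensor (Int_mf If) (Int_mf Ih).
 by move=> x y /=; rewrite normrM.
split => //; have [_ <- _] := rint_fubini1 I.
rewrite mulrC -rintZ//; apply: eq_rint => x /=.
by rewrite rintZ// mulrC.
Qed.

Definition qf (K : pt -> pt -> R) f h : R := rint m4 (fun z : pt * pt => K z.1 z.2 * (f z.1 * h z.2)).
Definition qI (K : pt -> pt -> R) f h := Int m4 (fun z : pt * pt => K z.1 z.2 * (f z.1 * h z.2)).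

Lemma K1_form f h : dens f -> dens h -> qI K1 f h /\ `|qf K1 f h| <= nL f * nL h.
Proof.
move=> [mf If _] [mh Ih _]; have [It rt] := tensor_int If Ih.
have mK : mfun (fun z : pt * pt => K1 z.1 z.2 * (f z.1 * h z.2)).
 by apply: measurable_funM; [exact: measurable_K1|exact: measurable_tensor].
have le (z : pt * pt) : `|K1 z.1 z.2 * (f z.1 * h z.2)| <= LL z.1 * `|f z.1| * (LL z.2 * `|h z.2|).
 rewrite !normrM ger0_norm ?K1_ge0// mulrACA ler_wpM2r ?mulr_ge0//; exact: K1_LL.
split; first exact: (Int_le It mK le).
by rewrite /nL -rt; exact: rint_bound.
Qed.

(** Cauchy-Schwarz on pairs with weight [K2], one factor depending on each variable; the marginals
    of [K2] are the constant [kap]. *)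
Lemma K2_form f h : dens f -> dens h -> qI K2 f h /\ qf K2 f h ^+ 2 <= kap ^+ 2 * (n2 f * n2 h).
Proof.
move=> [mf _ If] [mh _ Ih].
have [I1 r1 _ _] := K2_mass If (fun x => sqr_ge0 _); have [_ _ I2 r2] := K2_mass Ih (fun x => sqr_ge0 _).
have m1 : mfun (fun z : pt * pt => f z.1).
 by apply: (measurableT_comp mf); exact: measurable_fst.
have m2 : mfun (fun z : pt * pt => h z.2).
 by apply: (measurableT_comp mh); exact: measurable_snd.
have k0 (z : pt * pt) : 0 <= K2 z.1 z.2 by exact: K2_ge0.
split; first exact: (Int_prod2 measurable_K2 k0 m1 m2 I1 I2).
have := cauchy_schwarz measurable_K2 k0 m1 m2 I1 I2.
by rewrite r1 r2 => /le_trans; apply; rewrite /n2; lra.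
Qed.

Definition q f h : R := qf K0 f h.

Lemma q_Int f h : dens f -> dens h -> qI K0 f h /\ q f h = qf K1 f h - qf K2 f h.
Proof.
move=> df dh; have [I1 _] := K1_form df dh; have [I2 _] := K2_form df dh.
have E : (fun z : pt * pt => K0 z.1 z.2 * (f z.1 * h z.2)) = (fun z : pt * pt =>
  K1 z.1 z.2 * (f z.1 * h z.2) - K2 z.1 z.2 * (f z.1 * h z.2)).
 by apply/funext => z; rewrite -mulrBl -K_split.
by rewrite /qI /q /qf E rintB//; split => //; exact: Int_B.
Qed.

Lemma qfC (K : pt -> pt -> R) f h : (forall x y, K x y = K y x) -> qI K f h ->
 qI K h f -> qf K f h = qf K h f.
Proof.
move=> KC I I'; rewrite /qf; have [_ <- _] := rint_fubini1 I; have [_ <- _] := rint_fubini2 I'.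
apply: eq_rint => x /=; apply: eq_rint => y /=.
by rewrite KC [f x * _]mulrC.
Qed.

Lemma qC f h : dens f -> dens h -> q f h = q h f.
Proof.
move=> df dh; have [I _] := q_Int df dh; have [I' _] := q_Int dh df.
exact: (qfC K0C).
Qed.

Lemma dens_D f h : dens f -> dens h -> dens (fun x => f x + h x).
Proof.
move=> [mf I1 I2] [mh J1 J2]; split; first exact: measurable_funD.
- apply: (Int_le (Int_D I1 J1)).
  apply: measurable_funM; first exact: measurable_LL.
  by apply: measurableT_comp => //; exact: measurable_funD.
 move=> x; rewrite normrM normr_id (ger0_norm (LL_ge0 x)) -mulrDr ler_wpM2l ?LL_ge0//.
 exact: ler_normD.
- have := @Int_sum2 _ _ mu2 (fun=> 1) f h (measurable_cst _) (fun=> ler01) mf mh.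
 have E (F : pt -> R) : (fun x => 1 * F x ^+ 2) = (fun x => F x ^+ 2) by apply/funext => x; rewrite mul1r.
 by rewrite (E f) (E h) (E (fun x => f x + h x)); apply.
Qed.

Lemma dens_Z c f : dens f -> dens (fun x => c * f x).
Proof.
move=> [mf I1 I2]; split; first exact: measurable_funM.
- apply: (eq_Int _ (Int_Z `|c| I1)) => x; rewrite normrM; ring.
- by apply: (eq_Int _ (Int_Z (c ^+ 2) I2)) => x; rewrite exprMn.
Qed.

Lemma qDl f1 f2 h : dens f1 -> dens f2 -> dens h -> q (fun x => f1 x + f2 x) h = q f1 h + q f2 h.
Proof.
move=> d1 d2 dh; have [I1 _] := q_Int d1 dh; have [I2 _] := q_Int d2 dh.
rewrite /q /qf -rintD//; apply: eq_rint => z; ring.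
Qed.

Lemma qZl c f h : dens f -> dens h -> q (fun x => c * f x) h = c * q f h.
Proof.
move=> d1 dh; have [I1 _] := q_Int d1 dh.
rewrite /q /qf -rintZ//; apply: eq_rint => z; ring.
Qed.

Lemma qDr f1 f2 h : dens f1 -> dens f2 -> dens h -> q h (fun x => f1 x + f2 x) = q h f1 + q h f2.
Proof.
by move=> d1 d2 dh; rewrite qC ?qDl ?[q _ h]qC//; exact: dens_D.
Qed.

Lemma qZr c f h : dens f -> dens h -> q h (fun x => c * f x) = c * q h f.
Proof.
by move=> d1 dh; rewrite qC ?qZl ?[q _ h]qC//; exact: dens_Z.
Qed.

Lemma integral_leb2 (D : set pt) (G : pt -> \bar R) : measurable D -> measurable_fun D G ->
 (\int[@leb2 R]_(x in D) G x = \int[mu2]_(x in D) G x)%E.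
Proof.
move=> mD mG; rewrite integralE [RHS]integralE !ge0_integral_leb2//.
 exact: measurable_funeneg.
exact: measurable_funepos.
Qed.

(** The iterated integral of [N0] is taken for [leb2]; integrability on the product turns it into a
    single integral over [m4]. *)
Lemma N0_q u : mfun u -> dens (fun x => u x ^+ 2) ->
 N0 u = (2 * pi)^-1 * q (fun x => u x ^+ 2) (fun x => u x ^+ 2).
Proof.
move=> mu du; have [I _] := q_Int du du; congr (_ * _).
rewrite /q /qf /rint; congr fine.
pose F (z : pt * pt) : \bar R := (K0 z.1 z.2 * (u z.1 ^+ 2 * u z.2 ^+ 2))%:E.
have mF : mfun F by apply/measurable_EFinP; exact: Int_mf I.
rewrite -(@integral12_prod_meas1 _ _ _ _ _ mu2 mu2 _ I).
have E x : (\int[@leb2 R]_y (ln (enorm (psub x y)) * u x ^+ 2 * u y ^+ 2)%:E = fubini_F mu2 F x)%E.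
 rewrite integral_leb2//.
  by rewrite /fubini_F; apply: eq_integral => y _; congr (_%:E); exact: (esym (mulrA _ _ _)).
 apply/measurable_EFinP; apply: measurable_funM; last exact: measurable_funX.
 apply: measurable_funM => //.
 by apply: (measurableT_comp measurable_K0 (measurable_pair1 x)).
under eq_integral do rewrite E.
apply: integral_leb2 => //.
exact: (@measurable_fubini_F _ _ _ _ _ mu2 mu2 _ I).
Qed.

End log_kernel.

(** * Calculus of weak gradients *)

Section weak_gradients.
Implicit Types (u v w g f phi zeta : pt -> R).

Lemma LI_D u v : LI u -> LI v -> LI (fun x => u x + v x).
Proof.
move=> [mu Iu] [mv Iv]; split; first exact: measurable_funD.
by move=> r; under eq_fun do rewrite mulrDl; exact: Int_D.
Qed.

Lemma LI_Z (c : R) u : LI u -> LI (fun x => c * u x).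
Proof.
move=> [mu Iu]; split; first exact: measurable_funM.
by move=> r; under eq_fun do rewrite -mulrA; exact: Int_Z.
Qed.

Lemma bs_cut zeta r : continuous zeta -> bs (fun x => zeta x * \1_(cube r) x).
Proof.
move=> cz; split.
 apply: measurable_funM; first exact: continuous_measurable2.
 by apply: measurable_indic; exact: measurable_cube.
have [M [_ hM]] : bounded_set [set zeta x | x in cube r].
 apply: compact_bounded; apply: continuous_compact; last exact: compact_cube.
 exact: continuous_subspaceT.
exists r, (M + 1) => x; rewrite indicE; have [xr|xr] := pselect (cube r x).
 by rewrite mem_set// !mulr1 (hM (M + 1)) ?ltrDl//; exists x.
by rewrite memNset// !mulr0 normr0.
Qed.

Lemma LI_M zeta u : continuous zeta -> LI u -> LI (fun x => zeta x * u x).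
Proof.
move=> cz Lu; split.
 by apply: measurable_funM; [exact: continuous_measurable2|exact: LI_mf Lu].
move=> r; have := Int_LI_bs Lu (bs_cut r cz).
by congr Int; apply/funext => x; rewrite mulrCA mulrA.
Qed.

Lemma bs_M zeta phi : continuous zeta -> bs phi -> bs (fun x => zeta x * phi x).
Proof.
move=> cz [mphi [r [C hC]]]; have [_ [r' [M hM]]] := bs_cut r cz; split.
 by apply: measurable_funM => //; exact: continuous_measurable2.
exists r, (`|M| * `|C|) => x; have := hC x; have := hM x; rewrite !indicE.
have [xr|xr] := pselect (cube r x).
 rewrite (mem_set xr) !mulr1 normrM => h1 h2; apply: ler_pM => //; last exact: le_trans h2 (ler_norm _).
 apply: le_trans h1 (le_trans (ler_norm _) _); rewrite normrM ler_piMr//.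
 by case: (_ \in _); rewrite ?normr1 ?normr0.
rewrite (memNset xr) !mulr0 => _ h2; have /eqP -> : `|zeta x * phi x| == 0 => //.
have /eqP p0 : `|phi x| == 0 by rewrite eq_le h2/=.
by rewrite normrM p0 mulr0.
Qed.

Lemma WG_comb (a b : R) u g1 g2 v h1 h2 : WG u g1 g2 -> WG v h1 h2 ->
 WG (fun x => a * u x + b * v x) (fun x => a * g1 x + b * h1 x) (fun x => a * g2 x + b * h2 x).
Proof.
move=> [Lu L1 L2 W] [Lv M1 M2 Z]; split; do ?by apply: LI_D; exact: LI_Z.
move=> phi tphi; have [w1 w2] := W _ tphi; have [z1 z2] := Z _ tphi.
have [bp bd] := test_fun_bs tphi.
have H f h psi : LI f -> LI h -> bs psi -> [int x, (a * f x + b * h x) * psi x] =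
  a * [int x, f x * psi x] + b * [int x, h x * psi x].
 move=> Lf Lh bpsi; have I1 := Int_LI_bs Lf bpsi; have I2 := Int_LI_bs Lh bpsi.
 rewrite -!rintZ// -rintD; do ?exact: Int_Z.
 by apply: eq_rint => x; ring.
by rewrite !H// w1 w2 z1 z2; split; ring.
Qed.

Lemma smooth_is_pd phi b : smooth phi -> is_pd b phi (pd b phi).
Proof.
move=> sp x; have [_ d] := sp [::]; have dx := d b x.
by split => //; rewrite /pd derive1E.
Qed.

Lemma is_pd_M b u u' v v' : is_pd b u u' -> is_pd b v v' ->
 is_pd b (fun x => u x * v x) (fun x => u' x * v x + u x * v' x).
Proof.
move=> hu hv x; have := idM (hu x) (hv x).
by rewrite /Defs.shift; case: b {hu hv}; rewrite !addr0; case: x.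
Qed.

(** [zeta * phi] is again a test function, and the classical product rule for it gives the weak
    one. *)
Lemma WG_mul zeta z1 z2 u g1 g2 : sm2 zeta -> sm2 z1 -> sm2 z2 ->
 is_pd true zeta z1 -> is_pd false zeta z2 -> WG u g1 g2 ->
 WG (fun x => zeta x * u x) (fun x => zeta x * g1 x + z1 x * u x) (fun x => zeta x * g2 x + z2 x * u x).
Proof.
move=> sz sz1 sz2 d1 d2 [Lu L1 L2 W].
have [cz _] := sm2_pd sz; have [cz1 _] := sm2_pd sz1; have [cz2 _] := sm2_pd sz2.
split; do ?exact: LI_M; do ?by apply: LI_D; exact: LI_M.
move=> phi tphi; have [sphi [r hr]] := tphi; have [bp bd] := test_fun_bs tphi.
have tz : test_fun (fun x => zeta x * phi x).
 split; first by apply: sm2_is_smooth; apply: sm2_mul => //; exact: sm2_smooth.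
 by exists r => x /hr ->; rewrite mulr0.
have [w1 w2] := W _ tz.
have H b z g : sm2 z -> LI g -> is_pd b zeta z ->
 [int x, u x * pd b (fun x => zeta x * phi x) x] = - [int x, g x * (zeta x * phi x)] ->
 [int x, zeta x * u x * pd b phi x] = - [int x, (zeta x * g x + z x * u x) * phi x].
 move=> sz' Lg dz; rewrite (is_pdE (is_pd_M dz (smooth_is_pd b sphi))) => E.
 have [cz' _] := sm2_pd sz'.
 have I1 := Int_LI_bs Lu (bs_M cz (bd b)); have I2 := Int_LI_bs Lu (bs_M cz' bp).
 have I3 := Int_LI_bs Lg (bs_M cz bp).
 have -> : [int x, zeta x * u x * pd b phi x] =
   [int x, u x * (z x * phi x + zeta x * pd b phi x)] - [int x, u x * (z x * phi x)].
  rewrite -rintB//; last by under eq_fun do rewrite mulrDr; exact: Int_D.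
  by apply: eq_rint => x; ring.
 rewrite E -opprD -rintD//; congr (- _); apply: eq_rint => x; ring.
by split; [exact: H w1|exact: H w2].
Qed.

Lemma LI_cst (d : R) : LI (fun _ : pt => d).
Proof.
split => // r; have := Int_Z d (Int_LI_bs (bs_LI (bs_cube r)) (bs_cube r)).
congr Int; apply/funext => x; rewrite indicE; case: (_ \in _); by rewrite ?mulr1 ?mulr0.
Qed.

Lemma bs_Int f : bs f -> Int mu2 f.
Proof. by move=> bf; have := Int_LI_bs (LI_cst 1) bf; under eq_fun do rewrite mul1r. Qed.

(* Difference quotients have integral zero by translation invariance and converge dominatedly to the derivative. *)
Lemma rint_pd b phi : test_fun phi -> rint mu2 (pd b phi) = 0.
Proof.
move=> tphi; have [sphi _] := tphi; have [bp bd] := test_fun_bs tphi; have [mh [r [C hC]]] := bd b.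
have sh x s : Defs.shift b x s = affm 1 (if b then (s, 0) else (0, s)) x.
 by rewrite /affm /Defs.shift; case: (b); rewrite /= !mul1r addr0.
have d x s : id1 s (fun t => phi (Defs.shift b x t)) (pd b phi (Defs.shift b x s)).
 have := idcomp (g := fun t => t - s) (x := s) (b := 1) (f := fun t => phi (Defs.shift b (Defs.shift b x s) t)).
 rewrite subrr => /(_ _ (smooth_is_pd b sphi _)); rewrite mulr1.
 have -> : (fun t => phi (Defs.shift b (Defs.shift b x s) (t - s))) = (fun t => phi (Defs.shift b x t)).
  apply/funext => t; congr phi; rewrite /Defs.shift; have e (y : R) : y + s + (t - s) = y + t by ring.
  by case: (b); rewrite /= e.
 by apply; have := idD (idid s) (idC (- s) s); rewrite addr0.
have x0 (x : pt) : Defs.shift b x 0 = x by rewrite /Defs.shift; case: (b); rewrite addr0; case: (x).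
pose q n x := n.+1%:R * (phi (Defs.shift b x n.+1%:R^-1) - phi x).
have Ip := bs_Int bp; have Is s : [L1 x, phi (Defs.shift b x s)].
 by under eq_fun do rewrite sh; exact: Int_affm.
have q0 n : rint mu2 (q n) = 0.
 rewrite /q rintZ ?rintB//; last exact: Int_B.
 by under eq_fun do rewrite sh; rewrite rint_affm// expr1n invr1 mul1r subrr mulr0.
have [n|||n x||_] := dominated_rint (m := mu2) (f_ := q) (f := pd b phi) (g := fun x => `|C| * \1_(cube (`|r| + 1)) x).
- by apply: Int_mf; apply: Int_Z; exact: Int_B.
- exact: mh.
- by apply: Int_Z; exact: bs_Int (bs_cube _).
- have h0 : 0 <= n.+1%:R^-1 :> R by rewrite invr_ge0.
 have [|s] := MVT_segment h0 (fun s _ => d x s).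
  by apply: derivable_within_continuous => s _; have [] := d x s.
 rewrite in_itv/= x0 subr0 => /andP[s0 s1] E; rewrite /q E mulrCA mulfV ?pnatr_eq0// mulr1.
 apply: le_trans (hC _) _; apply: le_trans (_ : `|C| * \1_(cube r) (Defs.shift b x s) <= _).
  by rewrite ler_wpM2r ?ler_norm// indicE.
 rewrite ler_wpM2l// !indicE ler_nat.
 case: (boolP (_ \in cube r)) => // /set_mem/cubeP hq; rewrite mem_set//; apply/cubeP.
 have s1' : s <= 1 by apply: le_trans s1 _; rewrite invf_le1// ler1n.
 have hs (t : R) : `|t + s| <= r -> `|t| <= `|r| + 1.
  by move=> /le_trans/(_ (ler_norm r)); rewrite !ler_norml => /andP[? ?]; apply/andP; split; lra.
 have ht (t : R) : `|t| <= r -> `|t| <= `|r| + 1 by move=> h; have := ler_norm r; lra.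
 by move: hq; rewrite /Defs.shift; case: (b) => /= -[e1 e2]; split; auto.
- apply: aeW => x; have [dx] := d x 0; rewrite x0 => <-.
 have /cvgr_dnbhsP/(_ (@harmonic R)) H := dx.
 rewrite (_ : q ^~ x = fun n => (harmonic n)^-1 *: (phi (Defs.shift b x (harmonic n *: 1 + 0)) - phi (Defs.shift b x 0))).
  by apply: H; split; [move=> n; rewrite invr_eq0 pnatr_eq0|exact: cvg_harmonic].
 by apply/funext => n; rewrite addr0 x0 /harmonic invrK [_ *: 1]mulr1.
under eq_fun do rewrite q0; move=> L; apply: (cvg_unique _ L) => //; exact: cvg_cst.
Qed.

(** Together with [WG_mul], constants provide the weak gradient of smooth functions such as
    bumps. *)
Lemma WG_cst (a : R) : WG (fun=> a) (fun=> 0) (fun=> 0).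
Proof.
split; do ?exact: LI_cst; move=> phi tphi; have [_ bd] := test_fun_bs tphi.
have z : [int x, 0 * phi x] = 0.
 by under eq_fun do rewrite mul0r; exact: rint0.
by rewrite z oppr0 !rintZ ?rint_pd ?mulr0//; exact: bs_Int.
Qed.

Lemma dil_affm (a : R) : dil a = affm a (0, 0).
Proof. by apply/funext => x; rewrite /dil /affm !addr0. Qed.

Lemma Int_dil (a : R) f : 0 < a -> Int mu2 f -> [L1 x, f (dil a x)].
Proof. by move=> a0 If; rewrite dil_affm; exact: Int_affm. Qed.

Lemma rint_dil (a : R) f : 0 < a -> Int mu2 f ->
 [int x, f (dil a x)] = a ^- 2 * rint mu2 f.
Proof. by move=> a0 If; rewrite dil_affm; exact: rint_affm. Qed.

Lemma dilK (a : R) x : a != 0 -> dil a (dil a^-1 x) = x.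
Proof. by move=> a0; rewrite /dil /= !mulrA mulfV// !mul1r; case: x. Qed.

Lemma cube_dil (a r : R) x : 0 < a -> cube r x -> cube (a * r) (dil a x).
Proof.
move=> a0 /cubeP[h1 h2]; apply/cubeP; rewrite /dil /= !normrM !(gtr0_norm a0).
by rewrite !ler_pM2l.
Qed.

Lemma WG_dil (a : R) u g1 g2 : 0 < a -> WG u g1 g2 ->
 WG (fun x => u (dil a x)) (fun x => a * g1 (dil a x)) (fun x => a * g2 (dil a x)).
Proof.
move=> a0 [Lu L1 L2 W]; have an0 := lt0r_neq0 a0.
have Ld f : LI f -> LI (fun x => f (dil a x)).
 move=> [mf If]; split.
  by rewrite dil_affm; apply: measurableT_comp => //; exact: measurable_affm.
 move=> r; have J := Int_indic (@measurable_cube r) (Int_dil a0 (If (a * r))).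
 move: J; congr Int; apply/funext => x; rewrite !indicE -mulrA; congr (_ * _).
 have [xr|xr] := pselect (cube r x); last by rewrite (memNset xr) mulr0.
 by rewrite (mem_set xr) mulr1 mem_set//; exact: cube_dil.
split; do ?exact: Ld; do ?by apply: LI_Z; exact: Ld.
move=> phi tphi; have [bp bd] := test_fun_bs tphi; have [sphi [r hr]] := tphi.
pose psi x := phi (dil a^-1 x).
have ai : 0 < a^-1 by rewrite invr_gt0.
have tpsi : test_fun psi.
 split; first by apply: sm2_is_smooth; rewrite /psi dil_affm; apply: sm2_aff; exact: sm2_smooth.
 exists (a * r) => x ax; rewrite /psi hr// enorm_dil ?(ltW ai)//.
 by rewrite mulrC ltr_pdivlMr// mulrC.
have pdE b : pd b psi = fun x => a^-1 * pd b phi (dil a^-1 x).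
 apply: is_pdE => x; have h1 := smooth_is_pd b sphi (dil a^-1 x).
 have h2 : is_derive (0 : R) (1 : R) (fun t => a^-1 * t) a^-1.
  by have := idM (idC a^-1 (0 : R)) (idid (0 : R)); rewrite mul0r mulr1 add0r.
 have := @idcomp (fun t => phi (Defs.shift b (dil a^-1 x) t)) (fun t => a^-1 * t) 0 (pd b phi (dil a^-1 x)) a^-1.
 rewrite mulr0 => /(_ h1 h2); rewrite mulrC.
 by congr (is_derive _ _ _ _); apply/funext => t; congr phi; rewrite /Defs.shift /dil; case: (b); rewrite /= mulrDr.
have [w1 w2] := W _ tpsi; have [bpsi bdpsi] := test_fun_bs tpsi.
have H b g : LI g -> [int x, u x * pd b psi x] = - [int x, g x * psi x] ->
  [int x, u (dil a x) * pd b phi x] = - [int x, a * g (dil a x) * phi x].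
 move=> Lg E; have I1 := Int_LI_bs Lu (bdpsi b); have I2 := Int_LI_bs Lg bpsi.
 have e1 := rint_dil a0 I1; have e2 := rint_dil a0 I2.
 have inj x : dil a^-1 (dil a x) = x by rewrite -{2}(invrK a) dilK// invr_neq0.
 have -> : (fun x => u (dil a x) * pd b phi x) = (fun x => a * (u (dil a x) * pd b psi (dil a x))).
  by apply/funext => x; rewrite pdE inj; field.
 have -> : (fun x => a * g (dil a x) * phi x) = (fun x => a * (g (dil a x) * psi (dil a x))).
  by apply/funext => x; rewrite /psi inj mulrA.
 rewrite rintZ; last exact: (Int_dil a0 I1).
 rewrite rintZ; last exact: (Int_dil a0 I2).
 by rewrite e1 e2 E; ring.
by split; [exact: H w1|exact: H w2].
Qed.

Lemma bs_sq phi : bs phi -> [L1 x, phi x ^+ 2].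
Proof. by move=> b; have := Int_LI_bs (bs_LI b) b; under eq_fun do rewrite -expr2. Qed.

Lemma L2_test f h phi (e : R) : 0 <= e -> LI f -> LI h -> bs phi ->
 [L1 x, (f x - h x) ^+ 2] -> [int x, (f x - h x) ^+ 2] <= e ^+ 2 ->
 `|[int x, f x * phi x] - [int x, h x * phi x]| <=
  e * Num.sqrt ([int x, phi x ^+ 2]).
Proof.
move=> e0 Lf Lh bphi I Ie; have I1 := Int_LI_bs Lf bphi; have I2 := Int_LI_bs Lh bphi.
have J := bs_sq bphi.
rewrite -rintB//.
have mfh : mfun (fun x => f x - h x) by apply: measurable_funB; [exact: LI_mf Lf|exact: LI_mf Lh].
have E (F : pt -> R) : (fun x => 1 * F x) = F by apply/funext => x; rewrite mul1r.
have := @cauchy_schwarz _ _ mu2 (fun=> 1) (fun x => f x - h x) phi (measurable_cst _) (fun=> ler01) mfh (proj1 bphi).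
rewrite !E => /(_ I J) CS.
rewrite -ler_sqr ?nnegrE ?mulr_ge0 ?sqrtr_ge0// norm_sq.
rewrite exprMn sqr_sqrtr; last by apply: rint_ge0 => x; exact: sqr_ge0.
have -> : (fun x => f x * phi x - h x * phi x) = (fun x => (f x - h x) * phi x).
 by apply/funext => x; rewrite mulrBl.
apply: le_trans CS _; rewrite ler_wpM2r//; apply: rint_ge0 => x; exact: sqr_ge0.
Qed.

(** For a fixed test function both sides of the defining identity are continuous in [L^2], so weak
    gradients form a closed relation. *)
Lemma WG_limit u g1 g2 : LI u -> LI g1 -> LI g2 ->
 (forall e : R, 0 < e -> exists v h1 h2, [/\ WG v h1 h2,
   [L1 x, (u x - v x) ^+ 2] /\ [int x, (u x - v x) ^+ 2] <= e ^+ 2,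
   [L1 x, (g1 x - h1 x) ^+ 2] /\ [int x, (g1 x - h1 x) ^+ 2] <= e ^+ 2 &
   [L1 x, (g2 x - h2 x) ^+ 2] /\ [int x, (g2 x - h2 x) ^+ 2] <= e ^+ 2]) ->
 WG u g1 g2.
Proof.
move=> Lu L1 L2 H; split => // phi tphi; have [bp bd] := test_fun_bs tphi.
have main b g : LI g -> (forall e : R, 0 < e -> exists v h,
  [/\ LI v /\ LI h, [int x, v x * pd b phi x] = - [int x, h x * phi x],
   [L1 x, (u x - v x) ^+ 2] /\ [int x, (u x - v x) ^+ 2] <= e ^+ 2 &
   [L1 x, (g x - h x) ^+ 2] /\ [int x, (g x - h x) ^+ 2] <= e ^+ 2]) ->
  [int x, u x * pd b phi x] = - [int x, g x * phi x].
 move=> Lg Hb; apply/eqP; rewrite -subr_eq0 opprK -normr_le0; apply/ler_addgt0Pr => e e0.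
 set C := Num.sqrt ([int x, pd b phi x ^+ 2]) + Num.sqrt ([int x, phi x ^+ 2]).
 have C0 : 0 <= C by rewrite addr_ge0// sqrtr_ge0.
 have d0 : 0 < e / (C + 1) by rewrite divr_gt0//; lra.
 have [v [h [[Lv Lh] E [I1 r1] [I2 r2]]]] := Hb _ d0.
 have h1 := L2_test (ltW d0) Lu Lv (bd b) I1 r1.
 have h2 := L2_test (ltW d0) Lg Lh bp I2 r2.
 rewrite add0r; apply: le_trans (_ : e / (C + 1) * C <= _); last first.
  by rewrite mulrAC ler_pdivrMr ?ler_pM2l//; lra.
 rewrite /C mulrDr; apply: le_trans (lerD h1 h2); rewrite E.
 have tri (a d y : R) : `|a + d| <= `|a - - y| + `|d - y|.
  by rewrite (_ : a + d = (a - - y) + (d - y)) ?ler_normD//; ring.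
 exact: tri.
split; apply: main => // e e0; have [v [h1 [h2 [[Lv M1 M2 Z] A B C]]]] := H e e0;
 have [w1 w2] := Z _ tphi.
- by exists v, h1.
- by exists v, h2.
Qed.

End weak_gradients.

Lemma funD11 (f g : pt -> R) : (fun x => 1 * f x + 1 * g x) = f + g.
Proof. by apply/funext => x; rewrite !mul1r. Qed.

Lemma funB11 (f g : pt -> R) : (fun x => 1 * f x + -1 * g x) = f - g.
Proof. by apply/funext => x; rewrite mul1r mulN1r. Qed.

(** * Weighted [L^2] products *)

Section weighted_products.
Context d (T : measurableType d) (m : {measure set T -> \bar R}).
Implicit Types (w f g h : T -> R).

Lemma discriminant (a b c : R) : 0 <= a -> 0 <= c ->
 (forall t : R, 0 <= a + 2 * t * b + t ^+ 2 * c) -> b ^+ 2 <= a * c.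
Proof.
move=> a0 c0 P; have [c1|c1] := ltP 0 c.
 have := P (- (b / c)); rewrite (_ : _ + _ = a - b ^+ 2 / c); last by field; rewrite gt_eqF.
 by rewrite subr_ge0 ler_pdivrMr.
have cE : c = 0 by lra.
have [->|b0] := eqVneq b 0; first by rewrite expr0n/= mulr_ge0.
have := P (- (a + 1) / (2 * b)); rewrite cE.
rewrite (_ : _ + _ = - 1); first by rewrite lerNr oppr0 ler10.
by field.
Qed.

(** The weights [one], [V] and [LL] give all the quadratic terms that follow. *)
Definition F2 w f := mfun f /\ Int m (fun x => w x * f x ^+ 2).
Definition bl w f h : R := rint m (fun x => w x * (f x * h x)).

Variable w : T -> R.
Hypotheses (mw : mfun w) (w0 : forall x, 0 <= w x).

Lemma bl_Int f h : F2 w f -> F2 w h -> Int m (fun x => w x * (f x * h x)).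
Proof. by move=> [mf If] [mh Ih]; exact: Int_prod2. Qed.

Lemma bl_ge0 f : 0 <= bl w f f.
Proof. by apply: rint_ge0 => x; rewrite mulr_ge0// -expr2 sqr_ge0. Qed.

Lemma blC f h : bl w f h = bl w h f.
Proof. by apply: eq_rint => x; rewrite [f x * _]mulrC. Qed.

Lemma F2_lin (a b : R) f h : F2 w f -> F2 w h -> F2 w (fun x => a * f x + b * h x).
Proof.
move=> [mf If] [mh Ih].
have Z (c : R) g : F2 w g -> F2 w (fun x => c * g x).
 move=> [mg Ig]; split; first exact: measurable_funM.
 by apply: (eq_Int _ (Int_Z (c ^+ 2) Ig)) => x; rewrite exprMn; ring.
have [mf' If'] := Z a f (conj mf If); have [mh' Ih'] := Z b h (conj mh Ih).
by split; [exact: measurable_funD|exact: Int_sum2].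
Qed.

Lemma bl_lin (a b : R) f h g : F2 w f -> F2 w h -> F2 w g ->
 bl w g (fun x => a * f x + b * h x) = a * bl w g f + b * bl w g h.
Proof.
move=> Ff Fh Fg; have I1 := bl_Int Fg Ff; have I2 := bl_Int Fg Fh.
rewrite /bl -!rintZ// -rintD; do ?exact: Int_Z.
by apply: eq_rint => x; ring.
Qed.

Lemma bl_sq_lin (a b : R) f h : F2 w f -> F2 w h ->
 bl w (fun x => a * f x + b * h x) (fun x => a * f x + b * h x) =
 a ^+ 2 * bl w f f + 2 * a * b * bl w f h + b ^+ 2 * bl w h h.
Proof.
move=> Ff Fh; rewrite bl_lin//; last exact: F2_lin.
by rewrite !(blC _ f) !(blC _ h) !bl_lin// (blC h f); ring.
Qed.

Lemma bl_CS f h : F2 w f -> F2 w h -> bl w f h ^+ 2 <= bl w f f * bl w h h.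
Proof.
move=> Ff Fh; apply: discriminant; do ?exact: bl_ge0.
move=> t; have := bl_ge0 (fun x => 1 * f x + t * h x); rewrite bl_sq_lin//.
by rewrite expr1n !mul1r mulr1.
Qed.

End weighted_products.

(** The data in the form used from here on. The weak gradient of [V] has disappeared: it acts only
    through the finite differences of [s_dil], which [potential_dilation] provides. *)
Record setting := Setting {
 sV : pt -> R; sb : R; sp : R; sV0 : R; sbeta : R; sC : R; sk : R;
 sV0_gt0 : 0 < sV0;
 sV_ge : forall x, sV0 <= sV x;
 sV_cont : continuous sV;
 sV_sub : forall M : R, (mu2 [set x | sV x <= M]%R < +oo)%E;
 sb_gt0 : 0 < sb;
 sp_itv : 2 < sp < 4;
 sbeta_gt0 : 0 < sbeta; sC_gt0 : 0 < sC; sk_gt0 : 0 < sk;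
 s_dil : forall k x, 0 <= k -> k <= sk ->
  `|sV (dil (1 + k) x) - sV x| <= sC * k * sV x /\
  - (k * (sbeta + 2 * (1 + sC * k) * sV x)) <= sV (dil (1 + k) x) - sV x }.

Context (D : setting).
Local Notation V := (sV D).
Local Notation b := (sb D).
Local Notation p := (sp D).
Local Notation X := ((pt -> R) * (pt -> R) * (pt -> R))%type.

(** * The energy space and its norm *)

Section energy_space.
Implicit Types (U W Y Z : X) (f g h u : pt -> R).

Definition one : pt -> R := fun=> 1.
Local Notation bl0 := (bl mu2 one).
Local Notation blV := (bl mu2 V).
Local Notation blL := (bl mu2 LL).

Lemma measurable_V : mfun V.
Proof. by apply: continuous_measurable2; exact: sV_cont. Qed.

Lemma V_ge0 x : 0 <= V x.
Proof. by apply: le_trans (sV_ge D x); apply: ltW; exact: sV0_gt0. Qed.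

Lemma measurable_one : mfun one. Proof. exact: measurable_cst. Qed.
Lemma one_ge0 x : 0 <= one x. Proof. exact: ler01. Qed.

(** A weak gradient is determined only almost everywhere, so it is carried along with the function;
    the triples form a vector space on which every term is a plain expression. *)
Definition EE U := [/\ WG U.1.1 U.1.2 U.2, F2 mu2 one U.1.2, F2 mu2 one U.2,
 F2 mu2 V U.1.1 & F2 mu2 LL U.1.1].

Lemma F2_one u : F2 mu2 one u <-> mfun u /\ [L1 x, u x ^+ 2].
Proof. by rewrite /F2 /one; under eq_fun do rewrite mul1r. Qed.

Lemma bl_oneE f h : bl0 f h = [int x, f x * h x].
Proof. by apply: eq_rint => x; rewrite mul1r. Qed.

Lemma bl_sqE w f : bl mu2 w f f = [int x, w x * f x ^+ 2].
Proof. by []. Qed.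

Lemma EE_F2u U : EE U -> F2 mu2 one U.1.1.
Proof.
move=> [_ _ _ _ [mu Iu]]; split => //; apply: (Int_le Iu).
 by apply: measurable_funM; [exact: measurable_one|exact: measurable_funX].
move=> x; rewrite mul1r ger0_norm ?sqr_ge0// ler_peMl ?sqr_ge0//; exact: LL_ge1.
Qed.

Lemma EE_H1 U : EE U -> H1 U.1.1 U.1.2 U.2.
Proof.
move=> EU; have /F2_one[_ I0] := EE_F2u EU; have [W /F2_one[_ I1] /F2_one[_ I2] _ _] := EU.
by split.
Qed.

Lemma EE_lin (s t : R) U W : EE U -> EE W -> EE (s *: U + t *: W).
Proof.
move=> [G1 A1 B1 V1 L1] [G2 A2 B2 V2 L2]; split.
- exact: (WG_comb s t G1 G2).
- exact: F2_lin measurable_one one_ge0 _ _ _ _ A1 A2.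
- exact: F2_lin measurable_one one_ge0 _ _ _ _ B1 B2.
- exact: F2_lin measurable_V V_ge0 _ _ _ _ V1 V2.
- exact: F2_lin measurable_LL LL_ge0 _ _ _ _ L1 L2.
Qed.

Lemma EE_Z (s : R) U : EE U -> EE (s *: U).
Proof. by move=> EU; have := EE_lin s 0 EU EU; rewrite scale0r addr0. Qed.

Lemma EE_D U W : EE U -> EE W -> EE (U + W).
Proof. by move=> EU EW; have := EE_lin 1 1 EU EW; rewrite !scale1r. Qed.

Lemma EE_B U W : EE U -> EE W -> EE (U - W).
Proof. by move=> EU EW; have := EE_lin 1 (-1) EU EW; rewrite scale1r scaleN1r. Qed.

Lemma EE_0 : EE 0.
Proof.
have F w : mfun w -> F2 mu2 w (fun _ : pt => 0).
 move=> mw; split => //; apply: (eq_Int _ (Int_0 mu2)) => x.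
 by rewrite expr0n/= mulr0.
split; [exact: WG_cst|exact: F measurable_one|exact: F measurable_one|
 exact: F measurable_V|exact: F measurable_LL].
Qed.

(** Gradient, potential, mass and weighted mass, all squared. Since [LL] is [1 + lnorm] and [V] is
    bounded below, [nrm] is equivalent to the norm of [E]. *)
Definition AA U : R := bl0 U.1.2 U.1.2 + bl0 U.2 U.2.
Definition VV U : R := blV U.1.1 U.1.1.
Definition mm U : R := bl0 U.1.1 U.1.1.
Definition BL U : R := blL U.1.1 U.1.1.
Definition NN U : R := AA U + VV U + BL U.
Definition nrm U : R := Num.sqrt (NN U).
Definition ip U W : R := bl0 U.1.2 W.1.2 + bl0 U.2 W.2 + blV U.1.1 W.1.1 + blL U.1.1 W.1.1.

Lemma AA_ge0 U : 0 <= AA U. Proof. by rewrite addr_ge0 ?bl_ge0//; exact: one_ge0. Qed.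
Lemma VV_ge0 U : 0 <= VV U. Proof. by apply: bl_ge0; exact: V_ge0. Qed.
Lemma mm_ge0 U : 0 <= mm U. Proof. by apply: bl_ge0; exact: one_ge0. Qed.
Lemma BL_ge0 U : 0 <= BL U. Proof. by apply: bl_ge0; exact: LL_ge0. Qed.
Lemma NN_ge0 U : 0 <= NN U. Proof. exact: addr_ge0 (addr_ge0 (AA_ge0 U) (VV_ge0 U)) (BL_ge0 U). Qed.
Lemma nrm_ge0 U : 0 <= nrm U. Proof. exact: sqrtr_ge0. Qed.
Lemma nrm_sq U : nrm U ^+ 2 = NN U. Proof. by rewrite sqr_sqrtr// NN_ge0. Qed.

Lemma NN_lin (s t : R) U W : EE U -> EE W ->
 NN (s *: U + t *: W) = s ^+ 2 * NN U + 2 * s * t * ip U W + t ^+ 2 * NN W.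
Proof.
move=> [G1 A1 B1 V1 L1] [G2 A2 B2 V2 L2]; rewrite /NN /AA /VV /BL /ip.
have e1 := bl_sq_lin measurable_one one_ge0 s t A1 A2.
have e2 := bl_sq_lin measurable_one one_ge0 s t B1 B2.
have e3 := bl_sq_lin measurable_V V_ge0 s t V1 V2.
have e4 := bl_sq_lin measurable_LL LL_ge0 s t L1 L2.
rewrite [X in X + _ + _ + _ = _]e1 [X in _ + X + _ + _ = _]e2 [X in _ + _ + X + _ = _]e3 [X in _ + _ + _ + X = _]e4.
by ring.
Qed.

Lemma ip_CS U W : EE U -> EE W -> `|ip U W| <= nrm U * nrm W.
Proof.
move=> EU EW; rewrite -ler_sqr ?nnegrE ?mulr_ge0 ?nrm_ge0// norm_sq.
rewrite exprMn !nrm_sq; apply: discriminant; do ?exact: NN_ge0.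
by move=> t; have := NN_ge0 (1 *: U + t *: W); rewrite NN_lin// expr1n !mul1r mulr1.
Qed.

Lemma nrm_D U W : EE U -> EE W -> nrm (U + W) <= nrm U + nrm W.
Proof.
move=> EU EW; rewrite -ler_sqr ?nnegrE ?addr_ge0 ?nrm_ge0// nrm_sq.
have := NN_lin 1 1 EU EW; rewrite !scale1r => ->.
have := le_trans (ler_norm _) (ip_CS EU EW); rewrite -!nrm_sq.
move: (nrm U) (nrm W) (ip U W) => x y z; nra.
Qed.

Lemma nrm_Z (s : R) U : EE U -> nrm (s *: U) = `|s| * nrm U.
Proof.
move=> EU; have := NN_lin s 0 EU EU; rewrite scale0r addr0 mulr0 expr0n/= !mul0r !addr0 => e.
by rewrite /nrm e sqrtrM ?sqr_ge0// sqrtr_sqr.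
Qed.

Lemma mm_le U : EE U -> [/\ mm U <= BL U, sV0 D * mm U <= VV U & [L1 x, U.1.1 x ^+ 2]].
Proof.
move=> EU; have Fu := EE_F2u EU; have /F2_one[mu I0] := Fu; have [_ _ _ [_ IV] [_ IL]] := EU.
split => //.
 rewrite /mm /BL !bl_sqE; apply: rint_le => //; first by case: Fu.
 by move=> x; rewrite ler_wpM2r ?sqr_ge0//; exact: LL_ge1.
rewrite /mm /VV bl_oneE !bl_sqE -rintZ//; apply: rint_le => //; first exact: Int_Z.
by move=> x; rewrite ler_wpM2r ?sqr_ge0//; exact: sV_ge.
Qed.

Definition S4 U : R := [int x, U.1.1 x ^+ 4].

Lemma S4_ge0 U : 0 <= S4 U. Proof. by apply: rint_ge0 => x; rewrite exprn_even_ge0. Qed.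

Lemma S4_le U : EE U -> [L1 x, U.1.1 x ^+ 4] /\ S4 U <= 16 * mm U * AA U.
Proof.
move=> EU; have [I4 h] := ladyzhenskaya (EE_H1 EU); split => //; apply: le_trans h _.
have [_ I1 I2 _] := EE_H1 EU; have [_ _ J1 J2] := EE_H1 EU.
apply: le_eq; rewrite /mm /AA !bl_oneE /grad2 -rintD//.
Qed.

Lemma S4_NN U : EE U -> S4 U <= 16 * NN U ^+ 2.
Proof.
move=> EU; have [_ h] := S4_le EU; apply: le_trans h _.
have [h1 _ _] := mm_le EU.
rewrite -mulrA ler_pM2l// expr2 /NN; have := AA_ge0 U; have := VV_ge0 U; have := mm_ge0 U.
move: (mm U) (AA U) (VV U) (BL U) h1 => m A v B; nra.
Qed.

Lemma measurable_u U : EE U -> mfun U.1.1.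
Proof. by move=> /EE_F2u[]. Qed.

(** Cauchy-Schwarz with weight [LL] gives the weighted [L^1] bound, and without weight, for the
    squares, the [L^2] bound. *)
Lemma dens_uw U W : EE U -> EE W -> [/\ dens (fun x => U.1.1 x * W.1.1 x),
 nL (fun x => U.1.1 x * W.1.1 x) ^+ 2 <= BL U * BL W &
 n2 (fun x => U.1.1 x * W.1.1 x) ^+ 2 <= S4 U * S4 W].
Proof.
move=> EU EW; have mu := measurable_u EU; have mw := measurable_u EW.
have [_ _ _ _ [_ LU]] := EU; have [_ _ _ _ [_ LW]] := EW.
have [I4u _] := S4_le EU; have [I4w _] := S4_le EW.
have LUabs (Y : X) : EE Y -> F2 mu2 LL (fun x => `|Y.1.1 x|).
 move=> EY; have [_ _ _ _ [mY LY]] := EY; split; first exact: measurableT_comp.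
 by apply: (eq_Int _ LY) => x; rewrite norm_sq.
have FsqE (Y : X) : EE Y -> F2 mu2 one (fun x => Y.1.1 x ^+ 2).
 move=> EY; apply/F2_one; split; first by apply: measurable_funX; exact: measurable_u.
 by have [I _] := S4_le EY; apply: (eq_Int _ I) => x; rewrite -exprM.
have e1 : (fun x => LL x * `|U.1.1 x * W.1.1 x|) = (fun x => LL x * (`|U.1.1 x| * `|W.1.1 x|)).
 by apply/funext => x; rewrite normrM.
have e2 : (fun x => (U.1.1 x * W.1.1 x) ^+ 2) = (fun x => one x * (U.1.1 x ^+ 2 * W.1.1 x ^+ 2)).
 by apply/funext => x; rewrite exprMn mul1r.
split.
- split; first exact: measurable_funM.
  by rewrite e1; apply: bl_Int; do ?[exact: measurable_LL|exact: LL_ge0|exact: LUabs].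
 by rewrite e2; apply: bl_Int; do ?[exact: measurable_one|exact: one_ge0|exact: FsqE].
- rewrite /nL e1; have := bl_CS measurable_LL LL_ge0 (LUabs _ EU) (LUabs _ EW).
 move=> /le_trans; apply; rewrite /BL !bl_sqE.
 have e (Y : X) : [int x, LL x * `|Y.1.1 x| ^+ 2] = [int x, LL x * Y.1.1 x ^+ 2].
  by apply: eq_rint => x; rewrite norm_sq.
 by rewrite !e.
- rewrite /n2 e2; have := bl_CS measurable_one one_ge0 (FsqE _ EU) (FsqE _ EW).
 move=> /le_trans; apply; rewrite !bl_oneE /S4.
 have e (Y : X) : [int x, Y.1.1 x ^+ 2 * Y.1.1 x ^+ 2] = [int x, Y.1.1 x ^+ 4].
  by apply: eq_rint => x; rewrite -exprD.
 by rewrite !e.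
Qed.

(** The [1] comes from [K1]; for [K2] each product contributes the factor [4] of [n2_nrm], whence
    [16 * kap]. *)
Definition CK : R := 1 + 16 * kap.

Lemma CK_ge1 : 1 <= CK. Proof. by rewrite lerDl mulr_ge0// kap_ge0. Qed.

Lemma nrm_BL U : BL U <= nrm U ^+ 2.
Proof. by rewrite nrm_sq lerDr addr_ge0 ?AA_ge0 ?VV_ge0. Qed.

Lemma sqr_le (a c : R) : 0 <= c -> a ^+ 2 <= c ^+ 2 -> a <= c.
Proof.
move=> c0 h; have [a0|a0] := leP 0 a; first by rewrite -ler_sqr.
exact: le_trans (ltW a0) c0.
Qed.

Lemma nL_nrm U W : EE U -> EE W -> nL (fun x => U.1.1 x * W.1.1 x) <= nrm U * nrm W.
Proof.
move=> EU EW; have [_ h _] := dens_uw EU EW; apply: sqr_le; first by rewrite mulr_ge0 ?nrm_ge0.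
by rewrite exprMn (le_trans h)// ler_pM ?BL_ge0 ?nrm_BL.
Qed.

Lemma n2_nrm U W : EE U -> EE W -> n2 (fun x => U.1.1 x * W.1.1 x) <= (4 * (nrm U * nrm W)) ^+ 2.
Proof.
move=> EU EW; have [_ _ h] := dens_uw EU EW; apply: sqr_le; first exact: sqr_ge0.
apply: le_trans h _; have h1 := S4_NN EU; have h2 := S4_NN EW.
rewrite (_ : _ ^+ 2 = (16 * NN U ^+ 2) * (16 * NN W ^+ 2)); last by rewrite -!nrm_sq; ring.
by rewrite ler_pM ?S4_ge0.
Qed.

Lemma q2_bound f h (x y : R) : dens f -> dens h -> 0 <= x -> 0 <= y -> n2 f <= x ^+ 2 -> n2 h <= y ^+ 2 ->
 `|qf K2 f h| <= kap * (x * y).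
Proof.
move=> df dh x0 y0 fx hy; have [_ h2] := K2_form df dh.
have k0 := kap_ge0.
rewrite -ler_sqr ?nnegrE ?mulr_ge0// norm_sq (le_trans h2)//.
by rewrite exprMn ler_wpM2l ?sqr_ge0// exprMn ler_pM ?n2_ge0.
Qed.

Lemma q_bound U W Y Z : EE U -> EE W -> EE Y -> EE Z ->
 `|q (fun x => U.1.1 x * W.1.1 x) (fun x => Y.1.1 x * Z.1.1 x)| <=
  CK * (nrm U * nrm W * (nrm Y * nrm Z)).
Proof.
move=> EU EW EY EZ; have [d1 _ _] := dens_uw EU EW; have [d2 _ _] := dens_uw EY EZ.
have [_ ->] := q_Int d1 d2; have [_ h1] := K1_form d1 d2.
have x0 : 0 <= 4 * (nrm U * nrm W) by rewrite !mulr_ge0 ?nrm_ge0.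
have y0 : 0 <= 4 * (nrm Y * nrm Z) by rewrite !mulr_ge0 ?nrm_ge0.
have h2 := q2_bound d1 d2 x0 y0 (n2_nrm EU EW) (n2_nrm EY EZ).
apply: le_trans (ler_normB _ _) _; rewrite /CK mulrDl mul1r; apply: lerD.
 by apply: le_trans h1 _; rewrite ler_pM ?nL_ge0 ?nL_nrm.
by apply: le_trans h2 _; apply: le_eq; ring.
Qed.

(* [\int (1 + a ^ 2) |v| |w|] *)
Lemma quad_bound U Y Z : EE U -> EE Y -> EE Z ->
 [L1 x, (1 + U.1.1 x ^+ 2) * (`|Y.1.1 x| * `|Z.1.1 x|)] /\
 [int x, (1 + U.1.1 x ^+ 2) * (`|Y.1.1 x| * `|Z.1.1 x|)] <=
  (1 + 16 * NN U) * (nrm Y * nrm Z).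
Proof.
move=> EU EY EZ; have mu := measurable_u EU; have my := measurable_u EY; have mz := measurable_u EZ.
have Fabs (W : X) : EE W -> F2 mu2 one (fun x => `|W.1.1 x|).
 move=> EW; have /F2_one[mW IW] := EE_F2u EW; apply/F2_one; split; first exact: measurableT_comp.
 by apply: (eq_Int _ IW) => x; rewrite norm_sq.
have Fsq (W : X) : EE W -> F2 mu2 one (fun x => W.1.1 x ^+ 2).
 move=> EW; apply/F2_one; split; first by apply: measurable_funX; exact: measurable_u.
 by have [I _] := S4_le EW; apply: (eq_Int _ I) => x; rewrite -exprM.
have [[mYZ _ I2] _ _] := dens_uw EY EZ.
have Fyz : F2 mu2 one (fun x => `|Y.1.1 x| * `|Z.1.1 x|).
 apply/F2_one; split; first by apply: measurable_funM; exact: measurableT_comp.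
 by apply: (eq_Int _ I2) => x; rewrite -normrM norm_sq.
have J1 := bl_Int measurable_one one_ge0 (Fabs _ EY) (Fabs _ EZ).
have J2 := bl_Int measurable_one one_ge0 (Fsq _ EU) Fyz.
have E : (fun x => (1 + U.1.1 x ^+ 2) * (`|Y.1.1 x| * `|Z.1.1 x|)) = (fun x =>
  one x * (`|Y.1.1 x| * `|Z.1.1 x|) + one x * (U.1.1 x ^+ 2 * (`|Y.1.1 x| * `|Z.1.1 x|))).
 by apply/funext => x; rewrite /one; ring.
rewrite E; split; first exact: Int_D.
rewrite rintD// mulrDl mul1r; apply: lerD.
 apply: sqr_le; first by rewrite mulr_ge0 ?nrm_ge0.
 have := bl_CS measurable_one one_ge0 (Fabs _ EY) (Fabs _ EZ).
 move=> /le_trans; apply; rewrite exprMn !nrm_sq.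
 have e (W : X) : EE W -> bl0 (fun x => `|W.1.1 x|) (fun x => `|W.1.1 x|) <= NN W.
  move=> EW; have [h _ _] := mm_le EW; apply: le_trans (_ : mm W <= _).
   by rewrite /mm !bl_oneE; apply: le_eq; apply: eq_rint => x; rewrite -!expr2 norm_sq.
  by apply: le_trans h _; rewrite /NN lerDr addr_ge0 ?AA_ge0 ?VV_ge0.
 by rewrite ler_pM ?e// bl_ge0//; exact: one_ge0.
apply: sqr_le; first by rewrite !mulr_ge0 ?nrm_ge0 ?NN_ge0.
have := bl_CS measurable_one one_ge0 (Fsq _ EU) Fyz.
move=> /le_trans; apply.
have -> : bl0 (fun x => U.1.1 x ^+ 2) (fun x => U.1.1 x ^+ 2) = S4 U.
 by rewrite bl_oneE; apply: eq_rint => x; rewrite -exprD.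
have -> : bl0 (fun x => `|Y.1.1 x| * `|Z.1.1 x|) (fun x => `|Y.1.1 x| * `|Z.1.1 x|) = n2 (fun x => Y.1.1 x * Z.1.1 x).
 by rewrite bl_oneE; apply: eq_rint => x; rewrite -expr2 -normrM norm_sq.
rewrite (_ : _ ^+ 2 = (16 * NN U ^+ 2) * (4 * (nrm Y * nrm Z)) ^+ 2); last by ring.
by rewrite ler_pM ?S4_ge0 ?n2_ge0 ?S4_NN ?n2_nrm.
Qed.

End energy_space.

Local Notation bl0 := (bl mu2 one).

(** * Triangle inequalities for sums of error terms *)

Section arithmetic.
Implicit Types (a c d e : R).

Lemma norm_add3 a c d (A C E : R) : `|a| <= A -> `|c| <= C -> `|d| <= E -> `|a + c - d| <= A + C + E.
Proof.
move=> h1 h2 h3; apply: le_trans (ler_normB _ _) _; apply: lerD => //.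
by apply: le_trans (ler_normD _ _) _; exact: lerD.
Qed.

Lemma norm_add4 a c d e (B : R) : `|a| <= B -> `|c| <= B -> `|d| <= B -> `|e| <= B ->
 `|a + c + d + e| <= 4 * B.
Proof.
move=> h1 h2 h3 h4; have -> : 4 * B = B + B + B + B by ring.
do 3!(apply: le_trans (ler_normD _ _) _; apply: lerD => //).
Qed.

Lemma norm_quartic1 (q1 q2 q3 q4 B : R) : `|q1| <= B -> `|q2| <= B -> `|q3| <= B -> `|q4| <= B ->
 `|4 * q1 + 2 * q2 + 4 * q3 + q4| <= 11 * B.
Proof.
rewrite !ler_norml => /andP[a1 a2] /andP[a3 a4] /andP[a5 a6] /andP[a7 a8].
by apply/andP; split; lra.
Qed.

Lemma norm_quartic2 (q1 q2 q3 q4 q5 B : R) : `|q1| <= B -> `|q2| <= B -> `|q3| <= B -> `|q4| <= B ->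
 `|q5| <= B -> `|2 * q1 + q2 + q3 + 2 * q4 + q5| <= 7 * B.
Proof.
rewrite !ler_norml => /andP[a1 a2] /andP[a3 a4] /andP[a5 a6] /andP[a7 a8] /andP[a9 a10].
by apply/andP; split; lra.
Qed.

Lemma le_sum4 (a1 a2 a3 a4 : R) : 0 <= a1 -> 0 <= a2 -> 0 <= a3 -> 0 <= a4 ->
 [/\ a1 <= a1 + a2 + a3 + a4, a2 <= a1 + a2 + a3 + a4, a3 <= a1 + a2 + a3 + a4 & a4 <= a1 + a2 + a3 + a4].
Proof. by move=> *; split; lra. Qed.

End arithmetic.

(** * The functional, its derivative, and local bounds *)

Section functional.
Implicit Types (U W Y Z : X) (f g h u : pt -> R) (r mu s t : R).

Definition pr U W : pt -> R := fun x => U.1.1 x * W.1.1 x.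
(** The four-linear form behind [N0]: its multilinearity and symmetries turn the quartic term into a
    polynomial along lines. *)
Definition Q4 U W Y Z : R := q (pr U W) (pr Y Z).

Lemma n2_diag U : n2 (pr U U) = S4 U.
Proof. by apply: eq_rint => x; rewrite /pr; ring. Qed.

Lemma dens_pr U W : EE U -> EE W -> dens (pr U W).
Proof. by move=> EU EW; have [] := dens_uw EU EW. Qed.

Lemma Q4_bound U W Y Z : EE U -> EE W -> EE Y -> EE Z ->
 `|Q4 U W Y Z| <= CK * (nrm U * nrm W * (nrm Y * nrm Z)).
Proof. exact: q_bound. Qed.

Lemma prC U W : pr U W = pr W U.
Proof. by apply/funext => x; rewrite /pr mulrC. Qed.

Lemma Q4C U W Y Z : EE U -> EE W -> EE Y -> EE Z -> Q4 U W Y Z = Q4 Y Z U W.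
Proof. by move=> EU EW EY EZ; rewrite /Q4 qC//; exact: dens_pr. Qed.

Lemma Q4_lin s t U U' W Y Z : EE U -> EE U' -> EE W -> EE Y -> EE Z ->
 Q4 (s *: U + t *: U') W Y Z = s * Q4 U W Y Z + t * Q4 U' W Y Z.
Proof.
move=> EU EU' EW EY EZ; rewrite /Q4.
have d1 := dens_pr EU EW; have d2 := dens_pr EU' EW; have d3 := dens_pr EY EZ.
rewrite -qZl// -qZl// -qDl//; do ?exact: dens_Z.
congr (q _ _); apply/funext => x; rewrite /pr /=.
rewrite -[(_ *: _ + _ *: _) x]/(s * U.1.1 x + t * U'.1.1 x); ring.
Qed.

Lemma Q4D1 U U' W Y Z : EE U -> EE U' -> EE W -> EE Y -> EE Z ->
 Q4 (U + U') W Y Z = Q4 U W Y Z + Q4 U' W Y Z.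
Proof. by move=> *; have := @Q4_lin 1 1 U U' W Y Z; rewrite !scale1r !mul1r; apply. Qed.

Lemma Q4D2 U U' W Y Z : EE U -> EE U' -> EE W -> EE Y -> EE Z ->
 Q4 W (U + U') Y Z = Q4 W U Y Z + Q4 W U' Y Z.
Proof. by move=> *; rewrite /Q4 !(prC W); exact: Q4D1. Qed.

Lemma Q4D3 U U' W Y Z : EE U -> EE U' -> EE W -> EE Y -> EE Z ->
 Q4 Y Z (U + U') W = Q4 Y Z U W + Q4 Y Z U' W.
Proof. by move=> EU EU' EW EY EZ; rewrite !(Q4C EY EZ)//; [exact: Q4D1|exact: EE_D]. Qed.

Lemma Q4D4 U U' W Y Z : EE U -> EE U' -> EE W -> EE Y -> EE Z ->
 Q4 Y Z W (U + U') = Q4 Y Z W U + Q4 Y Z W U'.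
Proof. by move=> *; rewrite /Q4 !(prC W); exact: Q4D3. Qed.

Lemma p2 : 2 < p. Proof. by case/andP: (sp_itv D). Qed.
Lemma p4 : p < 4. Proof. by case/andP: (sp_itv D). Qed.
Lemma b0 : 0 < b. Proof. exact: sb_gt0. Qed.

Lemma pow2_le (t : R) : 0 <= t -> t `^ (p - 2) <= 1 + t ^+ 2.
Proof.
move=> t0; have := powR_interp (sp_itv D) (@ltr01 R) t0.
by rewrite !powR1 mul1r.
Qed.

Lemma pow_sum_le (a c : R) : (`|a| + `|c|) `^ (p - 2) <= 2 * (1 + a ^+ 2) + 2 * (1 + c ^+ 2).
Proof.
apply: le_trans (pow2_le _) _; first by rewrite addr_ge0.
rewrite -[a ^+ 2]norm_sq -[c ^+ 2]norm_sq.
by have := sqr_ge0 (`|a| - `|c|); move: `|a| `|c| => x y; nra.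
Qed.

Lemma measurable_powR_norm f (s : R) : mfun f -> mfun (fun x => `|f x| `^ s).
Proof.
move=> mf; apply: (measurableT_comp (measurable_powR s) (g := fun x => `|f x|)).
exact: measurableT_comp.
Qed.

Lemma measurable_spow f : mfun f -> mfun (fun x => spow p (f x)).
Proof. by move=> mf; apply: measurable_funM => //; exact: measurable_powR_norm. Qed.

Lemma Int_quad U Y Z : EE U -> EE Y -> EE Z ->
 [L1 x, (1 + U.1.1 x ^+ 2) * (`|Y.1.1 x| * `|Z.1.1 x|)].
Proof. by move=> EU EY EZ; have [] := quad_bound EU EY EZ. Qed.

Lemma Int_pow U : EE U -> [L1 x, `|U.1.1 x| `^ p].
Proof.
move=> EU; apply: (Int_le (Int_quad EU EU EU)).
 by apply: measurable_powR_norm; exact: measurable_u EU.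
move=> x; rewrite ger0_norm ?powR_ge0// -(powR_sub22 p2)//.
rewrite -expr2; apply: ler_wpM2r; first exact: sqr_ge0.
by apply: le_trans (pow2_le _) _ => //; rewrite norm_sq.
Qed.

Lemma spow_le (t : R) : `|spow p t| <= (1 + t ^+ 2) * `|t|.
Proof.
rewrite /spow normrM ger0_norm ?powR_ge0// ler_wpM2r//.
by apply: le_trans (pow2_le _) _ => //; rewrite norm_sq.
Qed.

Lemma spow_term U W : EE U -> EE W -> [L1 x, spow p (U.1.1 x) * W.1.1 x] /\
 `|[int x, spow p (U.1.1 x) * W.1.1 x]| <= (1 + 16 * NN U) * (nrm U * nrm W).
Proof.
move=> EU EW; have [I h] := quad_bound EU EU EW.
have mf : mfun (fun x => spow p (U.1.1 x) * W.1.1 x).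
 by apply: measurable_funM; [apply: measurable_spow; exact: measurable_u EU|exact: measurable_u EW].
have le x : `|spow p (U.1.1 x) * W.1.1 x| <= (1 + U.1.1 x ^+ 2) * (`|U.1.1 x| * `|W.1.1 x|).
 by rewrite normrM mulrA ler_wpM2r//; exact: spow_le.
split; first exact: (Int_le I mf le).
by apply: le_trans (rint_bound I mf le) h.
Qed.

Definition PP U : R := [int x, `|U.1.1 x| `^ p].
(** [Ifun] on triples: the coefficient is [4^-1 * (2 * pi)^-1]. The perturbed functional is [Jm mu],
    with derivative [dJm mu]. *)
Definition JJ U : R := 2^-1 * (AA U + VV U) + (8 * pi)^-1 * Q4 U U U U - b / p * PP U.
Definition BB U : R := 2^-1 * BL U.
Definition DJ U W : R := bl0 U.1.2 W.1.2 + bl0 U.2 W.2 + bl mu2 V U.1.1 W.1.1 +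
 (2 * pi)^-1 * Q4 U U U W - b * [int x, spow p (U.1.1 x) * W.1.1 x].
Definition DB U W : R := bl mu2 LL U.1.1 W.1.1.
Definition Jm mu U := JJ U + mu * BB U.
Definition dJm mu U W := DJ U W + mu * DB U W.

Lemma DJ_lin U W W' s t : EE U -> EE W -> EE W' -> DJ U (s *: W + t *: W') = s * DJ U W + t * DJ U W'.
Proof.
move=> EU EW EW'; have [G1 A1 B1 V1 L1] := EU; have [G2 A2 B2 V2 L2] := EW; have [G3 A3 B3 V3 L3] := EW'.
rewrite /DJ.
have e1 := bl_lin measurable_one one_ge0 s t A2 A3 A1.
have e2 := bl_lin measurable_one one_ge0 s t B2 B3 B1.
have e3 := bl_lin measurable_V V_ge0 s t V2 V3 V1.
rewrite [X in X + _ + _ + _ - _ = _]e1 [X in _ + X + _ + _ - _ = _]e2 [X in _ + _ + X + _ - _ = _]e3.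
have -> : Q4 U U U (s *: W + t *: W') = s * Q4 U U U W + t * Q4 U U U W'.
 have EC := EE_lin s t EW EW'.
 rewrite (Q4C EU EU EU EC) {1}/Q4 prC -/(Q4 (s *: W + t *: W') U U U) Q4_lin//.
 by rewrite /Q4 !(prC _ U) -/(Q4 U W U U) -/(Q4 U W' U U) !(Q4C EU _ EU EU).
have [I1 _] := spow_term EU EW; have [I2 _] := spow_term EU EW'.
have -> : [int x, spow p (U.1.1 x) * (s *: W + t *: W').1.1 x] =
  s * [int x, spow p (U.1.1 x) * W.1.1 x] + t * [int x, spow p (U.1.1 x) * W'.1.1 x].
 rewrite -!rintZ// -rintD; do ?exact: Int_Z.
 apply: eq_rint => x; rewrite -[(_ *: _ + _ *: _).1.1 x]/(s * W.1.1 x + t * W'.1.1 x).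
 by move: (spow p _) => a; ring.
by ring.
Qed.

Lemma dJm_lin mu U W W' s t : EE U -> EE W -> EE W' ->
 dJm mu U (s *: W + t *: W') = s * dJm mu U W + t * dJm mu U W'.
Proof.
move=> EU EW EW'; rewrite /dJm DJ_lin//.
have [_ _ _ _ L1] := EU; have [_ _ _ _ L2] := EW; have [_ _ _ _ L3] := EW'.
have e := bl_lin measurable_LL LL_ge0 s t L2 L3 L1.
rewrite /DB [X in _ + mu * X = _]e; ring.
Qed.

Lemma energy_parts U : [/\ 0 <= bl0 U.1.2 U.1.2, 0 <= bl0 U.2 U.2, 0 <= VV U & 0 <= BL U] /\
 [/\ bl0 U.1.2 U.1.2 <= NN U, bl0 U.2 U.2 <= NN U, VV U <= NN U & BL U <= NN U].
Proof.
have P : [/\ 0 <= bl0 U.1.2 U.1.2, 0 <= bl0 U.2 U.2, 0 <= VV U & 0 <= BL U].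
 by split; [exact: bl_ge0 one_ge0 _|exact: bl_ge0 one_ge0 _|exact: VV_ge0|exact: BL_ge0].
by split=> //; have [y1 y2 y3 y4] := P; exact: le_sum4.
Qed.

Lemma bl_nrm U W : EE U -> EE W -> [/\ `|bl0 U.1.2 W.1.2| <= nrm U * nrm W,
 `|bl0 U.2 W.2| <= nrm U * nrm W, `|bl mu2 V U.1.1 W.1.1| <= nrm U * nrm W &
 `|bl mu2 LL U.1.1 W.1.1| <= nrm U * nrm W].
Proof.
move=> EU EW.
have [G1 A1 B1 V1 L1] := EU; have [G2 A2 B2 V2 L2] := EW.
have H (x c d : R) : x ^+ 2 <= c * d -> 0 <= c -> 0 <= d -> c <= NN U -> d <= NN W -> `|x| <= nrm U * nrm W.
 move=> h c0 d0 cU dW; apply: sqr_le; first by rewrite mulr_ge0 ?nrm_ge0.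
 by rewrite norm_sq exprMn !nrm_sq (le_trans h)// ler_pM.
have [[u1 u2 u3 u4] [ul1 ul2 ul3 ul4]] := energy_parts U; have [[w1 w2 w3 w4] [wl1 wl2 wl3 wl4]] := energy_parts W.
split.
- apply: (H _ _ _ (bl_CS measurable_one one_ge0 A1 A2)) => //.
- apply: (H _ _ _ (bl_CS measurable_one one_ge0 B1 B2)) => //.
- apply: (H _ _ _ (bl_CS measurable_V V_ge0 V1 V2)) => //.
- apply: (H _ _ _ (bl_CS measurable_LL LL_ge0 L1 L2)) => //.
Qed.

(** [powR_taylor] pointwise, with the power [p - 2] replaced by a quadratic polynomial, so that
    [quad_bound] integrates the remainder. *)
Lemma pow_taylor_bound U W : EE U -> EE W ->
 `|PP (U + W) - PP U - p * [int x, spow p (U.1.1 x) * W.1.1 x]| <=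
  p * (p - 1) * (2 * (1 + 16 * NN U) + 2 * (1 + 16 * NN (U + W))) * nrm W ^+ 2.
Proof.
move=> EU EW; have EUW := EE_D EU EW.
have [I1 r1] := quad_bound EU EW EW; have [I2 r2] := quad_bound EUW EW EW.
have J1 := Int_pow EU; have J2 := Int_pow EUW; have [J3 _] := spow_term EU EW.
have p20 := p2; have pp : 0 <= p * (p - 1) by rewrite mulr_ge0//; alra.
rewrite /PP -rintZ// -!rintB//; do ?[exact: Int_B|exact: Int_Z].
pose G x := p * (p - 1) * (2 * ((1 + U.1.1 x ^+ 2) * (`|W.1.1 x| * `|W.1.1 x|)) +
  2 * ((1 + (U + W).1.1 x ^+ 2) * (`|W.1.1 x| * `|W.1.1 x|))).
have IG : Int mu2 G by apply: Int_Z; apply: Int_D; exact: Int_Z.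
apply: le_trans (rint_bound (g := G) IG _ _) _.
- exact: (Int_mf (Int_B (Int_B J2 J1) (Int_Z p J3))).
- move=> x; have := powR_taylor (U.1.1 x) ((U + W).1.1 x) p20.
 rewrite -[(U + W).1.1 x]/(U.1.1 x + W.1.1 x) [U.1.1 x + W.1.1 x - U.1.1 x]addrC addKr.
 rewrite -[p * _ * W.1.1 x]mulrA => /le_trans; apply.
 rewrite -mulrA /G; apply: ler_wpM2l => //.
 rewrite -normrM -expr2 [`|_ ^+ 2|]ger0_norm ?sqr_ge0//.
 have w20 := sqr_ge0 (W.1.1 x); move: (W.1.1 x ^+ 2) w20 => w2 w20.
 rewrite [2 * (_ * w2)]mulrA [2 * ((1 + (U + W).1.1 x ^+ 2) * w2)]mulrA -mulrDl.
 by apply: ler_wpM2r => //; exact: pow_sum_le.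
rewrite /G rintZ; last by apply: Int_D; exact: Int_Z.
rewrite rintD; do ?exact: Int_Z.
rewrite !rintZ// -[leRHS]mulrA; apply: ler_wpM2l => //; rewrite [leRHS]mulrDl expr2.
by apply: lerD; rewrite -[leRHS]mulrA ler_pM2l.
Qed.

Lemma pow_lip_bound U W Y : EE U -> EE W -> EE Y ->
 `|[int x, spow p ((U + W).1.1 x) * Y.1.1 x] - [int x, spow p (U.1.1 x) * Y.1.1 x]| <=
  (p - 1) * (2 * (1 + 16 * NN (U + W)) + 2 * (1 + 16 * NN U)) * (nrm W * nrm Y).
Proof.
move=> EU EW EY; have EUW := EE_D EU EW.
have [I1 r1] := quad_bound EU EW EY; have [I2 r2] := quad_bound EUW EW EY.
have [J1 _] := spow_term EU EY; have [J2 _] := spow_term EUW EY.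
have p20 := p2; have pp : 0 <= p - 1 by alra.
rewrite -rintB//.
pose G x := (p - 1) * (2 * ((1 + (U + W).1.1 x ^+ 2) * (`|W.1.1 x| * `|Y.1.1 x|)) +
  2 * ((1 + U.1.1 x ^+ 2) * (`|W.1.1 x| * `|Y.1.1 x|))).
have IG : Int mu2 G by apply: Int_Z; apply: Int_D; exact: Int_Z.
apply: le_trans (rint_bound (g := G) IG _ _) _.
- exact: (Int_mf (Int_B J2 J1)).
- move=> x; have := spow_lip ((U + W).1.1 x) (U.1.1 x) p20.
 rewrite -[(U + W).1.1 x - U.1.1 x]/(U.1.1 x + W.1.1 x - U.1.1 x) [U.1.1 x + W.1.1 x - U.1.1 x]addrC addKr => h.
 rewrite -mulrBl normrM; apply: le_trans (ler_wpM2r (normr_ge0 _) h) _.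
 rewrite -!mulrA /G; apply: ler_wpM2l => //.
 rewrite !mulrA -mulrDl -mulrDl -!mulrA ler_wpM2r ?mulr_ge0//.
 exact: pow_sum_le.
rewrite /G rintZ; last by apply: Int_D; exact: Int_Z.
rewrite rintD; do ?exact: Int_Z.
rewrite !rintZ// -[leRHS]mulrA; apply: ler_wpM2l => //; rewrite [leRHS]mulrDl.
by apply: lerD; rewrite -[leRHS]mulrA ler_pM2l.
Qed.

Lemma NN_le_r U r : nrm U <= r -> 0 <= r -> NN U <= r ^+ 2.
Proof. by move=> h r0; rewrite -nrm_sq ler_sqr ?nnegrE ?nrm_ge0. Qed.

Definition c2 : R := (2 * pi)^-1.

Lemma c2_gt0 : 0 < c2. Proof. by rewrite invr_gt0 mulr_gt0// pi_gt0. Qed.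

Lemma c8E : (8 * pi)^-1 = c2 / 4 :> R.
Proof. by rewrite /c2; have := @pi_gt0 R; move: (@pi R) => t t0; field; rewrite gt_eqF. Qed.

(** One constant on the ball of radius [r] for the second order remainder, the Lipschitz bound and
    the bound of the derivative. Its three summands are the quadratic, quartic and power
    contributions; [CS_parts] separates the uses. *)
Definition CS r : R := 4 * (1 + r) + c2 * CK * (7 * r ^+ 2 + r ^+ 3) +
 b * 3 * ((4 + 160 * r ^+ 2) + (1 + 16 * r ^+ 2) * r).

(** The quadratic and quartic terms are expanded exactly; only the power term leaves a genuine
    Taylor remainder. *)
Lemma sq_lin1 U W : EE U -> EE W -> JJ (U + W) - JJ U - DJ U W =
 2^-1 * (AA W + VV W) + (8 * pi)^-1 * (4 * Q4 U W U W + 2 * Q4 U U W W + 4 * Q4 U W W W + Q4 W W W W)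
 - b / p * (PP (U + W) - PP U - p * [int x, spow p (U.1.1 x) * W.1.1 x]).
Proof.
move=> EU EW; have EUW := EE_D EU EW.
have [G1 A1 B1 V1 L1] := EU; have [G2 A2 B2 V2 L2] := EW.
have e1 := bl_sq_lin measurable_one one_ge0 1 1 A1 A2.
have e2 := bl_sq_lin measurable_one one_ge0 1 1 B1 B2.
have e3 := bl_sq_lin measurable_V V_ge0 1 1 V1 V2.
rewrite !funD11 in e1 e2 e3.
have eq4 : Q4 (U + W) (U + W) (U + W) (U + W) = Q4 U U U U + 4 * Q4 U U U W + 4 * Q4 U W U W +
  2 * Q4 U U W W + 4 * Q4 U W W W + Q4 W W W W.
 rewrite Q4D1// !Q4D2// !Q4D3// !Q4D4//; do ?exact: EE_D.
 have s1 Y Z Y' Z' : Q4 Y Z Y' Z' = Q4 Z Y Y' Z' by rewrite /Q4 (prC Y).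
 have s2 Y Z Y' Z' : Q4 Y Z Y' Z' = Q4 Y Z Z' Y' by rewrite /Q4 (prC Y').
 rewrite (s1 W U) (s1 W U U W) (s1 W U W U) (s1 W U W W) (s2 U U W U) (s2 U W W U) (s2 W W W U).
 rewrite (Q4C EU EW EU EU) (Q4C EW EW EU EU) (Q4C EW EW EU EW); ring.
rewrite /JJ /DJ /AA /VV eq4 [bl0 (U + W).1.2 _]e1 [bl0 (U + W).2 _]e2 [bl mu2 V (U + W).1.1 _]e3.
have p20 := p2; rewrite c8E -/c2.
move: (Q4 U U U U) (Q4 U U U W) (Q4 U W U W) (Q4 U U W W) (Q4 U W W W) (Q4 W W W W) => z1 z2 z3 z4 z5 z6.
move: (PP (U + W)) (PP U) (rint _ _) => y1 y2 y3.
move: (bl0 U.1.2 U.1.2) (bl0 U.1.2 W.1.2) (bl0 W.1.2 W.1.2) => a1 a2 a3.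
move: (bl0 U.2 U.2) (bl0 U.2 W.2) (bl0 W.2 W.2) => b1 b2' b3.
move: (bl mu2 V U.1.1 U.1.1) (bl mu2 V U.1.1 W.1.1) (bl mu2 V W.1.1 W.1.1) => d1 d2 d3.
move: (sp D) p20 (sb D) c2 => pp pp2 bb cc.
by field; rewrite gt_eqF//; alra.
Qed.

Lemma CS_ge0 r : 0 <= r -> 0 < CS r.
Proof.
move=> r0; have := c2_gt0; have := CK_ge1; have := b0 => h1 h2 h3.
have r2 := sqr_ge0 r; have r3 := exprn_ge0 3 r0.
have k1 : 0 <= 7 * r ^+ 2 + r ^+ 3 by lra.
have k2 : 0 <= 4 + 160 * r ^+ 2 + (1 + 16 * r ^+ 2) * r.
 by have : 0 <= r ^+ 2 * r by [exact: mulr_ge0]; lra.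
have k3 : 0 <= c2 * CK * (7 * r ^+ 2 + r ^+ 3).
 by apply: mulr_ge0 => //; apply: mulr_ge0; lra.
have k4 : 0 <= b * 3 * (4 + 160 * r ^+ 2 + (1 + 16 * r ^+ 2) * r).
 by apply: mulr_ge0 => //; lra.
rewrite /CS; lra.
Qed.

Lemma CS_parts r : 0 <= r ->
 4 + c2 * CK * (7 * r ^+ 2) + b * 3 * (4 + 160 * r ^+ 2) <= CS r /\
 4 * r + c2 * CK * r ^+ 3 + b * 3 * ((1 + 16 * r ^+ 2) * r) <= CS r.
Proof.
move=> r0; have := c2_gt0; have := CK_ge1; have := b0 => h1 h2 h3.
have r2 := sqr_ge0 r; have r3 := exprn_ge0 3 r0.
have cc : 0 <= c2 * CK by apply: mulr_ge0; lra.
have k1 := mulr_ge0 cc r2; have k2 := mulr_ge0 cc r3.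
have k3 : 0 <= b * r ^+ 2 by apply: mulr_ge0 => //; lra.
have k4 : 0 <= b * r by apply: mulr_ge0 => //; lra.
have k5 : 0 <= b * r ^+ 2 * r by exact: mulr_ge0.
by rewrite /CS; move: (c2 * CK) k1 k2 => cq k1 k2; split; lra.
Qed.

Lemma Q4_r U W Y Z (x y z w : R) : EE U -> EE W -> EE Y -> EE Z ->
 nrm U <= x -> nrm W <= y -> nrm Y <= z -> nrm Z <= w -> `|Q4 U W Y Z| <= CK * (x * y * (z * w)).
Proof.
move=> EU EW EY EZ h1 h2 h3 h4; apply: le_trans (Q4_bound EU EW EY EZ) _.
have c0 : 0 <= CK by have := CK_ge1; lra.
by rewrite ler_wpM2l// !ler_pM ?mulr_ge0 ?nrm_ge0.
Qed.

Lemma p_factor (x y t : R) : 0 <= x -> 0 <= y -> y <= t -> x <= 2 ^+ 2 * t ->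
 (p - 1) * (2 * (1 + 16 * x) + 2 * (1 + 16 * y)) <= 3 * (4 + 160 * t).
Proof.
have := p2; have := p4; move: (sp D) => q q4 q2 x0 y0 yt xt.
by apply: ler_pM; lra.
Qed.

Lemma Jm_taylor r mu U W : 0 <= mu <= 1 -> EE U -> EE W -> nrm U <= r -> nrm W <= r ->
 `|Jm mu (U + W) - Jm mu U - dJm mu U W| <= CS r * nrm W ^+ 2.
Proof.
move=> /andP[m0 m1] EU EW Ur Wr; have r0 : 0 <= r by exact: le_trans (nrm_ge0 U) Ur.
have EUW := EE_D EU EW.
have [_ _ _ _ L1] := EU; have [_ _ _ _ L2] := EW.
have e4 := bl_sq_lin measurable_LL LL_ge0 1 1 L1 L2.
rewrite !funD11 in e4.
have -> : Jm mu (U + W) - Jm mu U - dJm mu U W = (JJ (U + W) - JJ U - DJ U W) + mu * (2^-1 * BL W).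
 rewrite /Jm /dJm /BB /DB /BL [bl mu2 LL (U + W).1.1 _]e4.
 move: (JJ _) (JJ _) (DJ _ _) (bl _ _ _ _) (bl _ _ _ _) (bl _ _ _ _) => z1 z2 z3 z4 z5 z6.
 by field.
rewrite (sq_lin1 EU EW); set n := nrm W ^+ 2.
have n0 : 0 <= n by exact: sqr_ge0.
have hW : 2^-1 * (AA W + VV W) + mu * (2^-1 * BL W) <= 2^-1 * n.
 rewrite /n nrm_sq /NN; have := BL_ge0 W => h; have : mu * BL W <= BL W by rewrite ler_piMl.
 lra.
have hW0 : 0 <= 2^-1 * (AA W + VV W) + mu * (2^-1 * BL W).
 apply: addr_ge0; apply: mulr_ge0 => //.
  by apply: addr_ge0; [exact: AA_ge0|exact: VV_ge0].
 by apply: mulr_ge0 => //; exact: BL_ge0.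
have c0 := c2_gt0; have ck := CK_ge1; have bb := b0; have p20 := p2; have p40 := p4.
set w := nrm W in Wr *; have w0 : 0 <= w by exact: nrm_ge0.
have q1 := Q4_r EU EW EU EW Ur (lexx w) Ur (lexx w).
have q2 := Q4_r EU EU EW EW Ur Ur (lexx w) (lexx w).
have q3 := Q4_r EU EW EW EW Ur (lexx w) Wr (lexx w).
have q4 := Q4_r EW EW EW EW Wr (lexx w) Wr (lexx w).
have hq : `|(8 * pi)^-1 * (4 * Q4 U W U W + 2 * Q4 U U W W + 4 * Q4 U W W W + Q4 W W W W)| <=
  c2 * CK * (7 * r ^+ 2) * n.
 have c4 : 0 <= c2 / 4 by rewrite divr_ge0// ltW.
 rewrite c8E normrM (ger0_norm c4) -[c2 / 4 * _]mulrA.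
 have -> : c2 * CK * (7 * r ^+ 2) * n = c2 * (7 * (CK * (r * w * (r * w)))) by rewrite /n -/w; ring.
 rewrite ler_pM2l//.
 have : `|4 * Q4 U W U W + 2 * Q4 U U W W + 4 * Q4 U W W W + Q4 W W W W| <= 11 * (CK * (r * w * (r * w))).
  move: q1 q2 q3 q4; rewrite (_ : r * r * (w * w) = r * w * (r * w)); last by ring.
  exact: norm_quartic1.
 have : 0 <= CK * (r * w * (r * w)) by apply: mulr_ge0; [alra|apply: mulr_ge0; exact: mulr_ge0].
 by move: (CK * _) `|_| => t z; clear; lra.
have hp : `|b / p * (PP (U + W) - PP U - p * [int x, spow p (U.1.1 x) * W.1.1 x])| <=
  b * 3 * (4 + 160 * r ^+ 2) * n.
 have bp : 0 <= b / p by rewrite divr_ge0//; alra.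
 rewrite normrM ger0_norm//; apply: le_trans (ler_wpM2l bp (pow_taylor_bound EU EW)) _.
 have -> : b / p * (p * (p - 1) * (2 * (1 + 16 * NN U) + 2 * (1 + 16 * NN (U + W))) * nrm W ^+ 2) =
   b * (p - 1) * (2 * (1 + 16 * NN U) + 2 * (1 + 16 * NN (U + W))) * n.
  by rewrite /n /w; field; rewrite gt_eqF//; alra.
 apply: ler_wpM2r => //.
 have h1 := NN_le_r Ur r0.
 have h2 : NN (U + W) <= (2 * r) ^+ 2.
  apply: NN_le_r; last by alra.
  by apply: le_trans (nrm_D EU EW) _; rewrite -/w; alra.
 rewrite -[b * (p - 1) * _]mulrA -[b * 3 * _]mulrA ler_pM2l// [2 * _ + _]addrC.
 by apply: p_factor; rewrite ?NN_ge0// exprMn in h2 *.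
apply: le_trans (_ : 2^-1 * n + c2 * CK * (7 * r ^+ 2) * n + b * 3 * (4 + 160 * r ^+ 2) * n <= _).
 set a1 := _ * (_ + _) in hW hW0 *; set a2 := mu * _ in hW hW0 *; set a3 := (8 * pi)^-1 * _ in hq *; set a4 := b / p * _ in hp *.
 have -> : a1 + a3 - a4 + a2 = (a1 + a2) + a3 - a4 by ring.
 by apply: norm_add3 => //; rewrite ger0_norm.
rewrite -!mulrDl; apply: ler_wpM2r => //; apply: le_trans (CS_parts r0).1.
by rewrite !lerD2r; alra.
Qed.

Lemma dJm_lip r mu U W Y : 0 <= mu <= 1 -> EE U -> EE W -> EE Y -> nrm U <= r -> nrm W <= r ->
 `|dJm mu (U + W) Y - dJm mu U Y| <= CS r * nrm W * nrm Y.
Proof.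
move=> /andP[m0 m1] EU EW EY Ur Wr; have r0 : 0 <= r by exact: le_trans (nrm_ge0 U) Ur.
have EUW := EE_D EU EW.
have [G1 A1 B1 V1 L1] := EU; have [G2 A2 B2 V2 L2] := EW; have [G3 A3 B3 V3 L3] := EY.
have e1 := bl_lin measurable_one one_ge0 1 1 A1 A2 A3.
have e2 := bl_lin measurable_one one_ge0 1 1 B1 B2 B3.
have e3 := bl_lin measurable_V V_ge0 1 1 V1 V2 V3.
have e4 := bl_lin measurable_LL LL_ge0 1 1 L1 L2 L3.
rewrite !funD11 !mul1r in e1 e2 e3 e4.
have [b1 b2 b3 b4] := bl_nrm EW EY.
have eq4 : Q4 (U + W) (U + W) (U + W) Y = Q4 U U U Y + (2 * Q4 U W U Y + Q4 W W U Y + Q4 U U W Y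
  + 2 * Q4 U W W Y + Q4 W W W Y).
 rewrite Q4D1// !Q4D2// !Q4D3//; do ?exact: EE_D.
 have s1 Y1 Y2 Y' Z' : Q4 Y1 Y2 Y' Z' = Q4 Y2 Y1 Y' Z' by rewrite /Q4 (prC Y1).
 rewrite (s1 W U U Y) (s1 W U W Y); ring.
have -> : dJm mu (U + W) Y - dJm mu U Y = (bl0 W.1.2 Y.1.2 + bl0 W.2 Y.2 + bl mu2 V W.1.1 Y.1.1
  + mu * bl mu2 LL W.1.1 Y.1.1) + c2 * (2 * Q4 U W U Y + Q4 W W U Y + Q4 U U W Y
  + 2 * Q4 U W W Y + Q4 W W W Y) - b * ([int x, spow p ((U + W).1.1 x) * Y.1.1 x] -
   [int x, spow p (U.1.1 x) * Y.1.1 x]).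
 rewrite /dJm /DJ /DB eq4 -/c2.
 rewrite [bl0 (U + W).1.2 _]blC [bl0 (U + W).2 _]blC [bl mu2 V (U + W).1.1 _]blC [bl mu2 LL (U + W).1.1 _]blC.
 rewrite [bl0 Y.1.2 (U + W).1.2]e1 [bl0 Y.2 (U + W).2]e2 [bl mu2 V Y.1.1 (U + W).1.1]e3 [bl mu2 LL Y.1.1 (U + W).1.1]e4.
 rewrite ![bl mu2 _ Y.1.2 _]blC ![bl mu2 _ Y.2 _]blC ![bl mu2 _ Y.1.1 _]blC; ring.
set w := nrm W in Wr b1 b2 b3 b4 *; set y := nrm Y in b1 b2 b3 b4 *.
have w0 : 0 <= w by exact: nrm_ge0. have y0 : 0 <= y by exact: nrm_ge0.
have wy0 : 0 <= w * y by exact: mulr_ge0.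
have c0 := c2_gt0; have ck := CK_ge1; have bb := b0; have p20 := p2; have p40 := p4.
have q1 := Q4_r EU EW EU EY Ur (lexx w) Ur (lexx y).
have q2 := Q4_r EW EW EU EY Wr (lexx w) Ur (lexx y).
have q3 := Q4_r EU EU EW EY Ur Ur (lexx w) (lexx y).
have q4 := Q4_r EU EW EW EY Ur (lexx w) Wr (lexx y).
have q5 := Q4_r EW EW EW EY Wr (lexx w) Wr (lexx y).
have hq : `|c2 * (2 * Q4 U W U Y + Q4 W W U Y + Q4 U U W Y + 2 * Q4 U W W Y + Q4 W W W Y)| <=
  c2 * CK * (7 * r ^+ 2) * (w * y).
 rewrite normrM (gtr0_norm c0).
 have -> : c2 * CK * (7 * r ^+ 2) * (w * y) = c2 * (7 * (CK * (r * w * (r * y)))) by ring.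
 rewrite ler_pM2l//.
 move: q1 q2 q3 q4 q5; rewrite (_ : r * r * (w * y) = r * w * (r * y)); last by ring.
 exact: norm_quartic2.
have hp : `|b * ([int x, spow p ((U + W).1.1 x) * Y.1.1 x] -
   [int x, spow p (U.1.1 x) * Y.1.1 x])| <= b * 3 * (4 + 160 * r ^+ 2) * (w * y).
 rewrite normrM ger0_norm; last exact: ltW.
 apply: le_trans (ler_wpM2l (ltW bb) (pow_lip_bound EU EW EY)) _.
 rewrite -/w -/y -[b * 3 * _]mulrA -[b * (3 * _) * _]mulrA ler_pM2l//; apply: ler_wpM2r => //.
 have h1 := NN_le_r Ur r0.
 have h2 : NN (U + W) <= (2 * r) ^+ 2.
  apply: NN_le_r; last by alra.
  by apply: le_trans (nrm_D EU EW) _; rewrite -/w; alra.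
 by apply: p_factor; rewrite ?NN_ge0// exprMn in h2 *.
have hb : `|bl0 W.1.2 Y.1.2 + bl0 W.2 Y.2 + bl mu2 V W.1.1 Y.1.1
  + mu * bl mu2 LL W.1.1 Y.1.1| <= 4 * (w * y).
 have b5 : `|mu * bl mu2 LL W.1.1 Y.1.1| <= w * y.
  by rewrite normrM (ger0_norm m0) -[leRHS]mul1r ler_pM.
 exact: norm_add4.
apply: le_trans (_ : 4 * (w * y) + c2 * CK * (7 * r ^+ 2) * (w * y) + b * 3 * (4 + 160 * r ^+ 2) * (w * y) <= _).
 exact: norm_add3.
rewrite -!mulrDl -[leRHS]mulrA; apply: ler_wpM2r => //; exact: (CS_parts r0).1.
Qed.

Lemma dJm_bound r mu U W : 0 <= mu <= 1 -> EE U -> EE W -> nrm U <= r ->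
 `|dJm mu U W| <= CS r * nrm W.
Proof.
move=> /andP[m0 m1] EU EW Ur; have r0 : 0 <= r by exact: le_trans (nrm_ge0 U) Ur.
have [b1 b2 b3 b4] := bl_nrm EU EW; have [_ hs] := spow_term EU EW.
have w0 := nrm_ge0 W; have hq := Q4_r EU EU EU EW Ur Ur Ur (lexx (nrm W)).
have c0 := c2_gt0; have ck := CK_ge1; have bb := b0.
set w := nrm W in b1 b2 b3 b4 hs w0 hq *.
have Uw : nrm U * w <= r * w by rewrite ler_wpM2r.
have hb : `|bl0 U.1.2 W.1.2 + bl0 U.2 W.2 + bl mu2 V U.1.1 W.1.1
  + mu * bl mu2 LL U.1.1 W.1.1| <= 4 * (r * w).
 have b5 : `|mu * bl mu2 LL U.1.1 W.1.1| <= nrm U * w.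
  by rewrite normrM (ger0_norm m0) -[leRHS]mul1r ler_pM.
 by apply: norm_add4 => //; apply: le_trans Uw.
have hq' : `|c2 * Q4 U U U W| <= c2 * CK * r ^+ 3 * w.
 rewrite normrM (gtr0_norm c0) -!mulrA ler_pM2l// (le_trans hq)//.
 by apply: le_eq; ring.
have hs' : `|b * [int x, spow p (U.1.1 x) * W.1.1 x]| <= b * 3 * ((1 + 16 * r ^+ 2) * r) * w.
 rewrite normrM (gtr0_norm bb) -!mulrA ler_pM2l//.
 apply: le_trans hs _; have h1 := NN_le_r Ur r0; have g1 := NN_ge0 U.
 apply: le_trans (_ : (1 + 16 * r ^+ 2) * (r * w) <= _).
  by apply: ler_pM => //; [alra|rewrite mulr_ge0 ?nrm_ge0|alra].
 by rewrite ler_peMl ?mulr_ge0 ?addr_ge0 ?mulr_ge0 ?sqr_ge0//; alra.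
have -> : dJm mu U W = (bl0 U.1.2 W.1.2 + bl0 U.2 W.2 + bl mu2 V U.1.1 W.1.1
  + mu * bl mu2 LL U.1.1 W.1.1) + c2 * Q4 U U U W - b * [int x, spow p (U.1.1 x) * W.1.1 x].
 by rewrite /dJm /DJ /DB -/c2; ring.
apply: le_trans (_ : 4 * r * w + c2 * CK * r ^+ 3 * w + b * 3 * ((1 + 16 * r ^+ 2) * r) * w <= _).
 by rewrite -mulrA; exact: norm_add3.
rewrite -!mulrDl; apply: ler_wpM2r => //; exact: (CS_parts r0).2.
Qed.

End functional.

(** * Passage between the given definitions and the energy space *)

Section interface.
Implicit Types (U W : X) (f : pt -> R).

Lemma integ_ltP f : mfun f -> (forall x, 0 <= f x) ->
 (integ f < +oo)%E <-> Int mu2 f.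
Proof.
move=> mf f0; rewrite integ_mu2//; split => [h|If]; first exact: Int_ge0.
by rewrite Int_fin// ltry.
Qed.

Lemma inL2P f : inLp 2 f <-> F2 mu2 one f.
Proof.
have E : mfun f -> (fun x => `|f x| `^ 2) = (fun x => f x ^+ 2).
 by move=> mf; apply/funext => x; rewrite powR_mulrn ?normr_ge0// norm_sq.
rewrite /inLp F2_one; split => -[mf]; rewrite (E mf) => h; split => //.
 by apply/integ_ltP => //; [exact: measurable_funX|move=> x; exact: sqr_ge0].
by apply/integ_ltP => //; [exact: measurable_funX|move=> x; exact: sqr_ge0].
Qed.

Lemma inE_EE u g1 g2 : Defs.inE V u g1 g2 <-> EE (u, g1, g2).
Proof.
have mV := measurable_V; have mL := @measurable_lnorm.
split.
 move=> [[/inL2P Fu /inL2P F1 /inL2P F2' /weak_gradP W] IV IL].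
 have [mu /= Iu] := Fu; have mu2' : mfun (fun x => u x ^+ 2) by exact: measurable_funX.
 split => //; split => //=.
  apply/integ_ltP => //; first exact: measurable_funM.
  by move=> x; rewrite mulr_ge0 ?sqr_ge0 ?V_ge0.
 have IL' : [L1 x, lnorm x * u x ^+ 2].
  apply/integ_ltP => //; first exact: measurable_funM.
  by move=> x; rewrite mulr_ge0 ?sqr_ge0 ?lnorm_ge0.
 by apply: (eq_Int _ (Int_D Iu IL')) => x; rewrite /LL mulrDl.
move=> EU; have Fu := EE_F2u EU; have [W F1 F2' [mu /= IV] [_ /= IL]] := EU.
have mu2' : mfun (fun x => u x ^+ 2) by exact: measurable_funX.
split; first by split; [exact/inL2P|exact/inL2P|exact/inL2P|exact/weak_gradP].
 apply/integ_ltP => //; first exact: measurable_funM.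
 by move=> x; rewrite mulr_ge0 ?sqr_ge0 ?V_ge0.
apply/integ_ltP => //; first exact: (measurable_funM mL).
 by move=> x; rewrite mulr_ge0 ?sqr_ge0 ?lnorm_ge0.
apply: (Int_le IL); first exact: (measurable_funM mL).
move=> x; rewrite (ger0_norm (mulr_ge0 (lnorm_ge0 x) (sqr_ge0 (u x)))).
by rewrite ler_wpM2r ?sqr_ge0// /LL lerDr.
Qed.

Lemma Ifun_JJ u g1 g2 : EE (u, g1, g2) -> Ifun V b p u g1 g2 = JJ (u, g1, g2).
Proof.
move=> EU; have Fu := EE_F2u EU; have [W F1 F2' [mu /= IV] [_ /= IL]] := EU.
have /F2_one[m1 I1] := F1; have /F2_one[m2 I2] := F2'.
rewrite /Ifun /JJ; congr (_ * _ + _ - _ * _).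
- rewrite /normV2 intR_rint; last first.
  apply: measurable_funD; last exact: measurable_funM measurable_V (measurable_funX _ mu).
  by apply: measurable_funD; exact: measurable_funX.
 have Is := Int_D I1 I2.
 rewrite (rintD Is IV) (rintD I1 I2) /AA /VV !bl_oneE bl_sqE.
 by [].
- rewrite N0_q//; last exact: (dens_pr EU EU).
 rewrite c8E /Q4 /pr /c2 /=; set z := q _ _.
 by rewrite mulrCA mulrA.
- by rewrite intR_rint//; apply: measurable_powR_norm.
Qed.

Lemma is_derive_quadratic (f : R -> R) (a C : R) :
 (forall t, `|t| <= 1 -> `|f t - f 0 - t * a| <= C * t ^+ 2) -> is_derive (0 : R) (1 : R) f a.
Proof.
move=> H.
have L : h^-1 *: (f (h *: (1 : R) + 0) - f 0) @[h --> 0^'] --> a.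
 apply/cvgrPdist_le => /= e e0.
 near=> h; have h0 : h != 0 by near: h; exact: nbhs_dnbhs_neq.
 have hd : `|h| <= e / (`|C| + 1).
  near: h; apply: (@dnbhs0_le _ R); rewrite divr_gt0// ltr_wpDl.
 have h1 : `|h| <= 1 by near: h; apply: (@dnbhs0_le _ R).
 rewrite addr0 [h *: 1]mulr1 -[X in `|X - _|](mulKf h0) -[_ *: _]/(h^-1 * _) -mulrBr normrM distrC.
 have hn : 0 < `|h| by rewrite normr_gt0.
 rewrite normfV mulrC ler_pdivrMr//; apply: le_trans (H h h1) _.
 apply: le_trans (_ : (`|C| + 1) * `|h| * `|h| <= _).
  rewrite -[h ^+ 2]norm_sq expr2 mulrA ler_wpM2r// ler_wpM2r//.
  by apply: le_trans (ler_norm C) _; rewrite lerDl.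
 rewrite ler_wpM2r// mulrC -ler_pdivlMr//; by rewrite ltr_wpDl.
have dl : derivable f 0 1 by apply/cvg_ex; exists a; exact: L.
by apply: DeriveDef => //; exact: cvg_lim L.
Unshelve. all: by end_near. Qed.

Lemma Jm_derive mu U W : 0 <= mu <= 1 -> EE U -> EE W ->
 is_derive (0 : R) (1 : R) (fun t : R => Jm mu (U + t *: W)) (dJm mu U W).
Proof.
move=> m01 EU EW; pose r := nrm U + nrm W.
have U0 := nrm_ge0 U; have W0 := nrm_ge0 W.
apply: (@is_derive_quadratic _ _ (CS r * nrm W ^+ 2)) => t t1.
have EtW := EE_Z t EW.
have h1 : nrm U <= r by rewrite lerDl.
have h2 : nrm (t *: W) <= r.
 by rewrite nrm_Z//; apply: le_trans (_ : nrm W <= _); [rewrite ler_piMl|rewrite lerDr].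
have := Jm_taylor m01 EU EtW h1 h2.
have -> : dJm mu U (t *: W) = t * dJm mu U W.
 by have := dJm_lin mu t 0 EU EW EW; rewrite scale0r addr0 mul0r addr0.
rewrite scale0r addr0 => /le_trans; apply.
by rewrite nrm_Z// exprMn norm_sq mulrCA mulrC.
Qed.

Definition crit mu U := EE U /\ forall W, EE W -> dJm mu U W = 0.

Lemma Jm0 U : Jm 0 U = JJ U. Proof. by rewrite /Jm mul0r addr0. Qed.
(** Along each line of [E] the functional has derivative [dJm 0 U W], and derivatives are unique; so
    criticality is the vanishing of this number. *)
Lemma critical_crit u g1 g2 : critical V b p u g1 g2 <-> crit 0 (u, g1, g2).
Proof.
have z01 : (0 <= (0 : R)) && ((0 : R) <= 1) by rewrite lexx ler01.
have key W : EE (u, g1, g2) -> EE W ->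
 (fun t : R => Ifun V b p (comb u W.1.1 t) (comb g1 W.1.2 t) (comb g2 W.2 t)) =
 (fun t : R => Jm 0 ((u, g1, g2) + t *: W)).
 move=> EU EW; apply/funext => t; rewrite Jm0.
 have EC := EE_D EU (EE_Z t EW).
 by rewrite -(Ifun_JJ (u := comb u W.1.1 t) (g1 := comb g1 W.1.2 t) (g2 := comb g2 W.2 t)).
split.
 move=> [/inE_EE EU H]; split => // -[[v h1] h2] EW.
 have h := H v h1 h2 (proj2 (inE_EE _ _ _) EW).
 rewrite (key (v, h1, h2) EU EW) in h.
 have h' := Jm_derive z01 EU EW.
 by rewrite -(@derive_val _ _ _ _ _ _ _ h') (@derive_val _ _ _ _ _ _ _ h).
move=> [EU H]; split; first exact/inE_EE.
move=> v h1 h2 /inE_EE EW; rewrite (key (v, h1, h2) EU EW).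
by have := Jm_derive z01 EU EW; rewrite (H _ EW).
Qed.

Lemma nontrivialP U : EE U -> nontrivial U.1.1 <-> 0 < mm U.
Proof.
move=> EU; have [_ _ I] := mm_le EU.
by rewrite /nontrivial integ_Int// lte_fin /mm bl_oneE.
Qed.

End interface.

(** * A Poincare inequality on a grid *)

Section grid.
Implicit Types (w : pt -> R).

Lemma rint_sum d (T : measurableType d) (m : {measure set T -> \bar R}) (I : Type) (s : seq I) (F : I -> T -> R) :
 (forall i, Int m (F i)) -> Int m (fun x => \sum_(i <- s) F i x) /\
 rint m (fun x => \sum_(i <- s) F i x) = \sum_(i <- s) rint m (F i).
Proof.
move=> IF; elim: s => [|i s [I1 e]].
 under eq_fun do rewrite big_nil; rewrite big_nil rint0; split => //; exact: Int_0.
under eq_fun do rewrite big_cons; rewrite big_cons -e -rintD//; split => //; exact: Int_D.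
Qed.

Variables (h : R) (n : nat).
Hypothesis h0 : 0 < h.

(** Half-open intervals, so that the boxes tile the square of half-side [n * h] and their indicators
    add up to its indicator. *)
Definition itvl (i : nat) : set R := `[(i%:R - n%:R) * h, (i.+1%:R - n%:R) * h[%classic.
Definition box (t : 'I_(n + n) * 'I_(n + n)) : set pt := itvl t.1 `*` itvl t.2.

Lemma measurable_box t : measurable (box t).
Proof. by apply: measurableX; exact: measurable_itv. Qed.

Lemma mu2_box t : mu2 (box t) = (h ^+ 2)%:E.
Proof.
have le i : (i%:R - n%:R) * h <= (i.+1%:R - n%:R) * h.
 by rewrite ler_pM2r// lerD2r ler_nat.
rewrite /box mu2_prod; [|exact: measurable_itv|exact: measurable_itv].
rewrite /itvl !leb1_itv// -EFinM -!mulrBl; congr _%:E.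
rewrite -![_.+1%:R]natr1 expr2; ring.
Qed.

Lemma Int_box t : Int mu2 (\1_(box t)) /\ rint mu2 (\1_(box t)) = h ^+ 2.
Proof.
have mb := measurable_box t.
have e : (\int[mu2]_x (\1_(box t) x)%:E = (h ^+ 2)%:E)%E.
 by rewrite integral_indic// setIT; exact: mu2_box.
split; last by rewrite /rint e.
by apply: Int_ge0 => //; rewrite e ltry.
Qed.

Let one_itvl (k : nat) (t : R) : \sum_(i < k) \1_(itvl i) t = (- n%:R * h <= t < (k%:R - n%:R) * h)%R%:R :> R.
Proof.
elim: k => [|k IH].
 by rewrite big_ord0 sub0r; case: (leP (- n%:R * h) t).
rewrite big_ord_recr /= IH indicE.
have hk : (k%:R - n%:R) * h <= (k.+1%:R - n%:R) * h by rewrite ler_pM2r// lerD2r ler_nat.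
have hk0 : - n%:R * h <= (k%:R - n%:R) * h by rewrite ler_pM2r// lerDr.
have E : (t \in itvl k) = ((k%:R - n%:R) * h <= t < (k.+1%:R - n%:R) * h).
 by apply/idP/idP; rewrite inE /itvl /= in_itv.
rewrite E; case: (leP ((k%:R - n%:R) * h) t) => h1 /=.
 by rewrite andbF (le_trans hk0 h1) add0r.
by rewrite (lt_le_trans h1 hk) andbT addr0.
Qed.

Lemma sum_box x : \sum_t \1_(box t) x =
 ((- n%:R * h <= x.1 < n%:R * h) && (- n%:R * h <= x.2 < n%:R * h))%R%:R :> R.
Proof.
have E t : \1_(box t) x = \1_(itvl t.1) x.1 * \1_(itvl t.2) x.2 :> R.
 rewrite !indicE -natrM mulnb; congr (_%:R); congr nat_of_bool.
 by apply/idP/andP; rewrite !inE /box; case.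
under eq_bigr do rewrite E.
rewrite -(pair_bigA _ (fun i j : 'I_(n + n) => \1_(itvl i) x.1 * \1_(itvl j) x.2)) /=.
rewrite -big_distrlr /= !one_itvl -natrM mulnb natrD addrK.
by [].
Qed.

Lemma sum_box2 x y : \sum_t \1_(box t) x * \1_(box t) y <= \1_(cube h) (psub y x) :> R.
Proof.
rewrite indicE.
have [c|c] := pselect (cube h (psub y x)).
 rewrite mem_set//; apply: le_trans (_ : \sum_t \1_(box t) x <= _).
  by apply: ler_sum => t _; rewrite ler_piMr// indicE; case: (_ \in _).
 by rewrite sum_box; case: (_ && _).
rewrite memNset//; rewrite big1// => t _; rewrite !indicE.
have [bx|bx] := pselect (box t x); last by rewrite (memNset bx) mul0r.
have [b|b] := pselect (box t y); last by rewrite (memNset b) mulr0.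
exfalso; apply: c; apply/cubeP; move: bx b; rewrite /box /itvl /= !in_itv/=.
rewrite -![_.+1%:R]natr1 => -[/andP[a1 a2] /andP[a3 a4]] [/andP[c1 c3] /andP[c4 c5]].
by split; rewrite ler_norml; apply/andP; split; lra.
Qed.

(** The variance identity on a box of area [h ^+ 2]: the squared difference is expanded in the
    double integral. *)
Lemma box_identity t w : mfun w -> [L1 x, w x ^+ 2] ->
 [/\ [L1 x, \1_(box t) x * w x], [L1 x, \1_(box t) x * w x ^+ 2],
  Int m4 (fun z => \1_(box t) z.1 * \1_(box t) z.2 * (w z.2 - w z.1) ^+ 2) &
  [int x, \1_(box t) x * w x ^+ 2] = h ^- 2 * [int x, \1_(box t) x * w x] ^+ 2 +
   (2 * h ^+ 2)^-1 * rint m4 (fun z => \1_(box t) z.1 * \1_(box t) z.2 * (w z.2 - w z.1) ^+ 2)].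
Proof.
move=> mw Iw; have [Ib rb] := Int_box t; have mb := measurable_box t.
have I2 : [L1 x, \1_(box t) x * w x ^+ 2].
 by have := Int_indic mb Iw; under eq_fun do rewrite mulrC.
have I1 : [L1 x, \1_(box t) x * w x].
 apply: (Int_le (Int_D Ib I2)); first by apply: measurable_funM => //; exact: measurable_indic.
 move=> x; rewrite indicE; case: (_ \in _) => /=; rewrite ?mul0r ?normr0 ?addr0//.
 by rewrite !mul1r -[w x ^+ 2]norm_sq; have := sqr_ge0 (`|w x| - 1); nra.
have [J1 e1] := tensor_int I2 Ib; have [J2 e2] := tensor_int Ib I2; have [J3 e3] := tensor_int I1 I1.
have E : (fun z => \1_(box t) z.1 * \1_(box t) z.2 * (w z.2 - w z.1) ^+ 2) =
 (fun z : pt * pt => ((\1_(box t) z.1 * w z.1 ^+ 2) * \1_(box t) z.2 +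
   \1_(box t) z.1 * (\1_(box t) z.2 * w z.2 ^+ 2)) - 2 * ((\1_(box t) z.1 * w z.1) * (\1_(box t) z.2 * w z.2))).
 by apply/funext => z; ring.
split => //; first by rewrite E; apply: Int_B; [exact: Int_D|exact: Int_Z].
rewrite E rintB; [|exact: Int_D|exact: Int_Z]; rewrite rintD// rintZ// e1 e2 e3 rb.
by field; rewrite gt_eqF.
Qed.

(** [translation_estimate] integrated over [cube h], of area [4 * h ^+ 2], on which the squared
    length of the translation is at most [2 * h ^+ 2]. *)
Lemma translation_mass w g1 g2 : H1 w g1 g2 ->
 Int m4 (fun z : pt * pt => \1_(cube h) z.1 * (w (trans z.1 z.2) - w z.2) ^+ 2) /\
 rint m4 (fun z : pt * pt => \1_(cube h) z.1 * (w (trans z.1 z.2) - w z.2) ^+ 2) <= 8 * h ^+ 4 * grad2 g1 g2.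
Proof.
move=> HH; have [[Lw _ _ _] _ _ _] := HH; have mw := LI_mf Lw.
have mc := @measurable_cube h.
have A0 : 0 <= grad2 g1 g2 by apply: rint_ge0 => x; rewrite addr_ge0// sqr_ge0.
have ec : (\int[mu2]_x (\1_(cube h) x)%:E = (4 * h ^+ 2)%:E)%E.
 have E : mu2 (cube h) = (4 * h ^+ 2)%:E.
  rewrite mu2_prod// leb1_itv; last by rewrite (ge0_cp (ltW h0)).
  by rewrite -EFinM; congr _%:E; ring.
 by rewrite integral_indic// setIT; exact: E.
have Ic : Int mu2 (\1_(cube h)) by apply: Int_ge0 => //; rewrite ec ltry.
have rc : rint mu2 (\1_(cube h)) = 4 * h ^+ 2 by rewrite /rint ec.
have mF : mfun (fun z : pt * pt => \1_(cube h) z.1 * (w (trans z.1 z.2) - w z.2) ^+ 2).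
 apply: measurable_funM; first by apply: (measurableT_comp (measurable_indic mc)); exact: measurable_fst.
 apply: measurable_funX; apply: measurable_funB; last by apply: (measurableT_comp mw); exact: measurable_snd.
 apply: (measurableT_comp mw); apply/measurable_fun_pairP.
 by split; apply: measurable_funD; mproj.
have slice z : [L1 x, \1_(cube h) z * (w (trans z x) - w x) ^+ 2] /\
  [int x, \1_(cube h) z * (w (trans z x) - w x) ^+ 2] <= 2 * h ^+ 2 * grad2 g1 g2 * \1_(cube h) z.
 have [I1 r1] := translation_estimate z HH; split; first exact: Int_Z.
 rewrite rintZ// indicE; have [c|c] := pselect (cube h z); last by rewrite memNset// mul0r mulr0.
 rewrite mem_set// mul1r mulr1; apply: le_trans r1 _; rewrite ler_wpM2r//.
 case/cubeP: c => c1 c3; rewrite -[z.1 ^+ 2]norm_sq -[z.2 ^+ 2]norm_sq.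
 have := normr_ge0 z.1; have := normr_ge0 z.2; nra.
have IF : Int m4 (fun z : pt * pt => \1_(cube h) z.1 * (w (trans z.1 z.2) - w z.2) ^+ 2).
 apply: (Int_prodP mF (Int_Z (2 * h ^+ 2 * grad2 g1 g2) Ic)) => z /=.
 have pos y : 0 <= \1_(cube h) z * (w (trans z y) - w y) ^+ 2 by rewrite mulr_ge0// sqr_ge0.
 under eq_integral do rewrite (ger0_norm (pos _)).
 by have [I1 r1] := slice z; rewrite Int_fin// lee_fin.
split => //; have [I1 <- _] := rint_fubini1 IF.
apply: le_trans (_ : [int z, 2 * h ^+ 2 * grad2 g1 g2 * \1_(cube h) z] <= _).
 by apply: rint_le => //; [exact: Int_Z|move=> z /=; case: (slice z)].
by rewrite rintZ// rc; apply: le_eq; ring.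
Qed.

(** Two points of a common box differ by a vector of [cube h]. So the double integrals of the
    variance identities add up to at most the translation differences averaged over [cube h] on the
    whole plane, and the constant does not depend on the number of boxes. *)
Lemma grid_poincare w g1 g2 : H1 w g1 g2 ->
 [int x, (\sum_t \1_(box t) x) * w x ^+ 2] <=
 h ^- 2 * (\sum_t [int x, \1_(box t) x * w x] ^+ 2) + 4 * h ^+ 2 * grad2 g1 g2.
Proof.
move=> HH; have [[Lw _ _ _] Iw _ _] := HH; have mw := LI_mf Lw.
have bi t := box_identity t mw Iw.
have I1 t : [L1 x, \1_(box t) x * w x ^+ 2] by have [] := bi t.
have I2 t : Int m4 (fun z => \1_(box t) z.1 * \1_(box t) z.2 * (w z.2 - w z.1) ^+ 2) by have [] := bi t.
have [S1 e1] := rint_sum (index_enum _) I1; have [S2 e2] := rint_sum (index_enum _) I2.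
under eq_fun do rewrite mulr_suml; rewrite e1.
under eq_bigr => t _ do (have [_ _ _ ->] := bi t).
rewrite big_split /= -!mulr_sumr lerD2l -e2.
have [IF rF] := translation_mass HH.
have le : rint m4 (fun z => \sum_t \1_(box t) z.1 * \1_(box t) z.2 * (w z.2 - w z.1) ^+ 2) <= 8 * h ^+ 4 * grad2 g1 g2.
 apply: le_trans rF; have [J1 <- a1] := rint_fubini1 S2; have [J2 <- a2] := rint_fubini2 IF.
 apply: rint_le_ae => //; apply: filterS2 a1 a2 => x /= b1 b2.
 (* At fixed [x] the substitution [y = x + z] turns pairs of points into translations. *)
 have := rint_affm x ltr01 b1; rewrite expr1n invr1 mul1r => <-.
 apply: rint_le => //; first exact: (Int_affm x ltr01 b1).
 move=> z /=; have -> : affm 1 x z = trans z x by rewrite /affm /trans !mul1r [_ + x.1]addrC [_ + x.2]addrC.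
 rewrite -mulr_suml ler_wpM2r ?sqr_ge0//.
 apply: le_trans (sum_box2 x (trans z x)) _.
 by rewrite /psub /trans /= [_ + z.1]addrC [_ + z.2]addrC !addrK; case: z.
rewrite ler_pdivrMl ?mulr_gt0 ?exprn_gt0//.
apply: le_trans le _; apply: le_eq; ring.
Qed.

End grid.

(** * Extraction of subsequences along an ultrafilter *)

Section ultra.

(** Compactness of the segment: every bounded sequence converges along the ultrafilter, so all
    averages on all grids converge along the same one. *)
Lemma ultra_bounded (G : set_system nat) (a : nat -> R) (M : R) : UltraFilter G ->
 (forall n, `|a n| <= M) -> exists l, forall e : R, 0 < e -> G [set n | `|a n - l| <= e].
Proof.
move=> UG aM.
have aI : (a @ G) `[- M, M]%classic.
 by rewrite /fmap /=; apply: filterS (@filterT _ G _) => n _ /=; rewrite in_itv/= -ler_norml.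
have [l [_ cl]] := @segment_compact R (- M) M (a @ G) _ aI.
exists l => e e0; have [//|nG] := in_ultra_setVsetC [set n | `|a n - l| <= e] UG.
have nl : nbhs l [set x | `|x - l| <= e].
 by apply/nbhs_ballP; exists e => //= x; rewrite /ball/= distrC => /ltW.
have aA : (a @ G) [set x | ~ (`|x - l| <= e)] by [].
by have [x [/= h1 h2]] := cl _ _ aA nl.
Qed.

(** [s k] is chosen beyond [s k.-1] in the intersection of the first [k + 1] sets, which performs
    the diagonal extraction once and for all. *)
Lemma ultra_subseq (P : nat -> nat -> nat -> Prop) (G : set_system nat) : ProperFilter G ->
 (forall N, G [set n | (N <= n)%N]) ->
 (forall j, exists A, G A /\ forall n k, A n -> A k -> P j n k) ->
 exists s : nat -> nat, (forall k, (s k < s k.+1)%N) /\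
  forall j n k, (j <= n)%N -> (j <= k)%N -> P j (s n) (s k).
Proof.
move=> PG Goo H; have [A HA] := choice H.
pose B j := [set n | forall i, (i <= j)%N -> A i n].
have GB j : G (B j).
 elim: j => [|j IH].
  by apply: filterS (proj1 (HA 0%N)) => n h i; rewrite leqn0 => /eqP ->.
 apply: filterS2 IH (proj1 (HA j.+1)) => n h1 h2 i; rewrite leq_eqVlt => /orP[/eqP ->//|].
 by rewrite ltnS; exact: h1.
have ex (jm : nat * nat) : exists n, (jm.2 < n)%N /\ B jm.1 n.
 have [n [h1 h2]] := filter_ex (filterI (Goo jm.2.+1) (GB jm.1)).
 by exists n.
have [f Hf] := choice ex.
pose s := fix s k := if k is k'.+1 then f (k'.+1, s k') else f (0%N, 0%N).
have sB k : B k (s k) by case: k => [|k]; [exact: (Hf (0%N, 0%N)).2|exact: (Hf (k.+1, s k)).2].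
exists s; split; first by move=> k; exact: (Hf (k.+1, s k)).1.
by move=> j n k jn jk; apply: (HA j).2; [exact: (sB n)|exact: (sB k)].
Qed.

End ultra.

(** * Compactness in [L^2] of bounded sequences *)

Section compactness.
Implicit Types (U W : X).

Lemma quad_le (w f h : pt -> R) : mfun w -> (forall x, 0 <= w x) -> F2 mu2 w f -> F2 mu2 w h ->
 bl mu2 w (f - h) (f - h) <= 2 * bl mu2 w f f + 2 * bl mu2 w h h /\
 bl mu2 w (f + h) (f + h) <= 2 * bl mu2 w f f + 2 * bl mu2 w h h.
Proof.
move=> mw w0 Ff Fh; have := bl_ge0 mu2 w0 (f - h); have := bl_ge0 mu2 w0 (f + h).
have := bl_sq_lin mw w0 1 (-1) Ff Fh; have := bl_sq_lin mw w0 1 1 Ff Fh; rewrite funD11 funB11 => -> ->.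
by move: (bl _ _ _ _) (bl _ _ _ _) (bl _ _ _ _) => a b c; split; lra.
Qed.

Lemma AAVV_sub U W (C : R) : EE U -> EE W -> AA U + VV U <= C -> AA W + VV W <= C ->
 AA (U - W) + VV (U - W) <= 4 * C.
Proof.
move=> [_ A1 B1 V1 _] [_ A2 B2 V2 _].
have [h1 _] := quad_le measurable_one one_ge0 A1 A2.
have [h2 _] := quad_le measurable_one one_ge0 B1 B2.
have [h3 _] := quad_le measurable_V V_ge0 V1 V2.
move=> c1 c2; move: c1 c2; rewrite /AA /VV.
have h1' : bl0 (U - W).1.2 (U - W).1.2 <= 2 * bl0 U.1.2 U.1.2 + 2 * bl0 W.1.2 W.1.2 := h1.
have h2' : bl0 (U - W).2 (U - W).2 <= 2 * bl0 U.2 U.2 + 2 * bl0 W.2 W.2 := h2.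
have h3' : bl mu2 V (U - W).1.1 (U - W).1.1 <= 2 * bl mu2 V U.1.1 U.1.1 + 2 * bl mu2 V W.1.1 W.1.1 := h3.
move: (bl mu2 _ (U - W).1.2 _) (bl mu2 _ (U - W).2 _) (bl mu2 _ (U - W).1.1 _) h1' h2' h3' => x1 x2 x3.
move: (bl mu2 _ U.1.2 _) (bl mu2 _ U.2 _) (bl mu2 _ U.1.1 _) => y1 y2 y3.
move: (bl mu2 _ W.1.2 _) (bl mu2 _ W.2 _) (bl mu2 _ W.1.1 _) => z1 z2 z3; alra.
Qed.

Lemma mm_bound U (C : R) : EE U -> AA U + VV U <= C -> [/\ mm U <= C / sV0 D, S4 U <= 16 * (C / sV0 D) * C & 0 <= C].
Proof.
move=> EU h; have [_ h1 _] := mm_le EU; have [_ h2] := S4_le EU.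
have a0 := AA_ge0 U; have v0 := VV_ge0 U; have m0 := mm_ge0 U; have s0 := sV0_gt0 D.
have hm : mm U <= C / sV0 D by rewrite ler_pdivlMr// mulrC; lra.
split => //; last by lra.
apply: le_trans h2 _; rewrite -!mulrA ler_pM2l// mulrA; apply: ler_pM => //; lra.
Qed.

(** Where [V > M], [u^2] is at most [V u^2 / M]. The set where [V <= M] has finite measure, so its
    part outside a large cube is small, and there [u^2 <= t + u^4 / t]. *)
Lemma tail_bound (C e : R) : 0 < e -> exists2 r : R, 0 < r & forall U, EE U -> AA U + VV U <= C ->
 [L1 x, (1 - \1_(cube r) x) * U.1.1 x ^+ 2] /\
 [int x, (1 - \1_(cube r) x) * U.1.1 x ^+ 2] <= e.
Proof.
move=> e0.
pose C' := `|C| + 1; have C0 : 0 < C' by rewrite ltr_wpDl.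
have s0 := sV0_gt0 D.
(* [M], [t] and the measure bound [e / (3 * t)] below are set so that each of the three
   contributions is at most [e / 3]; [S] bounds the integral of [u^4]. *)
pose M := 3 * C' / e; have M0 : 0 < M by rewrite divr_gt0 ?mulr_gt0.
pose S := 16 * (C' / sV0 D) * C'; have S0 : 0 < S by rewrite !mulr_gt0 ?invr_gt0.
pose t := 3 * S / e; have t0 : 0 < t by apply: divr_gt0 => //; apply: mulr_gt0.
pose A := [set x | V x <= M].
have mA : measurable A by apply: measurable_le_set => //; exact: measurable_V.
have IA : Int mu2 (\1_A).
 by apply: Int_ge0 => //; rewrite integral_indic// setIT; exact: sV_sub.
have mE r : measurable (A `\` cube r) by apply: measurableD => //; exact: measurable_cube.
have IE r : Int mu2 (\1_(A `\` cube r)).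
 apply: (Int_le IA); first exact: measurable_indic.
 move=> x; rewrite !indicE ger0_norm ?ler0n// ler_nat; case: (boolP (x \in A `\` _)) => //.
 by rewrite inE => -[/mem_set ->].
have leA (n : nat) x : `|\1_(A `\` cube n%:R) x| <= \1_A x :> R.
 rewrite !indicE ger0_norm ?ler0n// ler_nat; case: (boolP (x \in A `\` _)) => //.
 by rewrite inE => -[/mem_set ->].
have cvA : [ae x, (\1_(A `\` cube n%:R) x : R) @[n --> \oo] --> (0 : R)].
 apply: nearW => x; have [k ck] := cube_cover x; apply: cvg_near_cst; near=> n.
 rewrite indicE memNset// => -[_]; apply; apply: cubeS ck; rewrite ler_nat.
 by near: n; exact: nbhs_infty_ge.
have [_ cv] := @dominated_rint _ _ mu2 (fun n => \1_(A `\` cube n%:R)) (fun=> 0) (\1_A)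
 (fun n => measurable_indic (mE n%:R)) (measurable_cst _) IA leA cvA.
have [n [n1 hn]] : exists n : nat, (0 < n)%N /\ rint mu2 (\1_(A `\` cube n%:R)) <= e / (3 * t).
 have d0 : 0 < e / (3 * t) by rewrite divr_gt0// mulr_gt0.
 rewrite rint0 in cv; have /cvgrPdist_le/(_ _ d0) h := cv.
 have [n [h1 h2]] := filter_ex (filterI (nbhs_infty_gt 0) h).
 exists n; split => //; move: h2; rewrite /= sub0r normrN; apply: le_trans; exact: ler_norm.
exists n%:R; first by rewrite ltr0n.
move=> U EU hC; have [hm hS _] := mm_bound EU hC.
have [_ _ I2] := mm_le EU; have [I4 _] := S4_le EU; have [_ _ _ [_ IV] _] := EU.
have hC' : C <= C' by rewrite /C'; have := ler_norm C; alra.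
have m0 := mm_ge0 U; have v0 := VV_ge0 U; have a0 := AA_ge0 U.
have C00 : 0 <= C by alra.
have It : [L1 x, (1 - \1_(cube n%:R) x) * U.1.1 x ^+ 2].
 have mc := @measurable_cube n%:R.
 apply: (eq_Int _ (Int_B I2 (Int_indic mc I2))) => x; ring.
split => //.
pose G x := M^-1 * (V x * U.1.1 x ^+ 2) + (t * \1_(A `\` cube n%:R) x + t^-1 * U.1.1 x ^+ 4).
have IG : Int mu2 G by apply: Int_D; [exact: Int_Z|apply: Int_D; exact: Int_Z].
apply: (@le_trans _ _ (rint mu2 G)).
 apply: rint_le => // x; rewrite /G; set u := U.1.1 x.
 have u2 : 0 <= u ^+ 2 by exact: sqr_ge0.
 have u4 : u ^+ 4 = (u ^+ 2) ^+ 2 by rewrite -exprM.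
 have p1 : 0 <= M^-1 * (V x * u ^+ 2) by rewrite mulr_ge0 ?invr_ge0 ?(ltW M0)// mulr_ge0 ?V_ge0.
 have p2 : 0 <= t^-1 * u ^+ 4 by rewrite u4 mulr_ge0 ?invr_ge0 ?(ltW t0)// sqr_ge0.
 rewrite !indicE; have [xc|xc] := pselect (cube n%:R x).
  rewrite (mem_set xc) subrr mul0r memNset; last by case.
  by rewrite mulr0 add0r addr_ge0.
 rewrite (memNset xc) subr0 mul1r; have [xA|xA] := pselect (A x).
  rewrite mem_set// mulr1; apply: le_trans (_ : t + t^-1 * u ^+ 4 <= _); last by rewrite lerDr.
  rewrite u4; move: (u ^+ 2) u2 => y y0.
  rewrite (_ : t + _ = (t ^+ 2 + y ^+ 2) / t); last by field; rewrite gt_eqF.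
  rewrite ler_pdivlMr//.
  have := sqr_ge0 (y - t); have := sqr_ge0 y; have := sqr_ge0 t; nra.
 rewrite memNset; last by case.
 rewrite mulr0 add0r; apply: le_trans (_ : M^-1 * (V x * u ^+ 2) <= _); last by rewrite lerDl.
 rewrite ler_pdivlMl// ler_wpM2r//; move/negP: xA; rewrite -ltNge => /ltW h; exact: h.
rewrite /G rintD; [|exact: Int_Z|by apply: Int_D; exact: Int_Z].
rewrite rintD; do ?exact: Int_Z.
rewrite !rintZ// -/(VV U) -/(S4 U).
have -> : e = e / 3 + (e / 3 + e / 3) by field.
apply: lerD; [|apply: lerD].
- rewrite ler_pdivrMl// /M (_ : 3 * C' / e * (e / 3) = C'); last by field; rewrite gt_eqF.
 by rewrite -[rint _ _]/(VV U); alra.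
- apply: le_trans (ler_wpM2l (ltW t0) hn) _; apply: le_eq.
 by field; rewrite gt_eqF.
- rewrite ler_pdivrMl// /t (_ : 3 * S / e * (e / 3) = S); last by field; rewrite gt_eqF.
 apply: le_trans hS _; rewrite /S -!mulrA ler_pM2l//.
 by rewrite !mulrA; apply: ler_pM => //; [rewrite divr_ge0// ltW|rewrite ler_pM2r ?invr_gt0].
Unshelve. all: by end_near. Qed.

(** Outside a cube [tail_bound] is uniform; inside, [grid_poincare] on a fine grid leaves finitely
    many box averages, which converge along the ultrafilter. *)
Lemma L2_compact (U_ : nat -> X) (C : R) : (forall n, EE (U_ n)) ->
 (forall n, AA (U_ n) + VV (U_ n) <= C) ->
 exists s : nat -> nat, (forall k, (s k < s k.+1)%N) /\
  forall e : R, 0 < e -> exists N, forall n k, (N <= n)%N -> (N <= k)%N -> mm (U_ (s n) - U_ (s k)) <= e.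
Proof.
move=> EU HC.
have [G [UG sG]] := ultraFilterLemma (eventually_filter).
have Goo N : G [set n | (N <= n)%N] by apply: sG; exact: nbhs_infty_ge.
suff H (e : R) : 0 < e -> exists A, G A /\ forall n k, A n -> A k -> mm (U_ n - U_ k) <= e.
 have [s [sS sP]] := @ultra_subseq (fun j n k => mm (U_ n - U_ k) <= j.+1%:R^-1) G _ Goo
  (fun j => H j.+1%:R^-1 ltac:(by rewrite invr_gt0)).
 exists s; split => // e e0; exists (Num.truncn e^-1) => n k nN kN.
 apply: le_trans (sP _ _ _ nN kN) _; rewrite invf_ple ?posrE//; exact/ltW/truncnS_gt.
move=> e0; have e3 : 0 < e / 3 by rewrite divr_gt0.
have [r r0 Hr] := tail_bound (4 * C) e3.
have C0 : 0 <= C by have [] := mm_bound (EU 0%N) (HC 0%N).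
(* Differences have energy at most [4 * C], so the gradient term of [grid_poincare] is at most
   [16 * h ^+ 2 * C], below [e / 3] for this [h]. *)
pose h := Num.min 1 (e / (48 * (C + 1))).
have h0 : 0 < h by rewrite lt_min ltr01 divr_gt0// mulr_gt0//; lra.
have hh : 4 * h ^+ 2 * (4 * C) <= e / 3.
 have h1 : h <= 1 by rewrite ge_min lexx.
 have h2 : h <= e / (48 * (C + 1)) by rewrite ge_min lexx orbT.
 have h3 : h ^+ 2 <= h by rewrite expr2 ler_piMr// ltW.
 have h4 : h * (48 * (C + 1)) <= e by rewrite -ler_pdivlMr// mulr_gt0//; lra.
 have : h ^+ 2 * C <= h * (C + 1) by apply: ler_pM => //; [exact: sqr_ge0|lra].
 lra.
pose n0 := (Num.truncn (r / h)).+1.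
have rn : r < n0%:R * h by rewrite -ltr_pdivrMr//; exact: truncnS_gt.
pose T := ('I_(n0 + n0) * 'I_(n0 + n0))%type.
pose a (t : T) n := [int x, \1_(box h t) x * (U_ n).1.1 x].
have [_ hmb] : True /\ (forall n, mm (U_ n) <= C / sV0 D).
 by split => // n; have [] := mm_bound (EU n) (HC n).
have I2n n : [L1 x, (U_ n).1.1 x ^+ 2] by have [] := mm_le (EU n).
have BI (t : T) n := box_identity h0 t (measurable_u (EU n)) (I2n n).
have ab t n : `|a t n| <= h ^+ 2 + C / sV0 D.
 have [Ib rb] := Int_box h0 t; have [I1 I2 _ _] := BI t n; have [_ _ I] := mm_le (EU n).
 rewrite /a; apply: le_trans (_ : [int x, \1_(box h t) x + (U_ n).1.1 x ^+ 2] <= _); last first.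
  by rewrite rintD// rb lerD2l -bl_oneE; exact: hmb.
 apply: rint_bound; [exact: Int_D|exact: Int_mf I1|move=> x].
 rewrite indicE; case: (_ \in _) => /=; rewrite ?mul0r ?normr0 ?add0r ?sqr_ge0// mul1r.
 rewrite -[(U_ n).1.1 x ^+ 2]norm_sq; have := sqr_ge0 (`|(U_ n).1.1 x| - 1); nra.
have lim t : exists l, forall d : R, 0 < d -> G [set n | `|a t n - l| <= d].
 exact: ultra_bounded (ab t).
have [l Hl] := choice lim.
(* [d] is such that [N] boxes, each contributing at most [4 * d ^+ 2 / h ^+ 2], add up to at most
   [e / 3]. *)
pose N : R := #|{: T}|%:R; pose d := Num.sqrt (e / 3 * h ^+ 2 / (4 * (N + 1))).
have N0 : 0 <= N by [].
have h20 : 0 < h ^+ 2 by rewrite exprn_gt0.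
have d20 : 0 < e / 3 * h ^+ 2 / (4 * (N + 1)) by rewrite divr_gt0// mulr_gt0//; alra.
have d0 : 0 < d by rewrite sqrtr_gt0.
have d2 : d ^+ 2 = e / 3 * h ^+ 2 / (4 * (N + 1)) by rewrite sqr_sqrtr// ltW.
have GA (s : seq T) : G [set n | forall t, t \in s -> `|a t n - l t| <= d].
 elim: s => [|t s IH]; first by apply: filterS (@filterT _ G _) => n _ t.
 apply: filterS2 IH (Hl t d d0) => n h1 h2 t'; rewrite inE => /orP[/eqP ->//|]; exact: h1.
exists [set n | forall t, `|a t n - l t| <= d]; split.
 by apply: filterS (GA (index_enum T)) => n h1 t; apply: h1; rewrite mem_index_enum.
move=> n k An Ak; have EW := EE_B (EU n) (EU k).
have [_ _ Iw] := mm_le EW; have AVw := AAVV_sub (EU n) (EU k) (HC n) (HC k).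
have [It rt] := Hr _ EW AVw.
have gp := grid_poincare n0 h0 (EE_H1 EW).
have bi (t : T) := box_identity h0 t (measurable_u EW) Iw.
have Ibx (t : T) : [L1 x, \1_(box h t) x * (U_ n - U_ k).1.1 x ^+ 2] by have [] := bi t.
have [S1 _] := rint_sum (index_enum T) Ibx.
have S1' : [L1 x, (\sum_(t : T) \1_(box h t) x) * (U_ n - U_ k).1.1 x ^+ 2].
 by under eq_fun do rewrite mulr_suml.
have -> : e = e / 3 + (e / 3 + e / 3) by field.
rewrite /mm bl_oneE.
apply: (@le_trans _ _ ([int x, (1 - \1_(cube r) x) * (U_ n - U_ k).1.1 x ^+ 2 +
  (\sum_(t : T) \1_(box h t) x) * (U_ n - U_ k).1.1 x ^+ 2])).
 apply: rint_le => //; first exact: Int_D.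
 move=> x; rewrite -mulrDl -expr2 ler_peMl ?sqr_ge0// sum_box// indicE.
 have [xc|xc] := pselect (cube r x); last by rewrite (memNset xc) subr0 lerDl.
 rewrite mem_set// subrr add0r; case/cubeP: xc => c1 c2.
 have inb (y : R) : `|y| <= r -> - n0%:R * h <= y < n0%:R * h.
  rewrite ler_norml => /andP[y1 y2]; apply/andP; split; last exact: le_lt_trans y2 rn.
  by rewrite mulNr; apply: le_trans y1; rewrite lerN2 ltW.
 by rewrite !inb.
rewrite rintD//; apply: lerD => //; apply: le_trans gp _; apply: lerD; last first.
 apply: le_trans hh; rewrite ler_pM2l ?mulr_gt0//.
 have [_ _ J1 J2] := EE_H1 EW; have := VV_ge0 (U_ n - U_ k).
 by rewrite /grad2 rintD//; move: AVw; rewrite /AA !bl_oneE; lra.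
rewrite ler_pdivrMl//.
apply: (@le_trans _ _ (\sum_(t : T) 4 * d ^+ 2)).
 apply: ler_sum => t _; have [I1 _ _ _] := BI t n; have [I2 _ _ _] := BI t k.
 have -> : [int x, \1_(box h t) x * (U_ n - U_ k).1.1 x] = a t n - a t k.
  rewrite /a -rintB//; apply: eq_rint => x.
  by rewrite -[(U_ n - U_ k).1.1 x]/((U_ n).1.1 x - (U_ k).1.1 x) mulrBr.
 have : `|a t n - a t k| <= 2 * d.
  have -> : a t n - a t k = (a t n - l t) - (a t k - l t) by ring.
  by apply: le_trans (ler_normB _ _) _; have := An t; have := Ak t; alra.
 rewrite -[(a t n - a t k) ^+ 2]norm_sq => h1.
 have -> : 4 * d ^+ 2 = (2 * d) ^+ 2 by ring.
 by rewrite ler_sqr ?nnegrE// mulr_ge0// ltW.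
rewrite sumr_const -[_ *+ _]mulr_natr -/N d2.
have -> : 4 * (e / 3 * h ^+ 2 / (4 * (N + 1))) * N = (h ^+ 2 * (e / 3)) * (N / (N + 1)).
 by field; rewrite gt_eqF//; lra.
rewrite ler_piMr//; first by rewrite mulr_ge0 ?ltW.
by rewrite ler_pdivrMr ?mul1r; alra.
Qed.

End compactness.

(** * Differences of almost critical points *)

Section monotonicity_estimate.
Implicit Types (U W Y Z : X) (f g h u : pt -> R) (r mu nu s t : R).

Definition n1 f : R := [int x, `|f x|].

Lemma n1_ge0 f : 0 <= n1 f. Proof. by apply: rint_ge0 => x. Qed.

(** [K1] is bounded by a sum of weights, not only by their product: each term keeps one unweighted
    norm, the one that becomes small under [L^2] convergence. *)
Lemma K1_form_L1 f h : dens f -> dens h -> `|qf K1 f h| <= n1 f * nL h + nL f * n1 h.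
Proof.
move=> df dh; have [IK _] := K1_form df dh.
have If := Int_abs (dens_Int1 df); have Ih := Int_abs (dens_Int1 dh).
have [_ Lf _] := df; have [_ Lh _] := dh.
have [I1 e1] := tensor_int If Lh; have [I2 e2] := tensor_int Lf Ih.
rewrite /n1 /nL -e1 -e2 -rintD//; apply: rint_bound; [exact: Int_D|exact: Int_mf IK|].
move=> z; rewrite !normrM (ger0_norm (K1_ge0 _ _)).
have h1 := K1_le z.1 z.2; have h2 : K1 z.1 z.2 <= LL z.1 + LL z.2 by rewrite /LL; alra.
have fh : 0 <= `|f z.1| * `|h z.2| by rewrite mulr_ge0.
apply: le_trans (ler_wpM2r fh h2) _; apply: le_eq; ring.
Qed.

Lemma n1_pr U W : EE U -> EE W -> n1 (pr U W) ^+ 2 <= mm U * mm W.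
Proof.
move=> EU EW.
have F (Y : X) : EE Y -> F2 mu2 one (fun x => `|Y.1.1 x|).
 move=> EY; have /F2_one[mW IW] := EE_F2u EY; apply/F2_one; split; first exact: measurableT_comp.
 by apply: (eq_Int _ IW) => x; rewrite norm_sq.
have := bl_CS measurable_one one_ge0 (F _ EU) (F _ EW).
have e (Y : X) : bl0 (fun x => `|Y.1.1 x|) (fun x => `|Y.1.1 x|) = mm Y.
 by rewrite /mm !bl_oneE; apply: eq_rint => x; rewrite -!expr2 norm_sq.
rewrite !e; apply: le_trans; rewrite bl_oneE /n1.
by apply: le_eq; congr (rint _ _ ^+ 2); apply/funext => x; rewrite /pr normrM.
Qed.

Lemma n2_pr U W (x y : R) : EE U -> EE W -> 0 <= x -> 0 <= y -> S4 U <= x ^+ 2 -> S4 W <= y ^+ 2 ->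
 n2 (pr U W) <= x * y.
Proof.
move=> EU EW x0 y0 hx hy; have [_ _ h] := dens_uw EU EW; apply: sqr_le; first exact: mulr_ge0.
by apply: le_trans h _; rewrite exprMn ler_pM ?S4_ge0.
Qed.

Lemma mm_NN U : EE U -> mm U <= NN U.
Proof.
move=> EU; have [h _ _] := mm_le EU; apply: le_trans h _.
by rewrite /NN lerDr addr_ge0 ?AA_ge0 ?VV_ge0.
Qed.

Lemma BL_NN U : BL U <= NN U.
Proof. by rewrite /NN lerDr addr_ge0 ?AA_ge0 ?VV_ge0. Qed.

Lemma pow_mono_bound U W Z : EE U -> EE W -> EE Z -> U.1.1 - W.1.1 = Z.1.1 ->
 `|[int x, spow p (U.1.1 x) * Z.1.1 x] - [int x, spow p (W.1.1 x) * Z.1.1 x]| <=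
  3 * (4 * mm Z + 2 * n2 (pr U Z) + 2 * n2 (pr W Z)).
Proof.
move=> EU EW EZ E; have [J1 _] := spow_term EU EZ; have [J2 _] := spow_term EW EZ.
have [_ _ Iz] := mm_le EZ; have [_ _ I1] := dens_pr EU EZ; have [_ _ I2] := dens_pr EW EZ.
pose G x := 3 * (4 * Z.1.1 x ^+ 2 + 2 * pr U Z x ^+ 2 + 2 * pr W Z x ^+ 2).
have IG : Int mu2 G by apply: Int_Z; apply: Int_D; [apply: Int_D|]; exact: Int_Z.
rewrite -rintB//; apply: le_trans (rint_bound (g := G) IG _ _) _.
- exact: Int_mf (Int_B J1 J2).
- move=> x; rewrite -mulrBl normrM.
 have Ex : U.1.1 x - W.1.1 x = Z.1.1 x by rewrite -E.
 have h := spow_lip (U.1.1 x) (W.1.1 x) p2; rewrite Ex in h.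
 apply: le_trans (ler_wpM2r (normr_ge0 _) h) _.
 rewrite -[_ * `|Z.1.1 x| * `|Z.1.1 x|]mulrA -expr2 norm_sq.
 have h2 := pow_sum_le (U.1.1 x) (W.1.1 x).
 rewrite /G /pr !exprMn; have z0 := sqr_ge0 (Z.1.1 x).
 have pp0 := powR_ge0 (`|U.1.1 x| + `|W.1.1 x|) (p - 2).
 move: (_ `^ _) (U.1.1 x ^+ 2) (W.1.1 x ^+ 2) (Z.1.1 x ^+ 2) z0 h2 pp0 => t u w z z0 h2 t0.
 have pr3 : (p - 1) * t <= 3 * (2 * (1 + u) + 2 * (1 + w)).
  by apply: ler_pM => //; have := p2; have := p4; alra.
 apply: le_trans (ler_wpM2r z0 pr3) _; apply: le_eq; ring.
rewrite /G rintZ; last by apply: Int_D; [apply: Int_D|]; exact: Int_Z.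
rewrite rintD; [|by apply: Int_D; exact: Int_Z|exact: Int_Z].
rewrite rintD; do ?exact: Int_Z.
rewrite !rintZ// /mm bl_oneE /n2; by [].
Qed.

Definition CM r : R := c2 * (kap * (32 * r ^+ 3) + (8 * r ^+ 3 + kap * (128 * r ^+ 3))) +
 b * (3 * (8 * r + 128 * r ^+ 3)) + 2 * r ^+ 2.

(** With [Z = U - W] and [S = U + W], the identities [U Z = Z^2 + W Z] and [U^2 = Z S + W^2] isolate
    the form at [(U^2, Z^2)], whose [K1] part is nonnegative. *)
Lemma quartic_difference U W : EE U -> EE W -> Q4 U U U (U - W) - Q4 W W W (U - W) =
 (qf K1 (pr U U) (pr (U - W) (U - W)) - qf K2 (pr U U) (pr (U - W) (U - W))) +
 q (pr (U - W) (U + W)) (pr W (U - W)).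
Proof.
move=> EU EW; have EZ := EE_B EU EW; have ES := EE_D EU EW.
have dU := dens_pr EU EU; have dZ := dens_pr EZ EZ; have dW := dens_pr EW EW.
have dWZ := dens_pr EW EZ; have dZS := dens_pr EZ ES.
have [_ <-] := q_Int dU dZ; rewrite /Q4.
have e1 : pr U (U - W) = fun x => pr (U - W) (U - W) x + pr W (U - W) x.
 apply/funext => x; rewrite /pr -[(U - W).1.1 x]/(U.1.1 x - W.1.1 x); ring.
have e2 : pr U U = fun x => pr (U - W) (U + W) x + pr W W x.
 apply/funext => x; rewrite /pr -[(U - W).1.1 x]/(U.1.1 x - W.1.1 x) -[(U + W).1.1 x]/(U.1.1 x + W.1.1 x); ring.
rewrite {1}e1 qDr// {2}e2 qDl//; ring.
Qed.

Let cm_arith (P Q S d e : R) : 0 <= P -> 0 <= Q -> 0 <= S -> 0 <= d -> 0 <= e ->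
 d * S + P * e + Q * e <= (P + Q + S) * (d + e).
Proof.
move=> P0 Q0 S0 d0 e0; have := mulr_ge0 P0 d0; have := mulr_ge0 Q0 d0; have := mulr_ge0 S0 e0; lra.
Qed.

Let final_arith (z t1 t2 c k1 k2 k3 k4 T S Q B : R) : 0 <= c -> `|t1| <= T -> `|t2| <= S ->
 c * (`|k2| + (`|k3| + `|k4|)) <= Q -> T + Q + S <= B ->
 z + c * k1 <= z + t1 + c * (k1 - k2 + (k3 - k4)) - t2 + B.
Proof.
move=> c0 h1 h2 h3 h4.
have a1 := ler_norm (- t1); have a2 := ler_norm t2; rewrite normrN in a1.
have a3 := ler_wpM2l c0 (ler_norm k2); have a4 := ler_wpM2l c0 (ler_norm (- k3)).
have a5 := ler_wpM2l c0 (ler_norm k4); rewrite normrN in a4; lra.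
Qed.

(** The [K1] term stays on the left, as it will control the weighted mass of the difference. On the
    right, everything apart from the derivatives carries either the change of parameter or a factor
    [L^2] norm of [U - W]. *)
Lemma monotone_estimate r mu nu U W : EE U -> EE W -> nrm U <= r -> nrm W <= r ->
 AA (U - W) + VV (U - W) + mu * BL (U - W) + c2 * qf K1 (pr U U) (pr (U - W) (U - W)) <=
 dJm mu U (U - W) - dJm nu W (U - W) + CM r * (`|mu - nu| + Num.sqrt (mm (U - W))).
Proof.
move=> EU EW Ur Wr; have EZ := EE_B EU EW; have ES := EE_D EU EW.
have r0 : 0 <= r by exact: le_trans (nrm_ge0 U) Ur.
have c20 := c2_gt0; have k0 := kap_ge0; have bb := b0.
set Z := U - W in EZ *; set eta := Num.sqrt (mm Z).
have eta0 : 0 <= eta by exact: sqrtr_ge0.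
have eta2 : eta ^+ 2 = mm Z by rewrite sqr_sqrtr// mm_ge0.
have Zr : nrm Z <= 2 * r.
 have -> : Z = U + (-1) *: W by rewrite scaleN1r.
 apply: le_trans (nrm_D EU (EE_Z (-1) EW)) _; rewrite nrm_Z// normrN1 mul1r; lra.
have Sr : nrm (U + W) <= 2 * r by apply: le_trans (nrm_D EU EW) _; lra.
have NNr Y t : nrm Y <= t -> NN Y <= t ^+ 2.
 by move=> h; apply: NN_le_r => //; exact: le_trans (nrm_ge0 Y) h.
have etar : eta <= 2 * r.
 apply: sqr_le; first by rewrite mulr_ge0.
 by rewrite eta2; apply: le_trans (mm_NN EZ) (NNr _ _ Zr).
have S4r Y t : EE Y -> 0 <= t -> nrm Y <= t -> S4 Y <= (4 * t ^+ 2) ^+ 2.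
 move=> EY t0 h; apply: le_trans (S4_NN EY) _; rewrite exprMn (_ : 4 ^+ 2 = 16); last by ring.
 by rewrite ler_pM2l// ler_sqr ?nnegrE ?NN_ge0 ?sqr_ge0// NNr.
have r20 : 0 <= r ^+ 2 by exact: sqr_ge0.
(* [S4 Z] is at most [16 * mm Z * AA Z], so [L^4] norms also gain from the small mass. *)
have S4Z : S4 Z <= (8 * r * eta) ^+ 2.
 have [_ h] := S4_le EZ; apply: le_trans h _; rewrite !exprMn eta2.
 have aZ : AA Z <= 4 * r ^+ 2.
  apply: le_trans (_ : NN Z <= _); first by rewrite /NN -addrA lerDl addr_ge0 ?VV_ge0 ?BL_ge0.
  by have := NNr _ _ Zr; rewrite exprMn; lra.
 have mz := mm_ge0 Z; have : mm Z * AA Z <= mm Z * (4 * r ^+ 2) by rewrite ler_wpM2l.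
 by rewrite -mulrA; lra.
have x0 : 0 <= 8 * r * eta by rewrite !mulr_ge0.
have r3 : 0 <= r ^+ 3 by exact: exprn_ge0.
have re0 : 0 <= r ^+ 3 * eta by exact: mulr_ge0.
have nUZ : n2 (pr U Z) <= 32 * r ^+ 3 * eta.
 have := n2_pr EU EZ _ x0 (S4r _ _ EU r0 Ur) S4Z; move=> /(_ (mulr_ge0 _ r20))/le_trans; apply => //.
 by apply: le_eq; ring.
have nWZ : n2 (pr W Z) <= 32 * r ^+ 3 * eta.
 have := n2_pr EW EZ _ x0 (S4r _ _ EW r0 Wr) S4Z; move=> /(_ (mulr_ge0 _ r20))/le_trans; apply => //.
 by apply: le_eq; ring.
have r2' : 0 <= 2 * r by rewrite mulr_ge0.
have nZS : n2 (pr Z (U + W)) <= 128 * r ^+ 3 * eta.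
 have := n2_pr EZ ES x0 _ S4Z (S4r _ _ ES r2' Sr); move=> /(_ (mulr_ge0 _ (sqr_ge0 _)))/le_trans; apply => //.
 by apply: le_eq; ring.
have q2a : `|qf K2 (pr U U) (pr Z Z)| <= kap * (32 * r ^+ 3 * eta).
 have h1 : n2 (pr U U) <= (4 * r ^+ 2) ^+ 2.
  by rewrite [leRHS]expr2; apply: n2_pr; rewrite ?mulr_ge0// S4r.
 have h2 : n2 (pr Z Z) <= (8 * r * eta) ^+ 2.
  by rewrite [leRHS]expr2; apply: n2_pr.
 have := q2_bound (dens_pr EU EU) (dens_pr EZ EZ) (mulr_ge0 (ler0n _ 4) r20) x0 h1 h2.
 by move=> /le_trans; apply; apply: le_eq; ring.
have q2b : `|qf K2 (pr Z (U + W)) (pr W Z)| <= kap * (128 * r ^+ 3 * eta).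
 set t := 128 * r ^+ 3 * eta; have t0 : 0 <= t by rewrite /t -mulrA mulr_ge0.
 have h1 : n2 (pr Z (U + W)) <= Num.sqrt t ^+ 2 by rewrite sqr_sqrtr.
 have h2 : n2 (pr W Z) <= Num.sqrt t ^+ 2.
  rewrite sqr_sqrtr//; apply: le_trans nWZ _; rewrite /t -!mulrA ler_wpM2r//; alra.
 have := q2_bound (dens_pr EZ ES) (dens_pr EW EZ) (sqrtr_ge0 t) (sqrtr_ge0 t) h1 h2.
 by rewrite -expr2 sqr_sqrtr.
have n1le Y Y' t : EE Y -> EE Y' -> nrm Y' <= t -> mm Y = eta ^+ 2 -> n1 (pr Y Y') <= eta * t.
 move=> EY EY' h e; apply: sqr_le; first by rewrite mulr_ge0// (le_trans (nrm_ge0 Y') h).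
 apply: le_trans (n1_pr EY EY') _; rewrite e exprMn ler_wpM2l ?sqr_ge0//.
 exact: le_trans (mm_NN EY') (NNr _ _ h).
have q1b : `|qf K1 (pr Z (U + W)) (pr W Z)| <= 8 * r ^+ 3 * eta.
 apply: le_trans (K1_form_L1 (dens_pr EZ ES) (dens_pr EW EZ)) _.
 have a1 : n1 (pr Z (U + W)) <= eta * (2 * r) by exact: n1le.
 have a2 : n1 (pr W Z) <= eta * r by rewrite prC; exact: n1le.
 have a3 : nL (pr W Z) <= r * (2 * r) by apply: le_trans (nL_nrm EW EZ) _; rewrite ler_pM ?nrm_ge0.
 have a4 : nL (pr Z (U + W)) <= 2 * r * (2 * r) by apply: le_trans (nL_nrm EZ ES) _; rewrite ler_pM ?nrm_ge0.
 have -> : 8 * r ^+ 3 * eta = eta * (2 * r) * (r * (2 * r)) + 2 * r * (2 * r) * (eta * r) by ring.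
 by apply: lerD; apply: ler_pM; rewrite ?n1_ge0 ?nL_ge0.
have hp : `|[int x, spow p (U.1.1 x) * Z.1.1 x] - [int x, spow p (W.1.1 x) * Z.1.1 x]| <=
  3 * (8 * r + 128 * r ^+ 3) * eta.
 have := @pow_mono_bound U W Z EU EW EZ erefl; move=> /le_trans; apply.
 have mz : mm Z <= 2 * r * eta by rewrite -eta2 expr2 ler_wpM2r.
 alra.
have hL : `|bl mu2 LL W.1.1 Z.1.1| <= 2 * r ^+ 2.
 have [_ _ _ h] := bl_nrm EW EZ; apply: le_trans h _.
 have -> : 2 * r ^+ 2 = r * (2 * r) by ring.
 by rewrite ler_pM ?nrm_ge0.
have qd := quartic_difference EU EW; rewrite -/Z in qd.
have [_ qe] := q_Int (dens_pr EZ ES) (dens_pr EW EZ); rewrite qe in qd.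
have [G1 A1 B1 V1 L1] := EU; have [G2 A2 B2 V2 L2] := EW; have [G3 A3 B3 V3 L3] := EZ.
have e1 := bl_lin measurable_one one_ge0 1 (-1) A1 A2 A3.
have e2 := bl_lin measurable_one one_ge0 1 (-1) B1 B2 B3.
have e3 := bl_lin measurable_V V_ge0 1 (-1) V1 V2 V3.
have e4 := bl_lin measurable_LL LL_ge0 1 (-1) L1 L2 L3.
rewrite !funB11 !mul1r !mulN1r in e1 e2 e3 e4.
have ed : dJm mu U Z - dJm nu W Z = AA Z + VV Z + mu * BL Z + (mu - nu) * bl mu2 LL W.1.1 Z.1.1 +
  c2 * (Q4 U U U Z - Q4 W W W Z) - b * ([int x, spow p (U.1.1 x) * Z.1.1 x] - [int x, spow p (W.1.1 x) * Z.1.1 x]).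
 rewrite /dJm /DJ /DB /AA /VV /BL -/c2.
 rewrite [bl0 Z.1.2 Z.1.2]e1 [bl0 Z.2 Z.2]e2 [bl mu2 V Z.1.1 Z.1.1]e3 [bl mu2 LL Z.1.1 Z.1.1]e4.
 rewrite ![bl mu2 _ Z.1.2 _]blC ![bl mu2 _ Z.2 _]blC ![bl mu2 _ Z.1.1 _]blC.
 move: (bl _ _ U.1.2 _) (bl _ _ W.1.2 _) (bl _ _ U.2 _) (bl _ _ W.2 _) => t1 t2 t3 t4.
 move: (bl _ _ U.1.1 _) (bl _ _ W.1.1 _) (bl _ _ U.1.1 _) (bl _ _ W.1.1 _) (Q4 _ _ _ _) (Q4 _ _ _ _) (rint _ _) (rint _ _) => t5 t6 t7 t8 t9 s1 s2 s3.
 ring.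
rewrite ed qd.
have hmu : `|(mu - nu) * bl mu2 LL W.1.1 Z.1.1| <= `|mu - nu| * (2 * r ^+ 2).
 by rewrite normrM ler_wpM2l.
have hb : `|b * ([int x, spow p (U.1.1 x) * Z.1.1 x] - [int x, spow p (W.1.1 x) * Z.1.1 x])| <=
  b * (3 * (8 * r + 128 * r ^+ 3) * eta).
 by rewrite normrM (gtr0_norm bb) ler_pM2l.
have hCM : `|mu - nu| * (2 * r ^+ 2) + c2 * (kap * (32 * r ^+ 3 * eta) + (8 * r ^+ 3 * eta + kap * (128 * r ^+ 3 * eta))) +
  b * (3 * (8 * r + 128 * r ^+ 3) * eta) <= CM r * (`|mu - nu| + eta).
 have p1 : 0 <= c2 * (kap * (32 * r ^+ 3) + (8 * r ^+ 3 + kap * (128 * r ^+ 3))).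
  by apply: mulr_ge0; [exact: ltW|apply: addr_ge0; [|apply: addr_ge0]; rewrite ?mulr_ge0].
 have p2' : 0 <= b * (3 * (8 * r + 128 * r ^+ 3)).
  by apply: mulr_ge0; [exact: ltW|rewrite mulr_ge0// addr_ge0// mulr_ge0].
 have := cm_arith p1 p2' (mulr_ge0 (ler0n _ 2) r20) (normr_ge0 (mu - nu)) eta0.
 rewrite -/(CM r); apply: le_trans.
 by apply: le_eq; ring.
have hc : c2 * (`|qf K2 (pr U U) (pr Z Z)| + (`|qf K1 (pr Z (U + W)) (pr W Z)| +
  `|qf K2 (pr Z (U + W)) (pr W Z)|)) <=
  c2 * (kap * (32 * r ^+ 3 * eta) + (8 * r ^+ 3 * eta + kap * (128 * r ^+ 3 * eta))).
 by rewrite ler_pM2l//; apply: lerD => //; exact: lerD.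
exact: (final_arith _ _ (ltW c20) hmu hb hc hCM).
Qed.

(** For [x] in a bounded set, [|y| <= |x - y| + 2 r], so the logarithmic weight at [y] exceeds
    [K1 x y] by at most a constant. *)
Lemma LL_K1 (r : R) x y : 0 <= r -> cube r x -> LL y - (1 + ln (2 + 2 * r)) <= K1 x y.
Proof.
move=> r0 /cubeP[x1 x2].
have ex : enorm x <= 2 * r.
 rewrite -ler_sqr ?nnegrE ?enorm_ge0 ?mulr_ge0// enorm_sq.
 rewrite -[x.1 ^+ 2]norm_sq -[x.2 ^+ 2]norm_sq.
 by have := normr_ge0 x.1; have := normr_ge0 x.2; nra.
set d := enorm (psub x y); have d0 : 0 <= d by exact: enorm_ge0.
have ey : enorm y <= d + 2 * r.
 have -> : enorm y = enorm (psub x (psub x y)).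
  by congr enorm; rewrite /psub /= !subKr; case: (y).
 apply: le_trans (enorm_psub _ _) _; rewrite addrC lerD2l//.
pose M := Num.max 1 d; have M1 : 1 <= M by rewrite le_max lexx.
have Md : d <= M by rewrite le_max lexx orbT.
have lM : ln M = K1 x y.
 rewrite /M /K1 /K0 -/d; have [h|h] := leP d 1.
  by rewrite ln1 (max_idPr _)// ln_le0.
 by rewrite (max_idPl _)// ln_ge0// ltW.
rewrite -lM /LL /lnorm opprD addrACA subrr add0r lerBlDr -lnM ?posrE; try lra.
have e0 := enorm_ge0 y.
rewrite ler_ln ?posrE; [nra|alra|]; apply: mulr_gt0; alra.
Qed.

(** A definite part of the mass of [U0], hence of any [F] close to it in [L^2], lies in a fixed
    cube; integrating [LL_K1] over this mass recovers the weighted norm of [Z] up to a multiple of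
    its mass. *)
Lemma K1_coercive U0 (m0 : R) : EE U0 -> 0 < m0 -> m0 <= mm U0 -> exists2 C, 0 <= C &
 forall F Z, EE F -> EE Z -> mm (F - U0) <= m0 / 8 ->
  m0 / 8 * BL Z - C * mm F * mm Z <= qf K1 (pr F F) (pr Z Z).
Proof.
move=> E0 m00 hm; have [_ _ I0] := mm_le E0.
have [r r0 hr] : exists2 r, 0 <= r & m0 / 2 <= [int x, \1_(cube r) x * U0.1.1 x ^+ 2].
 have mc r := @measurable_cube r.
 have mi (n : nat) : mfun (fun x => \1_(cube n%:R) x * U0.1.1 x ^+ 2).
  by apply: measurable_funM; [exact: measurable_indic|exact: Int_mf I0].
 have le (n : nat) x : `|\1_(cube n%:R) x * U0.1.1 x ^+ 2| <= U0.1.1 x ^+ 2.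
  by rewrite indicE; case: (_ \in _); rewrite ?mul1r ?mul0r ?normr0 ?sqr_ge0// ger0_norm// sqr_ge0.
 have cv : [ae x, \1_(cube n%:R) x * U0.1.1 x ^+ 2 @[n --> \oo] --> U0.1.1 x ^+ 2].
  apply: nearW => x; have [k ck] := cube_cover x; apply: cvg_near_cst; near=> n.
  rewrite indicE mem_set ?mul1r//; apply: cubeS ck; rewrite ler_nat; near: n; exact: nbhs_infty_ge.
 have [_ h] := dominated_rint mi (Int_mf I0) I0 le cv.
 have : [int x, U0.1.1 x ^+ 2] > m0 / 2.
  by apply: (@lt_le_trans _ _ m0); [lra|move: hm; rewrite /mm bl_oneE].
 move=> h2; have h3 : \forall n \near \oo, m0 / 2 < [int x, \1_(cube n%:R) x * U0.1.1 x ^+ 2].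
  exact: (cvgr_gt _ h _ h2).
 have [n hn] := filter_ex h3; exists n%:R => //; exact: ltW hn.
have l0 : 0 <= 1 + ln (2 + 2 * r) by rewrite addr_ge0// ln_ge0//; lra.
exists (1 + ln (2 + 2 * r)) => // F Z EF EZ hF.
have [_ _ IF] := mm_le EF; have [_ _ IZ] := mm_le EZ; have [_ _ ID] := mm_le (EE_B EF E0).
have mc := @measurable_cube r.
have Ic f : Int mu2 f -> [L1 x, \1_(cube r) x * f x].
 by move=> If; apply: (eq_Int _ (Int_indic mc If)) => x; rewrite mulrC.
set m := [int x, \1_(cube r) x * F.1.1 x ^+ 2].
(* From [u0^2 <= 2 f^2 + 2 (f - u0)^2] on the cube: [m0 / 2 <= 2 * m + 2 * (m0 / 8)]. *)
have mle : m0 / 8 <= m.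
 have : [int x, \1_(cube r) x * U0.1.1 x ^+ 2] <=
   [int x, 2 * (\1_(cube r) x * F.1.1 x ^+ 2) + 2 * (F - U0).1.1 x ^+ 2].
  apply: rint_le; [exact: Ic|by apply: Int_D; apply: Int_Z => //; exact: Ic|move=> x].
  rewrite -[(F - U0).1.1 x]/(F.1.1 x - U0.1.1 x) indicE; case: (_ \in _) => /=.
   rewrite !mul1r; have := sqr_ge0 (2 * F.1.1 x - U0.1.1 x); nra.
  by rewrite !mul0r mulr0 add0r mulr_ge0// sqr_ge0.
 rewrite rintD; [|by apply: Int_Z; exact: Ic|exact: Int_Z].
 rewrite !rintZ//; last exact: Ic.
 by move: hF; rewrite /mm bl_oneE -/m; move: hr; alra.
have mF : m <= mm F.
 rewrite /m /mm bl_oneE; apply: rint_le; [exact: Ic|exact: IF|move=> x].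
 by rewrite indicE; case: (_ \in _); rewrite ?mul1r ?mul0r// -expr2 sqr_ge0.
have [_ _ _ _ [_ IL]] := EZ.
have IT : [L1 y, LL y * Z.1.1 y ^+ 2 - (1 + ln (2 + 2 * r)) * Z.1.1 y ^+ 2].
 by apply: Int_B => //; exact: Int_Z.
have [It et] := tensor_int (Ic _ IF) IT.
have [IK _] := K1_form (dens_pr EF EF) (dens_pr EZ EZ).
apply: le_trans (_ : m * (BL Z - (1 + ln (2 + 2 * r)) * mm Z) <= _).
 have b0 := BL_ge0 Z; have z0 := mm_ge0 Z; move: (1 + ln _) l0 => l l0.
 rewrite mulrBr; apply: lerD; first by rewrite ler_wpM2r.
 rewrite lerN2 mulrA ler_wpM2r// mulrC ler_wpM2l//.
have -> : m * (BL Z - (1 + ln (2 + 2 * r)) * mm Z) =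
  m * [int y, LL y * Z.1.1 y ^+ 2 - (1 + ln (2 + 2 * r)) * Z.1.1 y ^+ 2].
 by rewrite rintB// ?rintZ//; [rewrite /mm bl_oneE /BL bl_sqE|exact: Int_Z].
rewrite -et; apply: rint_le => // z; rewrite /pr -!expr2.
have f0 := sqr_ge0 (F.1.1 z.1); have z0 := sqr_ge0 (Z.1.1 z.2); have fz := mulr_ge0 f0 z0.
rewrite indicE -mulrBl; have [c|c] := pselect (cube r z.1); last first.
 by rewrite memNset// !mul0r mulr_ge0// K1_ge0.
rewrite mem_set// mul1r mulrCA; apply: ler_wpM2r => //; exact: LL_K1.
Unshelve. all: by end_near. Qed.

End monotonicity_estimate.

(** * Sequences tending to zero *)

Section small_sequences.
Implicit Types (a c : nat -> R).

(** An upper bound only: meant for sequences that are nonnegative for another reason. *)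
Definition small a := forall e : R, 0 < e -> exists N, forall n, (N <= n)%N -> a n <= e.
Definition small2 (a : nat -> nat -> R) := forall e : R, 0 < e ->
 exists N, forall n k, (N <= n)%N -> (N <= k)%N -> a n k <= e.

Lemma small_sub a (s : nat -> nat) : (forall k, (s k < s k.+1)%N) -> small a -> small (fun n => a (s n)).
Proof.
move=> sS H e /H[N HN]; exists N => n nN; apply: HN; apply: leq_trans nN _.
exact: increasing_subseq_ge.
Qed.

Lemma small_D a c : small a -> small c -> small (fun n => a n + c n).
Proof.
move=> H1 H2 e e0; have e2 : 0 < e / 2 by lra.
have [N1 h1] := H1 _ e2; have [N2 h2] := H2 _ e2; exists (maxn N1 N2) => n.
rewrite geq_max => /andP[/h1 a1 /h2 a2]; lra.
Qed.

Lemma small_Z (C : R) a : 0 <= C -> (forall n, 0 <= a n) -> small a -> small (fun n => C * a n).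
Proof.
move=> C0 a0 H e e0; have d0 : 0 < e / (C + 1) by rewrite divr_gt0//; lra.
have [N h] := H _ d0; exists N => n /h h'.
apply: le_trans (_ : (C + 1) * a n <= _); first by rewrite ler_wpM2r// lerDl.
by rewrite mulrC -ler_pdivlMr//; lra.
Qed.

Lemma sqrt_le (x e : R) : 0 < e -> x <= e ^+ 2 -> Num.sqrt x <= e.
Proof. by move=> e0 /ler_wsqrtr; rewrite sqrtr_sqr gtr0_norm. Qed.

Lemma small_sqrt a : small a -> small (fun n => Num.sqrt (a n)).
Proof.
move=> H e e0; have [N h] := H (e ^+ 2) (exprn_gt0 2 e0); exists N => n /h h'.
exact: sqrt_le.
Qed.

Lemma small_le a c : (forall n, a n <= c n) -> small c -> small a.
Proof. by move=> h H e /H[N HN]; exists N => n /HN; apply: le_trans. Qed.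

End small_sequences.

(** * Completeness and convergence of Palais-Smale sequences *)

Section completeness.
Implicit Types (U W : X) (f g w : pt -> R).

(** Fatou at fixed [n] along the almost everywhere convergent subsequence. The limit [f] is given
    beforehand, so that one function serves all weights. *)
Lemma complete_weight w (f_ : nat -> pt -> R) f (s : nat -> nat) :
 mfun w -> (forall x, 0 <= w x) -> (forall n, F2 mu2 w (f_ n)) -> mfun f ->
 (forall k, (s k < s k.+1)%N) -> [ae x, f_ (s k) x @[k --> \oo] --> f x] ->
 small2 (fun n k => bl mu2 w (f_ n - f_ k) (f_ n - f_ k)) ->
 F2 mu2 w f /\ small (fun n => bl mu2 w (f_ n - f) (f_ n - f)).
Proof.
move=> mw w0 Ff mf sS cv H.
have mf_ n : mfun (f_ n) by case: (Ff n).
have sub f' g : F2 mu2 w f' -> F2 mu2 w g -> F2 mu2 w (f' - g).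
 by move=> h1 h2; have := F2_lin mw w0 1 (-1) h1 h2; rewrite funB11.
have key (e : R) : 0 < e -> exists N, forall n, (N <= n)%N -> F2 mu2 w (f_ n - f) /\ bl mu2 w (f_ n - f) (f_ n - f) <= e.
 move=> /H[N HN]; exists N => n nN.
 have [] := @fatou_rint_near _ _ mu2 (fun k x => w x * (f_ n x - f_ (s k) x) ^+ 2) (fun x => w x * (f_ n x - f x) ^+ 2) e.
 - by move=> k; have [_] := sub _ _ (Ff n) (Ff (s k)).
 - by apply: measurable_funM => //; apply: measurable_funX; exact: measurable_funB.
 - by move=> k x; rewrite mulr_ge0// sqr_ge0.
 - by move=> x; rewrite mulr_ge0// sqr_ge0.
 - exists N => // k /= kN; apply: HN => //; exact: leq_trans kN (increasing_subseq_ge sS k).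
 - apply: filterS cv => x cvx; apply: cvgM; first exact: cvg_cst.
  have h : f_ n x - f_ (s k) x @[k --> \oo] --> f_ n x - f x by apply: cvgB => //; exact: cvg_cst.
  by rewrite /=; under eq_fun do rewrite expr2; rewrite expr2; exact: cvgM.
 by move=> h1 h2; split => //; split => //; exact: measurable_funB.
split; last by move=> e /key[N HN]; exists N => n /HN[].
have [N HN] := key 1 ltr01; have [h1 _] := HN N (leqnn N).
have := sub _ _ (Ff N) h1; congr (F2 _ _ _); apply/funext => x.
by rewrite -[(f_ N - (f_ N - f)) x]/(f_ N x - (f_ N x - f x)) subKr.
Qed.

(** Riesz-Fischer for the function and its two derivatives separately; [WG_limit] shows that the
    limits still form a weak gradient. *)
Lemma E_complete (U_ : nat -> X) : (forall n, EE (U_ n)) -> small2 (fun n k => NN (U_ n - U_ k)) ->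
 exists2 U, EE U & small (fun n => NN (U_ n - U)).
Proof.
move=> EU H.
have F1 n : F2 mu2 one (U_ n).1.2 by case: (EU n).
have F2' n : F2 mu2 one (U_ n).2 by case: (EU n).
have Fu n : F2 mu2 one (U_ n).1.1 by apply: EE_F2u (EU n).
have FV n : F2 mu2 V (U_ n).1.1 by case: (EU n).
have FL n : F2 mu2 LL (U_ n).1.1 by case: (EU n).
have le n k := (energy_parts (U_ n - U_ k)).2.
have small2_le (a : nat -> nat -> R) : (forall n k, a n k <= NN (U_ n - U_ k)) -> small2 a.
 by move=> h e /H[N HN]; exists N => n k nN kN; exact: le_trans (h n k) (HN n k nN kN).
have S1 : small2 (fun n k => bl0 ((U_ n).1.2 - (U_ k).1.2) ((U_ n).1.2 - (U_ k).1.2)).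
 by apply: small2_le => n k; case: (le n k).
have S2 : small2 (fun n k => bl0 ((U_ n).2 - (U_ k).2) ((U_ n).2 - (U_ k).2)).
 by apply: small2_le => n k; case: (le n k).
have S3 : small2 (fun n k => bl mu2 V ((U_ n).1.1 - (U_ k).1.1) ((U_ n).1.1 - (U_ k).1.1)).
 by apply: small2_le => n k; case: (le n k).
have S4' : small2 (fun n k => bl mu2 LL ((U_ n).1.1 - (U_ k).1.1) ((U_ n).1.1 - (U_ k).1.1)).
 by apply: small2_le => n k; case: (le n k).
have S5 : small2 (fun n k => bl0 ((U_ n).1.1 - (U_ k).1.1) ((U_ n).1.1 - (U_ k).1.1)).
 by apply: small2_le => n k; exact: mm_NN (EE_B (EU n) (EU k)).
have RF (f_ : nat -> pt -> R) : (forall n, F2 mu2 one (f_ n)) ->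
  small2 (fun n k => bl0 (f_ n - f_ k) (f_ n - f_ k)) ->
  exists f, exists s : nat -> nat, [/\ mfun f, (forall k, (s k < s k.+1)%N) &
   [ae x, f_ (s k) x @[k --> \oo] --> f x]].
 move=> Ff S; apply: riesz_fischer.
 - by move=> n; case: (Ff n).
 - move=> n k; have [_] := F2_lin measurable_one one_ge0 1 (-1) (Ff n) (Ff k).
  by congr Int; apply/funext => x; rewrite !mul1r mulN1r.
 - move=> e /S[N HN]; exists N => n k nN kN; have := HN n k nN kN.
  by rewrite bl_oneE; apply: le_trans.
have [u [s0 [mu s0S cu]]] := RF _ Fu S5; have [g1 [s1 [m1 s1S c1]]] := RF _ F1 S1.
have [g2 [s2 [m2 s2S c2]]] := RF _ F2' S2.
have mo := @measurable_one; have o0 := @one_ge0.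
have [Gu Su] := complete_weight mo o0 Fu mu s0S cu S5.
have [G1 Sg1] := complete_weight mo o0 F1 m1 s1S c1 S1.
have [G2 Sg2] := complete_weight mo o0 F2' m2 s2S c2 S2.
have [GV SV] := complete_weight measurable_V V_ge0 FV mu s0S cu S3.
have [GL SL] := complete_weight measurable_LL LL_ge0 FL mu s0S cu S4'.
have LIo f : F2 mu2 one f -> LI f.
 move=> /F2_one[mf If]; split => // r; have mc := @measurable_cube r.
 have Ic := bs_Int (bs_cube r).
 apply: (Int_le (Int_D If Ic)); first by apply: measurable_funM => //; exact: measurable_indic.
 move=> x; rewrite indicE; case: (_ \in _) => /=; last by rewrite mulr0 normr0 addr0 sqr_ge0.
 by rewrite mulr1 -[f x ^+ 2]norm_sq; have := sqr_ge0 (`|f x| - 1); nra.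
have EUl : EE (u, g1, g2).
 split => //; apply: WG_limit; do ?exact: LIo.
 move=> e e0; have e20 : 0 < e ^+ 2 by rewrite exprn_gt0.
 have [N0 h0] := Su _ e20; have [N1 h1] := Sg1 _ e20; have [N2 h2] := Sg2 _ e20.
 pose n := maxn N0 (maxn N1 N2).
 have /and3P[n0 n1 n2] : [&& (N0 <= n)%N, (N1 <= n)%N & (N2 <= n)%N].
  by rewrite /n !leq_max !leqnn !orbT.
 have cvt f f' : F2 mu2 one f -> F2 mu2 one f' -> bl0 (f' - f) (f' - f) <= e ^+ 2 ->
   [L1 x, (f x - f' x) ^+ 2] /\ [int x, (f x - f' x) ^+ 2] <= e ^+ 2.
  move=> h h' hle; have E : (fun x => (f x - f' x) ^+ 2) = (fun x => (f' x - f x) ^+ 2).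
   by apply/funext => x; rewrite -opprB sqrrN.
  rewrite E; split; last by apply: le_trans hle; rewrite bl_oneE.
  have [_] := F2_lin mo o0 1 (-1) h' h.
  by congr Int; apply/funext => x; rewrite !mul1r mulN1r.
 exists (U_ n).1.1, (U_ n).1.2, (U_ n).2; split; first by case: (EU n).
 - exact: cvt (Fu n) (h0 _ n0).
 - exact: cvt (F1 n) (h1 _ n1).
 - exact: cvt (F2' n) (h2 _ n2).
exists (u, g1, g2) => //.
exact: (small_D (small_D (small_D Sg1 Sg2) SV) SL).
Qed.

Lemma CM_ge0 (r : R) : 0 <= r -> 0 <= CM r.
Proof.
move=> r0; have r2 := sqr_ge0 r; have r3 := exprn_ge0 3 r0; have k0 := kap_ge0.
rewrite /CM; apply: addr_ge0; last by apply: mulr_ge0.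
apply: addr_ge0; (apply: mulr_ge0; [apply: ltW|]); [exact: c2_gt0| |exact: b0|by rewrite mulr_ge0// addr_ge0// mulr_ge0].
by apply: addr_ge0; [|apply: addr_ge0]; rewrite ?mulr_ge0.
Qed.

(** The local Lipschitz bounds carry levels and almost criticality to the limit; the change of
    parameter costs only a multiple of [|mu_ n - mu|] on bounded sets. *)
Lemma PS_limit (r mu : R) (U_ : nat -> X) (mu_ : nat -> R) U : 0 <= mu <= 1 -> (forall n, 0 <= mu_ n <= 1) ->
 (forall n, EE (U_ n)) -> (forall n, nrm (U_ n) <= r) -> EE U -> small (fun n => NN (U_ n - U)) ->
 small (fun n => `|mu_ n - mu|) ->
 (forall e : R, 0 < e -> exists N, forall n, (N <= n)%N -> forall W, EE W -> `|dJm (mu_ n) (U_ n) W| <= e * nrm W) ->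
 crit mu U /\ small (fun n => `|Jm (mu_ n) (U_ n) - Jm mu U|).
Proof.
move=> mu01 mu_01 EU Ur EUl S Smu Sd.
have r0 : 0 <= r by exact: le_trans (nrm_ge0 _) (Ur 0%N).
have C0 := CS_ge0 (addr_ge0 r0 ler01); set C := CS (r + 1) in C0.
have Sn : small (fun n => nrm (U_ n - U)) by exact: small_sqrt S.
have EZ n : EE (U - U_ n) by exact: EE_B.
have nZ n : nrm (U - U_ n) = nrm (U_ n - U).
 have -> : U - U_ n = (-1) *: (U_ n - U) by rewrite scaleN1r opprB.
 by rewrite nrm_Z ?normrN1 ?mul1r//; exact: EE_B.
have Ur1 n : nrm (U_ n) <= r + 1 by have := Ur n; lra.
have [N1 HN1] := Sn 1 ltr01.
have Zr n : (N1 <= n)%N -> nrm (U - U_ n) <= r + 1 by move=> /HN1; rewrite nZ; lra.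
have UE n : U = U_ n + (U - U_ n) by rewrite addrC subrK.
have DBle n W : EE W -> `|DB (U_ n) W| <= r * nrm W.
 by move=> EW; have [_ _ _ h] := bl_nrm (EU n) EW; apply: le_trans h _; rewrite ler_wpM2r ?nrm_ge0.
split.
 split => // W EW; have w0 := nrm_ge0 W.
 apply/eqP; rewrite -normr_le0; apply/ler_addgt0Pr => e e0; rewrite add0r.
 pose d := e / (3 * (nrm W * (1 + r + C) + 1)).
 have den : 0 < 3 * (nrm W * (1 + r + C) + 1).
  by have : 0 <= nrm W * (1 + r + C) by [apply: mulr_ge0 => //; lra]; lra.
 have d0 : 0 < d by exact: divr_gt0.
 have [N2 h2] := Sn _ d0; have [N3 h3] := Smu _ d0; have [N4 h4] := Sd _ d0.
 pose n := maxn (maxn N1 N2) (maxn N3 N4).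
 have /and4P[n1 n2 n3 n4] : [&& (N1 <= n)%N, (N2 <= n)%N, (N3 <= n)%N & (N4 <= n)%N].
  by rewrite /n !leq_max !leqnn !orbT.
 have b1 := h4 _ n4 W EW.
 have b2 : `|dJm mu (U_ n) W - dJm (mu_ n) (U_ n) W| <= d * (r * nrm W).
  have -> : dJm mu (U_ n) W - dJm (mu_ n) (U_ n) W = - (mu_ n - mu) * DB (U_ n) W by rewrite /dJm; ring.
  by rewrite normrM normrN ler_pM ?h3 ?DBle.
 have b3 : `|dJm mu U W - dJm mu (U_ n) W| <= C * d * nrm W.
  have := dJm_lip mu01 (EU n) (EZ n) EW (Ur1 n) (Zr n n1); rewrite -UE => /le_trans; apply.
  by rewrite ler_wpM2r// ler_pM2l// nZ h2.
 have -> : dJm mu U W = (dJm mu U W - dJm mu (U_ n) W) + (dJm mu (U_ n) W - dJm (mu_ n) (U_ n) W) + dJm (mu_ n) (U_ n) W by ring.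
 apply: le_trans (ler_normD _ _) _; apply: le_trans (lerD (ler_normD _ _) (lexx _)) _.
 apply: le_trans (lerD (lerD b3 b2) b1) _.
 have -> : C * d * nrm W + d * (r * nrm W) + d * nrm W = d * (nrm W * (1 + r + C)) by ring.
 rewrite /d mulrAC ler_pdivrMr//; apply: ler_wpM2l; first exact: ltW.
 by have : 0 <= nrm W * (1 + r + C) by [apply: mulr_ge0 => //; alra]; alra.
have SB : small (fun n => C * nrm (U_ n - U) + C * nrm (U_ n - U) ^+ 2 + r ^+ 2 * `|mu_ n - mu|).
 apply: small_D; first apply: small_D.
 - by apply: small_Z => // [|n]; [exact: ltW|exact: nrm_ge0].
 - apply: small_Z => // [|n|]; [exact: ltW|exact: sqr_ge0|].
  by move: S; congr small; apply/funext => n; rewrite nrm_sq.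
 - by apply: small_Z => //; exact: sqr_ge0.
move=> e /SB[N HN]; exists (maxn N1 N) => n; rewrite geq_max => /andP[n1 /HN]; apply: le_trans.
have t := Jm_taylor mu01 (EU n) (EZ n) (Ur1 n) (Zr n n1); rewrite -UE in t.
have d := dJm_bound mu01 (EU n) (EZ n) (Ur1 n).
rewrite nZ -/C in t; rewrite nZ -/C in d.
have b : `|Jm (mu_ n) (U_ n) - Jm mu (U_ n)| <= r ^+ 2 * `|mu_ n - mu|.
 have -> : Jm (mu_ n) (U_ n) - Jm mu (U_ n) = (mu_ n - mu) * BB (U_ n) by rewrite /Jm; ring.
 rewrite normrM mulrC ler_wpM2r// /BB ger0_norm ?mulr_ge0 ?BL_ge0//.
 have := BL_NN (U_ n); have := NN_le_r (Ur n) r0; have := BL_ge0 (U_ n); alra.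
have -> : Jm (mu_ n) (U_ n) - Jm mu U = (Jm (mu_ n) (U_ n) - Jm mu (U_ n)) -
  (Jm mu U - Jm mu (U_ n) - dJm mu (U_ n) (U - U_ n)) - dJm mu (U_ n) (U - U_ n) by ring.
apply: le_trans (ler_normB _ _) _; apply: le_trans (lerD (ler_normB _ _) (lexx _)) _.
apply: le_trans (lerD (lerD b t) d) _; lra.
Qed.

Lemma sqrt_small2 (a : nat -> nat -> R) : small2 a -> small2 (fun n k => Num.sqrt (a n k)).
Proof.
move=> H e e0; have [N h] := H (e ^+ 2) (exprn_gt0 2 e0); exists N => n k nN kN; have h' := h n k nN kN.
exact: sqrt_le.
Qed.

Lemma qfK1_ge0 U W : 0 <= qf K1 (pr U U) (pr W W).
Proof.
apply: rint_ge0 => z; rewrite mulr_ge0 ?K1_ge0// mulr_ge0//; rewrite /pr -expr2; exact: sqr_ge0.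
Qed.

Lemma diff_estimate (r e mu nu : R) U W : 0 <= e -> EE U -> EE W -> nrm U <= r -> nrm W <= r ->
 (forall Y, EE Y -> `|dJm mu U Y| <= e * nrm Y) -> (forall Y, EE Y -> `|dJm nu W Y| <= e * nrm Y) ->
 AA (U - W) + VV (U - W) + mu * BL (U - W) + c2 * qf K1 (pr U U) (pr (U - W) (U - W)) <=
 4 * r * e + CM r * (`|mu - nu| + Num.sqrt (mm (U - W))).
Proof.
move=> e0 EU EW Ur Wr dU dW; have EZ := EE_B EU EW.
apply: le_trans (monotone_estimate mu nu EU EW Ur Wr) _; rewrite lerD2r.
have h1 := le_trans (ler_norm _) (dU _ EZ); have h2 := dW _ EZ.
rewrite ler_norml in h2; case/andP: h2 => h2 _.
have Zr : nrm (U - W) <= 2 * r.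
 have -> : U - W = U + (-1) *: W by rewrite scaleN1r.
 apply: le_trans (nrm_D EU (EE_Z (-1) EW)) _; rewrite nrm_Z// normrN1 mul1r; lra.
have := ler_wpM2l e0 Zr; lra.
Qed.

Let subseq_lt (s : nat -> nat) (N : nat) : (forall k, (s k < s k.+1)%N) -> forall k, (s (N + k) < s (N + k.+1))%N.
Proof. by move=> h k; rewrite addnS. Qed.

(* Two almost critical points at bounded distance: [diff_estimate] controls the norm of their difference
  as soon as the left-hand side dominates [NN]. *)
Lemma PS_cauchy (r mu a C : R) (U_ : nat -> X) (mu_ : nat -> R) : 0 <= mu <= 1 -> (forall n, 0 <= mu_ n <= 1) ->
 (forall n, EE (U_ n)) -> (forall n, nrm (U_ n) <= r) -> 0 < a -> 0 <= C ->
 small2 (fun n k => mm (U_ n - U_ k)) -> small (fun n => `|mu_ n - mu|) ->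
 (forall n k, a * NN (U_ n - U_ k) <= AA (U_ n - U_ k) + VV (U_ n - U_ k) + mu_ n * BL (U_ n - U_ k)
   + c2 * qf K1 (pr (U_ n) (U_ n)) (pr (U_ n - U_ k) (U_ n - U_ k)) + C * mm (U_ n - U_ k)) ->
 (forall e : R, 0 < e -> exists N, forall n, (N <= n)%N -> forall W, EE W -> `|dJm (mu_ n) (U_ n) W| <= e * nrm W) ->
 exists U, [/\ EE U, crit mu U, small (fun n => NN (U_ n - U)) & small (fun n => `|Jm (mu_ n) (U_ n) - Jm mu U|)].
Proof.
move=> mu01 mu_01 EU Ur a0 C0 S Smu co Sd.
have r0 : 0 <= r by exact: le_trans (nrm_ge0 _) (Ur 0%N).
have CM0 := CM_ge0 r0.
suff /E_complete[//|U EUl SU] : small2 (fun n k => NN (U_ n - U_ k)).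
 by have [c1 c2'] := PS_limit mu01 mu_01 EU Ur EUl SU Smu Sd; exists U.
move=> e e0; pose M := 4 * r + 3 * CM r + C + 1.
have M0 : 0 < M by rewrite /M; lra.
pose d := a * e / M; have d0 : 0 < d by rewrite divr_gt0// mulr_gt0.
have [N1 h1] := S _ d0; have [N2 h2] := sqrt_small2 S d0; have [N3 h3] := Smu _ d0; have [N4 h4] := Sd _ d0.
exists (maxn (maxn N1 N2) (maxn N3 N4)) => n k.
rewrite !geq_max => /andP[/andP[n1 n2] /andP[n3 n4]] /andP[/andP[k1 k2] /andP[k3 k4]].
rewrite -(ler_pM2l a0); apply: le_trans (co n k) _.
have es := diff_estimate (ltW d0) (EU n) (EU k) (Ur n) (Ur k) (h4 n n4) (h4 k k4).
apply: le_trans (lerD es (ler_wpM2l C0 (h1 n k n1 k1))) _.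
have mk : `|mu_ n - mu_ k| <= 2 * d.
 have -> : mu_ n - mu_ k = (mu_ n - mu) - (mu_ k - mu) by ring.
 by apply: le_trans (ler_normB _ _) _; have := h3 n n3; have := h3 k k3; alra.
have h5 : CM r * (`|mu_ n - mu_ k| + Num.sqrt (mm (U_ n - U_ k))) <= CM r * (2 * d + d).
 by apply: ler_wpM2l => //; apply: lerD => //; exact: h2.
have dM : d * M = a * e by rewrite /d divfK// gt_eqF.
rewrite -dM /M; move: (CM r) h5 => cm h5; alra.
Qed.

(* The perturbation makes [J_mu] coercive in [E]: bounded Palais-Smale sequences converge. *)
Lemma PS_perturbed (r mu : R) (U_ : nat -> X) : 0 < mu <= 1 -> (forall n, EE (U_ n)) -> (forall n, nrm (U_ n) <= r) ->
 (forall e : R, 0 < e -> exists N, forall n, (N <= n)%N -> forall W, EE W -> `|dJm mu (U_ n) W| <= e * nrm W) ->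
 exists U, exists2 s : nat -> nat, (forall k, (s k < s k.+1)%N) &
  [/\ EE U, crit mu U, small (fun n => NN (U_ (s n) - U)) & small (fun n => `|Jm mu (U_ (s n)) - Jm mu U|)].
Proof.
move=> /andP[mu0 mu1] EU Ur Sd.
have r0 : 0 <= r by exact: le_trans (nrm_ge0 _) (Ur 0%N).
have AV n : AA (U_ n) + VV (U_ n) <= r ^+ 2.
 by apply: le_trans (NN_le_r (Ur n) r0); rewrite lerDl BL_ge0.
have [s [sS S]] := L2_compact EU AV.
have mu01 : 0 <= mu <= 1 by rewrite mu1 ltW.
have H : small (fun _ : nat => `|mu - mu|) by move=> e e0; exists 0%N => n _; rewrite subrr normr0 ltW.
have co n k : mu * NN (U_ (s n) - U_ (s k)) <= AA (U_ (s n) - U_ (s k)) + VV (U_ (s n) - U_ (s k)) + mu * BL (U_ (s n) - U_ (s k))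
   + c2 * qf K1 (pr (U_ (s n)) (U_ (s n))) (pr (U_ (s n) - U_ (s k)) (U_ (s n) - U_ (s k))) + 0 * mm (U_ (s n) - U_ (s k)).
 have h1 := mulr_ge0 (ltW c2_gt0) (qfK1_ge0 (U_ (s n)) (U_ (s n) - U_ (s k))).
 have h2 := AA_ge0 (U_ (s n) - U_ (s k)); have h3 := VV_ge0 (U_ (s n) - U_ (s k)).
 move: h1 h2 h3; rewrite /NN.
 move: (AA _) (VV _) (BL _) (mm _) (c2 * _) => x y z t q h1 h2 h3.
 have := ler_wpM2r h2 mu1; have := ler_wpM2r h3 mu1; lra.
have [|U [h1 h2 h3 h4]] := PS_cauchy (r := r) (mu_ := fun=> mu) mu01 (fun=> mu01) (fun n => EU (s n)) (fun n => Ur (s n)) mu0 (lexx 0) S H co.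
 move=> e /Sd[N HN]; exists N => n nN; apply: HN; apply: leq_trans nN _; exact: increasing_subseq_ge.
by exists U; exists s.
Qed.

Lemma nontrivial_limit (m0 : R) (U_ : nat -> X) U : (forall n, EE (U_ n)) -> EE U -> 0 < m0 ->
 (forall n, m0 <= mm (U_ n)) -> small (fun n => NN (U_ n - U)) -> 0 < mm U.
Proof.
move=> EU EUl m00 mU S; have d0 : 0 < m0 / 8 by lra.
have [N /(_ N (leqnn N)) h] := S _ d0.
have hm := le_trans (mm_NN (EE_B (EU N) EUl)) h.
have EZ := EE_B (EU N) EUl.
have [_ _ FU] := mm_le EUl; have := mm_ge0 U; rewrite le_eqVlt => /orP[/eqP e|//].
have [+ _] := quad_le measurable_one one_ge0 (EE_F2u EUl) (EE_F2u (EE_B EUl (EU N))).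
rewrite -[bl _ _ (U.1.1 - _) _]/(mm (U - (U - U_ N))) subKr => h1; have := mU N.
have e2 : mm (U - U_ N) = mm (U_ N - U).
 by rewrite /mm !bl_oneE; apply: eq_rint => x; rewrite -[LHS]mulrNN !opprB.
move: h1; rewrite -[bl _ _ U.1.1 _]/(mm U) -[bl _ _ (U - U_ N).1.1 _]/(mm (U - U_ N)) e2 e; lra.
Qed.

(* Bounded sequences of almost critical points of [J_(mu_n)], possibly with [mu_n -> 0] : the kernel
  [ln (1 + |x - y|)] replaces the missing logarithmic weight as soon as the [L^2] norms stay away from 0. *)
Lemma PS_vanishing (mu C m0 : R) (U_ : nat -> X) (mu_ : nat -> R) : 0 <= mu <= 1 -> (forall n, 0 <= mu_ n <= 1) ->
 (forall n, EE (U_ n)) -> (forall n, AA (U_ n) + VV (U_ n) <= C) ->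
 (forall n, qf K1 (pr (U_ n) (U_ n)) (pr (U_ n) (U_ n)) <= C) ->
 0 < m0 -> (forall n, m0 <= mm (U_ n)) -> small (fun n => `|mu_ n - mu|) ->
 (forall n, crit (mu_ n) (U_ n)) ->
 exists U, exists2 s : nat -> nat, (forall k, (s k < s k.+1)%N) &
  [/\ 0 < mm U, crit mu U, small (fun n => NN (U_ (s n) - U)) & small (fun n => `|Jm (mu_ (s n)) (U_ (s n)) - Jm mu U|)].
Proof.
move=> mu01 mu_01 EU AV qC m00 mU Smu cr.
have [s [sS S]] := L2_compact EU AV.
have d0 : 0 < m0 / 8 by lra.
have [N0 hN] := S _ d0.
have [C1 C10 K] := K1_coercive (EU (s N0)) m00 (mU _).
have Clo n : (N0 <= n)%N -> mm (U_ (s n) - U_ (s N0)) <= m0 / 8 by move=> h; exact: hN.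
have C0 : 0 <= C by apply: le_trans (AV 0%N); rewrite addr_ge0 ?AA_ge0 ?VV_ge0.
(* [K1_coercive] with [F = Z = U_ (s n)] and these mass bounds controls the weighted mass by [CB],
   hence the full norm. *)
pose M := C / sV0 D; have V0 := sV0_gt0 D.
have M0 : 0 <= M by rewrite divr_ge0// ltW.
have mM n : mm (U_ n) <= M.
 have [_ h _] := mm_le (EU n); rewrite ler_pdivlMr// mulrC; apply: le_trans h _.
 by apply: le_trans (AV n); rewrite lerDr AA_ge0.
pose CB := (C + C1 * M * M) / (m0 / 8).
have CB0 : 0 <= CB := divr_ge0 (addr_ge0 C0 (mulr_ge0 (mulr_ge0 C10 M0) M0)) (ltW d0).
have Bb n : (N0 <= n)%N -> BL (U_ (s n)) <= CB.
 move=> h; have := K _ _ (EU (s n)) (EU (s n)) (Clo n h) => k.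
 rewrite ler_pdivlMr// mulrC; have := qC (s n).
 have : C1 * mm (U_ (s n)) * mm (U_ (s n)) <= C1 * M * M.
  apply: ler_pM (mm_ge0 _) (ler_wpM2l C10 (mM _)) (mM _); exact: mulr_ge0 C10 (mm_ge0 _).
 move: k; lra.
pose r := Num.sqrt (C + CB).
pose T n := U_ (s (N0 + n)); pose nu n := mu_ (s (N0 + n)).
have ET n : EE (T n) by exact: EU.
have sT : forall k, (s (N0 + k) < s (N0 + k.+1))%N by exact: subseq_lt.
have Tr n : nrm (T n) <= r.
 by apply: ler_wsqrtr; rewrite /NN; apply: lerD; [exact: AV|apply: Bb; rewrite leq_addr].
have ST : small2 (fun n k => mm (T n - T k)).
 move=> e /S[N HN]; exists N => n k nN kN; apply: HN; exact: leq_trans nN (leq_addl _ _) || exact: leq_trans kN (leq_addl _ _).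
have Snu : small (fun n => `|nu n - mu|) by exact: (small_sub sT Smu).
have c20 := c2_gt0.
(* The same coercivity, now with [Z] a difference, supplies the missing [BL] term with coefficient
   [c2 * (m0 / 8)], at the price of a multiple of its mass. *)
pose a := Num.min 1 (c2 * (m0 / 8)).
have a0 : 0 < a by rewrite lt_min ltr01 mulr_gt0.
have a1 : a <= 1 by rewrite ge_min lexx.
have a2 : a <= c2 * (m0 / 8) by rewrite ge_min lexx orbT.
pose C2 := c2 * C1 * M.
have C20 : 0 <= C2 := mulr_ge0 (mulr_ge0 (ltW c20) C10) M0.
have co n k : a * NN (T n - T k) <= AA (T n - T k) + VV (T n - T k) + nu n * BL (T n - T k)
   + c2 * qf K1 (pr (T n) (T n)) (pr (T n - T k) (T n - T k)) + C2 * mm (T n - T k).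
 have EZ := EE_B (ET n) (ET k); have := K _ _ (ET n) EZ (Clo _ (leq_addr _ _)).
 have := mM (s (N0 + n)); rewrite -/(T n).
 have := AA_ge0 (T n - T k); have := VV_ge0 (T n - T k); have := BL_ge0 (T n - T k).
 have := mm_ge0 (T n - T k); have /andP[] := mu_01 (s (N0 + n)); rewrite -/(nu n) /NN /C2.
 move: (T n - T k) => Z; move: (AA Z) (VV Z) (BL Z) (mm Z) (qf _ _ _) (mm (T n)) (nu n) => x y z t q t' v.
 move=> v0 _ t0 z0 y0 x0 tM hq.
 have h1 := ler_wpM2r x0 a1; have h2 := ler_wpM2r y0 a1; have h3 := ler_wpM2r z0 a2.
 have h4 := ler_wpM2l (ltW c20) hq; have h5 := mulr_ge0 v0 z0.
 have h6 : c2 * (C1 * t' * t) <= c2 * (C1 * M * t).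
  by rewrite ler_pM2l// ler_wpM2r// ler_wpM2l.
 move: h1 h2 h3 h4 h5 h6; alra.
have [|U [h1 h2 h3 h4]] := PS_cauchy (r := r) mu01 (fun n => mu_01 (s (N0 + n))) ET Tr a0 C20 ST Snu co.
 by move=> e e0; exists 0%N => n _ W EW; have [_ ->//] := cr (s (N0 + n)); rewrite normr0 mulr_ge0 ?nrm_ge0// ltW.
exists U; exists (fun n => s (N0 + n)%N) => //; split => //.
exact: nontrivial_limit ET h1 m00 (fun n => mU _) h3.
Qed.

End completeness.

(** * Scaling of the logarithmic form *)

Section scaling.
Implicit Types (a : R) (x y : pt) (f h : pt -> R).

Lemma dilVK a x : a != 0 -> dil a^-1 (dil a x) = x.
Proof. by move=> a0; rewrite /dil /= !mulrA mulVf// !mul1r; case: x. Qed.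

Lemma LL_dil_le a x : 0 < a -> LL x <= (1 + a^-1) * LL (dil a x).
Proof.
move=> a0; have L0 := LL_ge0 (dil a x); have i0 : 0 < a^-1 by rewrite invr_gt0.
have [a1|a1] := leP 1 a.
 have [h _] := LL_dil x a1; apply: le_trans h _; rewrite ler_peMl//; lra.
have h1 : 1 <= a^-1 by rewrite invf_ge1// ltW.
have [_] := LL_dil (dil a x) h1; rewrite dilVK ?gt_eqF// => /le_trans; apply.
by rewrite ler_wpM2r// lerDr.
Qed.

Lemma measurable_dil a f : mfun f -> mfun (fun x => f (dil a x)).
Proof. by move=> mf; rewrite dil_affm; apply: measurableT_comp => //; exact: measurable_affm. Qed.

Lemma Int_LL_dil a f : 0 < a -> mfun f -> [L1 x, LL x * `|f x|] ->
 [L1 x, LL x * `|f (dil a x)|].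
Proof.
move=> a0 mf I; have J := Int_Z (1 + a^-1) (Int_dil a0 I); apply: (Int_le J).
 by apply: measurable_funM; [exact: measurable_LL|apply: measurableT_comp => //; exact: measurable_dil].
move=> x; rewrite ger0_norm ?mulr_ge0 ?LL_ge0// mulrA ler_wpM2r//; exact: LL_dil_le.
Qed.

Lemma dens_dil a f : 0 < a -> dens f -> dens (fun x => f (dil a x)).
Proof.
move=> a0 [mf I1 I2]; split; [exact: measurable_dil|exact: Int_LL_dil|exact: (Int_dil a0 I2)].
Qed.

Definition dil4 a (z : pt * pt) : pt * pt := (dil a z.1, dil a z.2).

Lemma measurable_dil4 a : mfun (dil4 a).
Proof.
by apply/measurable_fun_pairP; split; rewrite /comp /dil4 /= dil_affm; apply: (measurableT_comp (measurable_affm a (0, 0))); mproj.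
Qed.

Lemma rint_dil4 a (F : pt * pt -> R) : 0 < a -> Int m4 F -> Int m4 (fun z => F (dil4 a z)) ->
 rint m4 (fun z => F (dil4 a z)) = a ^- 4 * rint m4 F.
Proof.
move=> a0 I I'; have [J1 <- J2] := rint_fubini1 (m1 := mu2) (m2 := mu2) I.
have [_ <- _] := rint_fubini1 (m1 := mu2) (m2 := mu2) I'.
have -> : a ^- 4 = a ^- 2 * a ^- 2 by rewrite -invfM -exprD.
rewrite -mulrA -rint_dil// -rintZ; last exact: (Int_dil a0 J1).
have mF := Int_mf I; have mF' := Int_mf I'.
apply: rint_ae; first exact: (measurable_rint1 mu2 mF').
 by apply: measurable_funM => //; apply: (measurable_dil a (f := fun x => [int y, F (x, y)])); exact: measurable_rint1.
have := ae_affm (0, 0) a0 J2; rewrite -dil_affm; apply: filterS => x /= Ix.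
by rewrite -(rint_dil a0 Ix).
Qed.

Lemma K0_dil a x y : 0 < a -> 0 < enorm (psub x y) -> K0 (dil a x) (dil a y) = ln a + K0 x y.
Proof.
move=> a0 e0; rewrite /K0 -lnM ?posrE//.
have -> : psub (dil a x) (dil a y) = dil a (psub x y) by rewrite /psub /dil /= -!mulrBr.
by rewrite enorm_dil// ltW.
Qed.

Lemma enorm_psub_eq0 x y : ~ 0 < enorm (psub x y) -> x = y.
Proof.
move=> h; have e0 : enorm (psub x y) = 0.
 by apply/eqP; rewrite eq_le enorm_ge0 andbT leNgt; apply/negP.
have h1 := enorm_ge1 (psub x y); have h2 := enorm_ge2 (psub x y); rewrite e0 !normr_le0 !subr_eq0 in h1 h2.
by case: x y h1 h2 {h e0} => x1 x2 [y1 y2] /= /eqP-> /eqP->.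
Qed.

Lemma K0_diag x : K0 x x = 0.
Proof.
by rewrite /K0 /psub /enorm /= !subrr expr0n/= addr0 sqrtr0 ln0.
Qed.

Lemma K0_dil_norm a x y : 0 < a -> `|K0 (dil a x) (dil a y)| <= `|K0 x y| + `|ln a|.
Proof.
move=> a0; have [e0|/enorm_psub_eq0->] := pselect (0 < enorm (psub x y)).
 by rewrite K0_dil// addrC ler_normD.
by rewrite !K0_diag normr0 add0r.
Qed.

Lemma K2_dil a x y : 1 <= a -> K2 (dil a x) (dil a y) <= K2 x y /\ K2 x y <= K2 (dil a x) (dil a y) + ln a.
Proof.
move=> a1; have a0 : 0 < a by lra.
have la := ln_ge0 a1; rewrite /K2; have [e0|/enorm_psub_eq0->] := pselect (0 < enorm (psub x y)).
 rewrite K0_dil//; move: (K0 x y) => t; split; rewrite ge_max.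
  by rewrite le_max; apply/andP; split; [apply/orP; left; lra|rewrite le_max lexx orbT].
 have h1 : - (ln a + t) <= Num.max (- (ln a + t)) 0 by rewrite le_max lexx.
 have h2 : 0 <= Num.max (- (ln a + t)) 0 by rewrite le_max lexx orbT.
 by move: (Num.max _ _) h1 h2 => s h1 h2; apply/andP; split; lra.
by rewrite !K0_diag oppr0 maxxx add0r.
Qed.

Lemma mu2_point x : [ae y, y <> x].
Proof.
have e : [set x] = `[x.1, x.1]%classic `*` `[x.2, x.2]%classic.
 by rewrite !set_itv1; case: x => x1 x2; apply/seteqP; split => [[y1 y2]//= [-> ->]|[y1 y2]/= [-> ->]].
exists [set x]; split; [by rewrite e; exact: measurableX| |by move=> y /= /contrapT].
by rewrite e mu2_prod// leb1_itv// subrr mul0e.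
Qed.

(** [ln (a r) = ln a + ln r] produces the product of the masses. On the diagonal, where the
    convention [ln 0 = 0] breaks the rule, nothing is lost because points are null sets. *)
Lemma q_dil a f h : 0 < a -> dens f -> dens h ->
 q (fun x => f (dil a x)) (fun x => h (dil a x)) = a ^- 4 * (q f h - ln a * (rint mu2 f * rint mu2 h)).
Proof.
move=> a0 df dh; have df' := dens_dil a0 df; have dh' := dens_dil a0 dh.
have [I _] := q_Int df dh; have [I' _] := q_Int df' dh'.
have [It rt] := tensor_int (dens_Int1 df') (dens_Int1 dh').
pose F (z : pt * pt) := K0 z.1 z.2 * (f z.1 * h z.2).
have JF : Int m4 (fun z => F (dil4 a z)).
 apply: (Int_le (Int_D (Int_abs I') (Int_Z `|ln a| (Int_abs It)))).
  apply: measurable_funM; last by exact: (measurable_tensor (measurable_dil a (let: And3 m _ _ := df in m)) (measurable_dil a (let: And3 m _ _ := dh in m))).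
  have -> : (fun z : pt * pt => K0 (dil4 a z).1 (dil4 a z).2) = (fun z => K0 z.1 z.2) \o (dil4 a) by [].
  apply: measurableT_comp; first exact: measurable_K0.
  exact: measurable_dil4.
 move=> z; rewrite /F /dil4 /= normrM [`|K0 z.1 z.2 * _|]normrM -mulrDl ler_wpM2r//; exact: K0_dil_norm.
have e := rint_dil4 a0 I JF.
have e2 : rint m4 (fun z => F (dil4 a z)) = q (fun x => f (dil a x)) (fun x => h (dil a x)) +
  ln a * rint m4 (fun z : pt * pt => f (dil a z.1) * h (dil a z.2)).
 rewrite -rintZ// /q /qf -rintD; [|exact: I'|exact: Int_Z].
 have IS := Int_D I' (Int_Z (ln a) It).
 have [_ <- _] := rint_fubini1 (m1 := mu2) (m2 := mu2) JF.
 have [_ <- _] := rint_fubini1 (m1 := mu2) (m2 := mu2) IS.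
 apply: eq_rint => x /=; apply: rint_ae.
 - exact: (measurableT_comp (Int_mf JF) (measurable_pair1 x)).
 - exact: (measurableT_comp (Int_mf IS) (measurable_pair1 x)).
 apply: filterS (mu2_point x) => y yx; rewrite /F /dil4 /= K0_dil//; first by ring.
 by apply: contrapT => /enorm_psub_eq0 h'; apply: yx; rewrite h'.
have -> : q f h = rint m4 F by [].
move: e2; rewrite e rt (rint_dil a0 (dens_Int1 df)) (rint_dil a0 (dens_Int1 dh)).
have -> : a ^- 4 = a ^- 2 * a ^- 2 by rewrite -invfM -exprD.
by move: (q _ _) (rint m4 F) => s t; lra.
Qed.

(* By scaling, [K2] is the sum of a bounded kernel and of a kernel of arbitrarily small mass. *)
Lemma K2_form_small a f h (s t : R) : 1 <= a -> dens f -> dens h -> (forall x, 0 <= f x) -> (forall x, 0 <= h x) ->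
 0 <= s -> 0 <= t -> n2 f <= s ^+ 2 -> n2 h <= t ^+ 2 ->
 qf K2 f h <= ln a * (rint mu2 f * rint mu2 h) + a^-1 * (kap * (s * t)).
Proof.
move=> a1 df dh f0 h0 s0 t0 fs ht; have a0 : 0 < a by lra.
have b0 : 0 < a^-1 by rewrite invr_gt0.
pose f' x := f (dil a^-1 x); pose h' x := h (dil a^-1 x).
have df' : dens f' := dens_dil b0 df; have dh' : dens h' := dens_dil b0 dh.
have [I _] := K2_form df dh; have [Ih qh] := K2_form df' dh'.
have [It rt] := tensor_int (dens_Int1 df) (dens_Int1 dh).
pose F (z : pt * pt) := K2 z.1 z.2 * (f' z.1 * h' z.2).
have FE z : F (dil4 a z) = K2 (dil a z.1) (dil a z.2) * (f z.1 * h z.2).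
 by rewrite /F /dil4 /f' /h' /= !dilVK// gt_eqF.
have JF : Int m4 (fun z => F (dil4 a z)).
 apply: (Int_le I).
  have -> : (fun z => F (dil4 a z)) = F \o dil4 a by [].
  apply: measurableT_comp; first exact: Int_mf Ih.
  exact: measurable_dil4.
 move=> z; rewrite FE ger0_norm ?mulr_ge0 ?K2_ge0// ler_wpM2r ?mulr_ge0//.
 by have [] := K2_dil z.1 z.2 a1.
apply: le_trans (_ : rint m4 (fun z => F (dil4 a z)) + ln a * rint m4 (fun z : pt * pt => f z.1 * h z.2) <= _).
 rewrite -rintZ// -rintD//; last exact: Int_Z.
 apply: rint_le => //; first by apply: Int_D => //; exact: Int_Z.
 by move=> z; rewrite FE -mulrDl ler_wpM2r ?mulr_ge0//; have [] := K2_dil z.1 z.2 a1.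
rewrite rt addrC lerD2l (rint_dil4 a0 Ih JF).
have n2d g : dens g -> n2 (fun x => g (dil a^-1 x)) = a ^+ 2 * n2 g.
 by move=> [_ _ Ig]; rewrite /n2 (rint_dil (f := fun x => g x ^+ 2) b0 Ig) exprVn invrK.
have as0 : 0 <= a * s by rewrite mulr_ge0// ltW.
have at0 : 0 <= a * t by rewrite mulr_ge0// ltW.
have k0 := kap_ge0.
have := q2_bound df' dh' as0 at0; rewrite !n2d// !exprMn !ler_wpM2l ?sqr_ge0// => /(_ isT isT) q2.
apply: le_trans (_ : a ^- 4 * (kap * (a * s * (a * t))) <= _).
 by apply: ler_wpM2l (le_trans (ler_norm _) q2); rewrite invr_ge0 exprn_ge0// ltW.
have -> : a ^- 4 * (kap * (a * s * (a * t))) = a^-1 ^+ 2 * (kap * (s * t)) by field; rewrite gt_eqF.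
apply: ler_wpM2r; first by rewrite !mulr_ge0.
by rewrite expr2 ler_piMl ?(ltW b0)// invf_le1.
Qed.

(** Prescribes the coefficient [s]^ (p - 2)[or]s [^ (p - 4)] when [powR_interp] is used for
    absorption. *)
Lemma powR_solve (e s : R) : 0 < e -> s != 0 -> exists2 t : R, 0 < t & t `^ s = e.
Proof.
move=> e0 s0; exists (e `^ (s^-1)); first exact: powR_gt0.
by rewrite -powRrM mulVf// powRr1// ltW.
Qed.

End scaling.

(** * Mountain pass geometry of the perturbed functionals *)

Section mountain_pass_geometry.
Implicit Types (U W Y Z : X) (a s t mu : R).

Lemma PP_interp s U : 0 < s -> EE U -> PP U <= s `^ (p - 2) * mm U + s `^ (p - 4) * S4 U.
Proof.
move=> s0 EU; have [_ _ I2] := mm_le EU; have [I4 _] := S4_le EU.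
rewrite /mm /S4 bl_oneE -!rintZ// -rintD; do ?exact: Int_Z.
apply: rint_le; [exact: Int_pow|by apply: Int_D; exact: Int_Z|move=> x].
rewrite -(powR_sub22 p2)// -expr2 -[U.1.1 x ^+ 4]/(U.1.1 x ^+ (2 * 2)%N) exprM.
have := powR_interp (sp_itv D) s0 (normr_ge0 (U.1.1 x)).
rewrite -[U.1.1 x ^+ 2]norm_sq; have := sqr_ge0 `|U.1.1 x|.
move: (_ `^ _) (_ `^ _) (_ `^ _) (`|U.1.1 x| ^+ 2) => w x1 x2 y y0 h.
have := ler_wpM2r y0 h; lra.
Qed.

(** The [K1] part is nonnegative. A large [a] makes the coefficient of [S4 U] small, at the price of
    a multiple of the squared mass. *)
Lemma Q4_lower a U : 1 <= a -> EE U ->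
 - (ln a * mm U ^+ 2 + a^-1 * (kap * S4 U)) <= Q4 U U U U.
Proof.
move=> a1 EU; have d := dens_pr EU EU; rewrite /Q4; have [_ ->] := q_Int d d.
have n2E := n2_diag U.
have S0 := S4_ge0 U; have sq := sqr_sqrtr S0; have pU x : 0 <= pr U U x by exact: sqr_ge0.
have := K2_form_small a1 d d pU pU (sqrtr_ge0 _) (sqrtr_ge0 _); move=> /(_ (S4 U) (S4 U)).
rewrite n2E sq lexx -!expr2 sq => /(_ isT isT); have := qfK1_ge0 U U.
have -> : rint mu2 (pr U U) = mm U by rewrite /mm bl_oneE.
move: (qf _ _ _) (qf _ _ _) => x y; lra.
Qed.

Lemma PP_ge0 U : 0 <= PP U.
Proof. by apply: rint_ge0 => x; exact: powR_ge0. Qed.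

Lemma JJ_lower a s U : 1 <= a -> 0 < s -> EE U ->
 2^-1 * (AA U + VV U) <= JJ U + c2 / 4 * (ln a * mm U ^+ 2 + a^-1 * (kap * S4 U)) +
  b / p * (s `^ (p - 2) * mm U + s `^ (p - 4) * S4 U).
Proof.
move=> a1 s0 EU; have h1 := Q4_lower a1 EU; have h2 := PP_interp s0 EU.
have c0 : 0 <= c2 / 4 by rewrite divr_ge0// ltW// c2_gt0.
have bp : 0 <= b / p by rewrite divr_ge0// ltW ?b0//; have := p2; lra.
rewrite /JJ c8E; have := ler_wpM2l c0 h1; have := ler_wpM2l bp h2.
move: (c2 / 4) (b / p) (Q4 U U U U) (PP U) (_ + a^-1 * _) (_ + _ * S4 U) => x y z w u v; lra.
Qed.

Let control_arith (S J x P Q y P' Q' P1 P2 K : R) : 2^-1 * S <= J + x * (P + Q) + y * (P' + Q') ->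
 x * P <= P1 -> x * Q <= 8^-1 * S -> y * P' <= P2 -> y * Q' <= 8^-1 * S -> J <= K -> S <= 4 * (K + P1 + P2).
Proof. lra. Qed.

(** A bound on [BB] bounds the mass, so [S4 U] becomes linear in [AA U] by Ladyzhenskaya and can be
    absorbed. *)
Lemma perturbed_control (K : R) : exists r : R, forall U mu, EE U -> 0 <= mu <= 1 -> BB U <= K -> Jm mu U <= K ->
 nrm U <= r.
Proof.
pose M := 2 * `|K| + 1; have M0 : 0 < M by rewrite /M; have := normr_ge0 K; lra.
have k0 := kap_ge0; have c0 := c2_gt0; have bb := b0; have pp := p2.
(* [a] and [s] are chosen so that the kernel term and the power term each take at most one eighth of
   [AA U + VV U]. *)
pose a : R := 1 + 32 * c2 * kap * M.
have a1 : 1 <= a by rewrite /a lerDl !mulr_ge0// ltW.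
have a0 : 0 < a by lra.
pose e := p / (128 * b * M).
have e0 : 0 < e by rewrite divr_gt0 ?mulr_gt0//; alra.
have p40 : p - 4 != 0 by rewrite subr_eq0 lt_eqF ?p4.
have [s s0 se] := powR_solve e0 p40.
pose C := `|K| + c2 / 4 * (ln a * M ^+ 2) + b / p * (s `^ (p - 2) * M).
exists (Num.sqrt (4 * C + M)) => U mu EU /andP[m0 _] BK JK.
have S0 : 0 <= AA U + VV U by rewrite addr_ge0 ?AA_ge0 ?VV_ge0.
have B0 := BL_ge0 U; have KK := ler_norm K; have [mB _ _] := mm_le EU; have mg := mm_ge0 U.
have BM : BL U <= M by move: BK; rewrite /BB /M; alra.
have mM : mm U <= M by alra.
have [_ h4] := S4_le EU; have S40 := S4_ge0 U.
have A0 := AA_ge0 U; have V0 := VV_ge0 U.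
have S4M : S4 U <= 16 * M * (AA U + VV U).
 apply: le_trans h4 _; rewrite -!mulrA ler_pM2l//; apply: ler_pM => //; alra.
apply: ler_wsqrtr; rewrite /NN; apply: lerD => //.
have h := JJ_lower a1 s0 EU.
have JK' : JJ U <= `|K|.
 move: JK; rewrite /Jm /BB; have : 0 <= mu * (2^-1 * BL U) by rewrite !mulr_ge0.
 alra.
have la := ln_ge0 a1; have bp : 0 <= b / p by rewrite divr_ge0// ltW//; alra.
have h1 : c2 / 4 * (ln a * mm U ^+ 2) <= c2 / 4 * (ln a * M ^+ 2).
 apply: ler_wpM2l; first by rewrite divr_ge0// ltW.
 by apply: ler_wpM2l => //; rewrite ler_sqr ?nnegrE// ltW.
have h2 : c2 / 4 * (a^-1 * (kap * S4 U)) <= 8^-1 * (AA U + VV U).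
 have : c2 / 4 * (a^-1 * (kap * S4 U)) <= c2 / 4 * (a^-1 * (kap * (16 * M * (AA U + VV U)))).
  by apply: ler_wpM2l; [rewrite divr_ge0// ltW|apply: ler_wpM2l; [rewrite invr_ge0 ltW|exact: ler_wpM2l]].
 move=> /le_trans; apply.
 have -> : c2 / 4 * (a^-1 * (kap * (16 * M * (AA U + VV U)))) = (4 * c2 * kap * M / a) * (AA U + VV U) by field; rewrite gt_eqF.
 apply: ler_wpM2r => //; rewrite ler_pdivrMr// /a.
 by have := mulr_ge0 (mulr_ge0 (ltW c0) k0) (ltW M0); alra.
have h3 : b / p * (s `^ (p - 2) * mm U) <= b / p * (s `^ (p - 2) * M).
 by apply: ler_wpM2l => //; apply: ler_wpM2l => //; exact: powR_ge0.
have h5 : b / p * (s `^ (p - 4) * S4 U) <= 8^-1 * (AA U + VV U).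
 rewrite se; apply: le_trans (_ : b / p * (e * (16 * M * (AA U + VV U))) <= _).
  by apply: ler_wpM2l => //; apply: ler_wpM2l => //; exact: ltW.
 apply: le_eq; rewrite /e; field.
 by rewrite !gt_eqF//; alra.
exact: control_arith h h1 h2 h3 h5 JK'.
Qed.

Definition SS U := AA U + VV U.

(** The mass part of the power term is absorbed through [V >= sV0 D]; all the rest is quadratic in
    [SS U], hence negligible for small [SS U]. The barrier is a level set of [SS], because [JJ] does
    not control the weighted mass. *)
Lemma barrier_at : exists2 s0 : R, 0 < s0 & forall U, EE U -> SS U <= s0 -> 4^-1 * SS U <= JJ U.
Proof.
have k0 := kap_ge0; have c0 := c2_gt0; have bb := b0; have pp := p2; have V0 := sV0_gt0 D.
pose e := p * sV0 D / (8 * b).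
have e0 : 0 < e by rewrite divr_gt0 ?mulr_gt0//; lra.
have p20 : p - 2 != 0 by rewrite subr_eq0 gt_eqF.
have [s s0 se] := powR_solve e0 p20.
have bp : 0 <= b / p by rewrite divr_ge0// ltW//; lra.
pose C := (c2 / 4 * kap + b / p * s `^ (p - 4)) * (16 / sV0 D).
have C0 : 0 <= C.
 apply: mulr_ge0; last by rewrite divr_ge0// ltW.
 by apply: addr_ge0; apply: mulr_ge0 => //; [rewrite divr_ge0// ltW|exact: powR_ge0].
exists (8 * C + 1)^-1; first by rewrite invr_gt0; lra.
move=> U EU hs; have S0 : 0 <= SS U by rewrite addr_ge0 ?AA_ge0 ?VV_ge0.
have h := JJ_lower (lexx 1) s0 EU; rewrite ln1 mul0r add0r invr1 mul1r in h.
have [_ mV _] := mm_le EU; have [_ h4] := S4_le EU; have mg := mm_ge0 U.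
have A0 := AA_ge0 U; have V00 := VV_ge0 U.
have mS : mm U <= SS U / sV0 D by rewrite ler_pdivlMr// mulrC /SS; alra.
have S4S : S4 U <= 16 / sV0 D * SS U ^+ 2.
 apply: le_trans h4 _; have -> : 16 / sV0 D * SS U ^+ 2 = 16 * (SS U / sV0 D * SS U) by field; rewrite gt_eqF.
 rewrite -mulrA ler_pM2l//; apply: ler_pM => //; rewrite /SS; alra.
have h1 : b / p * (s `^ (p - 2) * mm U) <= 8^-1 * SS U.
 rewrite se; apply: le_trans (_ : b / p * (e * (SS U / sV0 D)) <= _).
  by apply: ler_wpM2l => //; apply: ler_wpM2l => //; exact: ltW.
 apply: le_eq; rewrite /e; field.
 by rewrite !gt_eqF//; alra.
have cc : 0 <= c2 / 4 * kap + b / p * s `^ (p - 4).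
 by apply: addr_ge0; apply: mulr_ge0 => //; [rewrite divr_ge0// ltW|exact: powR_ge0].
have h2 : (c2 / 4 * kap + b / p * s `^ (p - 4)) * S4 U <= C * SS U ^+ 2.
 by apply: le_trans (ler_wpM2l cc S4S) _; rewrite mulrA.
have h3 : C * SS U ^+ 2 <= 8^-1 * SS U.
 rewrite expr2 mulrA; apply: ler_wpM2r => //.
 apply: le_trans (ler_wpM2l C0 hs) _; rewrite ler_pdivrMr; alra.
have E : 2^-1 * (AA U + VV U) = 2^-1 * SS U by [].
rewrite E in h; move: h h1 h2 h3.
move: (SS U ^+ 2) (s `^ _) (s `^ _) (b / p) (c2 / 4) => q2 w1 w2 x y; alra.
Qed.

Lemma SS_segm U W t : EE U -> EE W -> SS ((1 - t) *: U + t *: W) =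
 (1 - t) ^+ 2 * SS U + 2 * (1 - t) * t * (bl0 U.1.2 W.1.2 + bl0 U.2 W.2 + bl mu2 V U.1.1 W.1.1) + t ^+ 2 * SS W.
Proof.
move=> [G1 A1 B1 V1 L1] [G2 A2 B2 V2 L2]; rewrite /SS /AA /VV.
have e1 := bl_sq_lin measurable_one one_ge0 (1 - t) t A1 A2.
have e2 := bl_sq_lin measurable_one one_ge0 (1 - t) t B1 B2.
have e3 := bl_sq_lin measurable_V V_ge0 (1 - t) t V1 V2.
rewrite [X in X + _ + _ = _]e1 [X in _ + X + _ = _]e2 [X in _ + _ + X = _]e3.
by ring.
Qed.

(** On an edge [SS] is a quadratic polynomial in the parameter; the intermediate value theorem
    applies to an edge that starts at or below the level and ends above it. *)
Lemma path_crossing (s0 : R) (n : nat) (g : nat -> X) : (forall i, EE (g i)) -> SS (g 0%N) <= s0 -> s0 < SS (g n) ->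
 exists i t, [/\ (i < n)%N, 0 <= t <= 1 & SS (segm g i t) = s0].
Proof.
move=> Eg h0; elim: n => [|n IH] hn; first by have := le_lt_trans h0 hn; rewrite ltxx.
have [h|h] := ltP s0 (SS (g n)).
 by have [i [t [lt01 t01 e]]] := IH h; exists i, t; split => //; exact: ltnW.
have cf : {within `[0, 1], continuous (fun t : R => SS (segm g n t))}.
 apply: continuous_subspaceT => t; rewrite /segm.
 under eq_fun do rewrite SS_segm//.
 have c1 : (fun t : R => 1 - t) x @[x --> t] --> 1 - t by apply: cvgB; [exact: cvg_cst|exact: cvg_id].
 apply: cvgD; first apply: cvgD.
 - by apply: cvgM; [rewrite expr2; under eq_fun do rewrite expr2; exact: cvgM|exact: cvg_cst].
 - by apply: cvgM; [apply: cvgM; [apply: cvgM; [exact: cvg_cst|]|exact: cvg_id]|exact: cvg_cst].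
 - by apply: cvgM; [exact: exprn_continuous|exact: cvg_cst].
have [|t] := IVT (v := s0) (@ler01 R) cf.
 rewrite /segm subr0 subrr !scale1r !scale0r addr0 add0r.
 by rewrite ge_min h/= le_max (ltW hn) orbT.
by rewrite in_itv/= => t01 e; exists n, t; split.
Qed.

Let bmp : pt -> R := tprod (bump (- 4^-1) 4^-1 1) (bump (- 4^-1) 4^-1 1).

Let bmp_out x : ~ (`|x.1| < 4^-1 /\ `|x.2| < 4^-1) -> bmp x = 0.
Proof.
move=> h; rewrite /bmp /tprod; have [h1|h1] := boolP (`|x.1| < 4^-1); last first.
 by rewrite bump_out ?mul0r// -ltr_norml.
rewrite [X in _ * X]bump_out ?mulr0// -ltr_norml; apply/negP => h2; exact: h.
Qed.

Let bmp_sm2 : sm2 bmp.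
Proof. by apply: sm2_mul; [apply: sm2_fst|apply: sm2_snd]; exact: bump_sm. Qed.

Let bmp_test : test_fun bmp.
Proof. by apply: tprod_test; do ?[exact: bump_sm|exact: bump_csupp]. Qed.

(** A bump supported in the square of half-side [1/4]: two points of the support are at squared
    distance at most [1/2 < (3/4)^2], so the logarithm is at most [ln (3 / 4) < 0]. *)
Lemma compact_element : exists2 U, EE U & 0 < mm U /\ Q4 U U U U <= ln (3 / 4) * mm U ^+ 2.
Proof.
have [cb pds] := sm2_pd bmp_sm2; have [z1 [s1 d1]] := pds true; have [z2 [s2 d2]] := pds false.
have [bb bd] := test_fun_bs bmp_test.
have b1 : bs z1 by have := bd true; rewrite (is_pdE d1).
have b2 : bs z2 by have := bd false; rewrite (is_pdE d2).
have sq f : bs f -> bs (fun x => f x ^+ 2).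
 move=> [mf [r [C h]]]; split; first exact: measurable_funX.
 exists r, (C ^+ 2) => x; rewrite normrX; have := h x; rewrite !indicE; case: (_ \in _) => /= h'.
  by rewrite !mulr1 in h' *; rewrite ler_sqr ?nnegrE// (le_trans _ h').
 by move: h'; rewrite !mulr0 normr_le0 => /eqP ->; rewrite normr0 expr0n.
have in1 x : bmp x != 0 -> `|x.1| < 4^-1 /\ `|x.2| < 4^-1.
 by move=> h; apply: contrapT => /bmp_out e; rewrite e eqxx in h.
have EU : EE (bmp, z1, z2).
 split => /=.
 - have := WG_mul bmp_sm2 s1 s2 d1 d2 (WG_cst 1).
  by congr WG; apply/funext => x; rewrite ?mulr0 ?add0r mulr1.
 - by apply/F2_one; split; [case: b1|apply: bs_Int; exact: sq].
 - by apply/F2_one; split; [case: b2|apply: bs_Int; exact: sq].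
 - by split; [case: bb|apply: bs_Int; apply: bs_M; [exact: sV_cont|exact: sq]].
 - split; [by case: bb|]; have Ib : [L1 x, bmp x ^+ 2] by apply: bs_Int; exact: sq.
  apply: (Int_le (Int_Z 2 Ib)).
   by apply: measurable_funM; [exact: measurable_LL|apply: measurable_funX; case: bb].
  move=> x; rewrite ger0_norm; last by apply: mulr_ge0; [exact: LL_ge0|exact: sqr_ge0].
  have [->|/in1[h1 h2]] := eqVneq (bmp x) 0; first by rewrite expr0n/= !mulr0.
  apply: ler_wpM2r; first exact: sqr_ge0.
  apply: le_trans (LL_le x) _.
  have : enorm x <= 1.
   apply: sqr_le => //; rewrite enorm_sq expr1n -[x.1 ^+ 2]norm_sq -[x.2 ^+ 2]norm_sq.
   by have := normr_ge0 x.1; have := normr_ge0 x.2; nra.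
  lra.
exists (bmp, z1, z2) => //; set U := (_, _, _) in EU *.
have [_ _ I2] := mm_le EU.
have mE : mm U = rint mu2 (pr U U) by rewrite /mm bl_oneE.
split.
 have := mm_ge0 U; rewrite le_eqVlt => /orP[/eqP e|//].
 have e0 : [int x, bmp x ^+ 2] = 0 by rewrite [RHS]e mE; congr rint.
 have ae0 : [ae x, bmp x ^+ 2 <= 0].
  have := rint_eq0 I2 (fun x => sqr_ge0 _) e0; apply: filterS => x.
  by rewrite -[(bmp, z1, z2).1.1]/bmp => ->.
 have c2b : continuous (fun x => bmp x ^+ 2).
  by move=> x; apply: (continuous_comp (f := bmp) (g := fun t => t ^+ 2)); [exact: cb|exact: exprn_continuous].
 have /= := ae_continuous_le c2b ae0 (0, 0); rewrite leNgt exprn_even_gt0// /bmp /tprod /bump /ramp /flat/=.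
 rewrite !sub0r !subr0 !opprK !invr_gt0 !ltr0n/= !expr0 !mul1r !invrK !expr1.
 by rewrite !mulf_neq0// subr_eq0 gt_eqF// expR_lt1 oppr_lt0 expR_gt0.
have d := dens_pr EU EU; have [I _] := q_Int d d.
have [It rt] := tensor_int (dens_Int1 d) (dens_Int1 d).
rewrite mE expr2 -rt -rintZ// /Q4 /q /qf.
have It' := Int_Z (ln (3 / 4)) It.
have [J1 <- K1'] := rint_fubini1 (m1 := mu2) (m2 := mu2) I; have [J2 <- K2'] := rint_fubini1 (m1 := mu2) (m2 := mu2) It'.
apply: rint_le_ae => //; apply: filterS2 K1' K2' => x Ix Ix'.
apply: rint_le_ae => //; apply: filterS (mu2_point x) => y yx /=.
rewrite -[pr U U x]/(bmp x * bmp x) -[pr U U y]/(bmp y * bmp y).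
suff h : bmp x != 0 -> bmp y != 0 -> K0 x y <= ln (3 / 4).
 have [->|nx] := eqVneq (bmp x) 0; first by rewrite mulr0 !mul0r !mulr0.
 have [->|ny] := eqVneq (bmp y) 0; first by rewrite !(mul0r, mulr0).
 have hh := h nx ny; move: (bmp x) (bmp y) => s t.
 by apply: ler_wpM2r => //; rewrite -!expr2; apply: mulr_ge0; exact: sqr_ge0.
move=> /in1[x1 x2] /in1[y1 y2].
have e0 : 0 < enorm (psub x y) by apply: contrapT => /enorm_psub_eq0 h; apply: yx.
rewrite /K0 ler_ln ?posrE//; apply: sqr_le => //; rewrite enorm_sq /=.
move: x1 x2 y1 y2; rewrite !ltr_norml => /andP[? ?] /andP[? ?] /andP[? ?] /andP[? ?]; nra.
Qed.

(** On multiples [t *: U] of the compactly supported element the negative quartic term wins; [t]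
    makes it outweigh [t ^+ 2 * (NN U + 1)], while the power term has the good sign. *)
Lemma valley : exists2 W, EE W & Jm 1 W < 0.
Proof.
have [U EU [m0 hq]] := compact_element.
have l0 : ln (3 / 4) < 0 :> R by rewrite ln_lt0//; apply/andP; split; lra.
have c0 := c2_gt0; have mm2 : 0 < mm U ^+ 2 by rewrite exprn_gt0.
pose k := - (c2 / 4 * (ln (3 / 4) * mm U ^+ 2)).
have k0 : 0 < k by rewrite oppr_gt0 pmulr_rlt0 ?divr_gt0// nmulr_rlt0.
have n0 := NN_ge0 U; pose t := Num.sqrt ((NN U + 1) / k).
have t2 : t ^+ 2 = (NN U + 1) / k by rewrite sqr_sqrtr// divr_ge0 ?(ltW k0)// addr_ge0.
exists (t *: U); first exact: EE_Z.
have nt : NN (t *: U) = t ^+ 2 * NN U.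
 by have := NN_lin t 0 EU EU; rewrite scale0r addr0 mulr0 expr0n/= !mul0r !addr0.
have qt : Q4 (t *: U) (t *: U) (t *: U) (t *: U) = t ^+ 2 * (t ^+ 2 * Q4 U U U U).
 have e : pr (t *: U) (t *: U) = fun x => t ^+ 2 * pr U U x.
  by apply/funext => x; rewrite /pr -[(t *: U).1.1 x]/(t * U.1.1 x); ring.
 by have d := dens_pr EU EU; rewrite /Q4 e qZl ?qZr//; exact: dens_Z.
have pp := PP_ge0 (t *: U); have bp : 0 <= b / p by rewrite divr_ge0// ltW ?b0//; have := p2; lra.
rewrite /Jm /BB /JJ mul1r qt c8E; have := mulr_ge0 bp pp; move: nt; rewrite /NN.
move: (AA _) (VV _) (BL _) => A W B nt; rewrite -/(NN U) in nt.
have hq' : c2 / 4 * (t ^+ 2 * (t ^+ 2 * Q4 U U U U)) <= - t ^+ 2 * (NN U + 1).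
 have -> : - t ^+ 2 * (NN U + 1) = c2 / 4 * (t ^+ 2 * (t ^+ 2 * (ln (3 / 4) * mm U ^+ 2))).
  have -> : c2 / 4 * (t ^+ 2 * (t ^+ 2 * (ln (3 / 4) * mm U ^+ 2))) = - t ^+ 2 * (t ^+ 2 * k) by rewrite /k; ring.
  by rewrite {3}t2 divfK// gt_eqF.
 by rewrite ler_pM2l ?divr_gt0// ler_wpM2l ?sqr_ge0// ler_wpM2l ?sqr_ge0.
have t0 : 0 < t ^+ 2 by rewrite t2 divr_gt0//; lra.
have := mulr_ge0 (ltW t0) n0; move: (b / p * _) (c2 / 4 * _) hq' nt => x y; lra.
Qed.

(** The monotonicity trick on the interval from [1 / (n + 2)] to [1 / (n + 1)]. The barrier gives
    the lower bound and the level at parameter [1] the upper one, both independent of [n]. *)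
Lemma perturbed_critical_points : exists r0 K : R, 0 < r0 /\ forall n : nat, exists mu U,
 [/\ 0 < mu <= n.+1%:R^-1, crit mu U, r0 <= Jm mu U & Jm mu U <= K].
Proof.
have [s0 s00 hs] := barrier_at; have [e Ee Je] := valley.
have r00 : 0 < 4^-1 * s0 by rewrite mulr_gt0.
have z w : bl mu2 w (0 : pt -> R) (0 : pt -> R) = 0.
 by rewrite /bl (_ : (fun x => _) = fun=> 0) ?rint0//; apply/funext => x; rewrite !mulr0.
have J0 : JJ 0 = 0.
 rewrite /JJ /AA /VV /PP /Q4 /q /qf !z (_ : (fun x => _ `^ _) = fun=> 0) ?rint0.
  rewrite (_ : (fun x => _) = fun=> 0) ?rint0; first by rewrite !(mulr0, addr0, subr0).
  by apply/funext => x; rewrite /pr /= !(mul0r, mulr0).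
 by apply/funext => x; rewrite normr0 powR0// gt_eqF//; have := p2; lra.
have B0 : BB (0 : X) = 0 by rewrite /BB /BL z mulr0.
have smooth r : exists2 C, 0 < C & forall mu u v w, 0 <= mu <= 1 -> EE u -> EE v -> EE w -> nrm u <= r -> nrm v <= r ->
 [/\ `|JJ (u + v) + mu * BB (u + v) - (JJ u + mu * BB u) - (DJ u v + mu * DB u v)| <= C * nrm v ^+ 2,
   `|DJ (u + v) w + mu * DB (u + v) w - (DJ u w + mu * DB u w)| <= C * nrm v * nrm w &
   `|DJ u w + mu * DB u w| <= C * nrm w].
 exists (CS `|r|); first exact: CS_ge0.
 move=> mu u v w m01 Eu Ev Ew ur vr; have ur' := le_trans ur (ler_norm r); have vr' := le_trans vr (ler_norm r).
 split; [exact: Jm_taylor|exact: dJm_lip|exact: dJm_bound].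
have barrier n g : [/\ g 0%N = 0, g n = e & forall i, EE (g i)] ->
  exists i t, [/\ (i < n)%N, 0 <= t <= 1 & 4^-1 * s0 <= JJ (segm g i t)].
 move=> [g0 gn Eg]; have S0 : SS (g 0%N) <= s0.
  by rewrite g0 /SS /AA /VV !z !addr0 ltW.
 have [|i [t [lt t01 St]]] := path_crossing (n := n) Eg S0.
  rewrite gn ltNge; apply/negP => h; have := hs _ Ee h; rewrite leNgt => /negP; apply.
  apply: lt_le_trans (_ : 0 <= _); last by rewrite mulr_ge0// addr_ge0 ?AA_ge0 ?VV_ge0.
  by move: Je; rewrite /Jm mul1r; apply: le_lt_trans; rewrite lerDl mulr_ge0// BL_ge0.
 exists i, t; split => //; rewrite -St; apply: hs; last by rewrite St.
 exact: EE_lin.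
have BB_ge0 U : 0 <= BB U by rewrite mulr_ge0// BL_ge0.
pose K := mp_level EE JJ BB e 1.
exists (4^-1 * s0), K; split => // n.
have i0 : 0 < n.+2%:R^-1 :> R by rewrite invr_gt0.
have il : n.+2%:R^-1 < n.+1%:R^-1 :> R by rewrite ltf_pV2 ?posrE// ltr_nat.
have i1 : n.+1%:R^-1 <= 1 :> R by rewrite invf_le1// ler1n.
have [mu [r [l [/andP[m1 m2] l1 l2 PS]]]] := monotonicity_trick EE_0 (@EE_D) (@EE_Z) nrm_ge0
 (@nrm_D) (@nrm_Z) BB_ge0 (@dJm_lin) smooth perturbed_control J0 B0 Ee Je r00 barrier (ltW i0) il i1.
have mu0 : 0 < mu by exact: lt_le_trans m1.
have mu1 : mu <= 1 by exact: le_trans i1.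
have d0 k : 0 < k.+1%:R^-1 :> R by rewrite invr_gt0.
have [U_ HU] := choice (fun k => PS _ (d0 k)).
have inv_small (c : R) : 0 < c -> exists N : nat, forall k, (N <= k)%N -> k.+1%:R^-1 <= c.
 move=> c0; have [N _ hN] := near_infty_natSinv_lt (PosNum c0).
 by exists N => k /hN/ltW.
have [||||U [s sS [EU cU _ SJ]]] := @PS_perturbed r mu U_.
- by rewrite mu0 mu1.
- by move=> k; case: (HU k).
- by move=> k; case: (HU k).
- move=> c /inv_small[N hN]; exists N => k /hN kc W EW; have [_ _ _ h] := HU k.
 by apply: le_trans (h W EW) _; rewrite ler_wpM2r ?nrm_ge0.
exists mu, U; suff -> : Jm mu U = l by split => //; rewrite mu0.
apply/eqP; rewrite -subr_eq0 -normr_le0; apply/ler_addgt0Pr => c c0; rewrite add0r.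
have c20 : 0 < c / 2 by alra.
have [N1 h1] := SJ _ c20; have [N2 h2] := inv_small _ c20.
pose k := maxn N1 N2; have := h1 k (leq_maxl _ _).
have h3 : (s k).+1%:R^-1 <= c / 2 by apply: h2; exact: leq_trans (leq_maxr _ _) (increasing_subseq_ge sS k).
have [_ _ h4 _] := HU (s k); have -> : Jm mu U - l = (Jm mu (U_ (s k)) - l) - (Jm mu (U_ (s k)) - Jm mu U) by ring.
move=> h5; apply: le_trans (ler_normB _ _) _; have := le_trans h4 h3; rewrite /Jm; move: h5; rewrite /Jm; alra.
Qed.

End mountain_pass_geometry.

(** * Decay of critical points *)

Section decay.
Implicit Types (U W Y Z : X) (a s t mu r : R) (f h eta z : pt -> R).

Lemma tail_small f (e : R) : Int mu2 f -> (forall x, 0 <= f x) -> 0 < e ->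
 exists2 n : nat, [L1 x, f x * \1_(~` cube n%:R) x] & [int x, f x * \1_(~` cube n%:R) x] <= e.
Proof.
move=> If f0 e0; have mc n : measurable (~` cube (n%:R : R)) by apply: measurableC; exact: measurable_cube.
have le (n : nat) x : `|f x * \1_(~` cube n%:R) x| <= f x.
 by rewrite indicE; case: (_ \in _); rewrite ?mulr1 ?mulr0 ?normr0// ger0_norm.
have cv : [ae x, f x * \1_(~` cube n%:R) x @[n --> \oo] --> (0 : R)].
 apply: nearW => x; have [k ck] := cube_cover x; apply: cvg_near_cst; near=> n.
 rewrite indicE memNset ?mulr0//= => h; apply: h; apply: cubeS ck; rewrite ler_nat; near: n; exact: nbhs_infty_ge.
have I n := Int_indic (mc n) If.
have [_] := dominated_rint (fun n => Int_mf (I n)) (measurable_cst (0 : R)) If le cv.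
rewrite rint0 => h.
have [n hn] : exists n : nat, [int x, f x * \1_(~` cube n%:R) x] < e.
 have hn : \forall n \near \oo, [int x, f x * \1_(~` cube n%:R) x] < e by exact: (cvgr_lt _ h _ e0).
 exact: filter_ex hn.
by exists n => //; exact: ltW.
Unshelve. all: by end_near. Qed.

Definition mulT eta z1 z2 U : X := (fun x => eta x * U.1.1 x, fun x => eta x * U.1.2 x + z1 x * U.1.1 x,
 fun x => eta x * U.2 x + z2 x * U.1.1 x).

Lemma F2_bM (w f h : pt -> R) (M : R) : mfun w -> (forall x, 0 <= w x) -> mfun f ->
 (forall x, `|f x| <= M) -> F2 mu2 w h -> F2 mu2 w (fun x => f x * h x).
Proof.
move=> mw w0 mf fM [mh Ih]; split; first exact: measurable_funM.
apply: (Int_le (Int_Z (M ^+ 2) Ih)).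
 by apply: measurable_funM => //; apply: measurable_funX; exact: measurable_funM.
move=> x; rewrite ger0_norm; last by apply: mulr_ge0 => //; exact: sqr_ge0.
rewrite exprMn mulrCA; apply: ler_wpM2r; first by apply: mulr_ge0 => //; exact: sqr_ge0.
by rewrite -[f x ^+ 2]norm_sq ler_sqr ?nnegrE// (le_trans _ (fM x)).
Qed.

Lemma sm2_measurable f : sm2 f -> mfun f.
Proof. by move=> /sm2_pd[cf _]; exact: continuous_measurable2. Qed.

Lemma EE_mulT eta z1 z2 U (M : R) : sm2 eta -> sm2 z1 -> sm2 z2 -> is_pd true eta z1 -> is_pd false eta z2 ->
 (forall x, `|eta x| <= M) -> (forall x, `|z1 x| <= M) -> (forall x, `|z2 x| <= M) -> EE U -> EE (mulT eta z1 z2 U).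
Proof.
move=> s0 s1 s2 d1 d2 b0 b1 b2 EU; have [W A1 A2 AV AL] := EU; have Fu := EE_F2u EU.
have mm := @sm2_measurable.
have mo := @measurable_one; have o0 := @one_ge0.
have add f h : F2 mu2 one f -> F2 mu2 one h -> F2 mu2 one (fun x => f x + h x).
 by move=> Ff Fh; have := F2_lin mo o0 1 1 Ff Fh; rewrite funD11.
split => /=.
- exact: WG_mul.
- by apply: add; apply: F2_bM mo o0 (mm _ _) _ _; eassumption.
- by apply: add; apply: F2_bM mo o0 (mm _ _) _ _; eassumption.
- by apply: F2_bM measurable_V V_ge0 (mm _ _) _ _; eassumption.
- by apply: F2_bM measurable_LL LL_ge0 (mm _ _) _ _; eassumption.
Qed.

(** The test function is [eta^2 u], and the product of [grad u] and [grad (eta^2 u)] is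
    [|grad (eta u)|^2 - u^2 |grad eta|^2]. *)
Lemma test_identity mu eta z1 z2 U (M : R) : sm2 eta -> sm2 z1 -> sm2 z2 -> is_pd true eta z1 -> is_pd false eta z2 ->
 (forall x, `|eta x| <= M) -> (forall x, `|z1 x| <= M) -> (forall x, `|z2 x| <= M) -> crit mu U ->
 let Y := mulT eta z1 z2 U in
 AA Y + VV Y + mu * BL Y + c2 * Q4 U U Y Y = b * [int x, `|U.1.1 x| `^ (p - 2) * Y.1.1 x ^+ 2] +
  [int x, (z1 x ^+ 2 + z2 x ^+ 2) * U.1.1 x ^+ 2].
Proof.
move=> s0 s1 s2 d1 d2 b0 b1 b2 [EU cU] Y.
have EY : EE Y := EE_mulT s0 s1 s2 d1 d2 b0 b1 b2 EU.
pose W := mulT eta z1 z2 Y; have EW : EE W := EE_mulT s0 s1 s2 d1 d2 b0 b1 b2 EY.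
have := cU W EW; rewrite /dJm /DJ /DB -/c2.
have mo := @measurable_one; have o0 := @one_ge0.
have Fu := EE_F2u EU; have [_ A1 A2 _ _] := EU; have [_ B1 B2 _ _] := EY; have [_ C1 C2' _ _] := EW.
have mm := @sm2_measurable.
have Fz1 := F2_bM mo o0 (mm _ s1) b1 Fu; have Fz2 := F2_bM mo o0 (mm _ s2) b2 Fu.
have key (g z yg wg : pt -> R) : F2 mu2 one g -> F2 mu2 one yg -> F2 mu2 one wg ->
  F2 mu2 one (fun x => z x * U.1.1 x) ->
  (forall x, yg x = eta x * g x + z x * U.1.1 x) -> (forall x, wg x = eta x * yg x + z x * Y.1.1 x) ->
  bl0 g wg = bl0 yg yg - bl0 (fun x => z x * U.1.1 x) (fun x => z x * U.1.1 x).
 move=> Fg Fy Fw Fz h1 h2; rewrite -[LHS](addrK (bl0 (fun x => z x * U.1.1 x) (fun x => z x * U.1.1 x))).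
 congr (_ - _); rewrite /bl -rintD; do ?exact: bl_Int.
 apply: eq_rint => x; rewrite h2 h1 /Y /=; ring.
rewrite (key U.1.2 z1 Y.1.2 W.1.2)// (key U.2 z2 Y.2 W.2)//.
have -> : bl mu2 V U.1.1 W.1.1 = VV Y.
 by rewrite /VV /bl; apply: eq_rint => x; rewrite /W /Y /=; ring.
have -> : bl mu2 LL U.1.1 W.1.1 = BL Y.
 by rewrite /BL /bl; apply: eq_rint => x; rewrite /W /Y /=; ring.
have -> : Q4 U U U W = Q4 U U Y Y.
 by rewrite /Q4; congr q; apply/funext => x; rewrite /pr /W /Y /=; ring.
have -> : [int x, spow p (U.1.1 x) * W.1.1 x] = [int x, `|U.1.1 x| `^ (p - 2) * Y.1.1 x ^+ 2].
 by apply: eq_rint => x; rewrite /spow /W /Y /=; ring.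
have -> : [int x, (z1 x ^+ 2 + z2 x ^+ 2) * U.1.1 x ^+ 2] =
  bl0 (fun x => z1 x * U.1.1 x) (fun x => z1 x * U.1.1 x) + bl0 (fun x => z2 x * U.1.1 x) (fun x => z2 x * U.1.1 x).
 rewrite /bl -rintD; do ?exact: bl_Int.
 by apply: eq_rint => x; rewrite /one; ring.
rewrite /AA; move: (bl _ _ _ _) (bl _ _ _ _) (VV Y) (BL Y) (Q4 _ _ _ _) (b * _) => x1 x2 x3 x4 x5 x6.
move: (bl _ _ _ _) (bl _ _ _ _) => y1 y2; lra.
Qed.

Let EE_split U (n : nat) : EE U -> [/\ dens (fun x => U.1.1 x ^+ 2 * \1_(cube n%:R) x),
 dens (fun x => U.1.1 x ^+ 2 * \1_(~` cube n%:R) x) &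
 n2 (fun x => U.1.1 x ^+ 2 * \1_(~` cube n%:R) x) = [int x, U.1.1 x ^+ 4 * \1_(~` cube n%:R) x]].
Proof.
move=> EU; have [mu I1 I2] := dens_pr EU EU; have mc := @measurable_cube n%:R; have mc' := measurableC mc.
have H (A : set pt) : measurable A -> dens (fun x => U.1.1 x ^+ 2 * \1_A x).
 move=> mA; have mf : mfun (fun x => U.1.1 x ^+ 2 * \1_A x) by apply: measurable_funM; [exact: mu|exact: measurable_indic].
 split => //.
 - apply: (Int_le I1); first by apply: measurable_funM; [exact: measurable_LL|exact: measurableT_comp].
  move=> x; rewrite ger0_norm ?mulr_ge0 ?LL_ge0// ler_wpM2l ?LL_ge0// normrM /pr -expr2 indicE.
  by case: (_ \in _); rewrite ?normr1 ?normr0 ?mulr1 ?mulr0.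
 - apply: (Int_le I2); first exact: measurable_funX.
  move=> x; rewrite ger0_norm ?sqr_ge0// exprMn /pr -expr2 indicE.
  by case: (_ \in _); rewrite ?expr1n ?expr0n/= ?mulr1 ?mulr0// sqr_ge0.
split; [exact: H|exact: H|].
rewrite /n2; apply: eq_rint => x; rewrite exprMn -exprM indicE.
by case: (_ \in _); rewrite ?expr1n ?expr0n.
Qed.

Let split_sum (f : pt -> R) (A : set pt) x : f x = f x * \1_A x + f x * \1_(~` A) x.
Proof. by rewrite -mulrDr !indicE in_setC; case: (_ \in _); rewrite ?addr0 ?add0r mulr1. Qed.

Let tau_arith (x y : R) : 0 <= x -> 0 <= y -> (x + y) * (8 * (x + y + 1))^-1 <= 8^-1.
Proof. by move=> x0 y0; rewrite ler_pdivrMr; lra. Qed.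

Let decay_arith (S w q y1 y2 y3 C1 k C2 t m v c s4 bb : R) : 0 <= w -> S + w + c * q = bb * y2 + y3 ->
 c * - q <= c * (C1 + k) -> bb * y2 <= bb * (v + s4 * y1) -> bb * s4 * y1 <= bb * s4 * (C2 + t) -> y3 <= m ->
 c * k + bb * s4 * t <= 8^-1 * S -> bb * v <= 8^-1 * S -> 0 <= S -> S <= 2 * (c * C1 + bb * s4 * C2 + m).
Proof. lra. Qed.

Lemma K2_near (x y : pt) : K2 x y != 0 -> enorm (psub x y) < 1.
Proof.
apply: contraR; rewrite -leNgt => h; rewrite /K2 /K0; apply/eqP/max_idPr.
by rewrite oppr_le0 ln_ge0.
Qed.

(* Testing with [eta ^ 2 u], where [eta] is bounded, [|eta| <= |x|] and [|grad eta| <= 1] : the terms of lower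
  order are absorbed outside of a large cube, uniformly in [eta]. *)
Lemma decay_estimate mu U : 0 <= mu -> crit mu U -> exists C : R, forall eta z1 z2 (M : R),
 sm2 eta -> sm2 z1 -> sm2 z2 -> is_pd true eta z1 -> is_pd false eta z2 ->
 (forall x, `|eta x| <= M) -> (forall x, `|z1 x| <= M) -> (forall x, `|z2 x| <= M) ->
 (forall x, z1 x ^+ 2 + z2 x ^+ 2 <= 1) -> (forall r x, cube r x -> `|eta x| <= r) ->
 SS (mulT eta z1 z2 U) <= C.
Proof.
move=> mu0 cU; have [EU _] := cU.
have k0 := kap_ge0; have c0 := c2_gt0; have bb := b0; have pp := p2; have V0 := sV0_gt0 D.
have e0 : 0 < sV0 D / (8 * b) by rewrite divr_gt0 ?mulr_gt0.
have p20 : p - 2 != 0 by rewrite subr_eq0 gt_eqF.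
have [s s0 se] := powR_solve e0 p20; set sp4 := s `^ (p - 4).
have sp40 : 0 <= sp4 := powR_ge0 _ _.
pose k4 := 4 / Num.sqrt (sV0 D); have k40 : 0 < k4 by rewrite divr_gt0// sqrtr_gt0.
(* [k4] comes from [S4 Y <= (k4 * SS Y) ^+ 2]. With [u^2] of [L^2] norm at most [tau] outside the
   cube, the far parts of the kernel and power terms take at most [SS Y / 8]. *)
pose tau := (8 * (c2 * kap * k4 + b * sp4 * k4 + 1))^-1.
have ck : 0 <= c2 * kap * k4 by rewrite !mulr_ge0// ltW.
have bk : 0 <= b * sp4 * k4 := mulr_ge0 (mulr_ge0 (ltW bb) sp40) (ltW k40).
have tau0 : 0 < tau by rewrite invr_gt0 mulr_gt0//; lra.
have [I4 _] := S4_le EU.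
have U40 x : 0 <= U.1.1 x ^+ 4 by rewrite exprn_even_ge0.
have t20 : 0 < tau ^+ 2 by rewrite exprn_gt0.
have [n _ hn] := tail_small I4 U40 t20.
have [df1 df2 n2f] := EE_split n EU; rewrite -n2f in hn.
set f1 := (fun x => U.1.1 x ^+ 2 * \1_(cube n%:R) x) in df1.
set f2 := (fun x => U.1.1 x ^+ 2 * \1_(~` cube n%:R) x) in df2 n2f hn.
have [mU _ Im] := mm_le EU; have dU := dens_pr EU EU.
(* [K2] vanishes at distance at least [1]: if one point lies in [cube n], the other lies in
   [cube (n + 1)], where [|eta| <= n + 1]. *)
pose r : R := n%:R + 1; have r0 : 0 <= r by rewrite addr_ge0.
pose C1 := r ^+ 2 * qf K2 (pr U U) (pr U U); pose C2 := r ^+ 2 * S4 U.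
exists (2 * (c2 * C1 + b * sp4 * C2 + mm U)) => eta z1 z2 M s0' s1 s2 d1 d2 b0' b1 b2 z12 er.
have := test_identity s0' s1 s2 d1 d2 b0' b1 b2 cU; set Y := mulT _ _ _ _ => tid.
have EY : EE Y := EE_mulT s0' s1 s2 d1 d2 b0' b1 b2 EU.
have dY := dens_pr EY EY; have [_ mY IY] := mm_le EY; have [IY4 h4] := S4_le EY.
have A0 := AA_ge0 Y; have VY0 := VV_ge0 Y; have m0 := mm_ge0 Y; have BL0 := BL_ge0 Y.
have S0 : 0 <= SS Y by rewrite addr_ge0.
have n2Y := n2_diag Y.
have S4Y : S4 Y <= (k4 * SS Y) ^+ 2.
 apply: le_trans h4 _; rewrite exprMn /k4 expr_div_n sqr_sqrtr ?(ltW V0)//.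
 have -> : 4 ^+ 2 / sV0 D * SS Y ^+ 2 = 16 * (SS Y / sV0 D * SS Y) by field; rewrite gt_eqF.
 rewrite -mulrA ler_pM2l//; apply: ler_pM => //; last by rewrite lerDl.
 by rewrite ler_pdivlMr// mulrC (le_trans mY)// lerDr.
have kS : 0 <= k4 * SS Y by rewrite mulr_ge0// ltW.
have pYE x : pr Y Y x = eta x ^+ 2 * pr U U x by rewrite /pr /Y /=; ring.
have sqn x : 0 <= U.1.1 x ^+ 2 := sqr_ge0 _.
have f1U x : 0 <= f1 x <= U.1.1 x ^+ 2.
 by rewrite /f1 indicE; case: (_ \in _); rewrite ?mulr1 ?mulr0 ?lexx ?sqn.
have h1 : - Q4 U U Y Y <= C1 + kap * (tau * (k4 * SS Y)).
 rewrite /Q4; have [_ ->] := q_Int dU dY.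
 have q10 : 0 <= qf K1 (pr U U) (pr Y Y) := qfK1_ge0 U Y.
 have [IK _] := K2_form dU dU; have [J1 _] := K2_form df1 dY; have [J2 _] := K2_form df2 dY.
 have E : qf K2 (pr U U) (pr Y Y) = qf K2 f1 (pr Y Y) + qf K2 f2 (pr Y Y).
  rewrite /qf -rintD//; apply: eq_rint => w; rewrite -mulrDr -mulrDl; congr (_ * (_ * _)).
  exact: (split_sum (fun x => U.1.1 x ^+ 2) (cube n%:R)).
 have q2 := q2_bound df2 dY (ltW tau0) kS hn; rewrite n2Y in q2; have := le_trans (ler_norm _) (q2 S4Y).
 suff : qf K2 f1 (pr Y Y) <= C1.
  by rewrite E; move: (qf _ _ _) (qf _ _ _) (kap * _) q10; clear => x1 x2 x3; lra.
 rewrite /C1 -rintZ//; apply: rint_le => //; first exact: Int_Z.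
 move=> [x y] /=; rewrite [leRHS]mulrCA; have [->|/K2_near nxy] := eqVneq (K2 x y) 0; first by rewrite !mul0r.
 apply: ler_wpM2l; first exact: K2_ge0.
 have pU w : 0 <= pr U U w by rewrite /pr -expr2.
 have pY : 0 <= pr Y Y y by rewrite /pr -expr2 sqr_ge0.
 have [xn|xn] := pselect (cube n%:R x); last first.
  by rewrite /f1 indicE memNset//= mulr0 mul0r; apply: mulr_ge0; [exact: sqr_ge0|exact: mulr_ge0].
 have -> : f1 x = pr U U x by rewrite /f1 indicE mem_set//= mulr1 expr2.
 suff ey : eta y ^+ 2 <= r ^+ 2.
  apply: le_trans (ler_wpM2r (mulr_ge0 (pU x) (pU y)) ey); rewrite pYE.
  by apply: le_eq; ring.
 rewrite -[eta y ^+ 2]norm_sq ler_sqr ?nnegrE//; apply: er.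
 move/cubeP: xn => [x1 x2]; have y1 := enorm_ge1 (psub x y); have y2 := enorm_ge2 (psub x y).
 have cy (t t' : R) : `|t| <= n%:R -> `|t - t'| < 1 -> `|t'| <= r.
  move=> ht ht'; have -> : t' = t - (t - t') by ring.
  by apply: le_trans (ler_normB _ _) _; apply: lerD => //; exact: ltW.
 apply/cubeP; split; [exact: cy x1 (le_lt_trans y1 nxy)|exact: cy x2 (le_lt_trans y2 nxy)].
have Iuy : [L1 x, pr U U x * pr Y Y x].
 have [_ _ I1] := dU; have [_ _ I2] := dY.
 have F1 : F2 mu2 one (pr U U) by apply/F2_one; split; [case: dU|].
 have F2' : F2 mu2 one (pr Y Y) by apply/F2_one; split; [case: dY|].
 by have := bl_Int measurable_one one_ge0 F1 F2'; under eq_fun do rewrite mul1r.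
have h2 : [int x, pr U U x * pr Y Y x] <= C2 + tau * (k4 * SS Y).
 have Fo f : dens f -> F2 mu2 one f by move=> [mf _ If]; apply/F2_one.
 have J1 := bl_Int measurable_one one_ge0 (Fo _ df1) (Fo _ dY).
 have J2 := bl_Int measurable_one one_ge0 (Fo _ df2) (Fo _ dY).
 have -> : [int x, pr U U x * pr Y Y x] = bl0 f1 (pr Y Y) + bl0 f2 (pr Y Y).
  rewrite /bl -rintD//; apply: eq_rint => x; rewrite -mulrDr -mulrDl /one mul1r; congr (_ * _).
  exact: (split_sum (fun x => U.1.1 x ^+ 2) (cube n%:R)).
 apply: lerD.
  rewrite /C2 /S4 -rintZ//; apply: rint_le => //; first exact: Int_Z.
  move=> x; rewrite /one mul1r pYE.
  have [xn|xn] := pselect (cube n%:R x); last by rewrite /f1 indicE memNset//= mulr0 mul0r mulr_ge0 ?sqr_ge0.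
  have ex : eta x ^+ 2 <= r ^+ 2.
   rewrite -[eta x ^+ 2]norm_sq ler_sqr ?nnegrE//; apply: er; apply: cubeS xn.
   by rewrite /r lerDl.
  rewrite /f1 indicE mem_set//= mulr1 /pr; have -> : U.1.1 x ^+ 2 * (eta x ^+ 2 * (U.1.1 x * U.1.1 x)) = eta x ^+ 2 * U.1.1 x ^+ 4 by ring.
  exact: ler_wpM2r.
 apply: sqr_le; first by rewrite mulr_ge0// ltW.
 apply: le_trans (bl_CS measurable_one one_ge0 (Fo _ df2) (Fo _ dY)) _.
 rewrite exprMn; apply: ler_pM; do ?[by apply: bl_ge0 => x; exact: one_ge0].
  by apply: le_trans hn; rewrite bl_oneE.
 by apply: le_trans S4Y; rewrite -n2Y bl_oneE.
have h3 : [int x, `|U.1.1 x| `^ (p - 2) * Y.1.1 x ^+ 2] <= sV0 D / (8 * b) * mm Y + sp4 * [int x, pr U U x * pr Y Y x].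
 rewrite /mm bl_oneE -!rintZ// -rintD; do ?exact: Int_Z.
 have q x : `|U.1.1 x| `^ (p - 2) * Y.1.1 x ^+ 2 <= sV0 D / (8 * b) * (Y.1.1 x * Y.1.1 x) + sp4 * (pr U U x * pr Y Y x).
  have := powR_interp (sp_itv D) s0 (normr_ge0 (U.1.1 x)); rewrite se -/sp4 norm_sq.
  move=> /(ler_wpM2r (sqr_ge0 (Y.1.1 x))) /le_trans; apply.
  by rewrite /pr; apply: le_eq; ring.
 have IR : [L1 x, sV0 D / (8 * b) * (Y.1.1 x * Y.1.1 x) + sp4 * (pr U U x * pr Y Y x)].
  by apply: Int_D; exact: Int_Z.
 apply: rint_le => //; apply: (Int_le IR) => [|x].
  apply: measurable_funM; first by apply: measurable_powR_norm; exact: measurable_u EU.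
  by apply: measurable_funX; exact: measurable_u EY.
 by rewrite ger0_norm; [exact: q|apply: mulr_ge0; [exact: powR_ge0|exact: sqr_ge0]].
have h5 : [int x, (z1 x ^+ 2 + z2 x ^+ 2) * U.1.1 x ^+ 2] <= mm U.
 rewrite /mm bl_oneE; have mz f : sm2 f -> mfun f by move=> /sm2_pd[cf _]; exact: continuous_measurable2.
 have le x : (z1 x ^+ 2 + z2 x ^+ 2) * U.1.1 x ^+ 2 <= U.1.1 x * U.1.1 x by rewrite -expr2 ler_piMl.
 apply: rint_le => //; apply: (Int_le Im) => [|x].
  apply: measurable_funM; last by apply: measurable_funX; exact: measurable_u EU.
  by apply: measurable_funD; apply: measurable_funX; exact: mz.
 rewrite ger0_norm; first by apply: le_trans (le x) _; rewrite expr2.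
 by apply: mulr_ge0; [apply: addr_ge0|]; exact: sqr_ge0.
have tk : c2 * (kap * (tau * (k4 * SS Y))) + b * sp4 * (tau * (k4 * SS Y)) <= 8^-1 * SS Y.
 have -> : c2 * (kap * (tau * (k4 * SS Y))) + b * sp4 * (tau * (k4 * SS Y)) = (c2 * kap * k4 + b * sp4 * k4) * tau * SS Y by ring.
 apply: ler_wpM2r => //; exact: tau_arith.
have bV : b * (sV0 D / (8 * b) * mm Y) <= 8^-1 * SS Y.
 have -> : b * (sV0 D / (8 * b) * mm Y) = 8^-1 * (sV0 D * mm Y) by field; rewrite gt_eqF.
 rewrite ler_pM2l//; apply: le_trans mY _; by rewrite /SS lerDr.
have mB : 0 <= mu * BL Y by exact: mulr_ge0.
have g1 := ler_wpM2l (ltW c0) h1; have g2 := ler_wpM2l (ltW bb) h3.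
have g3 := ler_wpM2l (mulr_ge0 (ltW bb) sp40) h2.
exact: (decay_arith mB tid g1 g2 g3 h5 tk bV S0).
Qed.

Lemma sin_bounds (t : R) : `|sin t| <= `|t| /\ `|sin t - t| <= t ^+ 2.
Proof.
have cont (f g : R -> R) x : (forall x, is_derive x (1 : R) f (g x)) -> {within `[0, x], continuous f}.
 by move=> d; apply: continuous_subspaceT => y; exact: is_derive_continuous (d y).
have pos (x : R) : 0 <= x -> `|sin x| <= x /\ `|sin x - x| <= x ^+ 2.
 move=> x0; have [|c] := MVT_segment x0 (fun y _ => is_derive_sin y); first exact: cont (@is_derive_sin R).
 rewrite in_itv/= sin0 !subr0 => /andP[c0 cx] ->.
 have [|d _] := MVT_segment c0 (fun y _ => is_derive_cos y); first exact: cont (@is_derive_cos R).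
 rewrite cos0 subr0 => e; split; first by rewrite normrM (ger0_norm x0) ler_piMl// cos_max.
 rewrite -[X in cos c * x - X]mul1r -mulrBl e normrM (ger0_norm x0) expr2 ler_wpM2r//.
 by rewrite normrM normrN (ger0_norm c0) (le_trans _ cx)// ler_piMl// sin_max.
have [t0|t0] := leP 0 t; first by have [h1 h2] := pos _ t0; rewrite (ger0_norm t0).
have [|h1 h2] := pos (- t); first by rewrite oppr_ge0 ltW.
by move: h1 h2; rewrite sinN normrN sqrrN (ltr0_norm t0) -opprD normrN.
Qed.

(** The cut-off [n sin (x / n)], with [n + 1] for [n]: bounded, smooth, at most [|x|], of slope at
    most [1], and tending to [x]. *)
Lemma scaled_sin (n : nat) (eta := fun t : R => n.+1%:R * sin (n.+1%:R^-1 * t + 0)) (z := fun t : R => cos (n.+1%:R^-1 * t + 0)) :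
 [/\ sm eta, sm z, forall t, is_derive t (1 : R) eta (z t), forall t, `|eta t| <= n.+1%:R &
   forall t, [/\ `|z t| <= 1, `|eta t| <= `|t| & `|eta t - t| <= t ^+ 2 / n.+1%:R]].
Proof.
have n0 : 0 < n.+1%:R :> R by rewrite ltr0n.
have n00 : n.+1%:R != 0 :> R by rewrite gt_eqF.
split.
- by apply: (@sm_mul (fun=> n.+1%:R)); [exact: sm_cst|apply: sm_aff; exact: sm_sin].
- by apply: sm_aff; exact: sm_cos.
- move=> t; have d1 : is_derive t (1 : R) (fun t => n.+1%:R^-1 * t + 0) (n.+1%:R^-1).
  have := idD (idM (idC n.+1%:R^-1 t) (idid t)) (idC (0 : R) t).
  by move/is_derive_eq; apply; ring.
 have := idM (idC n.+1%:R t) (@idcomp sin _ _ _ _ (is_derive_sin _) d1).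
 by move/is_derive_eq; apply; rewrite /z mul0r add0r mulrCA mulfV// mulr1.
- by move=> t; rewrite /eta normrM ger0_norm ?ler_piMr ?sin_max// ltW.
- move=> t; have [h1 h2] := sin_bounds (n.+1%:R^-1 * t + 0); rewrite addr0 in h1 h2.
 rewrite /z /eta addr0 cos_max; split => //.
  rewrite normrM gtr0_norm//; apply: le_trans (ler_wpM2l (ltW n0) h1) _.
  by rewrite normrM gtr0_norm ?invr_gt0// mulrA mulfV// mul1r.
 have -> : n.+1%:R * sin (n.+1%:R^-1 * t) - t = n.+1%:R * (sin (n.+1%:R^-1 * t) - n.+1%:R^-1 * t).
  by rewrite mulrBr mulrA mulfV// mul1r.
 rewrite normrM (gtr0_norm n0); apply: le_trans (ler_wpM2l (ltW n0) h2) _.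
 by apply: le_eq; field.
Qed.

Lemma scaled_sin_cvg (x : R) : (n.+1%:R * sin (n.+1%:R^-1 * x + 0) : R) @[n --> \oo] --> x.
Proof.
apply/cvgrPdist_le => e e0; near=> n; rewrite distrC; have [_ _ _ _ /(_ x)[_ _]] := scaled_sin n; move=> /le_trans; apply.
rewrite ler_pdivrMr ?ltr0n// mulrC -ler_pdivrMr//; apply: le_trans (ltW (truncnS_gt _)) _.
rewrite ler_nat ltnS; near: n; exact: nbhs_infty_ge.
Unshelve. all: by end_near. Qed.

Lemma is_pd_fst (f f' : R -> R) : (forall t, is_derive t (1 : R) f (f' t)) ->
 is_pd true (fun x => f x.1) (fun x => f' x.1) /\ is_pd false (fun x => f x.1) (fun=> 0).
Proof.
by move=> d; split => x; [exact: is_derive_addl (d x.1)|rewrite /Defs.shift /=; exact: is_derive_cst].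
Qed.

Lemma is_pd_snd (f f' : R -> R) : (forall t, is_derive t (1 : R) f (f' t)) ->
 is_pd false (fun x => f x.2) (fun x => f' x.2) /\ is_pd true (fun x => f x.2) (fun=> 0).
Proof.
by move=> d; split => x; [exact: is_derive_addl (d x.2)|rewrite /Defs.shift /=; exact: is_derive_cst].
Qed.

(** [decay_estimate] for the cut-offs [scaled_sin] of one coordinate at a time, its bound being
    uniform, then Fatou. *)
Lemma decay mu U : 0 <= mu -> crit mu U ->
 [L1 x, x.1 ^+ 2 * (U.1.1 x ^+ 2 + U.1.2 x ^+ 2 + U.2 x ^+ 2)] /\
 [L1 x, x.2 ^+ 2 * (U.1.1 x ^+ 2 + U.1.2 x ^+ 2 + U.2 x ^+ 2)].
Proof.
move=> mu0 cU; have [C hC] := decay_estimate mu0 cU; have [EU _] := cU.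
have [_ /F2_one[m1 I1] /F2_one[m2 I2] _ _] := EU; have [_ _ Iu] := mm_le EU.
have V0 := sV0_gt0 D; pose B := 2 * C + 2 * mm U + C / sV0 D.
pose N x := U.1.1 x ^+ 2 + U.1.2 x ^+ 2 + U.2 x ^+ 2.
have N0 x : 0 <= N x by rewrite !addr_ge0 ?sqr_ge0.
have mN : mfun N.
 apply: measurable_funD; last exact: measurable_funX.
 by apply: measurable_funD; apply: measurable_funX => //; exact: measurable_u EU.
have mc f : sm2 f -> mfun f by move=> /sm2_pd[cf _]; exact: continuous_measurable2.
have s0 : sm2 (fun _ : pt => 0 : R) by apply: (@sm2_fst (fun=> 0)); exact: sm_cst.
have bnd eta z1 z2 (M : R) : sm2 eta -> sm2 z1 -> sm2 z2 -> is_pd true eta z1 -> is_pd false eta z2 ->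
  (forall x, `|eta x| <= M) -> (forall x, `|z1 x| <= M) -> (forall x, `|z2 x| <= M) ->
  (forall x, z1 x ^+ 2 + z2 x ^+ 2 <= 1) -> (forall r x, cube r x -> `|eta x| <= r) ->
  [L1 x, eta x ^+ 2 * N x] /\ [int x, eta x ^+ 2 * N x] <= B.
 move=> s s1 s2 d1 d2 b0 b1 b2 z12 er; have := hC _ _ _ _ s s1 s2 d1 d2 b0 b1 b2 z12 er.
 have EY := EE_mulT s s1 s2 d1 d2 b0 b1 b2 EU; set Y := mulT _ _ _ _ in EY * => h.
 have [_ /F2_one[n1 J1] /F2_one[n2 J2] _ _] := EY; have [_ hV J0] := mm_le EY.
 have hm : mm Y <= C / sV0 D.
  by rewrite ler_pdivlMr// mulrC (le_trans hV)// (le_trans _ h)// lerDr AA_ge0.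
 have hA : AA Y <= C by apply: le_trans h; rewrite lerDl VV_ge0.
 (* [eta grad u] is [grad (eta u) - u grad eta], and [|grad eta| <= 1]. *)
 have q x : eta x ^+ 2 * N x <= 2 * (Y.1.2 x ^+ 2 + Y.2 x ^+ 2) + 2 * U.1.1 x ^+ 2 + Y.1.1 x ^+ 2.
  rewrite /N /Y /mulT /=; have := z12 x; have := sqr_ge0 (U.1.1 x).
  move: (eta x) (z1 x) (z2 x) (U.1.1 x) (U.1.2 x) (U.2 x) => e y1 y2 u g1 g2 u0 y12.
  have := ler_wpM2r u0 y12; have := sqr_ge0 (e * g1 + 2 * (y1 * u)); have := sqr_ge0 (e * g2 + 2 * (y2 * u)); lra.
 have I12 : [L1 x, 2 * (Y.1.2 x ^+ 2 + Y.2 x ^+ 2) + 2 * U.1.1 x ^+ 2].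
  by apply: Int_D; apply: Int_Z => //; exact: Int_D.
 have IR := Int_D I12 J0.
 have IL : [L1 x, eta x ^+ 2 * N x].
  apply: (Int_le IR) => [|x]; first by apply: measurable_funM => //; apply: measurable_funX; exact: mc.
  by rewrite ger0_norm// mulr_ge0// sqr_ge0.
 split => //; apply: le_trans (rint_le IL IR q) _.
 rewrite rintD// rintD; [|by apply: Int_Z; exact: Int_D|exact: Int_Z].
 rewrite rintZ; last exact: Int_D.
 rewrite rintZ// rintD//; move: hA hm; rewrite /AA /B /mm !bl_oneE.
 move: ([int x, Y.1.2 x ^+ 2]) ([int x, Y.2 x ^+ 2]) ([int x, Y.1.1 x ^+ 2]).
 move: ([int x, U.1.1 x ^+ 2]) (C / _) => w1 w2 w3 w4 w5 hA hm.
 by apply: lerD => //; apply: lerD => //; rewrite ler_pM2l.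
have lim (c : pt -> R) (et : nat -> pt -> R) : mfun c -> (forall x, et n x @[n --> \oo] --> c x) ->
  (forall n, [L1 x, et n x ^+ 2 * N x] /\ [int x, et n x ^+ 2 * N x] <= B) ->
  [L1 x, c x ^+ 2 * N x].
 move=> mc' cv H; apply: (proj1 (fatou_rint (fun n => proj1 (H n)) _ _ _ (fun n => proj2 (H n)) _)).
 - by apply: measurable_funM => //; exact: measurable_funX.
 - by move=> n x; rewrite mulr_ge0// sqr_ge0.
 - by move=> x; rewrite mulr_ge0// sqr_ge0.
 apply: nearW => x; apply: cvgM; last exact: cvg_cst.
 by rewrite expr2; under eq_fun do rewrite expr2; apply: cvgM; exact: cv.
have c1 (z : R) : `|z| <= 1 -> z ^+ 2 <= 1 by move=> h; rewrite -norm_sq expr_le1.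
split.
 apply: (lim _ (fun n x => n.+1%:R * sin (n.+1%:R^-1 * x.1 + 0)) (@measurable_fst _ _ _ _)) => [x|n]; first exact: scaled_sin_cvg.
 have [se sz de eM hb] := scaled_sin n; have [p1 p2'] := is_pd_fst de; have n1 : 1 <= n.+1%:R :> R by rewrite ler1n.
 apply: (bnd _ _ _ n.+1%:R (sm2_fst se) (sm2_fst sz) s0 p1 p2') => [x|x|x|x|r x /cubeP[h _]] //.
 - by have [h _ _] := hb x.1; exact: le_trans h n1.
 - by rewrite normr0.
 - by rewrite expr0n addr0 c1//; have [] := hb x.1.
 - by have [_ h' _] := hb x.1; exact: le_trans h' h.
apply: (lim _ (fun n x => n.+1%:R * sin (n.+1%:R^-1 * x.2 + 0)) (@measurable_snd _ _ _ _)) => [x|n]; first exact: scaled_sin_cvg.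
have [se sz de eM hb] := scaled_sin n; have [p1 p2'] := is_pd_snd de; have n1 : 1 <= n.+1%:R :> R by rewrite ler1n.
apply: (bnd _ _ _ n.+1%:R (sm2_snd se) s0 (sm2_snd sz) p2' p1) => [x|x|x|x|r x /cubeP[_ h]] //.
- by rewrite normr0.
- by have [h _ _] := hb x.2; exact: le_trans h n1.
- by rewrite expr0n add0r c1//; have [] := hb x.2.
- by have [_ h' _] := hb x.2; exact: le_trans h' h.
Qed.

End decay.

(** * Dilations and the Pohozaev inequality *)

Section pohozaev.
Implicit Types (U W Y Z : X) (k mu : R) (f g h : pt -> R).

(* The functions of the dilation parameter [l = 1 + k] are compared to powers of [t = 1 - l ^- 2]. *)
Lemma dilation_limit (B c m q P : R) : 0 <= c -> 0 <= m -> 0 <= B ->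
 (forall e, 0 < e -> exists K, exists2 k1, 0 < k1 & forall k, 0 < k -> k <= k1 ->
   0 <= 2^-1 * (k * B * (1 + k) ^- 2) + c / 4 * ((1 + k) ^- 4 * (q - ln (1 + k) * m ^+ 2) - q) +
    (1 - (1 + k) ^- 2) * P + K * k ^+ 2 + e * k) ->
 c * q + c / 4 * m ^+ 2 <= B / 2 + 2 * P.
Proof.
move=> c0 m0 B0 H; pose Y := 4^-1 * B - c / 2 * q - c / 8 * m ^+ 2 + P.
suff : 0 <= Y by rewrite /Y; lra.
apply/ler_addgt0Pr => e e0; have e2 : 0 < e / 2 by lra.
have [K [k1 k10 h]] := H _ e2; pose K' := `|K| + c / 4 * (`|q| + m ^+ 2).
have m20 := sqr_ge0 m; have K0 : 0 <= K' by rewrite addr_ge0// mulr_ge0 ?divr_ge0// addr_ge0.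
pose k := Num.min k1 (Num.min 2^-1 (e / 4 / (K' + 1))).
have d0 : 0 < e / 4 / (K' + 1) by rewrite !divr_gt0//; lra.
have k0 : 0 < k by rewrite !lt_min k10 d0 invr_gt0 ltr0n.
have kk1 : k <= k1 by rewrite ge_min lexx.
have k2 : k <= 2^-1 by rewrite !ge_min lexx !orbT.
have kd : k <= e / 4 / (K' + 1) by rewrite !ge_min lexx !orbT.
have := h k k0 kk1; set t := 1 - (1 + k) ^- 2; clear h H.
have l0 : 0 < 1 + k by lra.
have l2 : 0 < (1 + k) ^+ 2 by rewrite exprn_gt0.
have tE : t * (1 + k) ^+ 2 = 2 * k + k ^+ 2.
 by rewrite /t mulrBl mulVf ?gt_eqF//; ring.
have kt : k <= t by rewrite -(ler_pM2r l2) tE; nra.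
have t2k : t <= 2 * k by rewrite -(ler_pM2r l2) tE; nra.
have i2 : (1 + k) ^- 2 = 1 - t by rewrite /t; ring.
have i4 : (1 + k) ^- 4 = (1 - t) ^+ 2 by rewrite -i2 expr2 -invfM -exprD.
have kb : k * (1 - t) <= t / 2.
 by rewrite -i2 ler_pdivrMr// mulrAC tE; nra.
have t1 : 0 <= 1 - t by rewrite -i2 invr_ge0 ltW.
(* [2 * ln (1 + k) = - ln (1 - t)], which is at least [t]. *)
have lt : t / 2 <= ln (1 + k).
 have el : ln (1 - t) = - (2 * ln (1 + k)).
  by rewrite -i2 lnV ?posrE// lnXn// mulr_natl.
 have h : -1 < - t by rewrite ltrN2 -subr_gt0 -i2 invr_gt0.
 by have := le_ln1Dx h; rewrite el; alra.
rewrite i2 i4; move: (ln (1 + k)) lt => l lt h.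
have h1 : 2^-1 * (k * B * (1 - t)) <= 4^-1 * (t * B) by have := ler_wpM2r B0 kb; alra.
have t0 : 0 < t by alra.
have h2 : c / 4 * ((1 - t) ^+ 2 * (q - l * m ^+ 2) - q) <= c / 4 * (- 2 * t * q + t ^+ 2 * `|q| - (t / 2 - t ^+ 2) * m ^+ 2).
 apply: ler_wpM2l; first by rewrite divr_ge0.
 have a1 : t ^+ 2 * q <= t ^+ 2 * `|q| by rewrite ler_wpM2l ?sqr_ge0// ler_norm.
 have a2 : (t / 2 - t ^+ 2) <= (1 - t) ^+ 2 * l.
  apply: le_trans (ler_wpM2l (sqr_ge0 _) lt); have := exprn_ge0 3 (ltW t0); alra.
 have := ler_wpM2r m20 a2; alra.
have k2t : k ^+ 2 <= t ^+ 2 by rewrite ler_sqr ?nnegrE ?(ltW k0) ?(ltW t0).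
have h3 : K * k ^+ 2 <= `|K| * t ^+ 2.
 apply: le_trans (ler_wpM2r (sqr_ge0 k) (ler_norm K)) _; exact: ler_wpM2l.
have h4 : e / 2 * k <= e / 2 * t by rewrite ler_pM2l.
have h5 : 0 <= t * (Y + e / 2 + t * K').
 apply: le_trans h _; apply: le_trans (lerD (lerD (lerD (lerD h1 h2) (lexx _)) h3) h4) _.
 by rewrite /Y /K'; apply: le_eq; field.
have h6 : t * K' <= e / 2.
 apply: le_trans (ler_wpM2r K0 t2k) _; have : k * (K' + 1) <= e / 4 by rewrite -ler_pdivlMr//; alra.
 rewrite mulrDr; alra.
move: h5; rewrite pmulr_rge0//; alra.
Qed.

Definition dilU k U : X := (fun x => U.1.1 (dil (1 + k) x), fun x => (1 + k) * U.1.2 (dil (1 + k) x), fun x => (1 + k) * U.2 (dil (1 + k) x)).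

(** The factor [(1 + k) ^+ 2] is the Jacobian that writes [VV U] against the dilated function. To
    first order the difference is [- k (2 V + (grad V, x))], at most [k * sbeta D]. *)
Lemma V_dil_bounds k x : 0 <= k -> k <= sk D -> sC D * k <= 2^-1 ->
 V x <= 2 * V (dil (1 + k) x) /\ V x - (1 + k) ^+ 2 * V (dil (1 + k) x) <= k * sbeta D + 4 * sC D * k ^+ 2 * V x.
Proof.
move=> k0 ks Ck; have [h1 h2] := s_dil x k0 ks; have V0 := V_ge0 x; have C0 := sC_gt0 D.
have := h1; rewrite ler_norml => /andP[h3 _].
have CkV := ler_wpM2r V0 Ck; split; first by lra.
move: (V x) (V (dil _ x)) (sC D) (sbeta D) h2 h3 V0 C0 CkV {h1} Ck => v v' C B h2 h3 v0 C0 CkV Ck.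
have vv : (1 - C * k) * v <= v' by lra.
have := ler_wpM2l (_ : 0 <= 2 * k + k ^+ 2) vv; move=> /(_ _)h.
have kk : 0 <= 2 * k + k ^+ 2 by rewrite addr_ge0 ?sqr_ge0// mulr_ge0.
have := h kk; have : 0 <= k ^+ 2 * ((1 - C * k) * v) by rewrite mulr_ge0 ?sqr_ge0// mulr_ge0//; lra.
lra.
Qed.

Section dilated_element.
Variables (k : R) (U : X).
Hypotheses (k0 : 0 <= k) (ks : k <= sk D) (Ck : sC D * k <= 2^-1) (EU : EE U).
Let l0 : 0 < 1 + k. Proof. by rewrite ltr_wpDr. Qed.
Let l1 : (1 + k) ^- 2 <= 1. Proof. by rewrite invf_le1 ?exprn_gt0// exprn_ege1// lerDl. Qed.

Lemma F2_dil (w f : pt -> R) (c : R) : mfun w -> (forall x, 0 <= w x) -> 0 <= c ->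
 (forall x, w x <= c * w (dil (1 + k) x)) -> F2 mu2 w f ->
 F2 mu2 w (fun x => f (dil (1 + k) x)) /\
 bl mu2 w (fun x => f (dil (1 + k) x)) (fun x => f (dil (1 + k) x)) <= c * ((1 + k) ^- 2 * bl mu2 w f f).
Proof.
move=> mw w0 c0 hw [mf If]; have J := Int_Z c (Int_dil l0 If).
have le x : w x * f (dil (1 + k) x) ^+ 2 <= c * (w (dil (1 + k) x) * f (dil (1 + k) x) ^+ 2).
 by rewrite mulrA ler_wpM2r ?sqr_ge0.
have mf' := measurable_dil (1 + k) mf.
have I' : [L1 x, w x * f (dil (1 + k) x) ^+ 2].
 apply: (Int_le J) => [|x]; first by apply: measurable_funM => //; exact: measurable_funX.
 by rewrite ger0_norm// mulr_ge0// sqr_ge0.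
split => //; rewrite !bl_sqE -(rint_dil l0 If) -rintZ ?rint_le//; exact: (Int_dil l0 If).
Qed.

Lemma F2_dil_one f : F2 mu2 one f -> F2 mu2 one (fun x => f (dil (1 + k) x)) /\
 bl0 (fun x => f (dil (1 + k) x)) (fun x => f (dil (1 + k) x)) = (1 + k) ^- 2 * bl0 f f.
Proof.
move=> Ff; have [Ff' _] := F2_dil measurable_one one_ge0 ler01 (fun x => ltac:(by rewrite mul1r)) Ff.
split => //; rewrite !bl_sqE; have [_ If] := Ff; by rewrite -(rint_dil l0 If).
Qed.

Lemma EE_dil : EE (dilU k U).
Proof.
have [G A1 A2 [mu IV] AL] := EU; have [B1 _] := F2_dil_one A1; have [B2 _] := F2_dil_one A2.
have Z f : F2 mu2 one f -> F2 mu2 one (fun x => (1 + k) * f x).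
 move=> Ff; have := F2_lin measurable_one one_ge0 (1 + k) 0 Ff Ff.
 by congr F2; apply/funext => x; rewrite mul0r addr0.
have l1' : 1 <= 1 + k by rewrite lerDl.
split => /=; [exact: WG_dil|exact: Z|exact: Z| |].
- apply: (proj1 (F2_dil measurable_V V_ge0 (ler0n _ 2) _ _)) => // x.
 by have [] := V_dil_bounds x k0 ks Ck.
- apply: (proj1 (F2_dil measurable_LL LL_ge0 ler01 _ _)) => // x.
 by rewrite mul1r; have [] := LL_dil x l1'.
Qed.

Lemma dilated_quadratic : [/\ AA (dilU k U) = AA U, mm (dilU k U) = (1 + k) ^- 2 * mm U, BL (dilU k U) <= BL U,
 VV (dilU k U) - VV U <= k * sbeta D * ((1 + k) ^- 2 * mm U) + 8 * sC D * k ^+ 2 * VV U &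
 PP (dilU k U) = (1 + k) ^- 2 * PP U].
Proof.
have [G A1 A2 [mu IV] AL] := EU; have [B1 e1] := F2_dil_one A1; have [B2 e2] := F2_dil_one A2.
have [B0 e0] := F2_dil_one (EE_F2u EU); have l1' : 1 <= 1 + k by rewrite lerDl.
have Z f : F2 mu2 one f -> bl0 (fun x => (1 + k) * f x) (fun x => (1 + k) * f x) = (1 + k) ^+ 2 * bl0 f f.
 move=> Ff; have := bl_sq_lin measurable_one one_ge0 (1 + k) 0 Ff Ff.
 rewrite mulr0 expr0n/= !mul0r !addr0 => <-; congr bl; apply/funext => x; rewrite mul0r addr0//.
have ln0 : (1 + k) ^+ 2 != 0 by rewrite gt_eqF// exprn_gt0.
split.
- by rewrite /AA /= !Z// e1 e2 !mulrA mulfV// !mul1r.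
- exact: e0.
- have [|_ h] := F2_dil measurable_LL LL_ge0 ler01 _ AL.
  by move=> x; rewrite mul1r; have [] := LL_dil x l1'.
 by apply: le_trans h _; rewrite mul1r ler_piMl// BL_ge0.
- have V2 x := proj1 (V_dil_bounds x k0 ks Ck).
 have [[_ IVd] hV] := F2_dil measurable_V V_ge0 (ler0n _ 2) V2 (conj mu IV).
 have VV2 : VV (dilU k U) <= 2 * VV U.
  by apply: le_trans hV _; rewrite ler_pM2l// ler_piMl// VV_ge0.
 have EV : VV U = (1 + k) ^+ 2 * [int x, V (dil (1 + k) x) * U.1.1 (dil (1 + k) x) ^+ 2].
  by rewrite (rint_dil l0 IV) mulrA mulfV// mul1r.
 have J1 := Int_dil l0 IV; have [_ /= J0] := iffLR (F2_one _) B0.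
 rewrite EV -e0 {1}/VV bl_sqE bl_oneE -rintZ// -rintB//; last exact: Int_Z.
 apply: le_trans (_ : [int x, k * sbeta D * (U.1.1 (dil (1 + k) x) ^+ 2) + 4 * sC D * k ^+ 2 * (V x * U.1.1 (dil (1 + k) x) ^+ 2)] <= _).
  apply: rint_le; [by apply: Int_B => //; exact: Int_Z|by apply: Int_D; exact: Int_Z|move=> x /=].
  have [_ h] := V_dil_bounds x k0 ks Ck; have := ler_wpM2r (sqr_ge0 (U.1.1 (dil (1 + k) x))) h.
  by move: (U.1.1 _ ^+ 2) (V x) (V _) => y1 y2 y3; lra.
 rewrite rintD; do ?exact: Int_Z; rewrite !rintZ// lerD//.
 rewrite -EV; have := ler_wpM2l (mulr_ge0 (mulr_ge0 (ler0n _ 4) (ltW (sC_gt0 D))) (sqr_ge0 k)) VV2.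
 by move=> h; apply: le_trans h _; apply: le_eq; ring.
- by rewrite /PP -(rint_dil l0 (Int_pow EU)).
Qed.

End dilated_element.

Section difference_bounds.
Variables (U W : X) (m0 A0 B2 z a s : R).
Hypotheses (EU : EE U) (EW : EE W) (z0 : 0 <= z) (mZ : mm (W - U) <= z ^+ 2) (mU : mm U <= m0) (mW : mm W <= m0)
 (aU : AA U <= A0) (aW : AA W <= A0) (a1 : 1 <= a) (s0 : 0 < s).
Hypotheses (FS : F2 mu2 (fun x => LL x ^+ 2) (U + W).1.1) (bS : bl mu2 (fun x => LL x ^+ 2) (U + W).1.1 (U + W).1.1 <= B2).
Let Z := W - U.
Let S := U + W.
Let EZ : EE Z. Proof. exact: EE_B. Qed.
Let ES : EE S. Proof. exact: EE_D. Qed.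
Let m00 : 0 <= m0. Proof. exact: le_trans (mm_ge0 U) mU. Qed.
Let A00 : 0 <= A0. Proof. exact: le_trans (AA_ge0 U) aU. Qed.
Let F : R := 16 * Num.sqrt (m0 * A0).
Let G : R := 8 * Num.sqrt A0.
Let F0 : 0 <= F. Proof. by rewrite mulr_ge0. Qed.
Let Gz : 0 <= G * z. Proof. by rewrite !mulr_ge0. Qed.

Let F4 Y : EE Y -> mm Y <= 4 * m0 -> AA Y <= 4 * A0 -> S4 Y <= F ^+ 2.
Proof.
move=> EY mY aY; have [_ h] := S4_le EY; apply: le_trans h _; rewrite exprMn sqr_sqrtr ?mulr_ge0//.
have := ler_pM (mm_ge0 Y) (AA_ge0 Y) mY aY; lra.
Qed.

Let FU : S4 U <= F ^+ 2. Proof. by apply: F4; rewrite // -[leLHS]mul1r ler_pM ?ler1n ?mm_ge0 ?AA_ge0. Qed.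
Let FW : S4 W <= F ^+ 2. Proof. by apply: F4; rewrite // -[leLHS]mul1r ler_pM ?ler1n ?mm_ge0 ?AA_ge0. Qed.

Let mS : mm S <= 4 * m0.
Proof. by have [_] := quad_le measurable_one one_ge0 (EE_F2u EU) (EE_F2u EW) => /le_trans; apply; move: mU mW; rewrite /mm; lra. Qed.

Let AA_quad : AA S <= 4 * A0 /\ AA Z <= 4 * A0.
Proof.
have [_ A1 A2 _ _] := EU; have [_ B1 B2' _ _] := EW.
have [h1 k1] := quad_le measurable_one one_ge0 B1 A1; have [h2 k2] := quad_le measurable_one one_ge0 B2' A2.
rewrite /S addrC; split; [apply: le_trans (lerD k1 k2) _|apply: le_trans (lerD h1 h2) _]; move: aU aW; rewrite /AA; lra.
Qed.

Let FSS : S4 S <= F ^+ 2. Proof. exact: F4 mS AA_quad.1. Qed.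

Let GZ : S4 Z <= (G * z) ^+ 2.
Proof.
have [_ h] := S4_le EZ; apply: le_trans h _; rewrite !exprMn sqr_sqrtr//.
have := ler_pM (mm_ge0 Z) (AA_ge0 Z) mZ AA_quad.2; lra.
Qed.

Let pr0 U' x : 0 <= pr U' U' x. Proof. by rewrite /pr -expr2 sqr_ge0. Qed.

Let rint_pr U' : rint mu2 (pr U' U') = mm U'. Proof. by rewrite /mm bl_oneE. Qed.

(** [Z] is small in [L^2] but its gradient is only bounded, so the root of [S4 Z] is of order [z]
    and a direct bound on [K2] would be linear in [z]. The parameter [a] makes this linear
    coefficient as small as desired. *)
Lemma Q4_error1 : - Q4 U U Z Z <= ln a * (m0 * z ^+ 2) + a^-1 * (kap * (F * (G * z))).
Proof.
have dU := dens_pr EU EU; have dZ := dens_pr EZ EZ; rewrite /Q4; have [_ ->] := q_Int dU dZ.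
have h1 : 0 <= qf K1 (pr U U) (pr Z Z) := qfK1_ge0 U Z.
have := K2_form_small a1 dU dZ (pr0 _) (pr0 _) F0 Gz; rewrite !n2_diag => /(_ FU GZ).
rewrite !rint_pr; have := ler_wpM2l (ln_ge0 a1) (ler_pM (mm_ge0 U) (mm_ge0 Z) mU mZ).
by move: (_ * (_ * _)) h1; move: (qf _ _ _) (qf _ _ _) => y1 y2 y3; lra.
Qed.

Let error_arith (q1 q2 q2' n l P la E T w : R) : - q1 <= n * l + l * n -> n * l <= P -> q2 <= q2' ->
 q2' <= la * (n * n) + w -> la * (n * n) <= la * E -> 2 * P = T -> - (q1 - q2) <= T + la * E + w.
Proof. lra. Qed.

(** [Z S] changes sign, so its [K1] part is bounded by the [L^1] norm times the weighted one. The
    weight is put on [S = U + W], whence the hypothesis with weight [LL ^+ 2], and both factors are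
    of order [z]. *)
Lemma Q4_error2 : - Q4 Z S Z S <= 4 * Num.sqrt m0 * Num.sqrt B2 * z ^+ 2 + ln a * (4 * m0 * z ^+ 2) + a^-1 * (kap * (F * (G * z))).
Proof.
have d := dens_pr EZ ES; rewrite /Q4; have [_ ->] := q_Int d d.
have B20 : 0 <= B2 by apply: le_trans bS; apply: bl_ge0 => x; exact: sqr_ge0.
have hn1 : n1 (pr Z S) <= 2 * Num.sqrt m0 * z.
 apply: sqr_le; first by rewrite !mulr_ge0.
 apply: le_trans (n1_pr EZ ES) _; rewrite !exprMn sqr_sqrtr// mulrC.
 by apply: ler_pM; rewrite ?mm_ge0//; apply: le_trans mS _; lra.
have hnL : nL (pr Z S) <= Num.sqrt B2 * z.
 apply: sqr_le; first by rewrite mulr_ge0.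
 have FZ : F2 mu2 one (fun x => `|Z.1.1 x|).
  have /F2_one[mz Iz] := EE_F2u EZ; apply/F2_one; split; first exact: measurableT_comp.
  by under eq_fun do rewrite norm_sq.
 have FL : F2 mu2 one (fun x => LL x * `|S.1.1 x|).
  have [ms Is] := FS; apply/F2_one; split; first by apply: measurable_funM; [exact: measurable_LL|exact: measurableT_comp].
  by apply: (eq_Int _ Is) => x; rewrite exprMn norm_sq.
 have := bl_CS measurable_one one_ge0 FZ FL.
 have -> : bl0 (fun x => `|Z.1.1 x|) (fun x => LL x * `|S.1.1 x|) = nL (pr Z S).
  by rewrite bl_oneE; apply: eq_rint => x; rewrite /pr normrM mulrCA.
 move=> /le_trans; apply; rewrite !exprMn sqr_sqrtr// mulrC; apply: ler_pM; do ?[by apply: bl_ge0 => x; exact: one_ge0].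
  apply: le_trans bS; rewrite bl_oneE; apply: le_eq; apply: eq_rint => x.
  by rewrite -expr2 exprMn norm_sq expr2.
 apply: le_trans mZ; rewrite /mm !bl_oneE; apply: le_eq; apply: eq_rint => x.
 by rewrite -!expr2 norm_sq.
have h1 := K1_form_L1 d d; have dn : dens (fun x => `|pr Z S x|).
 have [md I1 I2] := d; split; first exact: measurableT_comp.
  by apply: (eq_Int _ I1) => x; rewrite normr_id.
 by apply: (eq_Int _ I2) => x; rewrite norm_sq.
have FG0 : 0 <= F * (G * z) by rewrite mulr_ge0.
have n2n : n2 (fun x => `|pr Z S x|) <= Num.sqrt (F * (G * z)) ^+ 2.
 rewrite sqr_sqrtr// mulrC; apply: le_trans (n2_pr EZ ES Gz F0 GZ FSS).
 by apply: le_eq; apply: eq_rint => x; rewrite norm_sq.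
have h2 := K2_form_small a1 dn dn (fun x => normr_ge0 _) (fun x => normr_ge0 _) (sqrtr_ge0 _) (sqrtr_ge0 _) n2n n2n.
rewrite -(expr2 (Num.sqrt _)) sqr_sqrtr// in h2.
have h3 : qf K2 (pr Z S) (pr Z S) <= qf K2 (fun x => `|pr Z S x|) (fun x => `|pr Z S x|).
 apply: rint_le; [by have [] := K2_form d d|by have [] := K2_form dn dn|move=> w].
 by rewrite ler_wpM2l ?K2_ge0// -normrM ler_norm.
have n10 := n1_ge0 (pr Z S); have nL0 := nL_ge0 (pr Z S).
have h4 := ler_pM n10 nL0 hn1 hnL; have h5 := ler_wpM2l (ln_ge0 a1) (ler_pM n10 n10 hn1 hn1).
have h6 : - qf K1 (pr Z S) (pr Z S) <= n1 (pr Z S) * nL (pr Z S) + nL (pr Z S) * n1 (pr Z S).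
 by apply: le_trans h1; rewrite -normrN ler_norm.
have e : 2 * Num.sqrt m0 * z * (2 * Num.sqrt m0 * z) = 4 * m0 * z ^+ 2.
 by rewrite -[X in _ = 4 * X * _](sqr_sqrtr m00); ring.
rewrite e in h5; apply: error_arith h6 h4 h3 h2 h5 _; ring.
Qed.

Lemma PP_error : PP U - PP W + p * [int x, spow p (U.1.1 x) * Z.1.1 x] >=
 - (p * (p - 1) * (s `^ (p - 2) * z ^+ 2 + s `^ (p - 4) * (4 * (F * (G * z))))).
Proof.
have WE : W = U + Z by rewrite addrC subrK.
have J1 := Int_pow EU; have J2 := Int_pow EW; have [J3 _] := spow_term EU EZ; have [_ _ IZ] := mm_le EZ.
have [_ _ I1] := dens_pr EU EZ; have [_ _ I2] := dens_pr EW EZ.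
have pp : 0 <= p * (p - 1) by rewrite mulr_ge0//; have := p2; lra.
rewrite lerNl; apply: le_trans (_ : `|[int x, `|W.1.1 x| `^ p - `|U.1.1 x| `^ p - p * (spow p (U.1.1 x) * Z.1.1 x)]| <= _).
 rewrite rintB; [|exact: Int_B|exact: Int_Z]; rewrite rintB// rintZ//; apply: le_trans (ler_norm _).
 rewrite -/(PP W) -/(PP U); move: (PP _) (PP _) (rint _ _) => y1 y2 y3.
 by apply: le_eq; ring.
pose g x := p * (p - 1) * (s `^ (p - 2) * Z.1.1 x ^+ 2 + s `^ (p - 4) * (2 * pr U Z x ^+ 2 + 2 * pr W Z x ^+ 2)).
have I3 : [L1 x, 2 * pr U Z x ^+ 2 + 2 * pr W Z x ^+ 2] by apply: Int_D; exact: Int_Z.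
have Ig : Int mu2 g by apply: Int_Z; apply: Int_D; exact: Int_Z.
apply: le_trans (rint_bound (g := g) Ig _ _) _.
- by have := Int_B (Int_B J2 J1) (Int_Z p J3); move/Int_mf.
- move=> x; have := powR_taylor (U.1.1 x) (W.1.1 x) p2; rewrite -[W.1.1 x - U.1.1 x]/(Z.1.1 x) -mulrA => /le_trans; apply.
 rewrite -mulrA /g; apply: ler_wpM2l => //.
 have := powR_interp (sp_itv D) s0 (addr_ge0 (normr_ge0 (U.1.1 x)) (normr_ge0 (W.1.1 x))).
 move=> /(ler_wpM2r (sqr_ge0 (Z.1.1 x)))/le_trans; apply; rewrite mulrDl lerD2l -mulrA.
 apply: ler_wpM2l; first exact: powR_ge0.
 rewrite /pr !exprMn -[U.1.1 x ^+ 2]norm_sq -[W.1.1 x ^+ 2]norm_sq.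
 have := mulr_ge0 (sqr_ge0 (`|U.1.1 x| - `|W.1.1 x|)) (sqr_ge0 (Z.1.1 x)).
 by move: `|U.1.1 x| `|W.1.1 x| (Z.1.1 x ^+ 2) => y1 y2 y3; lra.
rewrite /g rintZ; last by apply: Int_D; exact: Int_Z.
apply: ler_wpM2l => //; rewrite rintD; do ?exact: Int_Z.
rewrite !rintZ//; apply: lerD; (apply: ler_wpM2l; first exact: powR_ge0).
 by move: mZ; rewrite /mm bl_oneE.
rewrite rintD; do ?exact: Int_Z; rewrite !rintZ//.
have := n2_pr EU EZ F0 Gz FU GZ; have := n2_pr EW EZ F0 Gz FW GZ; rewrite /n2; lra.
Qed.

End difference_bounds.

(** [flow_L2] with [c = 0]: the velocity is [k x], and [|x|] is at most the length of the moved
    point, so the increment is bounded by [k |y| |grad u (y)|], square integrable by [decay]. *)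
Lemma dil_L2 mu U : 0 <= mu -> crit mu U ->
 exists2 c, 0 <= c & forall k, 0 <= k -> mm (dilU k U - U) <= (c * k) ^+ 2.
Proof.
move=> mu0 cU; have [I1 I2] := decay mu0 cU; have [[W _ _ _ _] _] := cU.
pose H x := x.1 ^+ 2 * (U.1.1 x ^+ 2 + U.1.2 x ^+ 2 + U.2 x ^+ 2) + x.2 ^+ 2 * (U.1.1 x ^+ 2 + U.1.2 x ^+ 2 + U.2 x ^+ 2).
have IH : Int mu2 H by exact: Int_D.
have H0 x : 0 <= H x.
 by apply: addr_ge0; (apply: mulr_ge0; first exact: sqr_ge0); rewrite !addr_ge0 ?sqr_ge0.
exists (Num.sqrt (2 * rint mu2 H)) => // k k0.
have IHk := Int_Z (2 * k ^+ 2) IH.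
have [|s x /andP[s0 _]|_ _] := @flow_L2 k (0, 0) _ _ _ (fun x => 2 * k ^+ 2 * H x) k0 W IHk.
- by move=> x; rewrite !mulr_ge0 ?sqr_ge0.
- rewrite flw_dil /= !addr0 /H /dil /=; set g1 := U.1.2 _; set g2 := U.2 _; set u := U.1.1 _.
 have ks : 0 <= k * s by rewrite mulr_ge0.
 have t1 (y : R) : y ^+ 2 <= ((1 + k * s) * y) ^+ 2.
  by rewrite exprMn ler_peMl ?sqr_ge0// exprn_ege1// lerDl.
 have := t1 x.1; have := t1 x.2; move: ((1 + k * s) * x.1) ((1 + k * s) * x.2) x.1 x.2 => y1 y2 x1 x2 h2 h1.
 apply: le_trans (_ : 2 * k ^+ 2 * (x1 ^+ 2 * g1 ^+ 2 + x2 ^+ 2 * g2 ^+ 2) <= _).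
  have := mulr_ge0 (sqr_ge0 k) (sqr_ge0 (x1 * g1 - x2 * g2)); alra.
 apply: ler_wpM2l; first by rewrite mulr_ge0 ?sqr_ge0.
 apply: lerD; apply: ler_pM; rewrite ?sqr_ge0//; have := sqr_ge0 u; have := sqr_ge0 g1; have := sqr_ge0 g2; alra.
rewrite rintZ// exprMn sqr_sqrtr; last by rewrite mulr_ge0// rint_ge0.
rewrite [leRHS]mulrAC; apply: le_trans; rewrite /mm bl_oneE; apply: le_eq.
by apply: eq_rint => x; rewrite flw_dil mulr1 expr2.
Qed.

(** Polarization: the difference of the two sides is half the square of [h - f]. *)
Lemma polar_le (w f h : pt -> R) : mfun w -> (forall x, 0 <= w x) -> F2 mu2 w f -> F2 mu2 w h ->
 bl mu2 w f (h - f) <= 2^-1 * (bl mu2 w h h - bl mu2 w f f).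
Proof.
move=> mw w0 Ff Fh; have e1 := bl_lin mw w0 1 (-1) Fh Ff Ff; have e2 := bl_sq_lin mw w0 1 (-1) Fh Ff.
rewrite !funB11 in e1 e2; have := bl_ge0 mu2 w0 (h - f); rewrite e2 e1 (blC _ _ h f).
alra.
Qed.

(** Expansion with [W^2 = U^2 + Z S] and [Z S = 2 U Z + Z^2], where [Z = W - U] and [S = U + W]. *)
Let Q4_difference U W : EE U -> EE W -> Q4 U U U (W - U) =
 4^-1 * (Q4 W W W W - Q4 U U U U) - 4^-1 * Q4 (W - U) (U + W) (W - U) (U + W) - 2^-1 * Q4 U U (W - U) (W - U).
Proof.
move=> EU EW; have EZ := EE_B EW EU; have ES := EE_D EU EW.
have dU := dens_pr EU EU; have dZ := dens_pr EZ EZ; have dUZ := dens_pr EU EZ; have dZS := dens_pr EZ ES.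
have e1 : pr W W = fun x => pr U U x + pr (W - U) (U + W) x.
 apply/funext => x; rewrite /pr -[(W - U).1.1 x]/(W.1.1 x - U.1.1 x) -[(U + W).1.1 x]/(U.1.1 x + W.1.1 x); ring.
have e2 : pr (W - U) (U + W) = fun x => 2 * pr U (W - U) x + pr (W - U) (W - U) x.
 apply/funext => x; rewrite /pr -[(W - U).1.1 x]/(W.1.1 x - U.1.1 x) -[(U + W).1.1 x]/(U.1.1 x + W.1.1 x); ring.
have eq1 : Q4 W W W W = Q4 U U U U + 2 * Q4 U U (W - U) (U + W) + Q4 (W - U) (U + W) (W - U) (U + W).
 by rewrite /Q4 e1 qDl ?qDr//; [rewrite (qC dZS dU); ring|exact: dens_D].
have eq2 : Q4 U U (W - U) (U + W) = 2 * Q4 U U U (W - U) + Q4 U U (W - U) (W - U).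
 by rewrite /Q4 {1}e2 qDr ?qZr//; exact: dens_Z.
by rewrite eq1 eq2; field.
Qed.

Let pohozaev_arith (g1 g2 g3 h1 h2 h3 h1' h2' h3' mu y l l' r q q' e1 e2 k B L m C V0 cc bp p' P la c sm sB a' kp s2 s4 E e bb : R) : bb = bp * p' ->
 0 <= cc -> 0 <= k -> 0 <= e -> 0 <= bp -> 0 <= mu -> y <= 2^-1 * (l' - l) -> l' <= l ->
 g1 <= 2^-1 * (h1' - h1) -> g2 <= 2^-1 * (h2' - h2) -> g3 <= 2^-1 * (h3' - h3) -> h1' + h2' = h1 + h2 ->
 h3' - h3 <= k * B * (L * m) + 8 * C * k ^+ 2 * V0 -> - e1 <= la * (m * (c * k) ^+ 2) + a' * (kp * (E * k)) ->
 - e2 <= 4 * sm * sB * (c * k) ^+ 2 + la * (4 * m * (c * k) ^+ 2) + a' * (kp * (E * k)) ->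
 - (p' * (p' - 1) * (s2 * (c * k) ^+ 2 + s4 * (4 * (E * k)))) <= P - L * P + p' * r ->
 cc * (a' * (kp * E)) <= e / 2 -> bb * (p' - 1) * (s4 * (4 * E)) <= e / 2 ->
 g1 + g2 + g3 + cc * (4^-1 * (q' - q) - 4^-1 * e2 - 2^-1 * e1) - bb * r + mu * y = 0 ->
 0 <= 2^-1 * (k * (B * m) * L) + cc / 4 * (q' - q) + (1 - L) * (bp * P) +
  (4 * C * V0 + cc * (2^-1 * (la * (m * c ^+ 2)) + 4^-1 * (4 * sm * sB * c ^+ 2 + la * (4 * m * c ^+ 2))) + bb * (p' - 1) * (s2 * c ^+ 2)) * k ^+ 2 + e * k.
Proof.
move=> -> c0 k0 e0 b0 m0 i1 i2 i3 i4 i5 i6 i7 i8 i9 i10 i11 i12.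
have y0 : mu * y <= 0 by rewrite mulr_ge0_le0//; alra.
have f1 := ler_wpM2l c0 i8; have f2 := ler_wpM2l c0 i9; have f3 := ler_wpM2l b0 i10.
have f4 := ler_wpM2r k0 i11; have f5 := ler_wpM2r k0 i12; have f6 := mulr_ge0 e0 k0; alra.
Qed.

(** Tested with [W - U], where [W] is the dilate of [U], the derivative becomes a difference of
    energies, which scale explicitly, up to errors [K k^2 + e k] with [e] arbitrary.
    [dilation_limit] then lets [k] tend to [0]. *)
Theorem pohozaev mu U : 0 <= mu -> crit mu U ->
 c2 * Q4 U U U U + c2 / 4 * mm U ^+ 2 <= sbeta D * mm U / 2 + 2 * (b / p * PP U).
Proof.
move=> mu0 cU; have [EU dU] := cU; have c0 := c2_gt0; have bb := b0; have pp := p2; have C0 := sC_gt0 D.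
have [c cc hc] := dil_L2 mu0 cU; have [D1 D2] := decay mu0 cU.
have p0 : 0 < p by exact: lt_trans pp.
have bp : 0 < b / p by rewrite divr_gt0.
have bE : b = b / p * p by rewrite divfK// gt_eqF.
have L20 x : 0 <= LL x ^+ 2 :> R by exact: sqr_ge0.
have mL2 : mfun (fun x => LL x ^+ 2 : R) by apply: measurable_funX; exact: measurable_LL.
have [_ _ Iu] := mm_le EU.
(* The squared logarithmic weight is at most [2 (1 + |x|^2)], integrable against [u^2] by
   [decay]. *)
have FL : F2 mu2 (fun x => LL x ^+ 2) U.1.1.
 split; first exact: measurable_u EU.
 have IR := Int_Z 2 (Int_D Iu (Int_D D1 D2)); apply: (Int_le IR).
  by apply: measurable_funM => //; apply: measurable_funX; exact: measurable_u EU.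
 move=> x; rewrite ger0_norm; last by apply: mulr_ge0; exact: sqr_ge0.
 have h : LL x ^+ 2 <= 2 * (1 + x.1 ^+ 2 + x.2 ^+ 2).
  apply: le_trans (_ : (1 + enorm x) ^+ 2 <= _); first by rewrite ler_sqr ?nnegrE ?LL_ge0 ?addr_ge0 ?enorm_ge0 ?LL_le.
  have := sqr_ge0 (enorm x - 1); have := enorm_sq x; nra.
 have := ler_wpM2r (sqr_ge0 (U.1.1 x)) h; have := mulr_ge0 (addr_ge0 (sqr_ge0 x.1) (sqr_ge0 x.2)) (addr_ge0 (sqr_ge0 (U.1.2 x)) (sqr_ge0 (U.2 x))).
 alra.
pose B2 := 4 * bl mu2 (fun x => LL x ^+ 2) U.1.1 U.1.1.
apply: dilation_limit; [exact: ltW|exact: mm_ge0|by rewrite mulr_ge0 ?mm_ge0// ltW// sbeta_gt0|].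
move=> e e0; pose E := 16 * Num.sqrt (mm U * AA U) * (8 * Num.sqrt (AA U) * c).
have E0 : 0 <= E by rewrite !mulr_ge0.
have k0 := kap_ge0.
(* [a], and [s] below, make the linear parts of the kernel and power errors at most [e / 2 * k]
   each. *)
pose a := 1 + 2 * c2 * kap * E / e.
have a1 : 1 <= a by rewrite /a lerDl divr_ge0 ?(ltW e0)// !mulr_ge0// ltW.
have a0 : 0 < a by alra.
have ha : c2 * (a^-1 * (kap * E)) <= e / 2.
 rewrite mulrCA mulrC ler_pdivrMr// /a; have -> : e / 2 * (1 + 2 * c2 * kap * E / e) = e / 2 + c2 * (kap * E) by field; rewrite gt_eqF.
 by rewrite lerDr divr_ge0// ltW.
have e'0 : 0 < e / (8 * (b * (p - 1) * E + 1)).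
 by rewrite divr_gt0// mulr_gt0//; have : 0 <= b * (p - 1) * E; [rewrite !mulr_ge0// ?ltW//; alra|alra].
have p40 : p - 4 != 0 by rewrite subr_eq0 lt_eqF ?p4.
have [s s0 se] := powR_solve e'0 p40.
have hs : b * (p - 1) * (s `^ (p - 4) * (4 * E)) <= e / 2.
 have bpE : 0 <= b * (p - 1) * E by rewrite !mulr_ge0// ?ltW//; alra.
 rewrite se; have -> : b * (p - 1) * (e / (8 * (b * (p - 1) * E + 1)) * (4 * E)) = e / 2 * (b * (p - 1) * E / (b * (p - 1) * E + 1)).
  by field; rewrite gt_eqF//; alra.
 rewrite ler_piMr ?divr_ge0 ?(ltW e0)// ler_pdivrMr; alra.
pose K1 := 4 * sC D * VV U + c2 * (2^-1 * (ln a * (mm U * c ^+ 2)) + 4^-1 * (4 * Num.sqrt (mm U) * Num.sqrt B2 * c ^+ 2 + ln a * (4 * mm U * c ^+ 2)))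
 + b * (p - 1) * (s `^ (p - 2) * c ^+ 2).
exists K1; exists (Num.min (sk D) (2^-1 / sC D)); first by rewrite lt_min sk_gt0 divr_gt0.
move=> k k0'; rewrite le_min => /andP[ks kC]; have kk := ltW k0'.
have Ck : sC D * k <= 2^-1 by rewrite mulrC -ler_pdivlMr.
have EW := EE_dil kk ks Ck EU; have [qA qm qB qV qP] := dilated_quadratic kk ks Ck EU.
set W := dilU k U in EW qA qm qB qV qP *.
have l0 : 0 < 1 + k by rewrite ltr_wpDr.
have l1' : 1 <= 1 + k by rewrite lerDl.
have l1 : (1 + k) ^- 2 <= 1 by rewrite invf_le1 ?exprn_gt0// exprn_ege1.
have mW : mm W <= mm U by rewrite qm ler_piMl// mm_ge0.
have z0 : 0 <= c * k by rewrite mulr_ge0.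
have FW : F2 mu2 (fun x => LL x ^+ 2) W.1.1 /\ bl mu2 (fun x => LL x ^+ 2) W.1.1 W.1.1 <= bl mu2 (fun x => LL x ^+ 2) U.1.1 U.1.1.
 have [|h1 h2] := F2_dil kk mL2 L20 ler01 _ FL.
  by move=> x; rewrite mul1r ler_sqr ?nnegrE ?LL_ge0//; have [] := LL_dil x l1'.
 split=> //; apply: le_trans h2 _; rewrite mul1r ler_piMl//; exact: bl_ge0.
have [FW1 bW] := FW; have EZ := EE_B EW EU; have mZ := hc k kk.
have FS : F2 mu2 (fun x => LL x ^+ 2) (U + W).1.1.
 by have := F2_lin mL2 L20 1 1 FL FW1; congr F2; apply/funext => x; rewrite !mul1r.
have bS : bl mu2 (fun x => LL x ^+ 2) (U + W).1.1 (U + W).1.1 <= B2.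
 apply: le_trans (quad_le mL2 L20 FL FW1).2 _.
 have a4 (y1 y2 : R) : y2 <= y1 -> 2 * y1 + 2 * y2 <= 4 * y1 by alra.
 exact: a4.
have aW : AA W <= AA U by rewrite qA.
have FG : 16 * Num.sqrt (mm U * AA U) * (8 * Num.sqrt (AA U) * (c * k)) = E * k by rewrite /E !mulrA.
have q1 := Q4_error1 EU EW z0 mZ (lexx _) (lexx _) aW a1.
have q2 := Q4_error2 EU EW z0 mZ (lexx _) mW (lexx _) aW a1 FS bS.
have q3 := PP_error EU EW z0 mZ (lexx _) mW (lexx _) aW s0.
have qW : Q4 W W W W = (1 + k) ^- 4 * (Q4 U U U U - ln (1 + k) * mm U ^+ 2).
 have d := dens_pr EU EU; rewrite /Q4 -[pr W W]/(fun x => pr U U (dil (1 + k) x)) q_dil//.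
 by rewrite /mm bl_oneE expr2.
have [_ A1 A2 [mu_ IV] AL] := EU; have [_ B1 B2' [mw IVw] BLw] := EW.
(* The gradient term is invariant under dilations in dimension two and the weighted mass decreases,
   so by polarization both contribute with a favourable sign. *)
have i1 := polar_le measurable_LL LL_ge0 AL BLw.
have i2 := polar_le measurable_one one_ge0 A1 B1.
have i3 := polar_le measurable_one one_ge0 A2 B2'.
have i4 := polar_le measurable_V V_ge0 (conj mu_ IV) (conj mw IVw).
have i5 : bl0 W.1.2 W.1.2 + bl0 W.2 W.2 = bl0 U.1.2 U.1.2 + bl0 U.2 U.2 by exact: qA.
have := dU _ EZ; rewrite /dJm /DJ /DB -/c2 (Q4_difference EU EW) => eq.
rewrite qP FG in q3; rewrite FG in q1; rewrite FG in q2.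
have := pohozaev_arith bE (ltW c0) kk (ltW e0) (ltW bp) mu0 i1 qB i2 i3 i4 i5 qV q1 q2 q3 ha hs eq.
by rewrite qW.
Qed.

End pohozaev.

(** * Uniform bounds on critical points and the ground state *)

Section ground_states.
Implicit Types (U W : X) (mu : R).

Lemma small_inv : small (fun n => n.+1%:R^-1 : R).
Proof.
move=> e e0; exists (Num.bound e^-1) => n hn.
rewrite -[leRHS]invrK lef_pV2 ?posrE ?invr_gt0//; apply: ltW.
apply: (@lt_le_trans _ _ (Num.bound e^-1)%:R); first by apply: archi_boundP; rewrite invr_ge0 ltW.
by rewrite ler_nat leqW.
Qed.

Lemma energy_identity mu U : crit mu U -> SS U + mu * BL U + c2 * Q4 U U U U = b * PP U.
Proof.
move=> [EU /(_ U EU)]; rewrite /dJm /DJ /DB.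
have -> : [int x, spow p (U.1.1 x) * U.1.1 x] = PP U.
 by apply: eq_rint => x; rewrite spow_mul// p2.
rewrite /SS /AA /BL /c2 /VV; lra.
Qed.

(** In the energy identity the power and the negative kernel part are absorbed by [VV U] and,
    through [S4 U <= 16 * mm U * AA U], by [AA U] as soon as the mass is below [C^-1]; this leaves
    no positive mass. *)
Lemma mass_lower : exists2 m0, 0 < m0 & forall mu U, 0 <= mu -> crit mu U -> 0 < mm U -> m0 <= mm U.
Proof.
have V0 := sV0_gt0 D; have bb := b0; have c0 := c2_gt0; have k0 := kap_ge0.
have e0 : 0 < sV0 D / (2 * b) by rewrite divr_gt0// mulr_gt0.
have [|s s0 se] := @powR_solve _ (p - 2) e0; first by rewrite gt_eqF// subr_gt0 p2.
pose C := 16 * (c2 * kap + b * s `^ (p - 4)) + 1.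
have C1 : 1 <= C by rewrite lerDr !(mulr_ge0, addr_ge0) ?powR_ge0// ltW.
exists C^-1 => [|mu U mu0 cU mp]; first by rewrite invr_gt0; lra.
have EU := cU.1; have := energy_identity cU; have := Q4_lower (lexx 1) EU; rewrite ln1 mul0r add0r invr1 mul1r.
have := PP_interp s0 EU; have [_] := S4_le EU; have [_ hV _] := mm_le EU; have A0 := AA_ge0 U.
have := mulr_ge0 mu0 (BL_ge0 U).
have bs : b * s `^ (p - 2) = sV0 D / 2 by rewrite se; field; rewrite gt_eqF.
have [//|] := leP C^-1 (mm U); rewrite -[C^-1]mul1r ltr_pdivlMr; last lra.
rewrite /SS /C => h y0 h1 h2 h3 h4; exfalso.
have h2' := ler_wpM2l (ltW bb) h2; have h3' := ler_wpM2l (ltW c0) h3.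
have w0 : 0 <= c2 * kap + b * s `^ (p - 4) by rewrite !(mulr_ge0, addr_ge0) ?powR_ge0// ltW.
have h1' := ler_wpM2l w0 h1; have h' := ler_wpM2r A0 (ltW h); have m1 := mulr_ge0 (ltW mp) A0.
have := mulr_gt0 V0 mp; move: bs => /(congr1 ( *%R^~ (mm U))).
alra.
Qed.

(** [P] stands for the power term, [m] for the mass, [A] for the gradient. For [q >= 3] the second
    inequality bounds [m], and a large [s] absorbs [A]. For [q < 3] it only gives [m <= M * x] with
    [x ^+ 2 = 1 + P]; taking [s = x], [P] is at most [G] times the power [q - 1] of [x], which is of
    lower order than [x ^+ 2]. *)
Lemma growth (q B c be k : R) : 2 < q < 4 -> 0 <= B -> 0 < c -> 0 <= be -> 0 <= k ->
 exists P0, forall P m A, 0 <= P -> 0 <= m -> 0 <= A -> A <= 4 * k + 2 * P ->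
  (2 * q - 6) * P + c * m ^+ 2 <= be * m + 4 * k ->
  (forall s, 0 < s -> P <= B * (s `^ (q - 2) * m + s `^ (q - 4) * (16 * m * A))) -> P <= P0.
Proof.
move=> /andP[q2 q4] B0 c0 be0 k0; pose M := (be + 4 * k + 2) / c + 1.
have cM : c * M = be + 4 * k + 2 + c by rewrite /M; field; rewrite gt_eqF.
have M1 : 1 <= M by rewrite lerDr divr_ge0 ?ltW//; lra.
have q40 : q - 4 != 0 by rewrite lt_eqF// subr_lt0.
have [q3|q3] := leP 3 q.
 have e0 : 0 < (64 * (B + 1) * M)^-1 by rewrite invr_gt0 !mulr_gt0//; lra.
 have [s s0 se] := powR_solve e0 q40; exists (2 * (B * s `^ (q - 2) * M) + 2 * k) => P m A P0 m0 A0 hA hm /(_ s s0).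
 have mM : m <= M.
  rewrite leNgt; apply/negP => h; have := mulr_ge0 (_ : 0 <= 2 * q - 6) P0 => /(_ ltac:(alra)).
  have := ler_wpM2l (ltW c0) (ler_wpM2r m0 (ltW h)); have : 1 <= m by alra.
  have := cM; nra.
 have p0 := powR_ge0 s (q - 2); have h1 := ler_wpM2l B0 (ler_wpM2l p0 mM).
 have h2 : B * (s `^ (q - 4) * (16 * m * A)) <= 4^-1 * A.
  rewrite se; apply: le_trans (_ : B * ((64 * (B + 1) * M)^-1 * (16 * M * A)) <= _).
   by apply: ler_wpM2l => //; apply: ler_wpM2l; [exact: ltW|apply: ler_wpM2r => //; alra].
  have -> : B * ((64 * (B + 1) * M)^-1 * (16 * M * A)) = 4^-1 * (B / (B + 1)) * A by field; rewrite !gt_eqF//; alra.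
  by apply: ler_wpM2r => //; rewrite ler_piMr// ler_pdivrMr; alra.
 alra.
pose G := B * (M + 16 * M * (4 * k + 2)).
have G0 : 0 <= G by apply: mulr_ge0 => //; have := mulr_ge0 (_ : 0 <= M) k0 => /(_ ltac:(alra)); alra.
have e0 : 0 < (2 * (G + 1))^-1 by rewrite invr_gt0; lra.
have [|t t0 te] := @powR_solve _ (q - 3) e0; first by rewrite lt_eqF// subr_lt0.
exists (2 * (G * t `^ (q - 1)) + 1) => P m A P0 m0 A0 hA hm; pose x := Num.sqrt (1 + P).
have x2 : x ^+ 2 = 1 + P by rewrite sqr_sqrtr// addr_ge0.
have x1 : 1 <= x by rewrite -sqrtr1 ler_wsqrtr// lerDl.
have x0 : 0 < x by alra.
move=> /(_ x x0).
have mM : m <= M * x.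
 rewrite leNgt; apply/negP => h.
 have h1 := ler_wpM2l (ltW c0) (ler_wpM2r m0 (ltW h)).
 have xm : x ^+ 2 <= x * m by rewrite expr2 ler_pM2l//; apply: le_trans (ltW h); rewrite ler_peMl// ltW.
 have mx : m <= x * m by rewrite ler_peMl.
 have h2 := ler_wpM2l be0 mx; have h3 := ler_wpM2l (_ : 0 <= 4 * k + 2) xm; have {}h3 := h3 ltac:(alra).
 have h4 : 0 < c * (x * m) by rewrite !mulr_gt0// (lt_trans _ h)// mulr_gt0//; alra.
 have h5 : 0 <= (2 * q - 4) * P by rewrite mulr_ge0//; alra.
 have h6 := mulr_ge0 k0 P0; move: (congr1 ( *%R^~ (x * m)) cM) h3; rewrite x2; alra.
have AM : A <= (4 * k + 2) * x ^+ 2 by rewrite x2; have := mulr_ge0 k0 P0; alra.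
have xp : x `^ (q - 4) * x ^+ 2 = x `^ (q - 2).
 by rewrite -(powR_mulrn 2 (ltW x0)) -powRD ?(gt_eqF x0) ?implybT//; congr (_ `^ _); alra.
have xq : x `^ (q - 2) * x = x `^ (q - 1).
 by rewrite -[X in _ * X](powRr1 (ltW x0)) -powRD ?(gt_eqF x0) ?implybT//; congr (_ `^ _); alra.
have hP : B * (x `^ (q - 2) * m + x `^ (q - 4) * (16 * m * A)) <= G * x `^ (q - 1).
 rewrite /G -[leRHS]mulrA; apply: ler_wpM2l => //; rewrite -xq.
 have a0 := powR_ge0 x (q - 2); have a4 := powR_ge0 x (q - 4).
 have hmA := ler_pM m0 A0 mM AM.
 have h1 := ler_wpM2l a0 mM; have h2 := ler_wpM2l a4 hmA.
 move: h1 h2; rewrite -xp; alra.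
have q31 : 2 < q + 1 < 4 by apply/andP; split; alra.
have := powR_interp q31 t0 (ltW x0).
have -> : q + 1 - 2 = q - 1 by alra.
have -> : q + 1 - 4 = q - 3 by alra.
rewrite te x2 => /(ler_wpM2l G0) h1 h2.
have h3 : G * ((2 * (G + 1))^-1 * (1 + P)) <= 2^-1 * (1 + P).
 have -> : G * ((2 * (G + 1))^-1 * (1 + P)) = 2^-1 * (G / (G + 1)) * (1 + P) by field; rewrite gt_eqF//; alra.
 by apply: ler_wpM2r; [alra|rewrite ler_piMr// ler_pdivrMr; alra].
alra.
Qed.

(** Eliminating [Q4] and [SS] between the level, the energy identity and [pohozaev] leaves the
    inequality with coefficient [2 p - 6] that [growth] treats; the other bounds follow from the one
    on the power term. *)
Lemma critical_bounds (K : R) : exists C, forall mu U, 0 <= mu -> crit mu U -> Jm mu U <= K ->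
 [/\ SS U <= C, qf K1 (pr U U) (pr U U) <= C & - C <= Jm mu U].
Proof.
have V0 := sV0_gt0 D; have bb := b0; have c0 := c2_gt0; have k0 := kap_ge0; have pp := p2; have p4 := p4.
have bp : 0 <= b / p by rewrite divr_ge0 ?ltW//; lra.
have be0 := sbeta_gt0 D.
have [||P0 hP0] := growth (c := c2 / 4) (be := sbeta D / 2) (sp_itv D) bp _ _ (normr_ge0 K); try lra.
pose S0 := 4 * `|K| + 2 * `|P0|; pose C := 4 * `|P0| / c2 + kap * (16 * (S0 / sV0 D) * S0).
have S00 : 0 <= S0 by rewrite addr_ge0 ?mulr_ge0.
have C0 : 0 <= C by rewrite addr_ge0 ?(divr_ge0, mulr_ge0) ?(ltW c0, ltW V0).
exists (S0 + C) => mu U mu0 cU JK; have EU := cU.1.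
have E := energy_identity cU; have poh := pohozaev mu0 cU; have [_ hS4] := S4_le EU.
have y0 := mulr_ge0 mu0 (BL_ge0 U); have A0 := AA_ge0 U; have W0 := VV_ge0 U; have m0 := mm_ge0 U.
pose P := b / p * PP U; have Pg : 0 <= P by rewrite mulr_ge0// PP_ge0.
have pP : b * PP U = p * P by rewrite /P; field; rewrite gt_eqF//; alra.
have KK := ler_norm K.
(* Four times the level minus the energy identity. *)
have J4 : SS U + mu * BL U = 4 * Jm mu U + (4 - p) * P.
 by move: E; rewrite pP /Jm /JJ /BB /SS c8E -/P; alra.
have P2 : (p - 2) * P >= 0 by rewrite mulr_ge0//; alra.
have PP0 : P <= `|P0|.
 apply: le_trans (ler_norm P0); apply: hP0 Pg m0 A0 _ _ _.
 - by move: J4; rewrite /SS; alra.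
 - by move: poh J4 E; rewrite -/P pP; alra.
 - move=> s s0; apply: ler_wpM2l => //; apply: le_trans (PP_interp s0 EU) _.
  by rewrite lerD2l ler_wpM2l ?powR_ge0.
have SC : SS U <= S0 by rewrite /S0; alra.
have p4P : (4 - p) * P <= 2 * P by apply: ler_wpM2r => //; alra.
have ss0 : 0 <= SS U by rewrite /SS addr_ge0.
split; [by alra| |by move: J4; rewrite /S0; have := normr_ge0 P0; have := normr_ge0 K; alra].
have [_ hS _] := mm_bound EU SC; have d := dens_pr EU EU; have [_ eQ] := q_Int d d.
have [_ q2] := K2_form d d.
have n2E := n2_diag U.
have {}q2 : qf K2 (pr U U) (pr U U) <= kap * S4 U.
 by apply: sqr_le; [rewrite mulr_ge0 ?S4_ge0|apply: le_trans q2 _; rewrite n2E exprMn expr2].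
have h1 := ler_wpM2l k0 hS.
have h2 : Q4 U U U U <= 4 * `|P0| / c2.
 rewrite ler_pdivlMr// mulrC; have : p * P <= 4 * P by apply: ler_wpM2r => //; alra.
 move: E; rewrite pP; alra.
by move: h2; rewrite /Q4 eQ /C; alra.
Qed.

Lemma critical_limit (K : R) (U_ : nat -> X) (mu_ : nat -> R) : (forall n, 0 <= mu_ n <= n.+1%:R^-1) ->
 (forall n, crit (mu_ n) (U_ n)) -> (forall n, 0 < mm (U_ n)) -> (forall n, Jm (mu_ n) (U_ n) <= K) ->
 exists U, exists2 s : nat -> nat, (forall k, (s k < s k.+1)%N) &
  [/\ 0 < mm U, crit 0 U & small (fun n => `|Jm (mu_ (s n)) (U_ (s n)) - JJ U|)].
Proof.
move=> Hmu cU mp JK; have [m0 m00 hm] := mass_lower; have [C hC] := critical_bounds K.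
have m_ge n : 0 <= mu_ n by have /andP[] := Hmu n.
have bd n := hC _ _ (m_ge n) (cU n) (JK n).
have [||||||U [s sS [h1 h2 _ h4]]] := PS_vanishing (mu := 0) (C := C) (mu_ := mu_) _ _ (fun n => (cU n).1) _ _ m00 _ _ cU.
- by rewrite lexx ler01.
- move=> n; have /andP[-> h] := Hmu n; apply: le_trans h _; rewrite invf_le1// ler1n//.
- by move=> n; have [] := bd n.
- by move=> n; have [] := bd n.
- by move=> n; apply: hm (m_ge n) (cU n) (mp n).
- apply: (small_le _ small_inv) => n /=; have /andP[h0 h] := Hmu n; by rewrite subr0 ger0_norm.
by exists U, s => //; split => //; rewrite -Jm0.
Qed.

Theorem ground_state_exists : exists U, [/\ 0 < mm U, crit 0 U &
 forall W, crit 0 W -> 0 < mm W -> JJ U <= JJ W].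
Proof.
have [U0 c0 m0] : exists2 U, crit 0 U & 0 < mm U.
 have [r0 [K [r00 H]]] := perturbed_critical_points.
 have /choice[f Hf] : forall n, exists z : R * X, [/\ 0 < z.1 <= n.+1%:R^-1, crit z.1 z.2, r0 <= Jm z.1 z.2 & Jm z.1 z.2 <= K].
  by move=> n; have [mu [U h]] := H n; exists (mu, U).
 have [|||| U [s _ [h1 h2 _]]] := @critical_limit K (fun n => (f n).2) (fun n => (f n).1).
 - by move=> n; have [/andP[/ltW-> ->]] := Hf n.
 - by move=> n; have [] := Hf n.
 (* With zero mass, [S4] and [PP] vanish and [Q4] is nonnegative; the energy identity then makes the
    level at most [0], against [r0 > 0]. *)
 - move=> n; have [/andP[z0 _] cU J _] := Hf n; have EU := cU.1; have := mm_ge0 (f n).2.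
  rewrite le_eqVlt => /orP[/eqP mE|//]; have := energy_identity cU; have := Q4_lower (lexx 1) EU.
  have := S4_ge0 (f n).2; have [_] := S4_le EU; rewrite -mE mulr0 mul0r => s1 s2.
  have -> : S4 (f n).2 = 0 by lra.
  have := PP_interp ltr01 EU; rewrite -mE; have -> : S4 (f n).2 = 0 by lra.
  rewrite ln1 !mulr0 mul0r !addr0 oppr0 => h1 h2 h3.
  have P0 : PP (f n).2 = 0 by apply/eqP; rewrite eq_le h1 PP_ge0.
  have c20 := mulr_ge0 (ltW c2_gt0) h2; move: J h3; rewrite /Jm /JJ /BB /SS c8E P0; lra.
 - by move=> n; have [] := Hf n.
 by exists U.
pose S := [set JJ U | U in [set U | crit 0 U /\ 0 < mm U]].
have S0 : S (JJ U0) by exists U0.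
(* Energies of critical points above [JJ U0 + 1] are harmless for the infimum, and below this value
   [critical_bounds] gives a lower bound. *)
have [C hC] := critical_bounds (JJ U0 + 1).
have lbS : has_inf S.
 split; first by exists (JJ U0).
 exists (- `|C| - `|JJ U0|) => _ [U [cU mU] <-]; have [h|h] := leP (JJ U) (JJ U0 + 1).
  have [|_ _] := hC 0 U (lexx 0) cU; rewrite Jm0//.
  have := ler_norm C; have := normr_ge0 (JJ U0); alra.
 by have := ler_norm (- JJ U0); rewrite normrN; have := normr_ge0 C; alra.
have /choice[f Hf] n : exists U, [/\ crit 0 U, 0 < mm U & JJ U <= inf S + n.+1%:R^-1].
 have n0 : 0 < n.+1%:R^-1 :> R by rewrite invr_gt0.
 have [_ [U [cU mU] <-] h] := inf_adherent n0 lbS.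
 by exists U; split => //; exact: ltW.
have [||||U [s sS [h1 h2 h3]]] := @critical_limit (JJ U0 + 1) f (fun=> 0).
- by move=> n; rewrite lexx /= invr_ge0.
- by move=> n; have [] := Hf n.
- by move=> n; have [] := Hf n.
- move=> n; rewrite Jm0; have [_ _ h] := Hf n; apply: le_trans h _; apply: lerD.
  by apply: ge_inf => //; case: lbS.
 by rewrite invf_le1// ler1n.
exists U; split => // W cW mW; apply: (@le_trans _ _ (inf S)); last by apply: ge_inf; [case: lbS|exists W].
apply/ler_addgt0Pr => e e0; have e2 : 0 < e / 2 by lra.
have [N1 H1] := h3 _ e2; have [N2 H2] := small_inv e2.
have := H1 (N1 + N2)%N (leq_addr _ _); rewrite Jm0 distrC => /(le_trans (ler_norm _)) /=.
have [_ _] := Hf (s (N1 + N2)%N); have /= := H2 (s (N1 + N2)%N) (leq_trans (leq_addl _ _) (increasing_subseq_ge sS _)).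
move: (inf S) (JJ _) (JJ _) (_^-1) => y1 y2 y3 y4; lra.
Qed.

End ground_states.

End planar.

(** * From the conditions on [V] to the setting *)

Lemma ae_leb2 (R : realType) (P : pt R -> Prop) : {ae @leb2 R, forall x, P x} -> {ae @mu2 R, forall x, P x}.
Proof. by move=> [A [mA A0 h]]; exists A; split=> //; rewrite -leb2E. Qed.

Lemma setting_exists (R : realType) (V : pt R -> R) (b p : R) : 0 < b -> 2 < p < 4 -> condV0 V -> condV1 V ->
 exists D : setting R, [/\ sV D = V, sb D = b & sp D = p].
Proof.
move=> b0 p24 [_ V0 Vs] [cV [g1 [g2 [/weak_gradP W [alpha [beta [a0 be0 /ae_leb2 HV]]]]]]].
(* [inf] is [0] on a set without infimum, so its positivity shows that [V] is bounded below. *)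
have hi : has_inf (range V) by apply: contrapT => /inf_out h; move: V0; rewrite h ltxx.
have Vge x : inf (range V) <= V x by apply: ge_inf; [case: hi|exists x].
have Vsub (M : R) : (@mu2 R [set x | V x <= M]%R < +oo)%E.
 have mV (N : R) : measurable [set x | V x <= N].
  by apply: closed_measurable2; apply: (closed_comp _ (@closed_le R N)) => x _; exact: cV.
 have M0 : 0 < `|M| + 1 by rewrite ltr_wpDl.
 apply: le_lt_trans (Vs _ M0); rewrite leb2E//; apply: le_measure; rewrite ?inE//.
 by move=> x /= h; apply: le_trans h _; apply: le_trans (ler_norm M) _; rewrite lerDl.
(* The constants of [potential_dilation]: the factor is [2 * alpha], and [alpha * k <= 4^-1] is the
   admissible range. *)
have [C0 k0] : 0 < 2 * alpha /\ 0 < (4 * alpha)^-1 by rewrite invr_gt0 !mulr_gt0.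
have dil_V k x : 0 <= k -> k <= (4 * alpha)^-1 ->
  `|V (dil (1 + k) x) - V x| <= 2 * alpha * k * V x /\
  - (k * (beta + 2 * (1 + 2 * alpha * k) * V x)) <= V (dil (1 + k) x) - V x.
 move=> k1 hk; apply: (potential_dilation cV _ W a0 be0 HV) => // [y|]; first exact: le_trans (ltW V0) (Vge y).
 by move: hk; rewrite invfM ler_pdivlMr// mulrC.
by exists (Setting V0 Vge cV Vsub b0 p24 be0 C0 k0 dil_V).
Qed.

Theorem theorem1p2 (R : realType) (V : pt R -> R) (b p : R) :
 0 < b -> 2 < p < 4 -> condV0 V -> condV1 V ->
 exists u : pt R -> R, ground_state V b p u.
Proof.
move=> b0 p24 V0 V1; have [D [<- <- <-]] := setting_exists b0 p24 V0 V1.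
have [[[u g1] g2] [mU cU hU]] := ground_state_exists D; exists u, g1, g2; split.
- exact/(nontrivialP cU.1).
- exact/critical_crit.
- move=> w k1 k2 nw /critical_crit cw; rewrite !Ifun_JJ; [|exact: cw.1|exact: cU.1].
 by apply: hU => //; apply/(nontrivialP cw.1).
Qed.
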